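(* For every tempered distribution $u \in \mathscr{S}'(\mathbb{R}^d)$, the Gabor wave front set and the homogeneous wave front set coincide: $\mathrm{WF}_G(u) = \mathrm{HWF}(u)$.
   Context: Notation: $(\cdot,\cdot)$ denotes the $L^2$ inner product and also the action of $\mathscr{S}'(\mathbb{R}^d)$ on $\mathscr{S}(\mathbb{R}^d)$ which is conjugate linear in the test function; $\langle z\rangle = (1+|z|^2)^{1/2}$; $T_x\varphi(y)=\varphi(y-x)$, $M_\xi\varphi(y)=e^{iy\cdot\xi}\varphi(y)$. Short-time Fourier transform: for $u\in\mathscr{S}'(\mathbb{R}^d)$ and $\varphi\in\mathscr{S}(\mathbb{R}^d)\setminus\{0\}$, $V_\varphi u(x,\xi)=(u,M_\xi T_x\varphi)$, $(x,\xi)\in\mathbb{R}^{2d}$. Gabor wave front set: $\mathrm{WF}_G(u)\subseteq\mathbb{R}^{2d}\setminus\{0\}$ is defined by its complement: $z_0\in\mathbb{R}^{2d}\setminus\{0\}$ is not in $\mathrm{WF}_G(u)$ if for one (equivalently, as is known, for all) $\varphi\in\mathscr{S}(\mathbb{R}^d)\setminus\{0\}$ there is an open cone $\Gamma\subseteq\mathbb{R}^{2d}\setminus\{0\}$ containing $z_0$ such that $\sup_{z\in\Gamma}\langle z\rangle^N|V_\varphi u(z)|<\infty$ for all $N\ge 0$. (Cone means invariant under multiplication by positive reals.) Weyl quantization: for a symbol $a$ on $\mathbb{R}^{2d}$, $a^w(x,D)u(x)=(2\pi)^{-d}\int_{\mathbb{R}^{2d}}e^{i(x-y)\cdot\xi}a\big(\tfrac{x+y}{2},\xi\big)u(y)\,dy\,d\xi$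 for $u \in \mathscr{S}(\mathbb{R}^d)$, extended to $u\in\mathscr{S}'(\mathbb{R}^d)$ by duality. For $h>0$, $a_h(z)=a(hz)$, and $a^w(hx,hD)=a_h^w(x,D)$. Homogeneous wave front set: $\mathrm{HWF}(u)\subseteq\mathbb{R}^{2d}\setminus\{0\}$ is defined by its complement: $z_0\in\mathbb{R}^{2d}\setminus\{0\}$ is not in $\mathrm{HWF}(u)$ if there exists $a\in C_c^\infty(\mathbb{R}^{2d})$ with $a(z_0)=1$ such that $\|a_h^w(x,D)u\|_{L^2}=\mathcal{O}(h^\infty)$ for $h\in(0,1]$. Here $f(h)=\mathcal{O}(h^\infty)$ means $\sup_{h\in(0,1]}h^{-N}|f(h)|<\infty$ for every integer $N\ge0$. *)

(* Defs.v *)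
From HB Require Import structures.
From mathcomp Require Import all_boot all_order all_algebra.
From mathcomp Require Import all_classical all_reals all_analysis.
From mathcomp.real_closed Require Import complex.
Import Order.TTheory GRing.Theory Num.Theory.
Import numFieldTopology.Exports numFieldNormedType.Exports.

Set Implicit Arguments.
Unset Strict Implicit.
Unset Printing Implicit Defensive.

Local Open Scope classical_set_scope.
Local Open Scope ring_scope.
Local Open Scope complex_scope.

(* MathComp-Analysis has no measurable structure on row vectors: we use the
  product sigma-algebra (generated by the coordinates, as the library does for
  tuples), and build the measure by recursion on [n] from the library's binary
  product. *)

Definition measure_rV_display : measure_display. Proof. exact. Qed.

Section measurable_rV.
Variables (R : realType) (n : nat).

Definition rV_coord (i : 'I_n) (v : 'rV[R]_n) : R := v ord0 i.

Let rV_set0 : g_sigma_preimage rV_coord set0.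
Proof. exact: sigma_algebra0. Qed.

Let rV_setC A : g_sigma_preimage rV_coord A -> g_sigma_preimage rV_coord (~` A).
Proof. exact: sigma_algebraC. Qed.

Let rV_bigcup (F : (set _)^nat) : (forall i, g_sigma_preimage rV_coord (F i)) ->
  g_sigma_preimage rV_coord (\bigcup_i (F i)).
Proof. exact: sigma_algebra_bigcup. Qed.

HB.instance Definition _ := @isMeasurable.Build measure_rV_display
  'rV[R]_n (g_sigma_preimage rV_coord) rV_set0 rV_setC rV_bigcup.

Lemma measurable_rV_coord (i : 'I_n) : measurable_fun [set: 'rV[R]_n] (rV_coord i).
Proof.
move=> _ Y mY; rewrite setTI; apply: sub_sigma_algebra => /=.
rewrite -bigcup_seq/=; exists i => /=; first by rewrite mem_index_enum.
by exists Y => //; rewrite setTI.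
Qed.

Lemma measurable_fun_rVP d (T : measurableType d) (f : T -> 'rV[R]_n) :
  measurable_fun [set: T] f <->
  forall i, measurable_fun [set: T] (rV_coord i \o f).
Proof.
split=> [mf i|mf]; first exact: measurableT_comp (measurable_rV_coord i) mf.
have sub : g_sigma_preimage (fun i => rV_coord i \o f) `<=` measurable.
  apply: smallest_sub; first exact: sigma_algebra_measurable.
  rewrite -bigcup_seq; apply: bigcup_sub => i _ A [B mB <-].
  exact: mf.
by move=> _ A mA; apply: sub; rewrite g_sigma_preimage_comp; exists A.
Qed.

End measurable_rV.

(* The library's canonical sigma-finite instance for [\x] is shadowed by the one
   for probability measures, so the fact is restated here as a lemma. *)
Lemma product_sigma_finite d1 d2 (T1 : measurableType d1)
    (T2 : measurableType d2) (R : realType)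
    (m1 : {sigma_finite_measure set T1 -> \bar R})
    (m2 : {sigma_finite_measure set T2 -> \bar R}) :
  sigma_finite setT (m1 \x m2)%E.
Proof.
have /sigma_finiteP[F [TF ndF Foo]] := sigma_finiteT m1.
have /sigma_finiteP[G [TG ndG Goo]] := sigma_finiteT m2.
exists (fun n => F n `*` G n).
  rewrite -setXTT TF TG predeqE => -[x y]; split.
    move=> [/= [n _ Fnx] [k _ Gky]]; exists (maxn n k) => //; split.
    - by move: x Fnx; exact/subsetPset/ndF/leq_maxl.
    - by move: y Gky; exact/subsetPset/ndG/leq_maxr.
  by move=> [n _ []/= ? ?]; split; exists n.
move=> k; have [? ?] := Foo k; have [? ?] := Goo k.
split; first exact: measurableX.
by rewrite product_measure1E// lte_mul_pinfty// ge0_fin_numE.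
Qed.

Section lebesgue_rV.
Variable R : realType.

Definition cons_rV n (p : R * 'rV[R]_n) : 'rV[R]_n.+1 := row_mx p.1%:M p.2.

Definition uncons_rV n (v : 'rV[R]_n.+1) : R * 'rV[R]_n :=
  (v ord0 ord0, \row_j v ord0 (lift ord0 j)).

Lemma cons_rV0 n (p : R * 'rV[R]_n) : cons_rV p ord0 ord0 = p.1.
Proof.
have := row_mxEl (p.1%:M : 'rV[R]_1) p.2 ord0 ord0.
by rewrite [RHS]mxE mulr1n => <-; congr (row_mx _ _ _ _); exact: val_inj.
Qed.

Lemma cons_rVS n (p : R * 'rV[R]_n) j : cons_rV p ord0 (lift ord0 j) = p.2 ord0 j.
Proof.
have <- := row_mxEr (p.1%:M : 'rV[R]_1) p.2 ord0 j.
by congr (row_mx _ _ _ _); exact: val_inj.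
Qed.

Lemma cons_rVK n : cancel (@cons_rV n) (@uncons_rV n).
Proof.
move=> p; rewrite /uncons_rV cons_rV0 [RHS]surjective_pairing; congr pair.
by apply/rowP => j; rewrite mxE cons_rVS.
Qed.

Lemma measurable_cons_rV n : measurable_fun [set: R * 'rV[R]_n] (@cons_rV n).
Proof.
apply/measurable_fun_rVP => i; have [j ->|->] := unliftP ord0 i.
- rewrite (_ : _ \o _ = @rV_coord R n j \o snd).
    by apply: measurableT_comp; [exact: measurable_rV_coord|].
  by apply/funext => p; rewrite /= /rV_coord cons_rVS.
- rewrite (_ : _ \o _ = fst) //.
  by apply/funext => p; rewrite /= /rV_coord cons_rV0.
Qed.

Lemma measurable_uncons_rV n : measurable_fun [set: 'rV[R]_n.+1] (@uncons_rV n).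
Proof.
apply/measurable_fun_pairP; split; first exact: (measurable_rV_coord ord0).
apply/measurable_fun_rVP => j.
rewrite (_ : _ \o _ = @rV_coord R n.+1 (lift ord0 j)).
  exact: measurable_rV_coord.
by apply/funext => v; rewrite /= /rV_coord mxE.
Qed.

Section step.
Local Open Scope ereal_scope.
Variables (n : nat) (m : {sigma_finite_measure set 'rV[R]_n -> \bar R}).

Definition lebesgue_rV_step : set 'rV[R]_n.+1 -> \bar R :=
  pushforward (@lebesgue_measure R \x m) (@cons_rV n).

Let mcons := @measurable_cons_rV n.

Let step0 : lebesgue_rV_step set0 = 0. Proof. exact: measure0. Qed.

Let step_ge0 A : 0 <= lebesgue_rV_step A. Proof. exact: measure_ge0. Qed.

Let step_sigma_additive : semi_sigma_additive lebesgue_rV_step.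
Proof. exact: measure_semi_sigma_additive. Qed.

HB.instance Definition _ := isMeasure.Build _ _ _ lebesgue_rV_step
  step0 step_ge0 step_sigma_additive.

Let step_sigma_finite : sigma_finite [set: 'rV[R]_n.+1] lebesgue_rV_step.
Proof.
have [F covF finF] := product_sigma_finite (@lebesgue_measure R) m.
exists (fun k => @uncons_rV n @^-1` F k) => [|k].
  by rewrite -preimage_bigcup -covF preimage_setT.
have [mF Foo] := finF k; split.
  by rewrite -[X in measurable X]setTI; exact: measurable_uncons_rV.
rewrite /lebesgue_rV_step /pushforward -comp_preimage.
rewrite (_ : @uncons_rV n \o @cons_rV n = id) ?preimage_id//.
by apply/funext => p /=; rewrite cons_rVK.
Qed.

HB.instance Definition _ := Measure_isSigmaFinite.Build _ _ _ lebesgue_rV_step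
  step_sigma_finite.

End step.

Fixpoint lebesgue_rV n : {sigma_finite_measure set 'rV[R]_n -> \bar R} :=
  if n is k.+1 then lebesgue_rV_step (lebesgue_rV k)
  else dirac (0 : 'rV[R]_0).

Lemma lebesgue_rV_box n (A : 'I_n -> set R) :
  (forall i, measurable (A i)) ->
  measurable [set v : 'rV[R]_n | forall i, A i (v ord0 i)] /\
  lebesgue_rV n [set v : 'rV[R]_n | forall i, A i (v ord0 i)] =
    (\prod_(i < n) lebesgue_measure (A i))%E.
Proof.
elim: n A => [|n IHn] A mA.
  rewrite (_ : [set _ | _] = setT); last by apply/seteqP; split => // v _ [].
  by split; [exact: measurableT|rewrite big_ord0 /= diracT].
have [mB muB] := IHn (A \o lift ord0) (fun i => mA _).
set B := [set v | _] in mB muB.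
have boxE : [set v : 'rV[R]_n.+1 | forall i, A i (v ord0 i)] =
    @uncons_rV n @^-1` (A ord0 `*` B).
  apply/seteqP; split => [v Av|v [/= A0 AS] i].
    by split => [|i] /=; rewrite ?mxE; exact: Av.
  by have [j ->|->//] := unliftP ord0 i; move: (AS j); rewrite mxE.
split.
  rewrite boxE -[X in measurable X]setTI; apply: measurable_uncons_rV => //.
  exact: measurableX.
rewrite boxE /= /lebesgue_rV_step /pushforward -comp_preimage.
rewrite (_ : @uncons_rV n \o @cons_rV n = id); last first.
  by apply/funext => p /=; rewrite cons_rVK.
rewrite preimage_id product_measure1E; [|exact: mA|exact: mB].
by rewrite big_ord_recl; congr (_ * _)%E; exact: muB.
Qed.

End lebesgue_rV.

Section functions.
Variables (R : realType) (n : nat).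
Local Notation E := 'rV[R]_n.
Local Notation C := R[i].
Implicit Types (f g : E -> C) (x y : E).

Definition dotv x y : R := \sum_(i < n) x ord0 i * y ord0 i.

(* the norm of ['rV[R]_n] in the library is the sup norm, hence [dotv] *)
Definition japanese x : R := Num.sqrt (1 + dotv x x).

Definition expi (t : R) : C := cos t +i* sin t.

(* s lists the differentiated coordinates with repetition: it plays the role of
   a multi-index, with order [size s] *)
Definition partials (s : seq 'I_n) (f : E -> R) : E -> R :=
  foldr (fun i (h : E -> R) => 'D_(delta_mx ord0 i) h) f s.

Definition smoothR (f : E -> R) : Prop :=
  forall s : seq 'I_n, continuous (partials s f) /\
    forall i x, derivable (partials s f) x (delta_mx ord0 i).

Definition smooth f : Prop :=
  smoothR (@complex.Re R \o f) /\ smoothR (@complex.Im R \o f).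

Definition cpartials (s : seq 'I_n) f : E -> C :=
  fun x => partials s (@complex.Re R \o f) x +i*
           partials s (@complex.Im R \o f) x.

Definition modulus (z : C) : R := Normc.normc z.

Definition cintegral f : C :=
  (\int[lebesgue_rV R n]_x complex.Re (f x)) +i*
  (\int[lebesgue_rV R n]_x complex.Im (f x)).

Definition schwartz_weights (k : nat) f : set R :=
  [set r | exists (s : seq 'I_n) x, (size s <= k)%N /\
           r = japanese x ^+ k * modulus (cpartials s f x)].

Definition schwartz f : Prop :=
  smooth f /\ forall k, has_ubound (schwartz_weights k f).

Definition schwartz_seminorm (k : nat) f : R := sup (schwartz_weights k f).

(* A tempered distribution is a conjugate-linear continuous functional on the
   Schwartz space; it is represented by a functional on all functions E -> C of
   which only the values on Schwartz functions are constrained, and used. *)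
Record tempered (u : (E -> C) -> C) : Prop := Tempered {
  tempered_antilinear : forall (c : C) f g, schwartz f -> schwartz g ->
    u (fun x => c * f x + g x) = conjc c * u f + u g;
  tempered_continuous : exists (K : R) (k : nat), forall f, schwartz f ->
    modulus (u f) <= K * schwartz_seminorm k f }.

Definition cc_smooth f : Prop := smooth f /\ compact (closure [set x | f x != 0]).

Definition fun_L2norm f : \bar R :=
  ('N[lebesgue_rV R n]_2%:E[EFin \o modulus \o f])%E.

Definition square_integrable f : Prop :=
  [/\ measurable_fun [set: E] (@complex.Re R \o f),
      measurable_fun [set: E] (@complex.Im R \o f) &
      (fun_L2norm f < +oo)%E].

(* u = (f, . ) on test functions *)
Definition represents f (u : (E -> C) -> C) : Prop :=
  forall g, schwartz g -> u g = cintegral (fun x => f x * conjc (g x)).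

(* the representing f is unique almost everywhere; the value is +oo if u is not
   in L^2 *)
Definition L2norm (u : (E -> C) -> C) : \bar R :=
  ereal_inf [set fun_L2norm f |
             f in [set f | square_integrable f /\ represents f u]].

Definition translation x f : E -> C := fun y => f (y - x).
Definition modulation (xi : E) f : E -> C := fun y => expi (dotv y xi) * f y.

End functions.

(* Phase space R^{2d} is ['rV[R]_(d + d)]; a point (x, xi) is [row_mx x xi]. *)

Section wave_front_sets.
Variables (R : realType) (d : nat).
Local Notation E := 'rV[R]_d.
Local Notation E2 := 'rV[R]_(d + d).
Local Notation C := R[i].
Implicit Types (u : (E -> C) -> C) (a : E2 -> C) (phi : E -> C).

Definition STFT phi u (z : E2) : C :=
  u (modulation (rsubmx z) (translation (lsubmx z) phi)).

Definition cone (G : set E2) : Prop :=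
  G `<=` [set z | z != 0] /\ forall t z, 0 < t -> G z -> G (t *: z).

Definition WFG u : set E2 :=
  [set z0 | z0 != 0 /\
    ~ exists phi, [/\ schwartz phi, exists x, phi x != 0 &
        exists G : set E2, [/\ open G, cone G, G z0 &
          forall N : nat, has_ubound
            [set japanese z ^+ N * modulus (STFT phi u z) | z in G]]]].

(* the integration variable is p = (y, xi) *)
Definition weyl a phi : E -> C := fun x =>
  ((2 * pi) ^- d)%:C * cintegral (fun p : E2 =>
     let y := lsubmx p in let xi := rsubmx p in
     expi (dotv (x - y) xi) * a (row_mx (2^-1 *: (x + y)) xi) * phi y).

(* extension by duality: the formal adjoint of a^w for the L^2 inner product is
   the Weyl quantization of the conjugate symbol *)
Definition weyl_dual a u : (E -> C) -> C := fun phi => u (weyl (@conjc R \o a) phi).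

Definition dilation (h : R) a : E2 -> C := fun z => a (h *: z).

Definition Ohinfty (f : R -> \bar R) : Prop :=
  forall N : nat,
    (ereal_sup [set (h ^- N)%:E * f h | h in [set h : R | 0 < h <= 1]%R] < +oo)%E.

Definition HWF u : set E2 :=
  [set z0 | z0 != 0 /\
    ~ exists a, [/\ cc_smooth a, a z0 = 1 &
        Ohinfty (fun h => L2norm (weyl_dual (dilation h a) u))]].

End wave_front_sets.

(* Main.v *)
Require Import Defs.
From mathcomp Require Import all_boot all_order all_algebra.
From mathcomp Require Import all_classical all_reals all_analysis.
From mathcomp.real_closed Require Import complex.
From HB Require Import structures.
From mathcomp Require Import measurable_realfun ring lra.
Import Order.TTheory GRing.Theory Num.Theory.
Import numFieldTopology.Exports numFieldNormedType.Exports.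

(* Conjugating by the time-frequency shift pi(z) turns the semiclassical
   operator b(hx, hD) into T_z = b(h x + h x0, h D + h xi0), z = (x0, xi0), whose
   symbol is slowly varying, so that T_z psi = b(h z) psi + O(h) in every Schwartz
   seminorm, uniformly in z.

   If z0 is not in HWF(u), witnessed by a, put b = conj(a). As long as h z stays
   near z0, the iterates of the remainder psi - T_z psi / b(h z) on a window phi
   are O(h^j); a Neumann series writes pi(z) phi as b_h^w(x, D) applied to a
   function bounded in L^2 plus O(h^infinity), and pairing with u gives
   V_phi u(z) = O(h^infinity). Every z in a cone around z0 is of this kind with
   h ~ 1/|z|.

   If z0 is not in WF_G(u), witnessed by phi and a cone, let a be a bump
   supported close to z0. Inverting the short-time Fourier transform shows that
   a_h^w(x, D) u is the function x |-> int V_phi u(w) (a_h^w pi(w) phi)(x) dw, up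
   to a constant. The kernel (a_h^w pi(w) phi)(x) is O(h^infinity) with rapid
   decay in (x, w) unless h w is close to z0; in that case w lies in the cone and
   V_phi u(w) is O(|w|^-infinity) = O(h^infinity). *)

Set Implicit Arguments.
Unset Strict Implicit.
Unset Printing Implicit Defensive.

Local Open Scope classical_set_scope.
Local Open Scope ring_scope.
Local Open Scope complex_scope.

(** * Modulus and measurability of complex functions *)

Section modulus.
Variable R : realType.
Implicit Types (z w : R[i]) (t s : R).

(** Two obstacles shape the proof. Continuity of u involves a seminorm of some finite order k, and
    the seminorms of pi(z) psi grow like |z|^(2k). This loss is paid in powers of h: in one
    direction by 2k additional steps of the Neumann series, since |z| = O(1/h) as long as h z stays
    bounded; in the other by decay of the kernel jointly in h, in h w and in the distance from x to
    the position of w. Moreover, u commutes with an integral of test functions only after an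
    argument, given here by Riemann sums that converge in every seminorm. Oscillatory integrals
    never appear. Every integrand is dominated by one product weight, so that Fubini's theorem,
    differentiation under the integral and the limits that occur reduce to pointwise bounds with
    explicit constants. The factor (2 pi)^d of the quantization and the constant K of Fourier
    inversion are never compared: each is nonzero and is divided out on its own. *)

Lemma modulus_ge0 z : 0 <= modulus z.
Proof. by case: z => a b; rewrite /modulus /= sqrtr_ge0. Qed.

Lemma modulus0 : modulus (0 : R[i]) = 0. Proof. exact: Normc.normc0. Qed.

Lemma modulus1 : modulus (1 : R[i]) = 1. Proof. exact: Normc.normc1. Qed.

Lemma modulusM z w : modulus (z * w) = modulus z * modulus w.
Proof. exact: Normc.normcM. Qed.

Lemma modulusV z : modulus z^-1 = (modulus z)^-1.
Proof. exact: Normc.normcV. Qed.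

Lemma modulusD z w : modulus (z + w) <= modulus z + modulus w.
Proof. exact: le_normcD. Qed.

Lemma modulusN z : modulus (- z) = modulus z.
Proof. by case: z => a b; rewrite /modulus /= !sqrrN. Qed.

Lemma modulusB z w : modulus (z - w) <= modulus z + modulus w.
Proof. by rewrite -[in leRHS](modulusN w) modulusD. Qed.

Lemma modulus_distC z w : modulus (z - w) = modulus (w - z).
Proof. by rewrite -modulusN opprB. Qed.

Lemma modulus_conj z : modulus (conjc z) = modulus z.
Proof. by case: z => a b; rewrite /modulus /= sqrrN. Qed.

Lemma modulus_real t : modulus t%:C = `|t|.
Proof. by rewrite /modulus /= expr0n /= addr0 sqrtr_sqr. Qed.

Lemma modulus_i t : modulus (t *i : R[i]) = `|t|.
Proof. by rewrite /modulus /= expr0n /= add0r sqrtr_sqr. Qed.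

Lemma modulus_eq0 z : (modulus z == 0) = (z == 0).
Proof.
by apply/eqP/eqP => [/Normc.eq0_normc //|->]; rewrite modulus0.
Qed.

Lemma modulus_gt0 z : (0 < modulus z) = (z != 0).
Proof. by rewrite lt_def modulus_eq0 modulus_ge0 andbT. Qed.

Lemma Re_le_modulus z : `|complex.Re z| <= modulus z.
Proof.
case: z => a b; rewrite /modulus /= -sqrtr_sqr ler_sqrt ?lerDl ?sqr_ge0//.
by rewrite addr_ge0 ?sqr_ge0.
Qed.

Lemma Im_le_modulus z : `|complex.Im z| <= modulus z.
Proof.
case: z => a b; rewrite /modulus /= -sqrtr_sqr ler_sqrt ?lerDr ?sqr_ge0//.
by rewrite addr_ge0 ?sqr_ge0.
Qed.

Lemma modulus_le z : modulus z <= `|complex.Re z| + `|complex.Im z|.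
Proof.
have {1}-> : z = (complex.Re z)%:C + (complex.Im z) *i.
  by case: z => a b /=; simpc.
by rewrite (le_trans (modulusD _ _)) ?modulus_real ?modulus_i.
Qed.

Lemma modulus_sum (I : Type) (r : seq I) (P : pred I) (F : I -> R[i]) :
  modulus (\sum_(i <- r | P i) F i) <= \sum_(i <- r | P i) modulus (F i).
Proof.
elim/big_ind2 : _ => [|x1 x2 y1 y2 h1 h2|//]; first by rewrite modulus0.
by rewrite (le_trans (modulusD _ _)) ?lerD.
Qed.

Lemma modulusX z k : modulus (z ^+ k) = modulus z ^+ k.
Proof. by elim: k => [|k IH]; rewrite ?expr0 ?modulus1 // !exprS modulusM IH. Qed.

Lemma Re_mul z w : complex.Re (z * w) =
  complex.Re z * complex.Re w - complex.Im z * complex.Im w.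
Proof. by case: z => a b; case: w. Qed.

Lemma Im_mul z w : complex.Im (z * w) =
  complex.Re z * complex.Im w + complex.Im z * complex.Re w.
Proof. by case: z => a b; case: w. Qed.

Lemma Re_add z w : complex.Re (z + w) = complex.Re z + complex.Re w.
Proof. by case: z => a b; case: w. Qed.

Lemma Im_add z w : complex.Im (z + w) = complex.Im z + complex.Im w.
Proof. by case: z => a b; case: w. Qed.

Lemma Re_opp z : complex.Re (- z) = - complex.Re z. Proof. by case: z. Qed.

Lemma Im_opp z : complex.Im (- z) = - complex.Im z. Proof. by case: z. Qed.

Lemma Re_conjc z : complex.Re (conjc z) = complex.Re z. Proof. by case: z. Qed.

Lemma Im_conjc z : complex.Im (conjc z) = - complex.Im z. Proof. by case: z. Qed.

Lemma complex_ext z w :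
  complex.Re z = complex.Re w -> complex.Im z = complex.Im w -> z = w.
Proof. by case: z => a b; case: w => a' b' /= -> ->. Qed.

Lemma conjcM z w : conjc (z * w) = conjc z * conjc w.
Proof. by apply: complex_ext; rewrite !(Re_conjc, Im_conjc, Re_mul, Im_mul); ring. Qed.

Lemma modulus_expi t : modulus (expi t) = 1.
Proof. by rewrite /expi /modulus /= cos2Dsin2 sqrtr1. Qed.

Lemma expiD t s : expi (t + s) = expi t * expi s.
Proof.
by apply: complex_ext; rewrite ?Re_mul ?Im_mul /= ?cosD ?sinD; ring.
Qed.

Lemma expi0 : expi (0 : R) = 1.
Proof. by rewrite /expi cos0 sin0. Qed.

Lemma expiN t : expi (- t) = conjc (expi t).
Proof. by rewrite /expi cosN sinN. Qed.

Lemma real_complexM t s : (t * s)%:C = t%:C * s%:C :> R[i].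
Proof. exact: rmorphM. Qed.

End modulus.

Section measurability.
Variable R : realType.

Section general.
Context d (T : measurableType d).
Implicit Types (f g : T -> R[i]).

Definition cmeasurable f :=
  measurable_fun [set: T] (@complex.Re R \o f) /\
  measurable_fun [set: T] (@complex.Im R \o f).

Lemma cmeasurable_cst (c : R[i]) : cmeasurable (fun=> c).
Proof. by split; exact: measurable_cst. Qed.

Lemma cmeasurableD f g : cmeasurable f -> cmeasurable g ->
  cmeasurable (fun x => f x + g x).
Proof.
move=> [f1 f2] [g1 g2]; split.
- rewrite (_ : _ \o _ = (@complex.Re R \o f) \+ (@complex.Re R \o g)).
    exact: measurable_funD.
  by apply/funext => x /=; rewrite Re_add.
- rewrite (_ : _ \o _ = (@complex.Im R \o f) \+ (@complex.Im R \o g)).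
    exact: measurable_funD.
  by apply/funext => x /=; rewrite Im_add.
Qed.

Lemma cmeasurableM f g : cmeasurable f -> cmeasurable g ->
  cmeasurable (fun x => f x * g x).
Proof.
move=> [f1 f2] [g1 g2]; split.
- rewrite (_ : _ \o _ = ((@complex.Re R \o f) \* (@complex.Re R \o g)) \-
    ((@complex.Im R \o f) \* (@complex.Im R \o g))).
    by apply: measurable_funB; exact: measurable_funM.
  by apply/funext => x /=; rewrite Re_mul.
- rewrite (_ : _ \o _ = ((@complex.Re R \o f) \* (@complex.Im R \o g)) \+
    ((@complex.Im R \o f) \* (@complex.Re R \o g))).
    by apply: measurable_funD; exact: measurable_funM.
  by apply/funext => x /=; rewrite Im_mul.
Qed.

Lemma cmeasurable_real (f : T -> R) : measurable_fun [set: T] f ->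
  cmeasurable (fun x => (f x)%:C).
Proof. by move=> mf; split => //; exact: measurable_cst. Qed.

Lemma cmeasurableN f : cmeasurable f -> cmeasurable (fun x => - f x).
Proof.
move=> mf; rewrite (_ : (fun x => _) = (fun x => (-1) * f x)).
  by apply: cmeasurableM => //; exact: cmeasurable_cst.
by apply/funext => x; rewrite mulN1r.
Qed.

Lemma cmeasurableB f g : cmeasurable f -> cmeasurable g ->
  cmeasurable (fun x => f x - g x).
Proof. by move=> mf mg; apply: cmeasurableD => //; exact: cmeasurableN. Qed.

Lemma cmeasurable_conj f : cmeasurable f -> cmeasurable (fun x => conjc (f x)).
Proof.
move=> [f1 f2]; split.
- rewrite (_ : _ \o _ = (@complex.Re R \o f)) //.
  by apply/funext => x /=; rewrite Re_conjc.
- rewrite (_ : _ \o _ = \- (@complex.Im R \o f)); last first.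
    by apply/funext => x /=; rewrite Im_conjc.
  exact: measurable_funN.
Qed.

Lemma cmeasurable_sum (I : Type) (r : seq I) (P : pred I) (F : I -> T -> R[i]) :
  (forall i, cmeasurable (F i)) -> cmeasurable (fun x => \sum_(i <- r | P i) F i x).
Proof.
move=> mF; elim: r => [|i r IH].
  rewrite (_ : (fun x => _) = fun=> 0); first exact: cmeasurable_cst.
  by apply/funext => x; rewrite big_nil.
case Pi : (P i); last first.
  rewrite (_ : (fun x => _) = fun x => \sum_(i <- r | P i) F i x)//.
  by apply/funext => x; rewrite big_cons Pi.
rewrite (_ : (fun x => _) = fun x => F i x + \sum_(i <- r | P i) F i x).
  exact: cmeasurableD.
by apply/funext => x; rewrite big_cons Pi.
Qed.

Lemma cmeasurable_expi (f : T -> R) : measurable_fun [set: T] f ->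
  cmeasurable (fun x => expi (f x)).
Proof.
move=> mf; split.
- apply: (measurableT_comp (f := @cos R)) => //.
  by apply: continuous_measurable_fun => x; exact: continuous_cos.
- apply: (measurableT_comp (f := @sin R)) => //.
  by apply: continuous_measurable_fun => x; exact: continuous_sin.
Qed.

Lemma measurable_modulus f : cmeasurable f ->
  measurable_fun [set: T] (fun x => modulus (f x)).
Proof.
move=> [f1 f2].
rewrite (_ : (fun x => _) = @Num.sqrt R \o
   (((@complex.Re R \o f) \* (@complex.Re R \o f)) \+
   ((@complex.Im R \o f) \* (@complex.Im R \o f)))); last first.
  by apply/funext => x /=; rewrite /modulus; case: (f x) => a b /=; rewrite !expr2.
apply: measurableT_comp; last by apply: measurable_funD; exact: measurable_funM.
by apply: continuous_measurable_fun => x; exact: sqrt_continuous.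
Qed.

End general.

Lemma cmeasurable_comp d d' (T : measurableType d) (T' : measurableType d')
    (f : T' -> R[i]) (g : T -> T') :
  cmeasurable f -> measurable_fun [set: T] g -> cmeasurable (f \o g).
Proof.
by move=> [f1 f2] mg; split;
  [apply: (measurableT_comp f1 mg)|apply: (measurableT_comp f2 mg)].
Qed.

(** The sigma-algebra is generated by the coordinates, so an open set has to be exhausted by
    countably many boxes: the cubes with rational centre and half-side [1/(k+1)] that it
    contains. *)
Lemma open_measurable_rV n (U : set 'rV[R]_n) : open U -> measurable U.
Proof.
move=> oU.
pose B (p : 'rV[rat]_n * nat) : set 'rV[R]_n :=
  [set v | forall i, v ord0 i \in `]ratr (p.1 ord0 i) - (p.2.+1%:R)^-1,
      ratr (p.1 ord0 i) + (p.2.+1%:R)^-1[].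
have mB p : measurable (B p).
  by have [+ _] := @lebesgue_rV_box R n (fun i => `]ratr (p.1 ord0 i) - (p.2.+1%:R)^-1,
      ratr (p.1 ord0 i) + (p.2.+1%:R)^-1[%classic)
    (fun i => measurable_itv _).
have -> : U = \bigcup_(p in [set p | B p `<=` U]) B p.
  apply/seteqP; split=> [v Uv|v [p /= pU /pU //]].
  have /nbhs_ballP [e /= e0 eU] := open_nbhs_nbhs (conj oU Uv).
  (* Two points of a cube of half-side [1/(k+1)] differ by less than twice that in each coordinate;
     the cube around [v] then stays in the ball of radius [e]. *)
  have [k ke] : exists k : nat, (k.+1%:R)^-1 *+ 2 < e.
    have [k _ /(_ _ (leqnn k))] :=
      near_infty_natSinv_lt (PosNum (divr_gt0 e0 (ltr0Sn R 1))).
    move=> /= hk; exists k; rewrite mulr2n; move: (_^-1) hk => x hk; lra.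

  have q i : exists q : rat, (ratr q : R) \in `]v ord0 i - (k.+1%:R)^-1, v ord0 i + (k.+1%:R)^-1[.
    apply: rat_in_itvoo; rewrite ltrBlDr -addrA ltrDl -mulr2n.
    by rewrite pmulrn_lgt0 // invr_gt0.
  exists (\row_i projT1 (cid (q i)), k).
  - move=> w wB; apply: eU; split => // i j; rewrite (ord1 i).
    have := wB j; rewrite /= mxE; case: cid => r /=; rewrite !in_itv /=.
    move=> /andP[h1 h2] /andP[h3 h4].
    rewrite /ball/= distrC ltr_distl.
    rewrite mulr2n in ke; apply/andP; split; move: h1 h2 h3 h4 ke; set x := _^-1; set y := v _ _; set z := w _ _; set t := ratr _; lra.
  - move=> i; rewrite /= mxE; case: cid => r /=; rewrite !in_itv /=.
    by move: (_^-1) => x /andP[h1 h2]; apply/andP; split; lra.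
rewrite bigcup_mkcond; apply: countable_bigcupT_measurable => //.
by move=> p; case: ifP => _ //; exact: measurable0.
Qed.

Lemma continuous_measurable_rV n (f : 'rV[R]_n -> R) :
  continuous f -> measurable_fun [set: 'rV[R]_n] f.
Proof.
move=> /continuousP cf; apply: (measurability _ (RGenOpens.measurableE R)).
move=> _ [_ [a [b ->] <-]]; rewrite setTI; apply: open_measurable_rV.
apply: cf; exact: interval_open.
Qed.

End measurability.

(** * Lebesgue integrals on row vectors *)

Section nonnegative_integrals.
Variable R : realType.
Local Notation leb := (@lebesgue_measure R).

(** Uniqueness of Lebesgue measure: [|h|] times the pushforward has the right value on half-open
    intervals. For negative [h] the preimage is half-open on the other side, which has the same
    length. *)
Lemma lebesgue_measure_affine (c h : R) (A : set R) : h != 0 -> measurable A ->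
  leb ((fun x => c + h * x) @^-1` A) = (`|h|^-1%:E * leb A)%E.
Proof.
move=> h0 mA.
have h0' : 0 < `|h| by rewrite normr_gt0.
have mphi : measurable_fun [set: measurableTypeR R]
    ((fun x => c + h * x) : measurableTypeR R -> measurableTypeR R).
  by apply: measurable_funD => //; exact: measurable_funM.
pose nu : {measure set (measurableTypeR R) -> \bar R} :=
  mscale (NngNum (ltW h0')) (pushforward leb
    ((fun x => c + h * x) : measurableTypeR R -> measurableTypeR R)).
suff /(_ _ mA) -> : forall A, measurable A -> leb A = nu mphi A.
  rewrite /= /mscale /= muleA -EFinM mulVf ?mul1e// gt_eqF//.
move=> {}A {}mA; apply: lebesgue_measure_unique => // _ [[a b]] _ <- /=.
rewrite /mscale /= /pushforward.
have [hp|hn|h00] := ltgtP 0 h; last by rewrite -h00 eqxx in h0.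
- have -> : (fun x => c + h * x) @^-1` `]a, b]%classic =
      `](a - c) / h, (b - c) / h]%classic.
    apply/seteqP; split=> x /=; rewrite !in_itv/= ltr_pdivrMr// ler_pdivlMr//;
    by move=> /andP[u v]; apply/andP; split; lra.
  rewrite !lebesgue_measure_itv/= !lte_fin ltr_pM2r ?invr_gt0// ltrD2r.
  case: ifP => _; rewrite ?mule0// gtr0_norm// -!EFinB -EFinM; congr EFin.
  by field.
- have -> : (fun x => c + h * x) @^-1` `]a, b]%classic =
      `[(b - c) / h, (a - c) / h[%classic.
    apply/seteqP; split=> x /=; rewrite !in_itv/= ler_ndivrMr// ltr_ndivlMr//;
    by move=> /andP[u v]; apply/andP; split; lra.
  rewrite !lebesgue_measure_itv/= !lte_fin ltr_nM2r ?invr_lt0// ltrD2r.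
  case: ifP => _; rewrite ?mule0// ltr0_norm// -!EFinB -EFinM; congr EFin.
  by field.
Qed.

Lemma ge0_integral_affine (c h : R) (f : R -> \bar R) : h != 0 ->
  measurable_fun [set: R] f -> (forall x, 0 <= f x)%E ->
  (\int[leb]_x f (c + h * x)%R = `|h|^-1%:E * \int[leb]_x f x)%E.
Proof.
move=> h0 mf f0.
have h0' : 0 <= `|h|^-1 by rewrite invr_ge0.
have mphi : measurable_fun [set: measurableTypeR R]
    ((fun x => c + h * x) : measurableTypeR R -> measurableTypeR R).
  by apply: measurable_funD => //; exact: measurable_funM.
have := @ge0_integral_pushforward _ _ (measurableTypeR R) (measurableTypeR R) R
  _ mphi leb setT f measurableT mf (fun y _ => f0 y).
rewrite preimage_setT => <-.
rewrite -(@ge0_integral_mscale _ _ R leb setT _ (NngNum h0'))//.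
apply: eq_measure_integral => //= A mA _.
by rewrite /mscale /= /pushforward lebesgue_measure_affine.
Qed.

Lemma integral_inv_oneDsqr :
  (\int[leb]_x ((1 + x ^+ 2)^-1)%:E = pi%:E)%E.
Proof.
rewrite (@ge0_symfun_integralT R (fun x => (oneDsqr x)^-1))//.
- by rewrite -set_itvcy integral0y_oneDsqr -EFinM; congr EFin; field.
- by move=> x; exact: continuous_oneDsqrV.
- by move=> x; rewrite /oneDsqr /= sqrrN.
Qed.

Variable n : nat.

Lemma ge0_integral_rVS (f : 'rV[R]_n.+1 -> \bar R) :
  measurable_fun [set: 'rV[R]_n.+1] f -> (forall x, 0 <= f x)%E ->
  (\int[lebesgue_rV R n.+1]_x f x =
   \int[leb]_t \int[lebesgue_rV R n]_x f (cons_rV (t, x)))%E.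
Proof.
move=> mf f0.
have mc : measurable_fun [set: measurableTypeR R * 'rV[R]_n] (@cons_rV R n).
  exact: measurable_cons_rV.
have := @ge0_integral_pushforward _ _ _
  'rV[R]_n.+1 R _ mc (leb \x lebesgue_rV R n)%E setT f
  measurableT mf (fun y _ => f0 y).
rewrite preimage_setT => e; rewrite -[LHS]/(integral (pushforward (leb \x lebesgue_rV R n)%E (@cons_rV R n)) setT f) e.
rewrite fubini_tonelli1//=.
exact: measurableT_comp (@measurable_cons_rV R n).
Qed.

End nonnegative_integrals.

Section measurability_rV.
Variable R : realType.
Context d (T : measurableType d).

Lemma measurable_entry n (f : T -> 'rV[R]_n) (i : 'I_n) :
  measurable_fun [set: T] f -> measurable_fun [set: T] (fun x => f x ord0 i).
Proof. by move/(measurable_fun_rVP f).1/(_ i). Qed.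

Lemma measurable_rVP n (f : T -> 'rV[R]_n) :
  (forall i, measurable_fun [set: T] (fun x => f x ord0 i)) ->
  measurable_fun [set: T] f.
Proof. by move=> mf; apply/measurable_fun_rVP. Qed.

Lemma measurable_rVD n (f g : T -> 'rV[R]_n) :
  measurable_fun [set: T] f -> measurable_fun [set: T] g ->
  measurable_fun [set: T] (fun x => f x + g x).
Proof.
move=> mf mg; apply: measurable_rVP => i.
rewrite (_ : (fun x => _) = (fun x => f x ord0 i) \+ (fun x => g x ord0 i)).
  by apply: measurable_funD; exact: measurable_entry.
by apply/funext => x; rewrite mxE.
Qed.

Lemma measurable_rVZ n (h : R) (f : T -> 'rV[R]_n) :
  measurable_fun [set: T] f -> measurable_fun [set: T] (fun x => h *: f x).
Proof.
move=> mf; apply: measurable_rVP => i.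
rewrite (_ : (fun x => _) = (fun=> h) \* (fun x => f x ord0 i)).
  by apply: measurable_funM => //; exact: measurable_entry.
by apply/funext => x; rewrite mxE.
Qed.

Lemma measurable_rVB n (f g : T -> 'rV[R]_n) :
  measurable_fun [set: T] f -> measurable_fun [set: T] g ->
  measurable_fun [set: T] (fun x => f x - g x).
Proof.
move=> mf mg; apply: measurable_rVP => i.
rewrite (_ : (fun x => _) = (fun x => f x ord0 i) \- (fun x => g x ord0 i)).
  by apply: measurable_funB; exact: measurable_entry.
by apply/funext => x; rewrite !mxE.
Qed.

Lemma measurable_row_mx m n (f : T -> 'rV[R]_m) (g : T -> 'rV[R]_n) :
  measurable_fun [set: T] f -> measurable_fun [set: T] g ->
  measurable_fun [set: T] (fun x => row_mx (f x) (g x)).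
Proof.
move=> mf mg; apply: measurable_rVP => i; rewrite -(fintype.splitK i).
case: (fintype.split i) => j /=.
- rewrite (_ : (fun x => _) = (fun x => f x ord0 j)); first exact: measurable_entry.
  by apply/funext => x; rewrite row_mxEl.
- rewrite (_ : (fun x => _) = (fun x => g x ord0 j)); first exact: measurable_entry.
  by apply/funext => x; rewrite row_mxEr.
Qed.

Lemma measurable_lsubmx m n (f : T -> 'rV[R]_(m + n)) :
  measurable_fun [set: T] f -> measurable_fun [set: T] (fun x => lsubmx (f x)).
Proof.
move=> mf; apply: measurable_rVP => i.
rewrite (_ : (fun x => _) = (fun x => f x ord0 (lshift n i))).
  exact: measurable_entry.
by apply/funext => x; rewrite mxE.
Qed.

Lemma measurable_rsubmx m n (f : T -> 'rV[R]_(m + n)) :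
  measurable_fun [set: T] f -> measurable_fun [set: T] (fun x => rsubmx (f x)).
Proof.
move=> mf; apply: measurable_rVP => i.
rewrite (_ : (fun x => _) = (fun x => f x ord0 (rshift m i))).
  exact: measurable_entry.
by apply/funext => x; rewrite mxE.
Qed.

Lemma measurable_dotv n (f g : T -> 'rV[R]_n) :
  measurable_fun [set: T] f -> measurable_fun [set: T] g ->
  measurable_fun [set: T] (fun x => dotv (f x) (g x)).
Proof.
move=> mf mg; rewrite /dotv.
apply: measurable_sum => i.
by apply: measurable_funM; exact: measurable_entry.
Qed.

End measurability_rV.

(** * An integrable weight adapted to products *)

Section weight.
Variable R : realType.

(* Integrable, and multiplicative over products of spaces, unlike the powers of
   [japanese]; this makes domination compatible with Fubini. *)
Definition weight n (x : 'rV[R]_n) : R := \prod_(i < n) (1 + x ord0 i ^+ 2)^-1.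

Lemma weight_factor_gt0 n (x : 'rV[R]_n) i : 0 < 1 + x ord0 i ^+ 2.
Proof. by rewrite ltr_pwDl// sqr_ge0. Qed.

Lemma weight_gt0 n (x : 'rV[R]_n) : 0 < weight x.
Proof. by apply: prodr_gt0 => i _; rewrite invr_gt0 weight_factor_gt0. Qed.

Lemma weight_ge0 n (x : 'rV[R]_n) : 0 <= weight x.
Proof. exact/ltW/weight_gt0. Qed.

Lemma weight_le1 n (x : 'rV[R]_n) : weight x <= 1.
Proof.
rewrite /weight -[leRHS](@big1_eq R 1 *%R _ (index_enum 'I_n) xpredT).
apply: ler_prod => i _; rewrite invr_ge0 ltW ?weight_factor_gt0//=.
by rewrite invf_le1 ?weight_factor_gt0// lerDl sqr_ge0.
Qed.

Lemma measurable_weight n : measurable_fun [set: 'rV[R]_n] (@weight n).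
Proof.
rewrite /weight; apply: measurable_prod => i _.
apply: (measurableT_comp (f := (fun x : R => (1 + x ^+ 2)^-1))).
  by apply: continuous_measurable_fun => x; exact: continuous_oneDsqrV.
exact: measurable_rV_coord.
Qed.

Lemma weight_cons n t (x : 'rV[R]_n) :
  weight (cons_rV (t, x)) = (1 + t ^+ 2)^-1 * weight x.
Proof.
rewrite /weight big_ord_recl cons_rV0; congr (_ * _).
by apply: eq_bigr => i _; rewrite cons_rVS.
Qed.

Lemma weight_row_mx m n (x : 'rV[R]_m) (y : 'rV[R]_n) :
  weight (row_mx x y) = weight x * weight y.
Proof.
rewrite /weight big_split_ord /=; congr (_ * _); apply: eq_bigr => i _.
  by rewrite row_mxEl.
by rewrite row_mxEr.
Qed.

Lemma integral_weight n :
  (\int[lebesgue_rV R n]_x (weight x)%:E = (pi ^+ n)%:E)%E.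
Proof.
elim: n => [|n IH].
  rewrite integral_dirac//; first by
    rewrite /dirac indicE mem_set// mul1e /weight big_ord0.
  by apply/measurable_EFinP; exact: measurable_weight.
rewrite ge0_integral_rVS; last 2 first.
- by apply/measurable_EFinP; exact: measurable_weight.
- by move=> x; rewrite lee_fin weight_ge0.
under eq_integral => t _.
  under eq_integral => x _ do rewrite weight_cons EFinM.
  rewrite ge0_integralZl//; last 3 first.
  - by apply/measurable_EFinP; exact: measurable_weight.
  - by move=> x _; rewrite lee_fin weight_ge0.
  - by rewrite lee_fin invr_ge0 addr_ge0// sqr_ge0.
  rewrite IH muleC.
  over.
rewrite ge0_integralZl//; last 3 first.
- apply/measurable_EFinP.
  by apply: continuous_measurable_fun => x; exact: continuous_oneDsqrV.
- by move=> x _; rewrite lee_fin invr_ge0 addr_ge0// sqr_ge0.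
- by rewrite lee_fin exprn_ge0// pi_ge0.
by rewrite integral_inv_oneDsqr exprSr -EFinM.
Qed.

End weight.

Section lifting.
Variables (R : realType) (d1 d2 : measure_display).
Variables (T1 : measurableType d1) (T2 : measurableType d2).
Variables (mu1 : {measure set T1 -> \bar R}) (mu2 : {measure set T2 -> \bar R}).

(** Positive and negative parts carry a substitution rule from nonnegative to integrable functions.
    The map is arbitrary, to serve both affine substitutions and the splitting of a row vector into
    two blocks. *)
Lemma Rintegral_comp (phi : T1 -> T2) (k : R) (g : T2 -> R) :
  (forall f : T2 -> \bar R, measurable_fun [set: T2] f -> (forall x, 0 <= f x)%E ->
    \int[mu1]_x f (phi x) = k%:E * \int[mu2]_x f x)%E ->
  mu2.-integrable [set: T2] (EFin \o g) ->
  \int[mu1]_x g (phi x) = k * \int[mu2]_x g x.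
Proof.
move=> H ig; rewrite /Rintegral integralE [in RHS]integralE.
have mg := measurable_int mu2 ig.
rewrite (_ : ((fun x => (g (phi x))%:E)^\+)%E = ((EFin \o g)^\+ \o phi)%E); last first.
  by apply/funext => x; rewrite /= !funeposE.
rewrite (_ : ((fun x => (g (phi x))%:E)^\-)%E = ((EFin \o g)^\- \o phi)%E); last first.
  by apply/funext => x; rewrite /= !funenegE.
rewrite (H (EFin \o g)^\+)%E//; last exact: measurable_funepos.
rewrite (H (EFin \o g)^\-)%E//; last exact: measurable_funeneg.
have := integrable_pos_fin_num measurableT ig.
have := integrable_neg_fin_num measurableT ig.
move/fineK => <- /fineK <-; rewrite -!EFinM -!EFinB /=.
by rewrite mulrBr.
Qed.

End lifting.

(** * Affine substitutions and splitting of variables *)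

Section affine_split.
Variable R : realType.

Lemma measurable_ge0_integral d (T : measurableType d) n
    (f : T * 'rV[R]_n -> \bar R) :
  measurable_fun [set: T * 'rV[R]_n] f -> (forall x, 0 <= f x)%E ->
  measurable_fun [set: T] (fun x => \int[lebesgue_rV R n]_y f (x, y))%E.
Proof.
move=> mf f0.
exact: (@measurable_fun_fubini_tonelli_F _ _ _ _ _ (lebesgue_rV R n) f mf f0).
Qed.

Lemma cons_rV_affine n (c : 'rV[R]_n.+1) h t x :
  c + h *: cons_rV (t, x) =
  cons_rV ((uncons_rV c).1 + h * t, (uncons_rV c).2 + h *: x).
Proof.
apply/rowP => j; rewrite mxE [X in _ + X]mxE.
have [j' ->|->] := unliftP ord0 j.
  by rewrite !cons_rVS /uncons_rV /= !mxE.
by rewrite !cons_rV0.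
Qed.

Lemma measurable_affine_rV n (c : 'rV[R]_n) h :
  measurable_fun [set: 'rV[R]_n] (fun x => c + h *: x).
Proof. by apply: measurable_rVD => //; exact: measurable_rVZ. Qed.

(** Induction on the dimension: the map acts on each coordinate separately, and each of them
    contributes one factor [|h|^-1]. *)
Lemma ge0_integral_affine_rV n (c : 'rV[R]_n) (h : R) (f : 'rV[R]_n -> \bar R) :
  h != 0 ->
  measurable_fun [set: 'rV[R]_n] f -> (forall x, 0 <= f x)%E ->
  (\int[lebesgue_rV R n]_x f (c + h *: x)%R =
   (`|h| ^- n)%:E * \int[lebesgue_rV R n]_x f x)%E.
Proof.
move=> h0; elim: n c f => [|n IH] c f mf f0.
  rewrite expr0 invr1 mul1e; apply: eq_integral => x _.
  by rewrite (_ : c + h *: x = x)//; apply/rowP => -[].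
have mc : measurable_fun [set: measurableTypeR R * 'rV[R]_n] (f \o @cons_rV R n).
  by apply: (measurableT_comp mf); exact: measurable_cons_rV.
rewrite !ge0_integral_rVS//; last first.
  by apply: (measurableT_comp mf); exact: measurable_affine_rV.
under eq_integral => t _.
  under eq_integral => x _ do rewrite cons_rV_affine.
  rewrite (IH _ (fun x => f (cons_rV (_, x))))//; last first.
    by apply: (measurableT_comp mc); exact: measurable_fun_pair.
  over.
set G := fun t : R => (\int[lebesgue_rV R n]_x f (cons_rV (t, x)))%E.
have mG : measurable_fun [set: measurableTypeR R] G.
  by apply: (measurable_ge0_integral mc) => x; apply: f0.
have G0 t : (0 <= G t)%E by apply: integral_ge0.
rewrite (_ : (fun t => _) = fun t => ((`|h| ^- n)%:E * G ((uncons_rV c).1 + h * t)%R)%E)//.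
have mH : measurable_fun [set: measurableTypeR R] (fun t => G ((uncons_rV c).1 + h * t)).
  have mphi : measurable_fun [set: measurableTypeR R]
      ((fun t => (uncons_rV c).1 + h * t) : measurableTypeR R -> measurableTypeR R).
    by apply: measurable_funD => //; exact: measurable_funM.
  exact: (measurableT_comp mG mphi).
rewrite ge0_integralZl; [|exact: measurableT|exact: mH|by []|]; last first.
  by rewrite lee_fin invr_ge0 exprn_ge0.
by rewrite ge0_integral_affine// muleA -EFinM exprS invfM mulrC.
Qed.

Lemma cons_row_mx m n t (x : 'rV[R]_m) (y : 'rV[R]_n) :
  cons_rV (t, row_mx x y) = row_mx (cons_rV (t, x)) y :> 'rV[R]_(m.+1 + n).
Proof.
apply/rowP => j; have [j' ->|->] := unliftP ord0 j; last first.
  rewrite cons_rV0 /=; have -> : ord0 = lshift n (ord0 : 'I_m.+1).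
    exact: val_inj.
  by rewrite row_mxEl cons_rV0.
rewrite cons_rVS /= -(fintype.splitK j'); case: (fintype.split j') => k /=.
  rewrite row_mxEl (_ : lift ord0 _ = lshift n (lift ord0 k)); last exact: val_inj.
  by rewrite row_mxEl cons_rVS.
rewrite row_mxEr (_ : lift ord0 _ = rshift m.+1 k); last exact: val_inj.
by rewrite row_mxEr.
Qed.

Lemma ge0_integral_row_mx m n (f : 'rV[R]_(m + n) -> \bar R) :
  measurable_fun [set: 'rV[R]_(m + n)] f -> (forall x, 0 <= f x)%E ->
  (\int[lebesgue_rV R (m + n)]_z f z =
   \int[lebesgue_rV R m]_x \int[lebesgue_rV R n]_y f (row_mx x y))%E.
Proof.
elim: m f => [|m IH] f mf f0.
  rewrite integral_dirac//; last first.
    apply: (measurable_ge0_integral (f := fun p => f (row_mx p.1 p.2))) => //.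
    by apply: (measurableT_comp mf); exact: measurable_row_mx.
  rewrite /dirac indicE mem_set// mul1e; apply: eq_integral => x _.
  by congr f; apply/rowP => j; rewrite -[j in RHS](@fintype.splitK 0 n);
   case: (fintype.split _) (@fintype.splitK 0 n j) => [[]//|k] /= <-;
   rewrite row_mxEr; congr (x _ _); exact: val_inj.
rewrite (@ge0_integral_rVS R (m + n))// [RHS]ge0_integral_rVS//; last 2 first.
- apply: (measurable_ge0_integral (f := fun p => f (row_mx p.1 p.2))) => //.
  by apply: (measurableT_comp mf); exact: measurable_row_mx.
- by move=> x; exact: integral_ge0.
apply: eq_integral => t _.
rewrite (IH (fun z => f (cons_rV (t, z) : 'rV[R]_(m.+1 + n))))//.
  apply: eq_integral => x _; apply: eq_integral => y _.
  by rewrite cons_row_mx.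
apply: (measurableT_comp (mf : measurable_fun [set: 'rV[R]_((m + n).+1)] f)).
apply: (measurableT_comp (measurable_cons_rV (R := R) (n := m + n))).
exact: measurable_fun_pair.
Qed.

End affine_split.

(** * Complex integrals dominated by the weight *)

Section complex_integrals.
Variable R : realType.

Lemma integrable_le_weight n (g : 'rV[R]_n -> R) (C : R) :
  measurable_fun [set: 'rV[R]_n] g -> (forall x, `|g x| <= C * weight x) ->
  (lebesgue_rV R n).-integrable [set: 'rV[R]_n] (EFin \o g).
Proof.
move=> mg gC; apply: (le_integrable measurableT (g := EFin \o (fun x => C * weight x))).
- exact/measurable_EFinP.
- by move=> x _; rewrite /= !lee_fin (le_trans (gC x))// ler_norm.
- have iw : (lebesgue_rV R n).-integrable [set: 'rV[R]_n] (EFin \o @weight R n).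
    apply/integrableP; split.
      by apply/measurable_EFinP; exact: measurable_weight.
    under eq_integral do rewrite /= ger0_norm ?weight_ge0//.
    by rewrite integral_weight ltry.
  exact: (integrableZl measurableT C iw).
Qed.

(** The class of integrands of the whole proof. It is stronger than integrability: a pointwise bound
    by [weight] passes to sections, to products with bounded functions and to affine
    substitutions. *)
Definition weighted n (f : 'rV[R]_n -> R[i]) :=
  cmeasurable f /\ exists C, forall x, modulus (f x) <= C * weight x.

(** The integral of [weight] is [pi ^+ n]; the factor 2 comes from estimating real and imaginary
    parts separately. *)
Definition weight_mass n : R := 2 * pi ^+ n.

Lemma weight_mass_gt0 n : 0 < weight_mass n.
Proof. by rewrite mulr_gt0// exprn_gt0// pi_gt0. Qed.

Lemma weighted_Re n (f : 'rV[R]_n -> R[i]) : weighted f ->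
  (lebesgue_rV R n).-integrable [set: 'rV[R]_n] (EFin \o (@complex.Re R \o f)).
Proof.
move=> [[mf _] [C fC]]; apply: (integrable_le_weight (C := C)) => // x.
exact: le_trans (Re_le_modulus _) (fC x).
Qed.

Lemma weighted_Im n (f : 'rV[R]_n -> R[i]) : weighted f ->
  (lebesgue_rV R n).-integrable [set: 'rV[R]_n] (EFin \o (@complex.Im R \o f)).
Proof.
move=> [[_ mf] [C fC]]; apply: (integrable_le_weight (C := C)) => // x.
exact: le_trans (Im_le_modulus _) (fC x).
Qed.

Lemma weightedD n (f g : 'rV[R]_n -> R[i]) : weighted f -> weighted g ->
  weighted (fun x => f x + g x).
Proof.
move=> [mf [C fC]] [mg [D gD]]; split; first exact: cmeasurableD.
by exists (C + D) => x; rewrite (le_trans (modulusD _ _))// mulrDl lerD.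
Qed.

Lemma weightedM n (c f : 'rV[R]_n -> R[i]) (K : R) : weighted f ->
  cmeasurable c -> (forall x, modulus (c x) <= K) ->
  weighted (fun x => c x * f x).
Proof.
move=> [mf [C fC]] mc cK; split; first exact: cmeasurableM.
exists (K * C) => x; rewrite modulusM -mulrA.
by apply: ler_pM => //; exact: modulus_ge0.
Qed.

Lemma weightedZ n (c : R[i]) (f : 'rV[R]_n -> R[i]) : weighted f ->
  weighted (fun x => c * f x).
Proof.
move=> wf; apply: (weightedM (c := fun=> c) (K := modulus c)) => //.
exact: cmeasurable_cst.
Qed.

Lemma weightedN n (f : 'rV[R]_n -> R[i]) : weighted f -> weighted (fun x => - f x).
Proof.
move=> [mf [C fC]]; split; first exact: cmeasurableN.
by exists C => x; rewrite modulusN.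
Qed.

Lemma weightedB n (f g : 'rV[R]_n -> R[i]) : weighted f -> weighted g ->
  weighted (fun x => f x - g x).
Proof. by move=> wf wg; apply: weightedD => //; exact: weightedN. Qed.

Lemma weighted_conj n (f : 'rV[R]_n -> R[i]) : weighted f ->
  weighted (fun x => conjc (f x)).
Proof.
move=> [mf [C fC]]; split; first exact: cmeasurable_conj.
by exists C => x; rewrite modulus_conj.
Qed.

Lemma weighted0 n : weighted (fun _ : 'rV[R]_n => 0).
Proof.
split; first exact: cmeasurable_cst.
by exists 0 => x; rewrite modulus0 mul0r.
Qed.

Lemma weighted_sum n (I : Type) (r : seq I) (P : pred I)
    (F : I -> 'rV[R]_n -> R[i]) :
  (forall i, weighted (F i)) -> weighted (fun x => \sum_(i <- r | P i) F i x).
Proof.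
move=> wF; elim: r => [|i r IH].
  by under [fun x => _]funext do rewrite big_nil; exact: weighted0.
under [fun x => _]funext do rewrite big_cons.
by case: (P i) => //; apply: weightedD.
Qed.

Lemma cintegralD n (f g : 'rV[R]_n -> R[i]) : weighted f -> weighted g ->
  cintegral (fun x => f x + g x) = cintegral f + cintegral g.
Proof.
move=> wf wg; apply: complex_ext; rewrite ?Re_add ?Im_add /cintegral /=.
- under eq_Rintegral do rewrite Re_add.
  by apply: RintegralD => //; exact: weighted_Re.
- under eq_Rintegral do rewrite Im_add.
  by apply: RintegralD => //; exact: weighted_Im.
Qed.

Lemma cintegralZ n (c : R[i]) (f : 'rV[R]_n -> R[i]) : weighted f ->
  cintegral (fun x => c * f x) = c * cintegral f.
Proof.
move=> wf; have rf := weighted_Re wf; have jf := weighted_Im wf.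
apply: complex_ext; rewrite ?Re_mul ?Im_mul /cintegral /=.
- under eq_Rintegral do rewrite Re_mul.
  rewrite RintegralB//; first by rewrite !RintegralZl.
  + exact: (integrableZl measurableT _ rf).
  + exact: (integrableZl measurableT _ jf).
- under eq_Rintegral do rewrite Im_mul.
  rewrite RintegralD//; first by rewrite !RintegralZl.
  + exact: (integrableZl measurableT _ jf).
  + exact: (integrableZl measurableT _ rf).
Qed.

Lemma cintegralZr n (c : R[i]) (f : 'rV[R]_n -> R[i]) : weighted f ->
  cintegral (fun x => f x * c) = cintegral f * c.
Proof.
move=> wf; rewrite mulrC -cintegralZ//.
by congr cintegral; apply/funext => x; rewrite mulrC.
Qed.

Lemma cintegralN n (f : 'rV[R]_n -> R[i]) : weighted f ->
  cintegral (fun x => - f x) = - cintegral f.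
Proof.
move=> wf; rewrite -mulN1r -cintegralZ//.
by congr cintegral; apply/funext => x; rewrite mulN1r.
Qed.

Lemma cintegralB n (f g : 'rV[R]_n -> R[i]) : weighted f -> weighted g ->
  cintegral (fun x => f x - g x) = cintegral f - cintegral g.
Proof. by move=> wf wg; rewrite cintegralD ?cintegralN//; exact: weightedN. Qed.

Lemma cintegral0 n : cintegral (fun _ : 'rV[R]_n => 0) = 0.
Proof.
by have := cintegralZ 0 (@weighted0 n); rewrite !mul0r.
Qed.

Lemma cintegral_sum n (I : Type) (r : seq I) (P : pred I)
    (F : I -> 'rV[R]_n -> R[i]) : (forall i, weighted (F i)) ->
  cintegral (fun x => \sum_(i <- r | P i) F i x) =
  \sum_(i <- r | P i) cintegral (F i).
Proof.
move=> wF; elim: r => [|i r IH].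
  by under [fun x => _]funext do rewrite big_nil; rewrite cintegral0 big_nil.
under [fun x => _]funext do rewrite big_cons.
rewrite big_cons; case: (P i) => //; rewrite cintegralD ?IH//.
exact: weighted_sum.
Qed.

Lemma cintegral_conj n (f : 'rV[R]_n -> R[i]) : weighted f ->
  cintegral (fun x => conjc (f x)) = conjc (cintegral f).
Proof.
move=> wf; apply: complex_ext; rewrite ?Re_conjc ?Im_conjc /cintegral /=.
- by apply: eq_Rintegral => x _; rewrite Re_conjc.
- rewrite -mulN1r -RintegralZl//; last exact: weighted_Im.
  by apply: eq_Rintegral => x _; rewrite Im_conjc mulN1r.
Qed.

Lemma cintegral_eq n (f g : 'rV[R]_n -> R[i]) : f =1 g ->
  cintegral f = cintegral g.
Proof. by move=> fg; congr cintegral; exact/funext. Qed.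

Lemma Rintegral_weight n : \int[lebesgue_rV R n]_x weight x = pi ^+ n.
Proof. by rewrite /Rintegral integral_weight. Qed.

Lemma Rintegral_le_weight n (g : 'rV[R]_n -> R) C :
  measurable_fun [set: 'rV[R]_n] g -> (forall x, `|g x| <= C * weight x) ->
  `|\int[lebesgue_rV R n]_x g x| <= C * pi ^+ n.
Proof.
move=> mg gC; apply: (le_trans (le_normr_Rintegral _ (integrable_le_weight mg gC))) => //.
rewrite -Rintegral_weight -RintegralZl//.
- apply: le_Rintegral => //.
  + apply: (integrable_le_weight (C := C)) => [|x]; last by rewrite normr_id.
    exact: measurableT_comp.
  + apply: (integrable_le_weight (C := `|C|)) => [|x].
      by apply: measurable_funM => //; exact: measurable_weight.
    by rewrite normrM (ger0_norm (weight_ge0 _)).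
- apply: (integrable_le_weight (C := 1)) => [|x]; first exact: measurable_weight.
  by rewrite mul1r ger0_norm ?weight_ge0.
Qed.

Lemma cintegral_le n (f : 'rV[R]_n -> R[i]) C :
  cmeasurable f -> (forall x, modulus (f x) <= C * weight x) ->
  modulus (cintegral f) <= C * weight_mass n.
Proof.
move=> [mr mi] fC; rewrite (le_trans (modulus_le _))// /weight_mass.
rewrite mulrCA mulr2n mulrDl mul1r lerD// Rintegral_le_weight// => x.
- exact: le_trans (Re_le_modulus _) (fC x).
- exact: le_trans (Im_le_modulus _) (fC x).
Qed.

Lemma measurable_Rintegral d (T : measurableType d) n (f : T * 'rV[R]_n -> R) :
  measurable_fun [set: T * 'rV[R]_n] f ->
  measurable_fun [set: T] (fun x => \int[lebesgue_rV R n]_y f (x, y)).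
Proof.
move=> mf; rewrite /Rintegral; apply: (measurableT_comp (f := fine)) => //.
under [fun x => _]funext do rewrite integralE.
apply: emeasurable_funB.
- rewrite (_ : (fun x => _) = fun x => (\int[lebesgue_rV R n]_y (EFin \o f)^\+ (x, y))%E).
    apply: measurable_ge0_integral => //.
    by apply: measurable_funepos; exact/measurable_EFinP.
  by apply/funext => x; apply: eq_integral => y _; rewrite !funeposE.
- rewrite (_ : (fun x => _) = fun x => (\int[lebesgue_rV R n]_y (EFin \o f)^\- (x, y))%E).
    apply: measurable_ge0_integral => //.
    by apply: measurable_funeneg; exact/measurable_EFinP.
  by apply/funext => x; apply: eq_integral => y _; rewrite !funenegE.
Qed.

Lemma cmeasurable_cintegral d (T : measurableType d) n
    (f : T -> 'rV[R]_n -> R[i]) :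
  cmeasurable (fun p : T * 'rV[R]_n => f p.1 p.2) ->
  cmeasurable (fun x => cintegral (f x)).
Proof.
move=> [mr mi]; split.
- exact: (measurable_Rintegral mr).
- exact: (measurable_Rintegral mi).
Qed.

Lemma integrable_le_weight2 m n (g : 'rV[R]_m * 'rV[R]_n -> R) (C : R) :
  measurable_fun [set: 'rV[R]_m * 'rV[R]_n] g ->
  (forall x y, `|g (x, y)| <= C * (weight x * weight y)) ->
  (lebesgue_rV R m \x lebesgue_rV R n)%E.-integrable
    [set: 'rV[R]_m * 'rV[R]_n] (EFin \o g).
Proof.
move=> mg gC.
have mabs : measurable_fun [set: 'rV[R]_m * 'rV[R]_n] (fun z => `|(g z)%:E|%E).
  by apply: measurableT_comp => //; exact/measurable_EFinP.
apply/integrable12ltyP; first exact/measurable_EFinP.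
have C0 : 0 <= C.
  have := le_trans (normr_ge0 _) (gC 0 0).
  by rewrite pmulr_lge0// mulr_gt0 ?weight_gt0.
apply: (@le_lt_trans _ _ (\int[lebesgue_rV R m]_x
    ((C * pi ^+ n)%:E * (weight x)%:E))%E).
  apply: ge0_le_integral => //.
  - by move=> x _; exact: integral_ge0.
  - exact: (@measurable_ge0_integral R _ _ n (fun z => `|(g z)%:E|%E)).
  - apply: emeasurable_funM => //.
    by apply/measurable_EFinP; exact: measurable_weight.
  - move=> x _ /=.
    apply: (@le_trans _ _ (\int[lebesgue_rV R n]_y ((C * weight x)%:E * (weight y)%:E))%E).
      apply: ge0_le_integral => //.
      + apply: (measurableT_comp mabs); exact: measurable_fun_pair.
      + apply: emeasurable_funM => //.
        by apply/measurable_EFinP; exact: measurable_weight.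
      + by move=> y _; rewrite -EFinM lee_fin -mulrA gC.
    rewrite ge0_integralZl//; last 3 first.
    + by apply/measurable_EFinP; exact: measurable_weight.
    + by move=> y _; rewrite lee_fin weight_ge0.
    + by rewrite lee_fin mulr_ge0 ?weight_ge0.
    by rewrite integral_weight -!EFinM lee_fin mulrAC.
rewrite ge0_integralZl//; last 3 first.
+ by apply/measurable_EFinP; exact: measurable_weight.
+ by move=> y _; rewrite lee_fin weight_ge0.
+ by rewrite lee_fin mulr_ge0 ?exprn_ge0 ?pi_ge0.
by rewrite integral_weight -EFinM ltry.
Qed.

Section two_variables.
Variables (m n : nat) (f : 'rV[R]_m -> 'rV[R]_n -> R[i]) (C : R).
Hypothesis mf : cmeasurable (fun p : 'rV[R]_m * 'rV[R]_n => f p.1 p.2).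
Hypothesis fC : forall x y, modulus (f x y) <= C * (weight x * weight y).

Let iRe := @integrable_le_weight2 m n _ C mf.1
  (fun x y => le_trans (Re_le_modulus _) (fC x y)).
Let iIm := @integrable_le_weight2 m n _ C mf.2
  (fun x y => le_trans (Im_le_modulus _) (fC x y)).

Lemma weighted_section x : weighted (f x).
Proof.
split; last by exists (C * weight x) => y; rewrite -mulrA.
apply: (cmeasurable_comp mf (g := fun y => (x, y))); exact: measurable_fun_pair.
Qed.

Lemma weighted_section2 y : weighted (f^~ y).
Proof.
split; last by exists (C * weight y) => x; rewrite mulrAC -mulrA.
apply: (cmeasurable_comp mf (g := fun x => (x, y))); exact: measurable_fun_pair.
Qed.

Lemma cintegral_exchange :
  cintegral (fun x => cintegral (f x)) = cintegral (fun y => cintegral (f^~ y)).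
Proof.
have wx := weighted_section; have wy := weighted_section2.
apply: complex_ext; rewrite /cintegral /=.
- congr fine; transitivity (\int[lebesgue_rV R m]_x \int[lebesgue_rV R n]_y
      (complex.Re (f x y))%:E)%E.
    by apply: eq_integral => x _; rewrite fineK// (integrable_fin_num _ (weighted_Re (wx x))).
  rewrite (Fubini iRe); apply: eq_integral => y _.
  by rewrite fineK// (integrable_fin_num _ (weighted_Re (wy y))).
- congr fine; transitivity (\int[lebesgue_rV R m]_x \int[lebesgue_rV R n]_y
      (complex.Im (f x y))%:E)%E.
    by apply: eq_integral => x _; rewrite fineK// (integrable_fin_num _ (weighted_Im (wx x))).
  rewrite (Fubini iIm); apply: eq_integral => y _.
  by rewrite fineK// (integrable_fin_num _ (weighted_Im (wy y))).
Qed.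

End two_variables.

Lemma cintegral_affine n (c : 'rV[R]_n) (h : R) (f : 'rV[R]_n -> R[i]) :
  h != 0 -> weighted f ->
  cintegral (fun x => f (c + h *: x)) = (`|h| ^- n)%:C * cintegral f.
Proof.
move=> h0 wf.
have H (g : 'rV[R]_n -> \bar R) : measurable_fun [set: 'rV[R]_n] g ->
    (forall x, 0 <= g x)%E -> (\int[lebesgue_rV R n]_x g (c + h *: x)%R =
    (`|h| ^- n)%:E * \int[lebesgue_rV R n]_x g x)%E.
  by move=> mg g0; exact: ge0_integral_affine_rV.
apply: complex_ext; rewrite ?Re_mul ?Im_mul /cintegral /= mul0r ?subr0 ?addr0.
- exact: (Rintegral_comp H (weighted_Re wf)).
- exact: (Rintegral_comp H (weighted_Im wf)).
Qed.

(** Peetre's inequality in each coordinate. *)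
Lemma weighted_shift_bound n (c : 'rV[R]_n) (h : R) : h != 0 ->
  exists2 K, 0 < K & forall x, weight (c + h *: x) <= K * weight x.
Proof.
move=> h0.
(* With [a] the entry of [c], [b] that of [x] and [t = h * b], both 1 and [t ^+ 2] are at most
   [2 * (1 + a ^+ 2) * (1 + (a + t) ^+ 2)], while [1 + b ^+ 2 = 1 + h ^- 2 * t ^+ 2]. *)
exists (\prod_(i < n) (2 * (1 + c ord0 i ^+ 2) * (1 + h ^- 2))).
  apply: prodr_gt0 => i _; rewrite !mulr_gt0// ltr_pwDl// ?sqr_ge0//.
  by rewrite invr_ge0 sqr_ge0.
move=> x; rewrite /weight -big_split /=; apply: ler_prod => i _.
rewrite invr_ge0 ltW ?weight_factor_gt0//= !mxE.
set a := c _ _; set b := x _ _.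
rewrite ler_pdivlMr ?ltr_pwDl ?sqr_ge0// mulrC ler_pdivrMr ?ltr_pwDl ?sqr_ge0//.
have e : h ^- 2 * h ^+ 2 = 1 by rewrite mulVf// expf_neq0.
have k0 : 0 <= h ^- 2 by rewrite invr_ge0 sqr_ge0.
set k := h ^- 2 in e k0 *.
have -> : 1 + b ^+ 2 = 1 + k * (h * b) ^+ 2 by rewrite exprMn mulrA e mul1r.
set t := h * b.
have h1 : t ^+ 2 <= 2 * (1 + a ^+ 2) * (1 + (a + t) ^+ 2).
  by have := sqr_ge0 (2 * a + t); have := sqr_ge0 (a * (a + t)); lra.
have h2 : 1 <= 2 * (1 + a ^+ 2) * (1 + (a + t) ^+ 2).
  have := sqr_ge0 a; have := sqr_ge0 (a + t).
  by have := sqr_ge0 (a * (a + t)); lra.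
have := ler_wpM2l k0 h1; set P := 2 * (1 + a ^+ 2) in h1 h2 *; set Q := 1 + (a + t) ^+ 2 in h1 h2 *.
move=> h3; rewrite (_ : P * (1 + k) * Q = P * Q + k * (P * Q)); last by ring.
exact: lerD.
Qed.

Lemma weighted_affine n (c : 'rV[R]_n) (h : R) (f : 'rV[R]_n -> R[i]) :
  h != 0 -> weighted f -> weighted (fun x => f (c + h *: x)).
Proof.
move=> h0 [mf [C fC]]; split.
  by apply: (cmeasurable_comp mf); exact: measurable_affine_rV.
have [K K0 HK] := weighted_shift_bound c h0.
have C0 : 0 <= C.
  have := le_trans (modulus_ge0 _) (fC 0).
  by rewrite pmulr_lge0// weight_gt0.
by exists (C * K) => x; rewrite (le_trans (fC _))// -mulrA ler_wpM2l.
Qed.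

Lemma cintegral_shift n (c : 'rV[R]_n) (f : 'rV[R]_n -> R[i]) :
  weighted f -> cintegral (fun x => f (x + c)) = cintegral f.
Proof.
move=> wf; have := cintegral_affine c (oner_neq0 R) wf.
rewrite normr1 expr1n invr1 mul1r => <-.
by apply: cintegral_eq => x; rewrite scale1r addrC.
Qed.

Lemma weighted_shift n (c : 'rV[R]_n) (f : 'rV[R]_n -> R[i]) :
  weighted f -> weighted (fun x => f (x + c)).
Proof.
move=> wf; have := weighted_affine c (oner_neq0 R) wf.
by congr weighted; apply/funext => x; rewrite scale1r addrC.
Qed.

Lemma weighted_row_mx m n (f : 'rV[R]_(m + n) -> R[i]) (C : R) :
  cmeasurable f -> (forall z, modulus (f z) <= C * weight z) ->
  cmeasurable (fun p : 'rV[R]_m * 'rV[R]_n => f (row_mx p.1 p.2)) /\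
  forall x y, modulus (f (row_mx x y)) <= C * (weight x * weight y).
Proof.
move=> mf fC; split; last by move=> x y; rewrite (le_trans (fC _))// weight_row_mx.
apply: (cmeasurable_comp mf).
exact: (measurable_row_mx (R := R) (f := fst) (g := snd)).
Qed.

Lemma cintegral_row_mx m n (f : 'rV[R]_(m + n) -> R[i]) : weighted f ->
  cintegral f = cintegral (fun x : 'rV[R]_m => cintegral (fun y : 'rV[R]_n => f (row_mx x y))).
Proof.
move=> wf; have [mf [C fC]] := wf; have [mg gC] := weighted_row_mx mf fC.
have H (g : 'rV[R]_(m + n) -> \bar R) : measurable_fun [set: 'rV[R]_(m + n)] g ->
    (forall x, 0 <= g x)%E ->
    (\int[lebesgue_rV R m \x lebesgue_rV R n]_p g (row_mx p.1 p.2) =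
    1%:E * \int[lebesgue_rV R (m + n)]_x g x)%E.
  move=> mG g0; rewrite mul1e ge0_integral_row_mx// fubini_tonelli1//.
  apply: (measurableT_comp mG).
  exact: (measurable_row_mx (R := R) (f := fst) (g := snd)).
have wx := weighted_section mg gC.
apply: complex_ext; rewrite /cintegral /=.
- rewrite -[LHS]mul1r -(Rintegral_comp H (weighted_Re wf)) /Rintegral.
  rewrite -(integral12_prod_meas1 (@integrable_le_weight2 m n _ C mg.1
    (fun x y => le_trans (Re_le_modulus _) (gC x y)))).
  congr fine; apply: eq_integral => x _.
  by rewrite fineK// (integrable_fin_num _ (weighted_Re (wx x))).
- rewrite -[LHS]mul1r -(Rintegral_comp H (weighted_Im wf)) /Rintegral.
  rewrite -(integral12_prod_meas1 (@integrable_le_weight2 m n _ C mg.2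
    (fun x y => le_trans (Im_le_modulus _) (gC x y)))).
  congr fine; apply: eq_integral => x _.
  by rewrite fineK// (integrable_fin_num _ (weighted_Im (wx x))).
Qed.

End complex_integrals.

(** * Directional derivatives of complex functions *)

Section directional.
Variables (R : realType) (n : nat).
Local Notation E := 'rV[R]_n.
Implicit Types (f g : E -> R) (x v : E) (t d : R) (j : 'I_n).

Definition ej j : E := delta_mx ord0 j.

Lemma is_derive_line f x v d t : is_derive (x + t *: v) v f d ->
  is_derive t 1 (fun s : R => f (x + s *: v)) d.
Proof.
have eq : (fun h : R => h^-1 *: (((fun s : R => f (x + s *: v)) \o shift t) (h *: 1)
      - f (x + t *: v))) =
    (fun h : R => h^-1 *: ((f \o shift (x + t *: v)) (h *: v) - f (x + t *: v))).
  apply/funext => h /=; congr (_ *: (f _ - _)).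
  by rewrite scaler1 scalerDl addrCA.
case=> D1 D2; apply: DeriveDef.
  by rewrite /derivable eq.
by rewrite /derive eq.
Qed.

Lemma mvt_direction f x v t (f' : E -> R) :
  (forall y, is_derive y v f (f' y)) ->
  exists2 c, `|c| <= `|t| & f (x + t *: v) - f x = t * f' (x + c *: v).
Proof.
move=> df; pose g s := f (x + s *: v).
have dg (s : R) : is_derive s (1 : R) g (f' (x + s *: v)) by exact: is_derive_line.
have cg a b : {within `[a, b], continuous g}.
  by apply: derivable_within_continuous => s _; exact: ex_derive.
have [t0|t0|<-] := ltgtP 0 t; last first.
- exists 0 => //; by rewrite scale0r addr0 subrr mul0r.
- have [c + e] := MVT t0 (fun s _ => dg s) (cg t 0).
  rewrite in_itv/= => /andP[c1 c2]; exists c.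
    by rewrite !ltr0_norm ?lerN2 ?ltW.
  rewrite -[f x]/(f x) -opprB; move: e; rewrite /g scale0r addr0 => ->.
  by rewrite sub0r mulrN opprK mulrC.
- have [c + e] := MVT t0 (fun s _ => dg s) (cg 0 t).
  rewrite in_itv/= => /andP[c1 c2]; exists c.
    by rewrite !gtr0_norm ?ltW.
  by move: e; rewrite /g scale0r addr0 => ->; rewrite subr0 mulrC.
Qed.

(** The criterion behind differentiation under an integral: a bound by [K * t ^+ 2] can be
    integrated, whereas a limit would require a convergence theorem. *)
Lemma is_derive_quadratic (V : normedModType R) (f : V -> R) (x v : V) (d K : R) :
  (forall t, `|f (x + t *: v) - f x - t * d| <= K * t ^+ 2) ->
  is_derive x v f d.
Proof.
move=> H.
have C : h^-1 *: ((f \o shift x) (h *: v) - f x) @[h --> 0^'] --> d.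
  apply/cvgrPdist_le => e e0.
  have K0 : 0 < `|K| + 1 by rewrite ltr_wpDl.
  near=> h.
  have h0 : h != 0 by near: h; exact: nbhs_dnbhs_neq.
  have h0' : 0 < `|h| by rewrite normr_gt0.
  rewrite distrC /= -(ler_pM2l h0') -normrM mulrBr [X in `|X - _|]mulrA divff// mul1r addrC.
  have := H h; rewrite addrC [h *: v + x]addrC => /le_trans; apply.
  rewrite -real_normK ?num_real// expr2 mulrCA ler_pM2l//.
  rewrite (@le_trans _ _ ((`|K| + 1) * `|h|))// ?ler_pM2r//.
    by rewrite (le_trans (ler_norm _))// lerDl.
  rewrite mulrC -ler_pdivlMr//.
  by near: h; apply: dnbhs0_le; rewrite divr_gt0.
by apply: DeriveDef; [exact: (cvgP _ C)|exact: (cvg_lim _ C)].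
Unshelve. all: by end_near. Qed.

Lemma is_derive_const_along f x v : (forall t, f (x + t *: v) = f x) ->
  is_derive x v f 0.
Proof.
move=> H; apply: (@is_derive_quadratic _ _ _ _ _ 0) => t.
by rewrite H mulr0 subrr subr0 normr0 mul0r.
Qed.

End directional.

Section complex_derivatives.
Variables (R : realType).

Definition cderive n (j : 'I_n) (f g : 'rV[R]_n -> R[i]) := forall x,
  is_derive x (ej R j) (@complex.Re R \o f) (complex.Re (g x)) /\
  is_derive x (ej R j) (@complex.Im R \o f) (complex.Im (g x)).

Definition ccontinuous n (f : 'rV[R]_n -> R[i]) :=
  continuous (@complex.Re R \o f) /\ continuous (@complex.Im R \o f).

Lemma cderiveM n (j : 'I_n) f f' g g' : cderive j f f' -> cderive j g g' ->
  cderive j (fun x => f x * g x) (fun x => f' x * g x + f x * g' x).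
Proof.
move=> F G x; have [f1 f2] := F x; have [g1 g2] := G x; split.
- rewrite (_ : _ \o _ = ((@complex.Re R \o f) * (@complex.Re R \o g)) -
    ((@complex.Im R \o f) * (@complex.Im R \o g))); last first.
    by apply/funext => y; rewrite /= Re_mul.
  apply: (is_derive_eq (is_deriveB (is_deriveM f1 g1) (is_deriveM f2 g2))).
  by rewrite Re_add !Re_mul /= /GRing.scale /=; ring.
- rewrite (_ : _ \o _ = ((@complex.Re R \o f) * (@complex.Im R \o g)) +
    ((@complex.Im R \o f) * (@complex.Re R \o g))); last first.
    by apply/funext => y; rewrite /= Im_mul.
  apply: (is_derive_eq (is_deriveD (is_deriveM f1 g2) (is_deriveM f2 g1))).
  by rewrite Im_add !Im_mul /= /GRing.scale /=; ring.
Qed.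

Lemma cderiveD n (j : 'I_n) f f' g g' : cderive j f f' -> cderive j g g' ->
  cderive j (fun x => f x + g x) (fun x => f' x + g' x).
Proof.
move=> F G x; have [f1 f2] := F x; have [g1 g2] := G x; split.
- rewrite (_ : _ \o _ = (@complex.Re R \o f) + (@complex.Re R \o g)); last first.
    by apply/funext => y; rewrite /= Re_add.
  by apply: (is_derive_eq (is_deriveD f1 g1)); rewrite Re_add.
- rewrite (_ : _ \o _ = (@complex.Im R \o f) + (@complex.Im R \o g)); last first.
    by apply/funext => y; rewrite /= Im_add.
  by apply: (is_derive_eq (is_deriveD f2 g2)); rewrite Im_add.
Qed.

Lemma cderive_cst n (j : 'I_n) (c : R[i]) : cderive j (fun=> c) (fun=> 0).
Proof. by move=> x; split; exact: is_derive_cst. Qed.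

Lemma cderiveZ n (j : 'I_n) (c : R[i]) f f' : cderive j f f' ->
  cderive j (fun x => c * f x) (fun x => c * f' x).
Proof.
move=> F; have := cderiveM (cderive_cst j c) F.
by congr cderive; apply/funext => x; rewrite mul0r add0r.
Qed.

Lemma cderive_sum n (j : 'I_n) (I : Type) (r : seq I) (F G : I -> 'rV[R]_n -> R[i]) :
  (forall i, cderive j (F i) (G i)) ->
  cderive j (fun x => \sum_(i <- r) F i x) (fun x => \sum_(i <- r) G i x).
Proof.
move=> H; elim: r => [|i r IH].
  have e (K : I -> 'rV[R]_n -> R[i]) : (fun x => \sum_(i <- [::]) K i x) = fun=> 0.
    by apply/funext => x; rewrite big_nil.
  by rewrite !e; exact: cderive_cst.
have e (K : I -> 'rV[R]_n -> R[i]) : (fun x => \sum_(i <- i :: r) K i x) =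
    fun x => K i x + \sum_(i <- r) K i x.
  by apply/funext => x; rewrite big_cons.
by rewrite !e; exact: cderiveD.
Qed.

Lemma cderive_conj n (j : 'I_n) f f' : cderive j f f' ->
  cderive j (fun x => conjc (f x)) (fun x => conjc (f' x)).
Proof.
move=> F x; have [f1 f2] := F x; split.
- rewrite (_ : _ \o _ = (@complex.Re R \o f)) ?Re_conjc//.
  by apply/funext => y; rewrite /= Re_conjc.
- rewrite (_ : _ \o _ = - (@complex.Im R \o f)) ?Im_conjc; last first.
    by apply/funext => y; rewrite /= Im_conjc.
  exact: is_deriveN.
Qed.

(** Only the restriction of [A] to the line through [x] along [v] enters, so the two spaces may have
    different dimensions, as for the embedding of one block of variables into phase space. *)
Lemma is_derive_rescale m n (f : 'rV[R]_m -> R) (A : 'rV[R]_n -> 'rV[R]_m)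
    (x : 'rV[R]_n) (v : 'rV[R]_n) (w : 'rV[R]_m) (h d : R) :
  (forall t, A (x + t *: v) = A x + (t * h) *: w) ->
  is_derive (A x) w f d -> is_derive x v (f \o A) (h * d).
Proof.
move=> HA df.
have H1 : is_derive (0 : R) 1 (fun s : R => f (A x + s *: w)) d.
  by apply: is_derive_line; rewrite scale0r addr0.
have H2 : is_derive (0 : R) 1 (fun s : R => h * s) h.
  rewrite (_ : (fun s => _) = (h \*: id)); last by [].
  by apply: (is_derive_eq (is_deriveZ h (is_derive_id _ _))); rewrite /GRing.scale /= mulr1.
have H1' : is_derive (h * 0) 1 (fun s : R => f (A x + s *: w)) d by rewrite mulr0.
have H3 := is_derive1_comp H1' H2.
have eq : (fun s : R => f (A x + s *: w)) \o (fun s => h * s) =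
    (fun s : R => (f \o A) (x + s *: v)).
  by apply/funext => s /=; rewrite HA mulrC.
rewrite eq in H3.
have eq2 : (fun k : R => k^-1 *: (((fun s : R => (f \o A) (x + s *: v)) \o shift 0) (k *: 1)
      - (f \o A) (x + (0 : R) *: v))) =
    (fun k : R => k^-1 *: (((f \o A) \o shift x) (k *: v) - (f \o A) x)).
  apply/funext => k /=; rewrite scale0r !addr0; congr (_ *: (f (A _) - _)).
  by rewrite scaler1 addrC.
case: H3 => D1 D2; apply: DeriveDef.
  by move: D1; rewrite /derivable eq2.
by move: D2; rewrite /derive eq2 => ->; rewrite mulrC.
Qed.

Lemma is_derive_comp_line n (l : 'rV[R]_n -> R) (x v : 'rV[R]_n) (h : R)
    (f : R -> R) (d : R) :
  (forall t, l (x + t *: v) = l x + t * h) ->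
  is_derive (l x) 1 f d -> is_derive x v (fun y => f (l y)) (h * d).
Proof.
(* A function of a real variable is viewed on row vectors of length 1, which makes
   [is_derive_rescale] applicable. *)
move=> Hl df; pose F (w : 'rV[R]_1) := f (w ord0 ord0).
have dF : is_derive (const_mx (l x) : 'rV[R]_1) (const_mx 1) F d.
  have eq : (fun h : R => h^-1 *: ((F \o shift (const_mx (l x) : 'rV[R]_1))
      (h *: const_mx 1) - F (const_mx (l x)))) =
      (fun h : R => h^-1 *: ((f \o shift (l x)) (h *: 1) - f (l x))).
    by apply/funext => k; rewrite /F /= !mxE.
  case: df => D1 D2; apply: DeriveDef; first by rewrite /derivable eq.
  by rewrite /derive eq.
have := @is_derive_rescale 1 n F (fun y => const_mx (l y)) x v (const_mx 1) h d.
rewrite /F => /(_ _ dF) H; have := H _.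
rewrite (_ : (fun w : 'rV[R]_1 => f (w ord0 ord0)) \o _ = (fun y => f (l y))).
  by apply => t; apply/rowP => k; rewrite !mxE Hl mulr1.
by apply/funext => y /=; rewrite mxE.
Qed.

Lemma cderive_rescale m n (f f' : 'rV[R]_m -> R[i]) (A : 'rV[R]_n -> 'rV[R]_m)
    (i : 'I_n) (j : 'I_m) (h : R) :
  (forall x t, A (x + t *: ej R i) = A x + (t * h) *: ej R j) ->
  cderive j f f' -> cderive i (fun x => f (A x)) (fun x => h%:C * f' (A x)).
Proof.
move=> HA df x; have [f1 f2] := df (A x).
rewrite Re_mul Im_mul /= !mul0r subr0 addr0; split.
- exact: (is_derive_rescale (HA x) f1).
- exact: (is_derive_rescale (HA x) f2).
Qed.

Lemma dotv_line n (x xi : 'rV[R]_n) t j :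
  dotv (x + t *: ej R j) xi = dotv x xi + t * xi ord0 j.
Proof.
rewrite /dotv; transitivity (\sum_k (x ord0 k * xi ord0 k +
    (if k == j then t * xi ord0 k else 0))).
  apply: eq_bigr => k _; rewrite !mxE eqxx /=.
  by case: (k == j); rewrite ?mulr1 ?mulr0 ?addr0 ?mulrDl.
by rewrite big_split /= -big_mkcond big_pred1_eq.
Qed.

Lemma cderive_expi n (j : 'I_n) (xi : 'rV[R]_n) :
  cderive j (fun y => expi (dotv y xi))
            (fun y => (xi ord0 j) *i * expi (dotv y xi)).
Proof.
move=> x; rewrite Re_mul Im_mul /= !mul0r sub0r add0r.
have H1 : is_derive (dotv x xi) 1 (@cos R) (- sin (dotv x xi)) by exact: is_derive_cos.
have H2 : is_derive (dotv x xi) 1 (@sin R) (cos (dotv x xi)) by exact: is_derive_sin.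
have line (f : R -> R) (d : R) : is_derive (dotv x xi) 1 f d ->
    is_derive x (ej R j) (fun y => f (dotv y xi)) (xi ord0 j * d).
  move=> df; apply: (@is_derive_comp_line n (fun y => dotv y xi)) => // t.
  exact: dotv_line.
split.
- by have := line _ _ H1; rewrite mulrN.
- exact: line _ _ H2.
Qed.

(** The mean value theorem fails for complex values; using it for real and imaginary parts costs the
    factor 2. *)
Lemma mvt_cderive n (j : 'I_n) f f' x t (M : R) : cderive j f f' ->
  (forall c, `|c| <= `|t| -> modulus (f' (x + c *: ej R j)) <= M) ->
  modulus (f (x + t *: ej R j) - f x) <= 2 * `|t| * M.
Proof.
move=> df fM; apply: (le_trans (modulus_le _)).
rewrite !Re_add !Re_opp !Im_add !Im_opp.
have [c ct ->] := mvt_direction x t (fun y => (df y).1).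
have [c' ct' ->] := mvt_direction x t (fun y => (df y).2).
rewrite -mulrA mulr_natl mulr2n !normrM lerD// ler_wpM2l//.
- exact: le_trans (Re_le_modulus _) (fM _ ct).
- exact: le_trans (Im_le_modulus _) (fM _ ct').
Qed.

(** Two mean value steps, from [f] to [f'] and from [f'] to [f''], in real and imaginary parts
    separately; the constant is not sharp. *)
Lemma taylor_cderive n (j : 'I_n) f f' f'' x t (M : R) :
  cderive j f f' -> cderive j f' f'' ->
  (forall c, `|c| <= `|t| -> modulus (f'' (x + c *: ej R j)) <= M) ->
  modulus (f (x + t *: ej R j) - f x - t%:C * f' x) <= 2 * M * t ^+ 2.
Proof.
move=> df ddf fM; apply: (le_trans (modulus_le _)).
have key (g g' g'' : 'rV[R]_n -> R) :
    (forall y, is_derive y (ej R j) g (g' y)) ->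
    (forall y, is_derive y (ej R j) g' (g'' y)) ->
    (forall c, `|c| <= `|t| -> `|g'' (x + c *: ej R j)| <= M) ->
    `|g (x + t *: ej R j) - g x - t * g' x| <= M * t ^+ 2.
  move=> dg ddg gM.
  have [c ct ->] := mvt_direction x t dg.
  have [c' ct' e] := mvt_direction x c ddg.
  rewrite -mulrBr e !normrM -[t ^+ 2]real_normK ?num_real// expr2 [M * _]mulrCA.
  apply: ler_wpM2l => //; rewrite mulrC; apply: ler_pM => //.
  by rewrite gM// (le_trans ct').
rewrite !Re_add !Re_opp !Im_add !Im_opp Re_mul Im_mul /= !mul0r subr0 addr0.
rewrite -mulrA mulr_natl mulr2n lerD//.
- apply: (key _ _ (@complex.Re R \o f'') (fun y => (df y).1) (fun y => (ddf y).1)) => c ct.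
  exact: le_trans (Re_le_modulus _) (fM _ ct).
- apply: (key _ _ (@complex.Im R \o f'') (fun y => (df y).2) (fun y => (ddf y).2)) => c ct.
  exact: le_trans (Im_le_modulus _) (fM _ ct).
Qed.

Lemma cderive_quadratic n (j : 'I_n) f f' K :
  (forall x t, modulus (f (x + t *: ej R j) - f x - t%:C * f' x) <= K * t ^+ 2) ->
  cderive j f f'.
Proof.
move=> H x; split; apply: (@is_derive_quadratic _ _ _ _ _ _ K) => t;
  apply: le_trans (H x t).
- apply: le_trans (Re_le_modulus _).
  by rewrite !Re_add !Re_opp Re_mul /= mul0r subr0.
- apply: le_trans (Im_le_modulus _).
  by rewrite !Im_add !Im_opp Im_mul /= mul0r addr0.
Qed.

End complex_derivatives.

(** * Japanese bracket and smooth functions *)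

Section japanese_bracket.
Variable R : realType.
Implicit Types (n : nat).

Lemma dotv_ge0 n (x : 'rV[R]_n) : 0 <= dotv x x.
Proof. by apply: sumr_ge0 => i _; rewrite -expr2 sqr_ge0. Qed.

Lemma japanese_sqr n (x : 'rV[R]_n) : japanese x ^+ 2 = 1 + dotv x x.
Proof. by rewrite sqr_sqrtr// addr_ge0// dotv_ge0. Qed.

Lemma japanese_ge1 n (x : 'rV[R]_n) : 1 <= japanese x.
Proof.
rewrite -(@ler_pXn2r _ 2)// ?nnegrE ?sqrtr_ge0//.
by rewrite japanese_sqr expr1n lerDl dotv_ge0.
Qed.

Lemma japanese_gt0 n (x : 'rV[R]_n) : 0 < japanese x.
Proof. exact: lt_le_trans (japanese_ge1 x). Qed.

Lemma japanese_ge0 n (x : 'rV[R]_n) : 0 <= japanese x.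
Proof. exact/ltW/japanese_gt0. Qed.

Lemma japaneseX_gt0 n (x : 'rV[R]_n) k : 0 < japanese x ^+ k.
Proof. exact/exprn_gt0/japanese_gt0. Qed.

Lemma japaneseX_ge1 n (x : 'rV[R]_n) k : 1 <= japanese x ^+ k.
Proof. by rewrite exprn_ege1// japanese_ge1. Qed.

Lemma japaneseX_le n (x : 'rV[R]_n) k l : (k <= l)%N ->
  japanese x ^+ k <= japanese x ^+ l.
Proof. by move=> kl; rewrite ler_weXn2l// japanese_ge1. Qed.

Lemma japaneseVX_le n (x : 'rV[R]_n) k l : (k <= l)%N ->
  japanese x ^- l <= japanese x ^- k.
Proof. by move=> kl; rewrite lef_pV2 ?posrE ?japaneseX_gt0// japaneseX_le. Qed.

Lemma japanese_le n m (x : 'rV[R]_n) (y : 'rV[R]_m) C : 0 <= C ->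
  1 + dotv x x <= C ^+ 2 * (1 + dotv y y) -> japanese x <= C * japanese y.
Proof.
move=> C0 H; rewrite -(@ler_pXn2r _ 2)// ?nnegrE ?mulr_ge0 ?sqrtr_ge0//.
by rewrite exprMn !japanese_sqr.
Qed.

Lemma sqr_entry_le_dotv n (x : 'rV[R]_n) i : x ord0 i ^+ 2 <= dotv x x.
Proof.
rewrite /dotv (bigD1 i)//= -expr2 lerDl.
by apply: sumr_ge0 => j _; rewrite -expr2 sqr_ge0.
Qed.

Lemma entry_le_japanese n (x : 'rV[R]_n) i : `|x ord0 i| <= japanese x.
Proof.
rewrite -(@ler_pXn2r _ 2)// ?nnegrE ?japanese_ge0//.
rewrite japanese_sqr real_normK ?num_real// (le_trans (sqr_entry_le_dotv x i))//.
by rewrite lerDr.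
Qed.

Lemma japaneseN n (x : 'rV[R]_n) : japanese (- x) = japanese x.
Proof.
by rewrite /japanese /dotv; congr (Num.sqrt (_ + _)); apply: eq_bigr => i _;
  rewrite !mxE mulrNN.
Qed.

(** Applied to a sum with an opposite vector, this is Peetre's inequality, by which decay is moved
    from one point to another throughout. *)
Lemma japaneseD n (x y : 'rV[R]_n) : japanese (x + y) <= 2 * (japanese x * japanese y).
Proof.
rewrite mulrA; apply: japanese_le; first by rewrite mulr_ge0// japanese_ge0.
rewrite exprMn japanese_sqr.
have h : dotv (x + y) (x + y) <= 2 * dotv x x + 2 * dotv y y.
  rewrite /dotv !mulr_sumr -big_split /=; apply: ler_sum => i _.
  rewrite !mxE; have := sqr_ge0 (x ord0 i - y ord0 i); nra.
move: (dotv_ge0 x) (dotv_ge0 y) h.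
move: (dotv (x + y) _) (dotv x x) (dotv y y) => a b c b0 c0 h.
have bc : 0 <= b * c by exact: mulr_ge0.
by rewrite expr2; lra.
Qed.

Lemma japanese_scale n (x : 'rV[R]_n) h : `|h| <= 1 -> japanese (h *: x) <= japanese x.
Proof.
move=> h1; rewrite -[leRHS]mul1r; apply: japanese_le => //.
rewrite expr1n mul1r lerD2l; apply: ler_sum => i _.
rewrite !mxE mulrACA -expr2 ler_piMl// -?expr2 ?sqr_ge0//.
by rewrite -real_normK ?num_real// expr_le1.
Qed.

Lemma japanese_le_max n (x : 'rV[R]_n) M : 1 <= M -> (forall i, `|x ord0 i| <= M) ->
  japanese x <= n.+1%:R * M.
Proof.
move=> M1 H; have M0 := le_trans ler01 M1.
rewrite -(@ler_pXn2r _ 2)// ?nnegrE ?japanese_ge0 ?mulr_ge0// japanese_sqr.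
have h : dotv x x <= n%:R * M ^+ 2.
  rewrite mulr_natl -[n in leRHS]card_ord -sumr_const; apply: ler_sum => i _.
  rewrite -expr2 -real_normK ?num_real//.
  by rewrite ler_pXn2r ?nnegrE.
have M2 : 1 <= M ^+ 2 by rewrite expr_ge1.
rewrite (le_trans (lerD M2 h))// -[X in X + _]mul1r -mulrDl exprMn.
apply: ler_wpM2r; first exact: sqr_ge0.
by rewrite nat1r -natrX ler_nat expnS expn1 leq_pmulr.
Qed.

(** Each of the [n] factors of [weight] is at least [japanese x ^- 2]. The exponent [2 * n] is the
    price of integrability in [n] variables, and recurs in all counts of decay below. *)
Lemma japanese_weight n (x : 'rV[R]_n) : japanese x ^- (2 * n) <= weight x.
Proof.
rewrite exprM -exprVn /weight.
have -> : (japanese x ^- 2) ^+ n = \prod_(i < n) japanese x ^- 2.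
  by rewrite prodr_const card_ord.
apply: ler_prod => i _; rewrite invr_ge0 sqr_ge0 /= japanese_sqr.
rewrite lef_pV2 ?posrE ?weight_factor_gt0 ?ltr_pwDl ?dotv_ge0//.
by rewrite lerD2l sqr_entry_le_dotv.
Qed.

Lemma dotv_row_mx m n (x x' : 'rV[R]_m) (y y' : 'rV[R]_n) :
  dotv (row_mx x y) (row_mx x' y') = dotv x x' + dotv y y'.
Proof.
rewrite /dotv big_split_ord /=; congr (_ + _); apply: eq_bigr => i _.
  by rewrite !row_mxEl.
by rewrite !row_mxEr.
Qed.

Lemma japanese_row_mx m n (x : 'rV[R]_m) (y : 'rV[R]_n) :
  japanese (row_mx x y) <= japanese x * japanese y.
Proof.
apply: japanese_le; first exact: japanese_ge0.
rewrite japanese_sqr dotv_row_mx; have := dotv_ge0 x; have := dotv_ge0 y.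
move: (dotv x x) (dotv y y) => a b b0 a0; have : 0 <= a * b by exact: mulr_ge0.
by lra.
Qed.

Lemma japanese_row_mxl m n (x : 'rV[R]_m) (y : 'rV[R]_n) :
  japanese x <= japanese (row_mx x y).
Proof.
rewrite -[leRHS]mul1r; apply: japanese_le => //.
by rewrite expr1n mul1r dotv_row_mx addrA lerDl dotv_ge0.
Qed.

Lemma japanese_row_mxr m n (x : 'rV[R]_m) (y : 'rV[R]_n) :
  japanese y <= japanese (row_mx x y).
Proof.
rewrite -[leRHS]mul1r; apply: japanese_le => //.
by rewrite expr1n mul1r dotv_row_mx addrCA lerDr dotv_ge0.
Qed.

Lemma japanese_entrywise n (x y : 'rV[R]_n) (C : R) : 0 <= C ->
  (forall i, `|x ord0 i| <= C * `|y ord0 i|) -> 1 <= C ->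
  japanese x <= C * japanese y.
Proof.
move=> C0 H C1; apply: japanese_le => //.
rewrite mulrDr mulr1 lerD ?expr_ge1// /dotv mulr_sumr; apply: ler_sum => i _.
rewrite -!expr2 -[x _ _ ^+ 2]real_normK ?num_real// -[y _ _ ^+ 2]real_normK ?num_real//.
by rewrite -exprMn ler_pXn2r ?nnegrE ?mulr_ge0.
Qed.

End japanese_bracket.

Section smooth_functions.
Variable R : realType.

Section one_dimension_vector.
Variable n : nat.
Local Notation E := 'rV[R]_n.
Implicit Types (f g : E -> R[i]) (s : seq 'I_n).

Lemma smooth_cderive f : smooth f -> forall s j,
  cderive j (cpartials s f) (cpartials (j :: s) f).
Proof.
move=> [f1 f2] s j x; split; apply/derivableP.
- exact: (f1 s).2.
- exact: (f2 s).2.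
Qed.

Lemma smooth_ccontinuous f : smooth f -> forall s, ccontinuous (cpartials s f).
Proof. by move=> [f1 f2] s; split; [exact: (f1 s).1|exact: (f2 s).1]. Qed.

Lemma cpartials_nil f : cpartials [::] f = f.
Proof. by apply/funext => x; rewrite /cpartials /=; case: (f x). Qed.

(** A guessed family of derivatives, verified one step at a time, yields smoothness together with
    all the partial derivatives. Smoothness of a constructed function is proved in this way
    below. *)
Lemma smooth_family (D : seq 'I_n -> E -> R[i]) :
  (forall s j, cderive j (D s) (D (j :: s))) ->
  (forall s, ccontinuous (D s)) ->
  smooth (D [::]) /\ forall s, cpartials s (D [::]) = D s.
Proof.
move=> dD cD.
have reE s : partials s (@complex.Re R \o D [::]) = @complex.Re R \o D s.
  elim: s => [//|j s IH] /=; rewrite IH; apply/funext => x.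
  by have [h _] := dD s j x; rewrite (@derive_val _ _ _ _ _ _ _ h).
have imE s : partials s (@complex.Im R \o D [::]) = @complex.Im R \o D s.
  elim: s => [//|j s IH] /=; rewrite IH; apply/funext => x.
  by have [_ h] := dD s j x; rewrite (@derive_val _ _ _ _ _ _ _ h).
split; last first.
  move=> s; apply/funext => x; rewrite /cpartials reE imE /=.
  by case: (D s x).
split=> s; rewrite ?reE ?imE; split; try exact: (cD s).1; try exact: (cD s).2.
- by move=> j x; have [h _] := dD s j x; exact: ex_derive.
- by move=> j x; have [_ h] := dD s j x; exact: ex_derive.
Qed.

Lemma cpartials_cat f s t : cpartials (s ++ t) f = cpartials s (cpartials t f).
Proof. by apply/funext => x; rewrite /cpartials /partials !foldr_cat. Qed.

Lemma smooth_cpartials f t : smooth f -> smooth (cpartials t f).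
Proof.
move=> sf; have := @smooth_family (fun s => cpartials (s ++ t) f).
case=> [s j|s|//]; first exact: smooth_cderive.
exact: smooth_ccontinuous.
Qed.

Lemma ccontinuousM f g : ccontinuous f -> ccontinuous g ->
  ccontinuous (fun x => f x * g x).
Proof.
move=> [f1 f2] [g1 g2]; split.
- rewrite (_ : _ \o _ = ((@complex.Re R \o f) * (@complex.Re R \o g)) -
    ((@complex.Im R \o f) * (@complex.Im R \o g))); last first.
    by apply/funext => y; rewrite /= Re_mul.
  by move=> x; exact: (continuousB (continuousM (f1 x) (g1 x)) (continuousM (f2 x) (g2 x))).
- rewrite (_ : _ \o _ = ((@complex.Re R \o f) * (@complex.Im R \o g)) +
    ((@complex.Im R \o f) * (@complex.Re R \o g))); last first.
    by apply/funext => y; rewrite /= Im_mul.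
  by move=> x; exact: (continuousD (continuousM (f1 x) (g2 x)) (continuousM (f2 x) (g1 x))).
Qed.

Lemma ccontinuousD f g : ccontinuous f -> ccontinuous g ->
  ccontinuous (fun x => f x + g x).
Proof.
move=> [f1 f2] [g1 g2]; split.
- rewrite (_ : _ \o _ = (@complex.Re R \o f) + (@complex.Re R \o g)); last first.
    by apply/funext => y; rewrite /= Re_add.
  by move=> x; exact: (continuousD (f1 x) (g1 x)).
- rewrite (_ : _ \o _ = (@complex.Im R \o f) + (@complex.Im R \o g)); last first.
    by apply/funext => y; rewrite /= Im_add.
  by move=> x; exact: (continuousD (f2 x) (g2 x)).
Qed.

Lemma ccontinuous_cst (c : R[i]) : @ccontinuous R n (fun=> c).
Proof.
split.
- by rewrite (_ : _ \o _ = cst (complex.Re c))//; exact: cst_continuous.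
- by rewrite (_ : _ \o _ = cst (complex.Im c))//; exact: cst_continuous.
Qed.

Lemma ccontinuous_conj f : ccontinuous f -> ccontinuous (fun x => conjc (f x)).
Proof.
move=> [f1 f2]; split.
- rewrite (_ : _ \o _ = (@complex.Re R \o f))//.
  by apply/funext => y; rewrite /= Re_conjc.
- rewrite (_ : _ \o _ = - (@complex.Im R \o f)); last first.
    by apply/funext => y; rewrite /= Im_conjc.
  by move=> x; exact: (continuousN (f2 x)).
Qed.

Lemma ccontinuous_sum (I : Type) (r : seq I) (F : I -> E -> R[i]) :
  (forall i, ccontinuous (F i)) -> ccontinuous (fun x => \sum_(i <- r) F i x).
Proof.
move=> H; elim: r => [|i r IH].
  rewrite (_ : (fun x => _) = fun=> 0); first exact: ccontinuous_cst.
  by apply/funext => x; rewrite big_nil.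
rewrite (_ : (fun x => _) = fun x => F i x + \sum_(i <- r) F i x).
  exact: ccontinuousD.
by apply/funext => x; rewrite big_cons.
Qed.

Lemma ccontinuous_measurable f : ccontinuous f -> cmeasurable f.
Proof. by move=> [f1 f2]; split; exact: continuous_measurable_rV. Qed.

Lemma smooth_measurable f s : smooth f -> cmeasurable (cpartials s f).
Proof. by move=> sf; apply: ccontinuous_measurable; exact: smooth_ccontinuous. Qed.

Lemma smooth_cmeasurable f : smooth f -> cmeasurable f.
Proof. by move=> /(smooth_measurable [::]); rewrite cpartials_nil. Qed.

(* index set of the Leibniz rule: the ways of distributing the derivations of [s]
   between two factors, as a sequence with repetitions *)
Fixpoint splits (s : seq 'I_n) : seq (seq 'I_n * seq 'I_n) :=
  if s is j :: s' then
    [seq (j :: p.1, p.2) | p <- splits s'] ++ [seq (p.1, j :: p.2) | p <- splits s']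
  else [:: ([::], [::])].

Lemma size_splits s : size (splits s) = (2 ^ size s)%N.
Proof.
elim: s => //= j s IH; rewrite size_cat !size_map IH expnS.
by rewrite mul2n addnn.
Qed.

Lemma splits_size s p : p \in splits s -> (size p.1 <= size s)%N /\ (size p.2 <= size s)%N.
Proof.
elim: s p => [|j s IH] p /=; first by rewrite inE => /eqP ->.
rewrite mem_cat => /orP[] /mapP[q /IH [h1 h2] ->] /=; split=> //; exact: leqW.
Qed.

Lemma smoothM_cpartials f g : smooth f -> smooth g ->
  smooth (fun x => f x * g x) /\
  forall s, cpartials s (fun x => f x * g x) =
    (fun x => \sum_(p <- splits s) cpartials p.1 f x * cpartials p.2 g x).
Proof.
move=> sf sg.
pose D s x := \sum_(p <- splits s) cpartials p.1 f x * cpartials p.2 g x.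
have D0 : D [::] = fun x => f x * g x.
  by apply/funext => x; rewrite /D /= big_seq1 /= !cpartials_nil.
have := @smooth_family D; rewrite D0; apply.
- move=> s j.
  have -> : D (j :: s) = fun x => \sum_(p <- splits s)
      (cpartials (j :: p.1) f x * cpartials p.2 g x +
       cpartials p.1 f x * cpartials (j :: p.2) g x).
    by apply/funext => x; rewrite /D /= big_cat !big_map big_split.
  by apply: cderive_sum => p; apply: cderiveM; exact: smooth_cderive.
- by move=> s; apply: ccontinuous_sum => p; apply: ccontinuousM; exact: smooth_ccontinuous.
Qed.

Lemma smoothM f g : smooth f -> smooth g -> smooth (fun x => f x * g x).
Proof. by move=> sf sg; case: (smoothM_cpartials sf sg). Qed.

(** The common form of all seminorm estimates. The bound is a function and not a number because its
    decay has to be followed through products, translations and integrals. *)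
Definition dbound (N : nat) (A : E -> R) f :=
  forall s, (size s <= N)%N -> forall x, modulus (cpartials s f x) <= A x.

Lemma dbound0 N A f x : dbound N A f -> modulus (f x) <= A x.
Proof. by move=> H; have := H [::] isT x; rewrite cpartials_nil. Qed.

Lemma dbound_ge0 N A f x : dbound N A f -> 0 <= A x.
Proof. by move=> /dbound0 H; exact: le_trans (modulus_ge0 _) (H x). Qed.

Lemma dbound_le N (A B : E -> R) f : (forall x, A x <= B x) ->
  dbound N A f -> dbound N B f.
Proof. by move=> AB H s sN x; exact: le_trans (H s sN x) (AB x). Qed.

Lemma dbound_leq N M (A : E -> R) f : (M <= N)%N -> dbound N A f -> dbound M A f.
Proof. by move=> MN H s sM x; apply: H; exact: leq_trans sM MN. Qed.

Lemma dboundM N A B f g : smooth f -> smooth g -> dbound N A f -> dbound N B g ->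
  dbound N (fun x => 2 ^+ N * (A x * B x)) (fun x => f x * g x).
Proof.
move=> sf sg fA gB s sN x; have [_ ->] := smoothM_cpartials sf sg.
rewrite (le_trans (modulus_sum _ _ _))//.
have A0 := dbound_ge0 x fA; have B0 := dbound_ge0 x gB.
have AB0 : 0 <= A x * B x by exact: mulr_ge0.
apply: (@le_trans _ _ (\sum_(p <- splits s) (A x * B x))).
  rewrite big_seq [leRHS]big_seq; apply: ler_sum => p /splits_size [h1 h2].
  rewrite modulusM; apply: ler_pM; rewrite ?modulus_ge0//.
  - exact/fA/(leq_trans h1).
  - exact/gB/(leq_trans h2).
rewrite big_const_seq count_predT size_splits iter_addr_0 -[leLHS]mulr_natl natrX.
by apply: ler_wpM2r => //; rewrite ler_weXn2l// ler1n.
Qed.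

Lemma smooth_lincomb f g (c : R[i]) : smooth f -> smooth g ->
  smooth (fun x => c * f x + g x) /\ forall s,
  cpartials s (fun x => c * f x + g x) = fun x => c * cpartials s f x + cpartials s g x.
Proof.
move=> sf sg.
have := @smooth_family (fun s x => c * cpartials s f x + cpartials s g x).
rewrite !cpartials_nil; apply.
- by move=> s j; apply: cderiveD; [apply: cderiveZ|]; exact: smooth_cderive.
- move=> s; apply: ccontinuousD; last exact: smooth_ccontinuous.
  apply: ccontinuousM; last exact: smooth_ccontinuous.
  exact: ccontinuous_cst.
Qed.

Lemma smooth_cst (c : R[i]) : @smooth R n (fun=> c) /\ forall s,
  cpartials s (fun=> c) = if s is [::] then (fun=> c) else (fun _ : E => 0).
Proof.
have := @smooth_family (fun s => if s is [::] then (fun=> c) else (fun _ : E => 0)).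
apply=> [[|? ?] j|[|? ?]]; try exact: cderive_cst; exact: ccontinuous_cst.
Qed.

Lemma smooth_conj f : smooth f -> smooth (fun x => conjc (f x)) /\ forall s,
  cpartials s (fun x => conjc (f x)) = fun x => conjc (cpartials s f x).
Proof.
move=> sf; have := @smooth_family (fun s x => conjc (cpartials s f x)).
rewrite cpartials_nil; apply.
- by move=> s j; apply: cderive_conj; exact: smooth_cderive.
- by move=> s; apply: ccontinuous_conj; exact: smooth_ccontinuous.
Qed.

Lemma continuous_entry (i : 'I_n) : continuous (fun x : E => x ord0 i).
Proof. by move=> x; exact: coord_continuous. Qed.

Lemma continuous_dotv (xi : E) : continuous (fun x : E => dotv x xi).
Proof.
rewrite /dotv; elim: (index_enum _) => [|i r IH] x.
  rewrite (_ : (fun y => _) = cst 0); first exact: cst_continuous.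
  by apply/funext => y; rewrite big_nil.
rewrite (_ : (fun y => _) = (fun y : E => y ord0 i * xi ord0 i) +
    (fun y => \sum_(k <- r) y ord0 k * xi ord0 k)); last first.
  by apply/funext => y; rewrite big_cons.
apply: (@continuousD _ _ _ _ _ x); last exact: IH.
exact: (continuousM (@continuous_entry i x) (@cst_continuous _ _ (xi ord0 i) x)).
Qed.

Lemma smooth_expi (xi : E) : smooth (fun y => expi (dotv y xi)) /\ forall s,
  cpartials s (fun y => expi (dotv y xi)) =
  fun y => (\prod_(j <- s) ((xi ord0 j) *i : R[i])) * expi (dotv y xi).
Proof.
have := @smooth_family (fun s y => (\prod_(j <- s) ((xi ord0 j) *i : R[i])) * expi (dotv y xi)).
rewrite (_ : (fun y => \prod_(j <- [::]) _ * _) = fun y => expi (dotv y xi)); last first.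
  by apply/funext => y; rewrite big_nil mul1r.
apply.
- move=> s j; have := cderiveZ (\prod_(j <- s) ((xi ord0 j) *i : R[i])) (cderive_expi j xi).
  by congr cderive; apply/funext => y; rewrite big_cons mulrCA mulrA.
- move=> s; apply: ccontinuousM; first exact: ccontinuous_cst.
  split.
  + rewrite (_ : _ \o _ = @cos R \o (fun y => dotv y xi))// => x.
    exact: (continuous_comp (@continuous_dotv xi x) (@continuous_cos R _)).
  + rewrite (_ : _ \o _ = @sin R \o (fun y => dotv y xi))// => x.
    exact: (continuous_comp (@continuous_dotv xi x) (@continuous_sin R _)).
Qed.

Lemma dbound_expi N (xi : E) :
  dbound N (fun=> japanese xi ^+ N) (fun y => expi (dotv y xi)).
Proof.
move=> s sN x; rewrite (smooth_expi xi).2 modulusM modulus_expi mulr1.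
apply: le_trans (japaneseX_le xi sN).
elim: s {sN} => [|j s IH]; first by rewrite big_nil modulus1.
rewrite big_cons modulusM exprS; apply: ler_pM; rewrite ?modulus_ge0//.
by rewrite modulus_i entry_le_japanese.
Qed.

End one_dimension_vector.

Lemma smooth_rescale m n (f : 'rV[R]_m -> R[i]) (A : 'rV[R]_n -> 'rV[R]_m)
    (sigma : 'I_n -> 'I_m) (h : R) :
  (forall i x t, A (x + t *: ej R i) = A x + (t * h) *: ej R (sigma i)) ->
  continuous A -> smooth f ->
  smooth (fun x => f (A x)) /\ forall s, cpartials s (fun x => f (A x)) =
    fun x => (h ^+ size s)%:C * cpartials (map sigma s) f (A x).
Proof.
move=> HA cA sf.
have := @smooth_family n (fun s x => (h ^+ size s)%:C * cpartials (map sigma s) f (A x)).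
rewrite /= (_ : (fun x => (h ^+ 0)%:C * _) = fun x => f (A x)); last first.
  by apply/funext => x; rewrite expr0 mul1r cpartials_nil.
apply.
- move=> s j; have := cderiveZ (h ^+ size s)%:C (cderive_rescale (HA j)
    (smooth_cderive sf (map sigma s) (sigma j))).
  by congr cderive; apply/funext => x; rewrite /= exprSr real_complexM mulrA.
- move=> s; apply: ccontinuousM; first exact: ccontinuous_cst.
  have [c1 c2] := smooth_ccontinuous sf (map sigma s).
  split=> x.
  + exact: (continuous_comp (cA x) (c1 (A x))).
  + exact: (continuous_comp (cA x) (c2 (A x))).
Qed.

Lemma continuous_affine_rV n (c : 'rV[R]_n) (h : R) :
  continuous (fun x : 'rV[R]_n => c + h *: x).
Proof.
by move=> x; exact: (continuousD (@cst_continuous _ _ c x)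
  (@scaler_continuous _ _ h x)).
Qed.

Lemma smooth_affine n (c : 'rV[R]_n) (h : R) f : smooth f ->
  smooth (fun x => f (c + h *: x)) /\ forall s, cpartials s (fun x => f (c + h *: x)) =
    fun x => (h ^+ size s)%:C * cpartials s f (c + h *: x).
Proof.
move=> sf.
have HA i x t : c + h *: (x + t *: ej R i) = (c + h *: x) + (t * h) *: ej R i.
  by rewrite scalerDr addrA scalerA mulrC.
have [h1 h2] := smooth_rescale (sigma := id) HA (@continuous_affine_rV n c h) sf.
by split=> // s; rewrite h2 map_id.
Qed.

Lemma dbound_affine n N (A : 'rV[R]_n -> R) (c : 'rV[R]_n) (h : R) f : smooth f ->
  `|h| <= 1 -> dbound N A f ->
  dbound N (fun x => A (c + h *: x)) (fun x => f (c + h *: x)).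
Proof.
move=> sf h1 fA s sN x; rewrite (smooth_affine c h sf).2 modulusM modulus_real.
rewrite -[leRHS]mul1r; apply: ler_pM; rewrite ?modulus_ge0 ?normr_ge0//.
  by rewrite normrX exprn_ile1.
exact: fA.
Qed.

End smooth_functions.

(** * Differentiation under the integral and decay of the Fourier transform *)

Section integral_calculus.
Variable R : realType.

(** Derivatives are known along the axes only, so the segment from [x] to [x + v] is replaced by a
    path with [n] edges parallel to the axes. It stays in the box spanned by [v] around [x]; a bound
    [M] that decays in [x] is therefore allowed. *)
Lemma lipschitz_path n (f : 'rV[R]_n -> R[i]) (f' : 'I_n -> 'rV[R]_n -> R[i])
    (x v : 'rV[R]_n) (M : R) :
  (forall j, cderive j f (f' j)) ->
  (forall j (p : 'rV[R]_n), (forall i, `|p ord0 i - x ord0 i| <= `|v ord0 i|) -> modulus (f' j p) <= M) ->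
  modulus (f (x + v) - f x) <= 2 * M * \sum_(i < n) `|v ord0 i|.
Proof.
move=> df fM.
(* The [k]-th vertex of the path: the first [k] coordinates have already moved. *)
pose y k : 'rV[R]_n := x + \row_(i < n) (if (i < k)%N then v ord0 i else 0).
have yn : y n = x + v.
  by congr (x + _); apply/rowP => i; rewrite mxE ltn_ord.
have y0 : y 0%N = x.
  by rewrite /y -[RHS]addr0; congr (x + _); apply/rowP => i; rewrite !mxE.
suff H k : (k <= n)%N ->
    modulus (f (y k) - f x) <= 2 * M * \sum_(i < n | (i < k)%N) `|v ord0 i|.
  rewrite -yn (le_trans (H n (leqnn n)))// le_eqVlt; apply/orP; left; apply/eqP; congr (_ * _).
  by apply: eq_bigl => i; rewrite ltn_ord.
elim: k => [_|k IH kn].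
  by rewrite y0 subrr modulus0 big_pred0// mulr0.
pose i0 := Ordinal kn.
have yS : y k.+1 = y k + v ord0 i0 *: ej R i0.
  rewrite /y -addrA; congr (x + _); apply/rowP => i; rewrite !mxE eqxx /=.
  case: (eqVneq i i0) => [->|ii0]; first by rewrite /= ltnS leqnn ltnn mulr1 add0r.
  rewrite mulr0 addr0 ltnS leq_eqVlt; case: (eqVneq (i : nat) k) => //= ik.
  by case/eqP: ii0; exact: val_inj.
rewrite (_ : f _ - _ = (f (y k.+1) - f (y k)) + (f (y k) - f x)); last by ring.
apply: (le_trans (modulusD _ _)).
rewrite (bigD1 i0)//= mulrDr lerD//.
  rewrite yS -mulrA [M * _]mulrC mulrA; apply: mvt_cderive => // c cv.
  apply: fM => i; rewrite !mxE eqxx /=.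
  case: (eqVneq i i0) => [->|ii0]; first by rewrite /= ltnn (_ : _ + _ - _ = c)//; ring.
  by rewrite mulr0 addr0 addrAC subrr add0r; case: ifP => // _; rewrite normr0.
rewrite (le_trans (IH (ltnW kn)))// le_eqVlt; apply/orP; left; apply/eqP; congr (_ * _).
apply: eq_bigl => i; rewrite ltnS [in RHS]leq_eqVlt.
case: (eqVneq i i0) => [->|ii0]; first by rewrite /= ltnn andbF.
rewrite andbT; by case: (eqVneq (i : nat) k) => //= ik; case/eqP: ii0; exact: val_inj.
Qed.

Lemma entry_le_norm n (v : 'rV[R]_n) i : `|v ord0 i| <= `|v|.
Proof.
rewrite /Num.norm /= mx_normrE.
exact: (le_bigmax _ (fun k => `|v k.1 k.2|) (ord0, i)).
Qed.

(** Existence of partial derivatives does not imply continuity, which smoothness also demands;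
    uniform bounds on them give a global Lipschitz estimate. *)
Lemma bounded_cderive_continuous n (f : 'rV[R]_n -> R[i]) (f' : 'I_n -> 'rV[R]_n -> R[i])
    (M : R) :
  (forall j, cderive j f (f' j)) -> (forall j p, modulus (f' j p) <= M) ->
  ccontinuous f.
Proof.
move=> df fM.
have L x y : modulus (f y - f x) <= 2 * `|M| * n%:R * `|y - x|.
  rewrite -{1}(subrK x y) [y - x + x]addrC.
  apply: (le_trans (lipschitz_path (M := `|M|) df _)).
    by move=> j p _; rewrite (le_trans (fM j p))// ler_norm.
  rewrite -[leRHS]mulrA; apply: ler_wpM2l; first by rewrite mulr_ge0.
  have -> : n%:R * `|y - x| = \sum_(i < n) `|y - x|.
    by rewrite sumr_const card_ord mulr_natl.
  by apply: ler_sum => i _; exact: entry_le_norm.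
have key (g : 'rV[R]_n -> R) : (forall x y, `|g y - g x| <= 2 * `|M| * n%:R * `|y - x|) ->
    continuous g.
  move=> Lg x; apply/(@cvgrPdist_le _ _ _ _ (nbhs_filter x)) => e e0.
  have K0 : 0 < 2 * `|M| * n%:R + 1 by rewrite ltr_wpDl// !mulr_ge0.
  have H : \forall y \near x, `|x - y| <= e / (2 * `|M| * n%:R + 1).
    apply/nbhs_normP; exists (e / (2 * `|M| * n%:R + 1)); first by rewrite /= divr_gt0.
    by move=> y /= /ltW.
  near=> y.
  rewrite distrC (le_trans (Lg x y))//.
  rewrite (@le_trans _ _ ((2 * `|M| * n%:R + 1) * `|y - x|))//.
    by rewrite ler_wpM2r// lerDl.
  rewrite mulrC -ler_pdivlMr// distrC.
  by near: y; exact: H.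
split; apply: key => x y; apply: le_trans (L x y).
- by apply: le_trans (Re_le_modulus _); rewrite Re_add Re_opp.
- by apply: le_trans (Im_le_modulus _); rewrite Im_add Im_opp.
Unshelve. all: by end_near. Qed.

(** The second-order Taylor bound is integrated in [y] and read back through [cderive_quadratic];
    dominated convergence is not involved. *)
Lemma cderive_cintegral m n (j : 'I_n) (G G' G'' : 'rV[R]_n -> 'rV[R]_m -> R[i]) (C : R) :
  (forall y, cderive j (G^~ y) (G'^~ y)) -> (forall y, cderive j (G'^~ y) (G''^~ y)) ->
  (forall x, weighted (G x)) -> (forall x, weighted (G' x)) ->
  (forall x y, modulus (G'' x y) <= C * weight y) ->
  cderive j (fun x => cintegral (G x)) (fun x => cintegral (G' x)).
Proof.
move=> dG dG' wG wG' G''C.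
apply: (@cderive_quadratic _ _ _ _ _ (2 * C * weight_mass R m)) => x t.
have wB : weighted (fun y => G (x + t *: ej R j) y - G x y) by exact: weightedB.
have wZ : weighted (fun y => t%:C * G' x y) by exact: weightedZ.
rewrite -cintegralB// -cintegralZ// -cintegralB//.
rewrite mulrAC; apply: cintegral_le; first by have [] := weightedB wB wZ.
move=> y.
rewrite (_ : 2 * C * t ^+ 2 * weight y = 2 * (C * weight y) * t ^+ 2); last by ring.
exact: (taylor_cderive (dG y) (dG' y)).
Qed.

Lemma smooth_cintegral m n (D : seq 'I_n -> 'rV[R]_n -> 'rV[R]_m -> R[i]) :
  (forall y s j, cderive j (D s ^~ y) (D (j :: s) ^~ y)) ->
  (forall s x, cmeasurable (D s x)) ->
  (forall s, exists C, forall x y, modulus (D s x y) <= C * weight y) ->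
  smooth (fun x => cintegral (D [::] x)) /\
  forall s, cpartials s (fun x => cintegral (D [::] x)) = fun x => cintegral (D s x).
Proof.
move=> dD mD bD.
have wD s x : weighted (D s x).
  by split=> //; have [C HC] := bD s; exists C => y; exact: HC.
have dI s j : cderive j (fun x => cintegral (D s x)) (fun x => cintegral (D (j :: s) x)).
  have [C HC] := bD [:: j, j & s].
  exact: (cderive_cintegral (G'' := D [:: j, j & s])).
apply: (@smooth_family _ _ (fun s x => cintegral (D s x))) => // s.
have [M HM] : exists M, forall j p, modulus (cintegral (D (j :: s) p)) <= M.
  have /choice [c hc] : forall j, exists C, forall x y, modulus (D (j :: s) x y) <= C * weight y.
    by move=> j; exact: bD.
  exists (\sum_j `|c j| * weight_mass R m) => j p.
  rewrite (le_trans (cintegral_le (mD _ _) (hc j p)))//.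
  rewrite (bigD1 j)//= (le_trans (ler_wpM2r (ltW (weight_mass_gt0 R m)) (ler_norm (c j))))//.
  by rewrite lerDl sumr_ge0// => i _; rewrite mulr_ge0// ltW// weight_mass_gt0.
exact: (bounded_cderive_continuous (dI s) HM).
Qed.

Lemma weight_shift1 n (x : 'rV[R]_n) (j : 'I_n) (c : R) : `|c| <= 1 ->
  weight (x + c *: ej R j) <= 3 * weight x.
Proof.
move=> c1; rewrite /weight (bigD1 j)//= [in leRHS](bigD1 j)//= mulrA.
apply: ler_pM.
- by rewrite invr_ge0 ltW ?weight_factor_gt0.
- by apply: prodr_ge0 => i _; rewrite invr_ge0 ltW ?weight_factor_gt0.
- rewrite !mxE !eqxx mulr1 ler_pdivlMr ?weight_factor_gt0// mulrC.
  rewrite ler_pdivrMr ?ltr_pwDl ?sqr_ge0//.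
  have c2 : c ^+ 2 <= 1 by rewrite -real_normK ?num_real// expr_le1.
  by set t := x _ _; have := sqr_ge0 (2 * t + 3 * c); lra.
- rewrite le_eqVlt; apply/orP; left; apply/eqP; apply: eq_bigr => i ij.
  by rewrite !mxE eqxx (negbTE ij) mulr0 addr0.
Qed.

(** Integration by parts out of translation invariance: the integral of [g (x + t *: ej R j) - g x]
    vanishes, and it equals [t] times the integral of [g'] up to [O(t ^+ 2)]. *)
Lemma cintegral_cderive0 n (j : 'I_n) (g g' g'' : 'rV[R]_n -> R[i]) (C : R) :
  cderive j g g' -> cderive j g' g'' -> weighted g -> weighted g' ->
  (forall x, modulus (g'' x) <= C * weight x) -> cintegral g' = 0.
Proof.
move=> dg dg' wg wg' g''C.
have C0 : 0 <= C.
  by have := le_trans (modulus_ge0 _) (g''C 0); rewrite pmulr_lge0// weight_gt0.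
have H t : 0 < t -> t <= 1 -> t * modulus (cintegral g') <= (6 * C * weight_mass R n) * t ^+ 2.
  move=> t0 t1.
  have wB : weighted (fun x => g (x + t *: ej R j) - g x).
    by apply: weightedB => //; exact: weighted_shift.
  have -> : t * modulus (cintegral g') = modulus (cintegral (fun x =>
      (g (x + t *: ej R j) - g x) - t%:C * g' x)).
    rewrite cintegralB//; last exact: weightedZ.
    rewrite cintegralB//; last exact: weighted_shift.
    rewrite cintegral_shift// subrr sub0r modulusN cintegralZ// modulusM modulus_real.
    by rewrite gtr0_norm.
  rewrite mulrAC; apply: cintegral_le.
    by have [] := weightedB wB (weightedZ t%:C wg').
  move=> x; rewrite (_ : _ * weight x = 2 * (C * (3 * weight x)) * t ^+ 2); last by ring.
  apply: (taylor_cderive dg dg') => c ct.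
  rewrite (le_trans (g''C _))// ler_wpM2l// weight_shift1//.
  by rewrite (le_trans ct)// gtr0_norm.
apply/eqP; rewrite -modulus_eq0 eq_le modulus_ge0 andbT leNgt; apply/negP => p0.
set p := modulus _ in p0 H; set A := 6 * C * _ in H.
have A0 : 0 <= A.
  by apply: mulr_ge0; [exact: mulr_ge0|exact/ltW/weight_mass_gt0].
(* The estimate [t * p <= A * t ^+ 2] would give [p <= A * t], while [t] is so small that [A * t] is
   at most [p / 2]. *)
pose t := Num.min 1 (p / (2 * (A + 1))).
have A1 : 0 < 2 * (A + 1) by rewrite mulr_gt0// ltr_wpDl.
have t0 : 0 < t by rewrite lt_min ltr01 divr_gt0.
have := H t t0; rewrite ge_min lexx => /(_ isT).
rewrite expr2 mulrCA ler_pM2l//.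
have tp : t * (2 * (A + 1)) <= p by rewrite -ler_pdivlMr// ge_min lexx orbT.
nra.
Qed.

(** Unnormalised, with a plus sign in the exponent; the inversion formula carries the minus sign. *)
Definition fourier n (f : 'rV[R]_n -> R[i]) (s : 'rV[R]_n) : R[i] :=
  cintegral (fun y => expi (dotv y s) * f y).

Lemma cmeasurable_expi_dotv n (s : 'rV[R]_n) : cmeasurable (fun y => expi (dotv y s)).
Proof. by apply: smooth_cmeasurable; case: (smooth_expi s). Qed.

Lemma weighted_expi n (s : 'rV[R]_n) f : weighted f ->
  weighted (fun y => expi (dotv y s) * f y).
Proof.
move=> wf; apply: (weightedM (K := 1)) => //; first exact: cmeasurable_expi_dotv.
by move=> x; rewrite modulus_expi.
Qed.

Lemma dbound_weighted n N C (f : 'rV[R]_n -> R[i]) s : smooth f -> (size s <= N)%N ->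
  dbound N (fun x => C * weight x) f -> weighted (cpartials s f).
Proof.
move=> sf sN fC; split; first exact: smooth_measurable.
by exists C => x; exact: fC.
Qed.

Lemma fourier_cpartials n C (f : 'rV[R]_n -> R[i]) (s : 'rV[R]_n) j : smooth f ->
  dbound 2 (fun x => C * weight x) f ->
  fourier (cpartials [:: j] f) s = - ((s ord0 j) *i) * fourier f s.
Proof.
move=> sf fC.
have w0 : weighted f by have := dbound_weighted (N := 2) (s := [::]) sf isT fC; rewrite cpartials_nil.
have w1 : weighted (cpartials [:: j] f) by exact: (dbound_weighted (N := 2) (s := [:: j]) sf isT fC).
have w2 : weighted (cpartials [:: j; j] f) by exact: (dbound_weighted (N := 2) (s := [:: j; j]) sf isT fC).
have d1 : cderive j f (cpartials [:: j] f).
  by have := smooth_cderive sf [::] j; rewrite cpartials_nil.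
have d2 := smooth_cderive sf [:: j] j.
have de := cderive_expi j s.
have dg := cderiveM de d1.
have dg' := cderiveD (cderiveM (cderiveZ ((s ord0 j) *i) de) d1) (cderiveM de d2).
have we := weighted_expi s.
have wg' : weighted (fun x => (s ord0 j) *i * expi (dotv x s) * f x +
    expi (dotv x s) * cpartials [:: j] f x).
  apply: weightedD; last exact: we.
  have := weightedZ ((s ord0 j) *i) (we _ w0).
  by congr weighted; apply/funext => x; rewrite mulrA.
have : exists K, forall x, modulus ((s ord0 j) *i * ((s ord0 j) *i * expi (dotv x s)) * f x +
    (s ord0 j) *i * expi (dotv x s) * cpartials [:: j] f x +
    ((s ord0 j) *i * expi (dotv x s) * cpartials [:: j] f x +
     expi (dotv x s) * cpartials [:: j; j] f x)) <= K * weight x.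
  exists (`|s ord0 j| * `|s ord0 j| * C + `|s ord0 j| * C + (`|s ord0 j| * C + C)) => x.
  have h0 := dbound0 x fC; have h1 := fC [:: j] isT x; have h2 := fC [:: j; j] isT x.
  rewrite !mulrDl -!mulrA.
  apply: (le_trans (modulusD _ _)); apply: lerD; apply: (le_trans (modulusD _ _)); apply: lerD.
  - rewrite !modulusM modulus_expi !modulus_i mul1r.
    by do 2 apply: ler_wpM2l => //.
  - by rewrite !modulusM modulus_expi !modulus_i mul1r; apply: ler_wpM2l.
  - by rewrite !modulusM modulus_expi !modulus_i mul1r; apply: ler_wpM2l.
  - by rewrite !modulusM modulus_expi mul1r.
case=> K HK.
have := cintegral_cderive0 dg dg' (we _ w0) wg' HK.
rewrite cintegralD//; [|have := weightedZ ((s ord0 j) *i) (we _ w0)|exact: we]; last first.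
  by congr weighted; apply/funext => x; rewrite mulrA.
rewrite /fourier addrC => /eqP; rewrite addr_eq0 => /eqP ->.
rewrite mulNr -cintegralZ; last exact: we.
by congr (- _); apply: cintegral_eq => x; rewrite mulrA.
Qed.

Lemma fourier_cpartialsX n C (f : 'rV[R]_n -> R[i]) (s : 'rV[R]_n) j N : smooth f ->
  dbound N.+1 (fun x => C * weight x) f ->
  fourier (cpartials (nseq N j) f) s = (- ((s ord0 j) *i)) ^+ N * fourier f s.
Proof.
elim: N C => [|N IH] C sf fC; first by rewrite cpartials_nil mul1r.
rewrite -[nseq N.+1 j]/([:: j] ++ nseq N j) cpartials_cat.
rewrite (@fourier_cpartials n C)//; last 2 first.
- exact: smooth_cpartials.
- move=> t t2 x; rewrite -cpartials_cat; apply: fC.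
  by rewrite size_cat size_nseq -addn2 addnC leq_add2l.
rewrite (IH C)//; first by rewrite exprS mulrA.
exact: dbound_leq fC.
Qed.

Lemma max_entry n (s : 'rV[R]_n) : (forall i, `|s ord0 i| <= 1) \/
  exists2 j, 1 < `|s ord0 j| & forall i, `|s ord0 i| <= `|s ord0 j|.
Proof.
have [H|/forallNP /= H] := pselect (exists i, 1 < `|s ord0 i|); last first.
  by left => i; rewrite leNgt; apply/negP/H.
right; case: H => i hi.
have [j _ Hj] := @arg_maxP _ _ _ i xpredT (fun i => `|s ord0 i|) isT.
by exists j; [exact: lt_le_trans (Hj i isT)|move=> k; exact: Hj].
Qed.

(** Integration by parts [N] times along the largest coordinate of [s], which controls [japanese s]
    up to [n.+1]. The order is [N.+1] because each integration by parts also bounds a second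
    derivative. *)
Lemma fourier_decay n N (C : R) (f : 'rV[R]_n -> R[i]) s : smooth f ->
  dbound N.+1 (fun x => C * weight x) f ->
  modulus (fourier f s) <= C * (weight_mass R n * n.+1%:R ^+ N) * japanese s ^- N.
Proof.
move=> sf fC.
have C0 : 0 <= C.
  have := dbound_ge0 0 fC; rewrite pmulr_lge0//; exact: weight_gt0.
have m0 := ltW (weight_mass_gt0 R n).
have key t : (size t <= N)%N -> modulus (fourier (cpartials t f) s) <= C * weight_mass R n.
  move=> tN; apply: cintegral_le.
    have w : weighted (cpartials t f).
      by apply: (dbound_weighted (N := N.+1) (C := C)) => //; exact: leqW.
    by have [] := weighted_expi s w.
  by move=> x; rewrite modulusM modulus_expi mul1r fC// leqW.
rewrite ler_pdivlMr ?japaneseX_gt0// [C * _]mulrA.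
(* When all entries are at most 1, [japanese s] is bounded and the trivial estimate suffices. *)
have [H|[j j1 H]] := max_entry s.
  apply: ler_pM; rewrite ?modulus_ge0 ?exprn_ge0 ?japanese_ge0//.
    by have := key [::] isT; rewrite cpartials_nil.
  apply: lerXn2r; rewrite ?nnegrE ?japanese_ge0//.
  by rewrite -[leRHS]mulr1; exact: japanese_le_max.
have j0 : 0 < `|s ord0 j| by rewrite (lt_trans ltr01).
have := key (nseq N j); rewrite size_nseq => /(_ (leqnn N)).
rewrite (fourier_cpartialsX s j sf fC) modulusM modulusX modulusN modulus_i => h.
apply: (@le_trans _ _ (modulus (fourier f s) * (n.+1%:R * `|s ord0 j|) ^+ N)).
  apply: ler_wpM2l; first exact: modulus_ge0.
  apply: lerXn2r; rewrite ?nnegrE ?japanese_ge0 ?mulr_ge0//.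
  by apply: japanese_le_max => //; exact: ltW.
rewrite exprMn [_ ^+ N * _ ^+ N]mulrC mulrA [modulus _ * _]mulrC.
by apply: ler_wpM2r => //; rewrite exprn_ge0.
Qed.

End integral_calculus.

(** * Bump functions *)

Section bump.
Variable R : realType.
Implicit Types (P : {poly R}) (t : R).

Definition flat P t : R := if 0 < t then P.[t^-1] * expR (- t^-1) else 0.

Lemma horner_expR_bounded P :
  exists2 K, 0 <= K & forall x : R, 0 <= x -> `|P.[x] * expR (- x)| <= K.
Proof.
(* Each monomial satisfies [x ^+ i <= (i.+1)! * expR x]: for [x <= 1] both factors on the right are
   at least 1, and for larger [x] the power is raised to [i.+1] and compared with one term of the
   exponential series. *)
exists (\sum_(i < size P) `|P`_i| * (i.+1)`!%:R).
  by apply: sumr_ge0 => i _; rewrite mulr_ge0.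
move=> x x0; rewrite normrM [`|expR _|]ger0_norm ?expR_ge0// horner_coef.
rewrite (le_trans (ler_wpM2r (expR_ge0 _) (ler_norm_sum _ _ _)))// mulr_suml.
apply: ler_sum => i _; rewrite normrM -mulrA; apply: ler_wpM2l => //.
rewrite ger0_norm ?exprn_ge0// expRN ler_pdivrMr ?expR_gt0//.
have f0 : 0 < (i.+1)`!%:R :> R by rewrite ltr0n fact_gt0.
have [x1|x1] := leP x 1.
  rewrite (@le_trans _ _ 1) ?exprn_ile1//.
  rewrite -[leLHS]mulr1 ler_pM// ?ler1n ?fact_gt0//.
  by rewrite (le_trans _ (expR_ge1Dx x))// lerDl.
rewrite (@le_trans _ _ (x ^+ i.+1))//; first by rewrite ler_weXn2l// ltW.
rewrite mulrC -ler_pdivrMr//.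
by rewrite (le_trans _ (expR_ge1Dxn i x0))// lerDr.
Qed.

Lemma is_derive_flat P t : is_derive t 1 (flat P) (flat ('X^2 * (P - P^`())) t).
Proof.
have [t0|t0|<-] := ltgtP 0 t.
- have H : is_derive t (1 : R) (fun s => P.[s^-1] * expR (- s^-1))
      (flat ('X^2 * (P - P^`())) t).
    have t00 : t != 0 by rewrite gt_eqF.
    have dV : is_derive t (1 : R) (fun s : R => s^-1) (- t ^- 2).
      apply: (is_derive_eq (@is_deriveV R id t 1 1 t00 (is_derive_id _ _))).
      by rewrite /GRing.scale /= mulr1.
    have dP := is_derive1_comp (is_derive_poly P t^-1) dV.
    have dE : is_derive t (1 : R) (fun s : R => expR (- s^-1)) (expR (- t^-1) * t ^- 2).
      have dN : is_derive t (1 : R) (fun s : R => - s^-1) (t ^- 2).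
        by apply: (is_derive_eq (is_deriveN dV)); rewrite opprK.
      exact: (is_derive1_comp (is_derive_expR _) dN).
    apply: (is_derive_eq (is_deriveM dP dE)).
    rewrite /flat t0 !hornerE /GRing.scale /= -exprVn.
    by ring.
  apply: near_eq_is_derive H; near=> s.
  rewrite /flat ifT//; near: s; exact: lt_nbhsr.
- have H : is_derive t (1 : R) (cst (0 : R)) (flat ('X^2 * (P - P^`())) t).
    by rewrite /flat ltNge ltW//=; exact: is_derive_cst.
  apply: near_eq_is_derive H; near=> s.
  rewrite /flat ifF//; apply/negbTE; rewrite -leNgt ltW//.
  near: s; exact: lt_nbhsl.
(* At the origin the additional factor ['X^2] turns boundedness into a bound [K * s ^+ 2], so the
   derivative is 0. *)
- have [K K0 HK] := horner_expR_bounded ('X^2 * P).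
  have -> : flat ('X^2 * (P - P^`())) 0 = 0 by rewrite /flat ltxx.
  apply: (@is_derive_quadratic _ _ _ _ _ _ K) => s.
  rewrite add0r mulr0 subr0 scaler1 {2}/flat ltxx subr0 /flat.
  have [s0|s0] := ltP 0 s; last by rewrite normr0 mulr_ge0// sqr_ge0.
  have sV : 0 <= s^-1 by rewrite invr_ge0 ltW.
  have := HK _ sV; rewrite !hornerE exprVn -mulrA normrM ger0_norm ?invr_ge0 ?sqr_ge0//.
  by rewrite [_ ^- 2 * _]mulrC ler_pdivrMr ?exprn_gt0// expr2 mulrA.
Unshelve. all: by end_near. Qed.

Definition flat_deriv (k : nat) : {poly R} := iter k (fun P => 'X^2 * (P - P^`())) 1.

Lemma smooth_flat n (j : 'I_n) (c h : R) :
  smooth (fun x : 'rV[R]_n => (flat 1 (c + h * x ord0 j))%:C).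
Proof.
pose l (x : 'rV[R]_n) := c + h * x ord0 j.
pose D (s : seq 'I_n) (x : 'rV[R]_n) : R[i] :=
  if all (pred1 j) s then (h ^+ size s * flat (flat_deriv (size s)) (l x))%:C else 0.
have -> : (fun x : 'rV[R]_n => (flat 1 (c + h * x ord0 j))%:C) = D [::].
  by apply/funext => x; rewrite /D /= expr0 mul1r.
have cl : continuous l.
  move=> x; apply: (@continuousD _ _ _ _ _ x); first exact: cst_continuous.
  exact: (continuousM (@cst_continuous _ _ h x) (@continuous_entry R n j x)).
apply: (proj1 (smooth_family _ _)).
- move=> s i; rewrite /D /=; case: (all (pred1 j) s); rewrite ?andbF; last exact: cderive_cst.
  rewrite andbT => x; case: (eqVneq i j) => [->|ij]; split => /=; try exact: is_derive_cst.
  + have lE (t : R) : l (x + t *: ej R j) = l x + t * h.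
      by rewrite /l !mxE !eqxx mulr1 mulrDr addrA [t * h]mulrC.
    have := is_derive_comp_line lE (is_deriveZ (h ^+ size s)
       (is_derive_flat (flat_deriv (size s)) (l x))).
    by rewrite /GRing.scale /= mulrA -exprS.
  + apply: is_derive_const_along => t /=.
    by rewrite /l !mxE eqxx /= eq_sym (negbTE ij) mulr0 addr0.
- move=> s; rewrite /D; case: (all _ s); last exact: ccontinuous_cst.
  split; last exact: cst_continuous.
  move=> x; apply: (@continuousM _ _ _ _ x); first exact: cst_continuous.
  apply: (continuous_comp (cl x)); apply: differentiable_continuous.
  by apply/derivable1_diffP; have [] := is_derive_flat (flat_deriv (size s)) (l x).
Qed.

Lemma flat_gt0 t : 0 < t -> 0 < flat 1 t.
Proof. by move=> t0; rewrite /flat t0 hornerE mul1r expR_gt0. Qed.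

Lemma flat_ge0 t : 0 <= flat 1 t.
Proof. by have [/flat_gt0/ltW//|t0] := ltP 0 t; rewrite /flat ltNge t0. Qed.

Lemma smooth_prod n (I : Type) (r : seq I) (F : I -> 'rV[R]_n -> R[i]) :
  (forall i, smooth (F i)) -> smooth (fun x => \prod_(i <- r) F i x).
Proof.
move=> sF; elim: r => [|i r IH].
  rewrite (_ : (fun x => _) = fun=> 1); first by case: (smooth_cst n (1 : R[i])).
  by apply/funext => x; rewrite big_nil.
rewrite (_ : (fun x => _) = fun x => F i x * \prod_(i <- r) F i x).
  exact: smoothM.
by apply/funext => x; rewrite big_cons.
Qed.

(** A product over the coordinates of two flat functions facing each other, divided by its value at
    [p]. The support is a cube, in agreement with the description of supports by coordinates. *)
Lemma bump_exists n (p : 'rV[R]_n) (e : R) : 0 < e ->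
  exists chi : 'rV[R]_n -> R, [/\ smooth (fun x => (chi x)%:C),
    forall x, 0 <= chi x, chi p = 1 &
    forall (x : 'rV[R]_n) i, e <= `|x ord0 i - p ord0 i| -> chi x = 0].
Proof.
move=> e0.
pose b (j : 'I_n) (x : 'rV[R]_n) : R :=
  flat 1 ((e - p ord0 j) + 1 * x ord0 j) * flat 1 ((e + p ord0 j) + (-1) * x ord0 j).
pose c : R := \prod_(j < n) b j p.
have c0 : 0 < c.
  apply: prodr_gt0 => j _; rewrite /b mul1r mulN1r subrK addrK.
  by rewrite mulr_gt0// flat_gt0.
exists (fun x => c^-1 * \prod_(j < n) b j x); split.
- rewrite (_ : (fun x => _) = fun x => (c^-1)%:C * (\prod_(j <- index_enum 'I_n) ((b j x)%:C : R[i]))).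
    apply: smoothM; first by case: (smooth_cst n ((c^-1)%:C : R[i])).
    apply: smooth_prod => j.
    rewrite (_ : (fun x => _) = fun x : 'rV[R]_n => (flat 1 ((e - p ord0 j) + 1 * x ord0 j))%:C *
       (flat 1 ((e + p ord0 j) + (-1) * x ord0 j))%:C).
      by apply: smoothM; exact: smooth_flat.
    by apply/funext => x; rewrite /b real_complexM.
  by apply/funext => x; rewrite real_complexM rmorph_prod.
- move=> x; apply: mulr_ge0; first by rewrite invr_ge0 ltW.
  by apply: prodr_ge0 => j _; rewrite mulr_ge0 ?flat_ge0.
- by rewrite mulVf// gt_eqF.
- move=> x i; rewrite ler_normr (bigD1 i)//= {1}/b mul1r mulN1r => h.
  suff -> : flat 1 (e - p ord0 i + x ord0 i) * flat 1 (e + p ord0 i - x ord0 i) = 0.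
    by rewrite mul0r mulr0.
  case/orP: h => h.
    by rewrite mulrC /flat [X in if X then _ else _]ltNge (_ : _ <= 0) ?mul0r//; lra.
  by rewrite /flat [X in if X then _ else _]ltNge (_ : _ <= 0) ?mul0r//; lra.
Qed.

End bump.

(** * Schwartz functions and tempered distributions *)

Section schwartz_functions.
Variable R : realType.

Section fixed_dimension.
Variable n : nat.
Local Notation E := 'rV[R]_n.
Implicit Types (f g : E -> R[i]) (rho : R).

(** Compact support in coordinates; [cc_smoothP] connects it with the topological definition. The
    strict inequality describes an open region, so that derivatives vanish there too. *)
Definition supported rho f := forall (x : E) i, rho < `|x ord0 i| -> f x = 0.

Lemma supported_cderive rho f g j : cderive j f g -> supported rho f -> supported rho g.
Proof.
move=> dfg sf x i xi.
have cx : {for x, continuous (fun y : E => `|y ord0 i|)}.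
  exact: (continuous_comp (@continuous_entry R n i x) (@norm_continuous _ _ _)).
have N : \forall y \near x, f y = 0.
  near=> y; apply: (sf y i); near: y.
  exact: (cvgr_gt _ cx).
have [d1 d2] := dfg x.
have N1 : \forall y \near x, (@complex.Re R \o f) y = cst 0 y.
  by apply: filterS N => y /= ->.
have N2 : \forall y \near x, (@complex.Im R \o f) y = cst 0 y.
  by apply: filterS N => y /= ->.
have := near_eq_is_derive N1 d1; have := near_eq_is_derive N2 d2.
move=> D2 D1; apply: complex_ext => /=.
  by have := derive_val (is_derive := D1); rewrite derive_cst => <-.
by have := derive_val (is_derive := D2); rewrite derive_cst => <-.
Unshelve. all: by end_near. Qed.

Lemma supported_cpartials rho f s : smooth f -> supported rho f ->
  supported rho (cpartials s f).
Proof.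
move=> sf; elim: s => [|j s IH] rf; first by rewrite cpartials_nil.
by apply: supported_cderive (smooth_cderive sf s j) _; exact: IH.
Qed.

Lemma compact_box rho : compact [set x : E | forall i, `|x ord0 i| <= rho].
Proof.
have := @rV_compact R n (fun=> `[- rho, rho]%classic) (fun=> @segment_compact R _ _).
congr compact; apply/seteqP; split=> x /= H i; have := H i;
  by rewrite in_itv/= ler_norml.
Qed.

Lemma supported_bounded rho f : smooth f -> supported rho f ->
  exists M, forall x, modulus (f x) <= M.
Proof.
move=> sf rf.
have key (g : E -> R) : continuous g ->
    exists M, forall x : E, (forall i, `|x ord0 i| <= rho) -> `|g x| <= M.
  move=> cg.
  have cc : {within [set x : E | forall i, `|x ord0 i| <= rho], continuous g}.
    exact: continuous_subspaceT.
  have /compact_bounded [M [_ HM]] := continuous_compact cc (@compact_box rho).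
  exists (M + 1) => x xB; apply: (HM (M + 1)); first by rewrite ltrDl.
  by exists x.
have := smooth_ccontinuous sf [::]; rewrite cpartials_nil => -[cr ci].
have [M1 H1] := key _ cr; have [M2 H2] := key _ ci.
exists (Num.max 0 (M1 + M2)) => x.
have [xB|/existsNP [i /negP]] := pselect (forall i, `|x ord0 i| <= rho); last first.
  by rewrite -ltNge => /rf ->; rewrite modulus0 le_max lexx.
rewrite le_max; apply/orP; right; apply: (le_trans (modulus_le _)).
by rewrite lerD; [|exact: H1|exact: H2].
Qed.

Lemma supported_dbound rho f N : smooth f -> supported rho f ->
  exists2 M, 0 <= M & dbound N (fun=> M) f.
Proof.
elim: N f => [|N IH] f sf rf; have [M0 HM0] := supported_bounded sf rf.
  exists M0; first exact: le_trans (modulus_ge0 _) (HM0 0).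
  by move=> [|//] _ x; rewrite cpartials_nil.
have /choice [M HM] : forall j, exists M, 0 <= M /\ dbound N (fun=> M) (cpartials [:: j] f).
  move=> j; have [|M M1 M2] := IH (cpartials [:: j] f) (smooth_cpartials _ sf).
    exact: supported_cpartials.
  by exists M.
have M00 : 0 <= M0 := le_trans (modulus_ge0 _) (HM0 0).
have S0 : 0 <= \sum_j M j by apply: sumr_ge0 => j _; case: (HM j).
exists (M0 + \sum_j M j); first exact: addr_ge0.
move=> s; case/lastP: s => [|s j] sN x.
  by rewrite cpartials_nil (le_trans (HM0 x))// lerDl.
rewrite -cats1 cpartials_cat; apply: (@le_trans _ _ (M j)).
  by have [_] := HM j; apply; move: sN; rewrite size_rcons.
rewrite (bigD1 j)//= addrCA lerDl addr_ge0//.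
by apply: sumr_ge0 => k _; case: (HM k).
Qed.

Lemma dbound_supported N M rho f (B : E -> R) : smooth f -> supported rho f ->
  dbound N (fun=> M) f -> (forall x, 0 <= B x) ->
  (forall x : E, (forall i, `|x ord0 i| <= rho) -> M <= B x) -> dbound N B f.
Proof.
move=> sf rf fM B0 MB s sN x.
have [xB|/existsNP [i /negP]] := pselect (forall i, `|x ord0 i| <= rho).
  by rewrite (le_trans (fM s sN x))// MB.
by rewrite -ltNge => /(supported_cpartials s sf rf) ->; rewrite modulus0.
Qed.

Lemma supported_dbound_japanese rho f N k : smooth f -> supported rho f ->
  exists2 C, 0 <= C & dbound N (fun x => C * japanese x ^- k) f.
Proof.
move=> sf rf; have [M M0 HM] := supported_dbound N sf rf.
have m1 : 1 <= Num.max 1 rho by rewrite le_max lexx.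
have C0 : 0 <= M * (n.+1%:R * Num.max 1 rho) ^+ k.
  by rewrite mulr_ge0// exprn_ge0// mulr_ge0// (le_trans ler01).
exists (M * (n.+1%:R * Num.max 1 rho) ^+ k) => //.
apply: (dbound_supported (M := M) (rho := rho)) => //.
  by move=> x; rewrite mulr_ge0// invr_ge0 exprn_ge0// japanese_ge0.
move=> x xB; rewrite ler_pdivlMr ?japaneseX_gt0//.
apply: ler_wpM2l => //; apply: lerXn2r; rewrite ?nnegrE ?japanese_ge0//.
  by rewrite mulr_ge0// (le_trans ler01).
by apply: japanese_le_max => // i; rewrite le_max xB orbT.
Qed.

Lemma supported_dbound_weight rho f N : smooth f -> supported rho f ->
  exists2 C, 0 <= C & dbound N (fun x => C * weight x) f.
Proof.
move=> sf rf; have [C C0 HC] := supported_dbound_japanese N (2 * n) sf rf.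
exists C => //; apply: dbound_le HC => x.
by apply: ler_wpM2l => //; exact: japanese_weight.
Qed.

Lemma cc_smoothP f : cc_smooth f <-> smooth f /\ exists rho, supported rho f.
Proof.
split=> [[sf cf]|[sf [rho rf]]]; split=> //.
  have [M [_ HM]] := compact_bounded cf.
  exists (M + 1) => x i xi; apply/eqP/negP => /negP fx.
  have : `|x| <= M + 1.
    by apply: (HM (M + 1)); [rewrite ltrDl|apply: subset_closure].
  by apply/negP; rewrite -ltNge (lt_le_trans xi)// entry_le_norm.
apply: (subclosed_compact _ (@compact_box rho)); first exact: closed_closure.
have cB : closed [set x : E | forall i, `|x ord0 i| <= rho].
  by apply: compact_closed; [exact: norm_hausdorff|exact: compact_box].
rewrite [X in _ `<=` X](_ : _ = closure [set x : E | forall i, `|x ord0 i| <= rho]).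
  apply: closure_subset => x /= fx i; rewrite leNgt; apply/negP => xi.
  by move: fx; rewrite (rf x i xi) eqxx.
exact/closure_id.
Qed.

(** The definition ties the order of differentiation to the power of the bracket; the estimates
    below vary them independently. *)
Lemma schwartzP f : schwartz f <->
  smooth f /\ forall N k, exists C, dbound N (fun x => C * japanese x ^- k) f.
Proof.
split=> [[sf bf]|[sf bf]]; split=> //.
  move=> N k; have [C HC] := bf (maxn N k).
  exists C => s sN x; rewrite ler_pdivlMr ?japaneseX_gt0// mulrC.
  apply: (@le_trans _ _ (japanese x ^+ maxn N k * modulus (cpartials s f x))).
    by apply: ler_wpM2r; rewrite ?modulus_ge0// japaneseX_le// leq_maxr.
  by apply: HC; exists s, x; split=> //; rewrite (leq_trans sN)// leq_maxl.
move=> k; have [C HC] := bf k k.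
exists C => _ [s [x [sk ->]]].
by rewrite mulrC -ler_pdivlMr ?japaneseX_gt0// HC.
Qed.

Lemma schwartz_smooth f : schwartz f -> smooth f. Proof. by case. Qed.

Lemma schwartz_dbound f N k : schwartz f ->
  exists2 C, 0 <= C & dbound N (fun x => C * japanese x ^- k) f.
Proof.
move=> /schwartzP [_ /(_ N k) [C HC]]; exists C => //.
by have := dbound_ge0 0 HC; rewrite pmulr_lge0// invr_gt0 japaneseX_gt0.
Qed.

Lemma schwartz_dbound_weight f N : schwartz f ->
  exists2 C, 0 <= C & dbound N (fun x => C * weight x) f.
Proof.
move=> sf; have [C C0 HC] := schwartz_dbound N (2 * n) sf.
exists C => //; apply: dbound_le HC => x.
by apply: ler_wpM2l => //; exact: japanese_weight.
Qed.

Lemma schwartz_weighted f : schwartz f -> weighted f.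
Proof.
move=> sf; have [C C0 HC] := schwartz_dbound_weight 0 sf.
split; first exact: smooth_cmeasurable (schwartz_smooth sf).
by exists C => x; exact: (dbound0 x HC).
Qed.

Lemma supported_schwartz rho f : smooth f -> supported rho f -> schwartz f.
Proof.
move=> sf rf; apply/schwartzP; split=> // N k.
by have [C _ HC] := supported_dbound_japanese N k sf rf; exists C.
Qed.

Lemma dbound_lincomb N A B f g (c : R[i]) : smooth f -> smooth g ->
  dbound N A f -> dbound N B g ->
  dbound N (fun x => modulus c * A x + B x) (fun x => c * f x + g x).
Proof.
move=> sf sg fA gB s sN x; rewrite (smooth_lincomb c sf sg).2.
rewrite (le_trans (modulusD _ _))// modulusM lerD ?gB//.
by apply: ler_wpM2l; rewrite ?modulus_ge0// fA.
Qed.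

Lemma schwartz_lincomb f g (c : R[i]) : schwartz f -> schwartz g ->
  schwartz (fun x => c * f x + g x).
Proof.
move=> sf sg; apply/schwartzP; split.
  by case: (smooth_lincomb c (schwartz_smooth sf) (schwartz_smooth sg)).
move=> N k; have [C C0 HC] := schwartz_dbound N k sf; have [D D0 HD] := schwartz_dbound N k sg.
exists (modulus c * C + D); rewrite (_ : (fun x => _) = fun x =>
    modulus c * (C * japanese x ^- k) + D * japanese x ^- k); last first.
  by apply/funext => x; rewrite mulrDl mulrA.
by apply: dbound_lincomb => //; exact: schwartz_smooth.
Qed.

Lemma schwartz0 : schwartz (fun _ : E => 0).
Proof.
have [h1 h2] := smooth_cst n (0 : R[i]).
apply/schwartzP; split=> // N k; exists 0 => s sN x; rewrite h2 mul0r.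
by case: s sN => *; rewrite modulus0.
Qed.

Lemma schwartzZ f (c : R[i]) : schwartz f -> schwartz (fun x => c * f x).
Proof.
move=> sf; have := schwartz_lincomb c sf schwartz0.
by congr schwartz; apply/funext => x; rewrite addr0.
Qed.

Lemma schwartzD f g : schwartz f -> schwartz g -> schwartz (fun x => f x + g x).
Proof.
move=> sf sg; have := schwartz_lincomb 1 sf sg.
by congr schwartz; apply/funext => x; rewrite mul1r.
Qed.

Lemma schwartz_sum (I : Type) (r : seq I) (F : I -> E -> R[i]) :
  (forall i, schwartz (F i)) -> schwartz (fun x => \sum_(i <- r) F i x).
Proof.
move=> sF; elim: r => [|i r IH].
  rewrite (_ : (fun x => _) = fun=> 0); first exact: schwartz0.
  by apply/funext => x; rewrite big_nil.
rewrite (_ : (fun x => _) = fun x => F i x + \sum_(i <- r) F i x).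
  exact: schwartzD.
by apply/funext => x; rewrite big_cons.
Qed.

Lemma seminorm_le f k C : dbound k (fun x => C * japanese x ^- k) f ->
  schwartz_seminorm k f <= C.
Proof.
move=> HC; apply: ge_sup.
  exists (japanese (0 : E) ^+ k * modulus (cpartials [::] f 0)).
  by exists [::], (0 : E); split.
move=> _ [s [x [sk ->]]].
by rewrite mulrC -ler_pdivlMr ?japaneseX_gt0// HC.
Qed.

(** Continuity in terms of [dbound]: any constant [C] valid for the seminorm may be used, without
    computing the supremum. *)
Lemma tempered_bound u : tempered u -> exists K k, 0 <= K /\
  forall f C, schwartz f -> dbound k (fun x => C * japanese x ^- k) f ->
    modulus (u f) <= K * C.
Proof.
move=> [_ [K [k H]]]; exists `|K|, k; split=> // f C sf HC.
have C0 : 0 <= schwartz_seminorm k f.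
  have [_ /(_ k) bf] := sf.
  apply: (@le_trans _ _ (japanese (0 : E) ^+ k * modulus (cpartials [::] f 0))).
    by rewrite mulr_ge0 ?modulus_ge0// exprn_ge0// japanese_ge0.
  by apply: ub_le_sup => //; exists [::], (0 : E); split.
rewrite (le_trans (H f sf))//.
apply: (@le_trans _ _ (`|K| * schwartz_seminorm k f)).
  by apply: ler_wpM2r => //; exact: ler_norm.
by apply: ler_wpM2l => //; exact: seminorm_le.
Qed.

Lemma tempered_sum u (I : Type) (r : seq I) (c : I -> R[i]) (F : I -> E -> R[i]) :
  tempered u -> (forall i, schwartz (F i)) ->
  u (fun x => \sum_(i <- r) c i * F i x) = \sum_(i <- r) conjc (c i) * u (F i).
Proof.
move=> [ul _] sF.
have u0 : u (fun=> 0) = 0.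
  have := ul (-1) _ _ schwartz0 schwartz0.
  rewrite (_ : (fun x => _) = fun=> 0); last by apply/funext => x; rewrite mulr0 addr0.
  by rewrite rmorphN rmorph1 mulN1r addNr.
elim: r => [|i r IH].
  by rewrite big_nil -[RHS]u0; congr u; apply/funext => x; rewrite big_nil.
rewrite big_cons -IH -ul//; last by apply: schwartz_sum => j; exact: schwartzZ.
by congr u; apply/funext => x; rewrite big_cons.
Qed.

(** The only source of strict positivity: it serves the nonvanishing of the inversion constant and
    of the energy of a window. *)
Lemma Rintegral_gt0 (g : E -> R) (C c delta : R) (p : E) :
  measurable_fun [set: E] g -> (forall x, 0 <= g x) -> (forall x, g x <= C * weight x) ->
  0 < c -> 0 < delta ->
  (forall x : E, (forall i, `|x ord0 i - p ord0 i| <= delta) -> c <= g x) ->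
  0 < \int[lebesgue_rV R n]_x g x.
Proof.
move=> mg g0 gC c0 d0 gc.
have ig := integrable_le_weight mg (fun x => eq_ind_r (fun t => t <= _) (gC x) (ger0_norm (g0 x))).
have [mB muB] := @lebesgue_rV_box R n (fun i => `[p ord0 i - delta, p ord0 i + delta]%classic)
  (fun i => measurable_itv _).
set B := [set v | _] in mB muB.
rewrite -lte_fin /Rintegral fineK; last exact: (integrable_fin_num measurableT ig).
have mg' : measurable_fun [set: E] (EFin \o g) by exact/measurable_EFinP.
have mg'' : measurable_fun B (EFin \o g) by exact: measurable_funTS.
apply: (@lt_le_trans _ _ (\int[lebesgue_rV R n]_(x in B) c%:E)%E).
  rewrite integral_cst// -[X in (_ < _ * X)%E]/(lebesgue_rV R n B) muB mule_gt0//.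
  apply: (big_ind (fun t : \bar R => 0 < t)%E) => // [x y|i _]; first exact: mule_gt0.
  rewrite lebesgue_measure_itv/= lte_fin ifT; last by rewrite ltrD2l gtrN.
  by rewrite -EFinB lte_fin subr_gt0 ltrD2l gtrN.
apply: (@le_trans _ _ (\int[lebesgue_rV R n]_(x in B) (g x)%:E)%E).
  apply: ge0_le_integral => //.
  - by move=> x _; rewrite lee_fin ltW.
  - move=> x Bx; rewrite lee_fin gc// => i.
    by have := Bx i; rewrite /= in_itv/= ler_distl.
by apply: ge0_subset_integral => // x _; rewrite lee_fin.
Qed.

End fixed_dimension.
End schwartz_functions.

(** * Fourier inversion *)

Section fourier_inversion.
Variable R : realType.

Lemma dotvC n (x y : 'rV[R]_n) : dotv x y = dotv y x.
Proof. by apply: eq_bigr => i _; rewrite mulrC. Qed.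

Lemma dotvDl n (x y z : 'rV[R]_n) : dotv (x + y) z = dotv x z + dotv y z.
Proof. by rewrite -big_split; apply: eq_bigr => i _; rewrite mxE mulrDl. Qed.

Lemma dotvZl n (h : R) (x y : 'rV[R]_n) : dotv (h *: x) y = h * dotv x y.
Proof. by rewrite /dotv mulr_sumr; apply: eq_bigr => i _; rewrite mxE mulrA. Qed.

Lemma dotvDr n (x y z : 'rV[R]_n) : dotv x (y + z) = dotv x y + dotv x z.
Proof. by rewrite dotvC dotvDl !(dotvC x). Qed.

Lemma dotvZr n (h : R) (x y : 'rV[R]_n) : dotv x (h *: y) = h * dotv x y.
Proof. by rewrite dotvC dotvZl dotvC. Qed.

Lemma dotvNl n (x y : 'rV[R]_n) : dotv (- x) y = - dotv x y.
Proof. by rewrite -scaleN1r dotvZl mulN1r. Qed.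

Lemma dotvNr n (x y : 'rV[R]_n) : dotv x (- y) = - dotv x y.
Proof. by rewrite dotvC dotvNl dotvC. Qed.

Lemma dotvBl n (x y z : 'rV[R]_n) : dotv (x - y) z = dotv x z - dotv y z.
Proof. by rewrite dotvDl dotvNl. Qed.

Lemma dotvBr n (x y z : 'rV[R]_n) : dotv x (y - z) = dotv x y - dotv x z.
Proof. by rewrite dotvDr dotvNr. Qed.

Lemma dotv0l n (x : 'rV[R]_n) : dotv 0 x = 0.
Proof. by rewrite -(scale0r (0 : 'rV_n)) dotvZl mul0r. Qed.

Lemma dotv0r n (x : 'rV[R]_n) : dotv x 0 = 0.
Proof. by rewrite dotvC dotv0l. Qed.

Lemma expi_lipschitz n (x s v : 'rV[R]_n) :
  modulus (expi (dotv (s + v) x) - expi (dotv s x)) <=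
  2 * japanese x * \sum_(i < n) `|v ord0 i|.
Proof.
apply: (lipschitz_path (fun j => cderive_expi j x)) => j p _.
by rewrite modulusM modulus_expi mulr1 modulus_i entry_le_japanese.
Qed.

Lemma sum_entries_le n (v : 'rV[R]_n) : \sum_(i < n) `|v ord0 i| <= n%:R * japanese v.
Proof.
have -> : n%:R * japanese v = \sum_(i < n) japanese v.
  by rewrite sumr_const card_ord mulr_natl.
by apply: ler_sum => i _; exact: entry_le_japanese.
Qed.

Lemma cmeasurable_fourier n (f : 'rV[R]_n -> R[i]) : cmeasurable f ->
  cmeasurable (fourier f).
Proof.
move=> mf; apply: cmeasurable_cintegral; apply: cmeasurableM.
  by apply: cmeasurable_expi; apply: measurable_dotv.
exact: (cmeasurable_comp mf measurable_snd).
Qed.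

(* enough derivatives for the Fourier transform to be integrable against a
   linear factor *)
Definition nice n (f : 'rV[R]_n -> R[i]) :=
  smooth f /\ exists C, dbound (2 * n).+2 (fun x => C * weight x) f.

Lemma nice_weighted n (f : 'rV[R]_n -> R[i]) : nice f -> weighted f.
Proof.
move=> [sf [C fC]]; split; first exact: smooth_cmeasurable.
by exists C => x; exact: dbound0 fC.
Qed.

Lemma schwartz_nice n (f : 'rV[R]_n -> R[i]) : schwartz f -> nice f.
Proof.
move=> sf; split; first exact: schwartz_smooth.
by have [C _ HC] := schwartz_dbound_weight (2 * n).+2 sf; exists C.
Qed.

Lemma nice_fourier n (f : 'rV[R]_n -> R[i]) : nice f ->
  exists2 C, 0 <= C & forall s, modulus (fourier f s) * japanese s <= C * weight s.
Proof.
move=> [sf [C fC]].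
have C0 : 0 <= C.
  by have := dbound_ge0 0 fC; rewrite pmulr_lge0// weight_gt0.
have K0 : 0 <= C * (weight_mass R n * n.+1%:R ^+ (2 * n).+1).
  by rewrite mulr_ge0// mulr_ge0 ?exprn_ge0// ltW// weight_mass_gt0.
eexists; first exact: K0.
move=> s; have H := fourier_decay s sf fC.
apply: (le_trans (ler_wpM2r (japanese_ge0 s) H)).
rewrite -[leLHS]mulrA; apply: ler_wpM2l => //.
rewrite [japanese s ^+ _]exprS invfM mulrAC mulVf ?mul1r ?gt_eqF ?japanese_gt0//.
exact: japanese_weight.
Qed.

Lemma weighted_fourier n (f : 'rV[R]_n -> R[i]) : nice f -> weighted (fourier f).
Proof.
move=> nf; have wf := nice_weighted nf; split; first by apply: cmeasurable_fourier; case: wf.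
have [C C0 H] := nice_fourier nf; exists C => s; apply: le_trans (H s).
by rewrite ler_peMr ?modulus_ge0 ?japanese_ge1.
Qed.

Lemma nice_lipschitz n (f : 'rV[R]_n -> R[i]) : nice f ->
  exists2 L, 0 <= L & forall x v, modulus (f (x + v) - f x) <= L * \sum_i `|v ord0 i|.
Proof.
move=> [sf [C fC]].
have C0 : 0 <= C.
  by have := dbound_ge0 0 fC; rewrite pmulr_lge0// weight_gt0.
exists (2 * C); first exact: mulr_ge0.
move=> x v; apply: (lipschitz_path (f' := fun j => cpartials [:: j] f)).
  by move=> j; have := smooth_cderive sf [::] j; rewrite cpartials_nil.
by move=> j p _; rewrite (le_trans (fC [:: j] isT p))// ler_piMr// weight_le1.
Qed.

Lemma fourier_lipschitz n (f : 'rV[R]_n -> R[i]) (C : R) : cmeasurable f ->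
  (forall y, japanese y * modulus (f y) <= C * weight y) ->
  forall s v, modulus (fourier f (s + v) - fourier f s) <=
    (2 * C * weight_mass R n) * \sum_i `|v ord0 i|.
Proof.
move=> mf fC s v.
have wf : weighted f.
  split=> //; exists C => y; apply: le_trans (fC y).
  by rewrite ler_peMl ?modulus_ge0 ?japanese_ge1.
rewrite /fourier -cintegralB; [|exact: weighted_expi..].
rewrite mulrAC; apply: cintegral_le.
  by have [] := weightedB (weighted_expi (s + v) wf) (weighted_expi s wf).
move=> y; rewrite -mulrBl modulusM dotvC [dotv y s]dotvC.
apply: (le_trans (ler_wpM2r (modulus_ge0 _) (expi_lipschitz y s v))).
rewrite (_ : _ * _ * _ * modulus _ = 2 * (\sum_i `|v ord0 i|) * (japanese y * modulus (f y))); last by ring.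
rewrite (_ : 2 * C * _ * _ = 2 * (\sum_i `|v ord0 i|) * (C * weight y)); last by ring.
by apply: ler_wpM2l => //; rewrite mulr_ge0// sumr_ge0.
Qed.

Section window.
Variable n : nat.
Variable chi : 'rV[R]_n -> R.
Let Phi (x : 'rV[R]_n) : R[i] := (chi x)%:C.
Hypothesis sPhi : smooth Phi.
Hypothesis chi0 : chi 0 = 1.
Hypothesis chi_ge0 : forall x, 0 <= chi x.
Hypothesis chi_supp : supported 1 Phi.

Let schPhi : schwartz Phi := supported_schwartz sPhi chi_supp.
Let nPhi : nice Phi := schwartz_nice schPhi.

Definition inversion_constant : R[i] := cintegral (fourier Phi).

(** The multiplication formula of the Fourier transform, with the dilation moved from [Phi] to [f].
    As [e] tends to 0 the left side tends to the integral of [fourier f] and the right side to [f 0]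
    times that of [fourier Phi]. *)
Lemma inversion_identity (f : 'rV[R]_n -> R[i]) (e : R) : 0 < e -> weighted f ->
  cintegral (fun s => fourier f s * Phi (e *: s)) =
  cintegral (fun y => f (e *: y) * fourier Phi y).
Proof.
move=> e0 wf; have en0 : e != 0 by rewrite gt_eqF.
have ei0 : e^-1 != 0 by rewrite invr_eq0.
have wPhi := schwartz_weighted schPhi.
have wPe : weighted (fun s => Phi (e *: s)).
  have := weighted_affine 0 en0 wPhi.
  by congr weighted; apply/funext => s; rewrite add0r.
have [mf [C fC]] := wf; have [mP [D PD]] := wPe.
pose F (s y : 'rV[R]_n) := expi (dotv y s) * f y * Phi (e *: s).
have mF : cmeasurable (fun p : 'rV[R]_n * 'rV[R]_n => F p.1 p.2).
  apply: cmeasurableM; last exact: (cmeasurable_comp mP measurable_fst).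
  apply: cmeasurableM; last exact: (cmeasurable_comp mf measurable_snd).
  by apply: cmeasurable_expi; apply: measurable_dotv.
have FC s y : modulus (F s y) <= (C * D) * (weight s * weight y).
  rewrite /F !modulusM modulus_expi mul1r [weight s * _]mulrC mulrACA.
  by apply: ler_pM; rewrite ?modulus_ge0.
transitivity (cintegral (fun s => cintegral (F s))).
  apply: cintegral_eq => s; rewrite /F /fourier.
  by rewrite cintegralZr//; exact: weighted_expi.
rewrite (cintegral_exchange mF FC).
have inner y : cintegral (F^~ y) = (e ^- n)%:C * (f y * fourier Phi (e^-1 *: y)).
  transitivity (f y * cintegral (fun s => expi (dotv s y) * Phi (e *: s))).
    rewrite -cintegralZ; last exact: weighted_expi.
    by apply: cintegral_eq => s; rewrite /F dotvC mulrAC [RHS]mulrC.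
  rewrite mulrCA; congr (_ * _).
  have := cintegral_affine 0 en0 (weighted_expi (e^-1 *: y) wPhi).
  rewrite gtr0_norm// => <-; apply: cintegral_eq => s.
  by rewrite add0r dotvZl dotvZr mulrA mulfV// mul1r.
have wFP : weighted (fourier Phi) := weighted_fourier nPhi.
have wFPe : weighted (fun y => fourier Phi (e^-1 *: y)).
  have := weighted_affine 0 ei0 wFP.
  by congr weighted; apply/funext => s; rewrite add0r.
have [K HK] : exists K, forall y, modulus (f y) <= K.
  have C0 : 0 <= C.
    by have := le_trans (modulus_ge0 _) (fC 0); rewrite pmulr_lge0// weight_gt0.
  by exists C => y; rewrite (le_trans (fC y))// ler_piMr// weight_le1.
have := cintegral_affine 0 en0 (weightedM wFPe mf HK).
rewrite gtr0_norm// => H.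
transitivity (cintegral (fun y => (e ^- n)%:C * (f y * fourier Phi (e^-1 *: y)))).
  by apply: cintegral_eq.
rewrite cintegralZ; last exact: (weightedM wFPe mf HK).
rewrite -H; apply: cintegral_eq => y.
by rewrite add0r scalerA mulVf// scale1r.
Qed.

(** The limit [e -> 0] in [inversion_identity], with a rate: [Phi] and [f] are Lipschitz, and the
    linear factor is absorbed by the decay of the transforms, so that both sides are within [O(e)]
    of their limits. *)
Lemma fourier_inversion0 (f : 'rV[R]_n -> R[i]) : nice f ->
  cintegral (fourier f) = inversion_constant * f 0.
Proof.
move=> nf; have wf := nice_weighted nf.
have wff := weighted_fourier nf; have wfP := weighted_fourier nPhi.
have [C1 C10 HC1] := nice_fourier nf; have [C2 C20 HC2] := nice_fourier nPhi.
have lip2 (g : 'rV[R]_n -> R[i]) : nice g ->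
    exists2 L, 0 <= L & forall e v, 0 < e -> modulus (g (e *: v) - g 0) <= e * (L * japanese v).
  move=> /nice_lipschitz [L L0 HL].
  exists (L * n%:R); first by rewrite mulr_ge0.
  move=> e v e0; have := HL 0 (e *: v); rewrite add0r => /le_trans; apply.
  rewrite (_ : \sum_i _ = e * \sum_i `|v ord0 i|); last first.
    by rewrite mulr_sumr; apply: eq_bigr => i _; rewrite mxE normrM gtr0_norm.
  rewrite mulrCA; apply: ler_wpM2l; first exact: ltW.
  by rewrite -[leRHS]mulrA; apply: ler_wpM2l => //; exact: sum_entries_le.
have [L1 L10 HL1] := lip2 _ nPhi; have [L2 L20 HL2] := lip2 _ nf.
pose B := (C1 * L1 + C2 * L2) * weight_mass R n.
have B0 : 0 <= B.
  by apply: mulr_ge0; [rewrite addr_ge0 ?mulr_ge0|exact/ltW/weight_mass_gt0].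
have key e : 0 < e -> modulus (cintegral (fourier f) - inversion_constant * f 0) <= e * B.
  move=> e0; have en0 : e != 0 by rewrite gt_eqF.
  have wPe : weighted (fun s => Phi (e *: s)).
    have := weighted_affine 0 en0 (schwartz_weighted schPhi).
    by congr weighted; apply/funext => s; rewrite add0r.
  have wfe : weighted (fun s => f (e *: s)).
    have := weighted_affine 0 en0 wf.
    by congr weighted; apply/funext => s; rewrite add0r.
  have bnd (g : 'rV[R]_n -> R[i]) : weighted g -> exists K, forall y, modulus (g y) <= K.
    move=> [_ [C gC]].
    have C0 : 0 <= C.
      by have := le_trans (modulus_ge0 _) (gC 0); rewrite pmulr_lge0// weight_gt0.
    by exists C => y; rewrite (le_trans (gC y))// ler_piMr// weight_le1.
  have [K1 HK1] := bnd _ wff; have [K2 HK2] := bnd _ wfe.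
  have w1 : weighted (fun s => fourier f s * Phi (e *: s)).
    by apply: (weightedM wPe _ HK1); case: wff.
  have w2 : weighted (fun y => f (e *: y) * fourier Phi y).
    by apply: (weightedM wfP _ HK2); case: wfe.
  have -> : cintegral (fourier f) - inversion_constant * f 0 =
     cintegral (fun s => fourier f s - fourier f s * Phi (e *: s)) +
     cintegral (fun y => f (e *: y) * fourier Phi y - f 0 * fourier Phi y).
    rewrite !cintegralB//; last exact: weightedZ.
    rewrite (inversion_identity e0 wf) (cintegralZ _ wfP) addrA subrK.
    by rewrite [f 0 * _]mulrC.
  rewrite (le_trans (modulusD _ _))// /B mulrDl mulrDr lerD// mulrA.
  - apply: cintegral_le; first by have [] := weightedB wff w1.
    move=> s.
    have -> : fourier f s - fourier f s * Phi (e *: s) = - (fourier f s * (Phi (e *: s) - Phi 0)).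
      by rewrite /Phi chi0; ring.
    rewrite modulusN modulusM.
    apply: (le_trans (ler_wpM2l (modulus_ge0 _) (HL1 e s e0))).
    rewrite (_ : _ * (e * (L1 * _)) = e * L1 * (modulus (fourier f s) * japanese s)); last by ring.
    rewrite (_ : e * (C1 * L1) * _ = e * L1 * (C1 * weight s)); last by ring.
    by apply: ler_wpM2l; [rewrite mulr_ge0// ltW|exact: HC1].
  - apply: cintegral_le; first by have [] := weightedB w2 (weightedZ (f 0) wfP).
    move=> s.
    rewrite -mulrBl modulusM.
    apply: (le_trans (ler_wpM2r (modulus_ge0 _) (HL2 e s e0))).
    rewrite (_ : e * (L2 * _) * _ = e * L2 * (modulus (fourier Phi s) * japanese s)); last by ring.
    rewrite (_ : e * (C2 * L2) * _ = e * L2 * (C2 * weight s)); last by ring.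
    by apply: ler_wpM2l; [rewrite mulr_ge0// ltW|exact: HC2].
apply/eqP; rewrite -subr_eq0 -modulus_eq0 eq_le modulus_ge0 andbT leNgt; apply/negP.
move: (modulus _) key => p key p0.
have B1 : 0 < B + 1 by rewrite ltr_wpDl.
have := key _ (divr_gt0 p0 B1).
rewrite mulrAC ler_pdivlMr// ler_pM2l//; lra.
Qed.

Lemma nice_shift (f : 'rV[R]_n -> R[i]) (x : 'rV[R]_n) : nice f ->
  nice (fun y => f (x + y)).
Proof.
move=> [sf [C fC]].
have C0 : 0 <= C.
  by have := dbound_ge0 0 fC; rewrite pmulr_lge0// weight_gt0.
have e : (fun y => f (x + y)) = (fun y => f (x + 1 *: y)).
  by apply/funext => y; rewrite scale1r.
rewrite e; split; first by case: (smooth_affine x 1 sf).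
have [K K0 HK] := weighted_shift_bound x (oner_neq0 R).
exists (C * K); apply: dbound_le (dbound_affine x sf _ fC); last by rewrite normr1.
by move=> y; rewrite -mulrA ler_wpM2l.
Qed.

Lemma fourier_inversion_window (f : 'rV[R]_n -> R[i]) (x : 'rV[R]_n) : nice f ->
  cintegral (fun s => fourier f s * expi (- dotv x s)) = inversion_constant * f x.
Proof.
move=> nf; rewrite -[in RHS](addr0 x) -(fourier_inversion0 (nice_shift x nf)).
apply: cintegral_eq => s; rewrite /fourier.
have := cintegral_shift x (weighted_expi s (nice_weighted nf)).
rewrite -[in X in _ = X]/(fourier f s) -cintegralZr; last exact: (weighted_expi s (nice_weighted nf)).
move=> _; rewrite -(cintegral_shift x); last first.
  have := weightedZ (expi (- dotv x s)) (weighted_expi s (nice_weighted nf)).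
  by congr weighted; apply/funext => y; rewrite mulrC.
apply: cintegral_eq => y; rewrite dotvDl expiD [y + x]addrC.
rewrite (_ : _ * _ * _ * _ = expi (dotv y s) * f (x + y) * (expi (dotv x s) * expi (- dotv x s))); last by ring.
by rewrite -expiD subrr expi0 mulr1.
Qed.

Lemma inversion_constant_neq0 : inversion_constant != 0.
Proof.
apply/eqP => K0.
have wfP := weighted_fourier nPhi; have wP := schwartz_weighted schPhi.
have [mfP [C HC]] := wfP; have [mP [D HD]] := wP.
have C0 : 0 <= C.
  by have := le_trans (modulus_ge0 _) (HC 0); rewrite pmulr_lge0// weight_gt0.
pose F (x s : 'rV[R]_n) := fourier Phi s * expi (- dotv x s) * conjc (Phi x).
have mF : cmeasurable (fun p : 'rV[R]_n * 'rV[R]_n => F p.1 p.2).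
  apply: cmeasurableM; last first.
    by apply: cmeasurable_conj; exact: (cmeasurable_comp mP measurable_fst).
  apply: cmeasurableM; first exact: (cmeasurable_comp mfP measurable_snd).
  apply: cmeasurable_expi; apply: measurable_funN; exact: measurable_dotv.
have FC x s : modulus (F x s) <= (D * C) * (weight x * weight s).
  rewrite /F !modulusM modulus_expi mulr1 modulus_conj mulrACA mulrC.
  by apply: ler_pM; rewrite ?modulus_ge0.
have wx (x : 'rV[R]_n) : weighted (fun s => fourier Phi s * expi (- dotv x s)).
  have := weighted_expi (- x) wfP; congr weighted; apply/funext => s.
  by rewrite dotvNr dotvC mulrC.
have E1 : cintegral (fun x => cintegral (F x)) = 0.
  rewrite -[RHS](@cintegral0 R n); apply: cintegral_eq => x.
  rewrite /F cintegralZr//.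
  by rewrite (fourier_inversion_window x nPhi) K0 !mul0r.
have E2 : cintegral (fun s => fourier Phi s * conjc (fourier Phi s)) = 0.
  rewrite -[RHS]E1 (cintegral_exchange mF FC); apply: cintegral_eq => s.
  rewrite /F [in LHS]/fourier -cintegral_conj; last exact: weighted_expi.
  rewrite -cintegralZ; last by apply: weighted_conj; exact: weighted_expi.
  by apply: cintegral_eq => x; rewrite conjcM expiN mulrA.
have gE (z : R[i]) : complex.Re (z * conjc z) = modulus z ^+ 2.
  case: z => a b; rewrite /modulus /= sqr_sqrtr; first by ring.
  by rewrite addr_ge0// sqr_ge0.
have E3 : \int[lebesgue_rV R n]_s (modulus (fourier Phi s) ^+ 2) = 0.
  transitivity (complex.Re (cintegral (fun s => fourier Phi s * conjc (fourier Phi s)))).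
    by apply: eq_Rintegral => s _; rewrite gE.
  by rewrite E2.
(* The transform at the origin is the integral of [chi], positive because [chi] is at least 1/2 on a
   box around 0. *)
have m0 : 0 < modulus (fourier Phi 0).
  apply: (@lt_le_trans _ _ (complex.Re (fourier Phi 0))); last first.
    exact: le_trans (ler_norm _) (Re_le_modulus _).
  rewrite (_ : complex.Re _ = \int[lebesgue_rV R n]_x chi x); last first.
    apply: eq_Rintegral => y _; rewrite dotv0r expi0 mul1r //.
  have [L L0 HL] := nice_lipschitz nPhi.
  have L1 : 0 < L * n%:R + 1 by rewrite ltr_wpDl ?mulr_ge0.
  apply: (@Rintegral_gt0 R n chi D 2^-1 (2^-1 / (L * n%:R + 1)) 0) => //.
  - by case: mP.
  - by move=> x; have := HD x; rewrite /Phi modulus_real ger0_norm.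
  - by rewrite divr_gt0.
  - move=> x xd; have := HL 0 x; rewrite add0r /Phi chi0.
    rewrite (_ : (chi x)%:C - 1%:C = (chi x - 1)%:C); last by rewrite rmorphB.
    rewrite modulus_real.
    have xs : \sum_i `|x ord0 i| <= n%:R * (2^-1 / (L * n%:R + 1)).
      have -> : n%:R * (2^-1 / (L * n%:R + 1)) = \sum_(i < n) (2^-1 / (L * n%:R + 1)).
        by rewrite sumr_const card_ord mulr_natl.
      by apply: ler_sum => i _; have := xd i; rewrite mxE subr0.
    have h : L * \sum_i `|x ord0 i| <= 2^-1.
      apply: (le_trans (ler_wpM2l L0 xs)); rewrite !mulrA ler_pdivrMr//; nra.
    move=> /le_trans/(_ h); rewrite ler_norml => /andP[h1 _]; lra.
(* One power beyond [2 * n] pays for the factor [japanese y] in the Lipschitz constant of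
   [expi (dotv y s)] as a function of [s]. *)
have [C' C'0 HC'] := schwartz_dbound 0 (2 * n).+1 schPhi.
have mPj y : japanese y * modulus (Phi y) <= C' * weight y.
  have h := dbound0 y HC'.
  apply: (le_trans (ler_wpM2l (japanese_ge0 y) h)).
  rewrite mulrCA; apply: ler_wpM2l => //.
  rewrite exprS invfM mulrA divff ?mul1r ?gt_eqF ?japanese_gt0//.
  exact: japanese_weight.
have lipF := fourier_lipschitz mP mPj.
set L := 2 * C' * _ in lipF.
have L0 : 0 <= L by apply: mulr_ge0; [exact: mulr_ge0|exact/ltW/weight_mass_gt0].
set m := modulus (fourier Phi 0) in m0.
have L1 : 0 < 2 * (L * n%:R + 1).
  by apply: mulr_gt0 => //; apply: ltr_wpDl => //; exact: mulr_ge0.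
(* The Lipschitz bound keeps the transform above half its value at 0 on a box, against the vanishing
   of its norm. *)
suff : 0 < \int[lebesgue_rV R n]_s (modulus (fourier Phi s) ^+ 2) by rewrite E3 ltxx.
apply: (@Rintegral_gt0 R n _ (C * C) ((m / 2) ^+ 2) (m / (2 * (L * n%:R + 1))) 0) => //.
- rewrite (_ : (fun s => _) = (fun s => modulus (fourier Phi s)) \* (fun s => modulus (fourier Phi s))).
    by apply: measurable_funM; exact: measurable_modulus.
  by apply/funext => s; rewrite expr2.
- by move=> s; exact: sqr_ge0.
- move=> s; rewrite expr2 -mulrA; apply: ler_pM; rewrite ?modulus_ge0//.
  by rewrite (le_trans (HC s))// ler_piMr// weight_le1.
- by rewrite exprn_gt0// divr_gt0.
- by rewrite divr_gt0.
- move=> s sd; have := lipF 0 s; rewrite add0r => hs.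
  have xs : \sum_i `|s ord0 i| <= n%:R * (m / (2 * (L * n%:R + 1))).
    have -> : n%:R * (m / (2 * (L * n%:R + 1))) = \sum_(i < n) (m / (2 * (L * n%:R + 1))).
      by rewrite sumr_const card_ord mulr_natl.
    by apply: ler_sum => i _; have := sd i; rewrite mxE subr0.
  have h : L * \sum_i `|s ord0 i| <= m / 2.
    apply: (le_trans (ler_wpM2l L0 xs)); rewrite !mulrA ler_pdivrMr//; nra.
  apply: lerXn2r; rewrite ?nnegrE ?modulus_ge0//; first by rewrite divr_ge0// ltW.
  have : m <= modulus (fourier Phi s) + m / 2.
    rewrite /m -{1}(subKr (fourier Phi s) (fourier Phi 0)).
    by rewrite (le_trans (modulusB _ _))// lerD2l (le_trans hs).
  move: m m0 {L1 xs h sd hs} => m _; move: (modulus _) => q hq; lra.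
Qed.

End window.

(* [K] is [(2 pi)^n], but only [K != 0] matters, and this follows without a
   Gaussian integral: if [K] were [0], Fubini would give the transform of a bump
   vanishing L^2 norm. *)
Lemma fourier_inversion (n : nat) : exists2 K : R[i], K != 0 & forall (f : 'rV[R]_n -> R[i]) x, nice f ->
  cintegral (fun s => fourier f s * expi (- dotv x s)) = K * f x.
Proof.
have [chi [schi chi_ge0 chi0 chi_supp]] := bump_exists (0 : 'rV[R]_n) ltr01.
have supp : supported 1 (fun x => (chi x)%:C).
  by move=> x i xi; rewrite (chi_supp x i)// mxE subr0 ltW.
exists (inversion_constant chi); first exact: inversion_constant_neq0.
by move=> f x nf; exact: fourier_inversion_window.
Qed.

End fourier_inversion.

(** * Semiclassical Weyl operators *)

Section partial_fourier.
Variables (R : realType) (d : nat).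
Local Notation E := 'rV[R]_d.
Local Notation E2 := 'rV[R]_(d + d).
Implicit Types (b : E2 -> R[i]) (q s x : E).

Lemma continuous_rVP m n (A : 'rV[R]_m -> 'rV[R]_n) :
  (forall i, continuous (fun z => A z ord0 i)) -> continuous A.
Proof.
move=> cA; have -> : A = fun z => \sum_(i <- index_enum 'I_n) A z ord0 i *: delta_mx ord0 i.
  by apply/funext => z; rewrite {1}(row_sum_delta (A z)).
elim: (index_enum _) => [|i r IH].
  by under [fun z => _]funext do rewrite big_nil; move=> z; exact: cst_continuous.
under [fun z => _]funext do rewrite big_cons.
move=> z; apply: (@continuousD _ _ _ _ _ z); last exact: IH.
exact: (continuousZr_tmp (cA i z)).
Qed.

Lemma continuous_row_mxr q : continuous (fun y : E => row_mx q y : E2).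
Proof.
apply: continuous_rVP => i; rewrite -(fintype.splitK i); case: (fintype.split i) => k /=.
  by under [fun x => _]funext do rewrite row_mxEl; move=> x; exact: cst_continuous.
by under [fun x => _]funext do rewrite row_mxEr; exact: continuous_entry.
Qed.

Lemma continuous_row_mxl q : continuous (fun y : E => row_mx y q : E2).
Proof.
apply: continuous_rVP => i; rewrite -(fintype.splitK i); case: (fintype.split i) => k /=.
  by under [fun x => _]funext do rewrite row_mxEl; exact: continuous_entry.
by under [fun x => _]funext do rewrite row_mxEr; move=> x; exact: cst_continuous.
Qed.

Lemma row_mxr_line q (i : 'I_d) (x : E) t :
  row_mx q (x + t *: ej R i) = row_mx q x + (t * 1) *: ej R (rshift d i) :> E2.
Proof.
apply/rowP => k; rewrite -(fintype.splitK k); case: (fintype.split k) => l /=.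
  rewrite row_mxEl [RHS]mxE row_mxEl [X in _ = _ + X]mxE [X in _ = _ + _ * X]mxE.
  by rewrite eq_lrshift mulr0 addr0.
rewrite row_mxEr [RHS]mxE row_mxEr [X in _ = _ + X]mxE [X in _ = _ + _ * X]mxE.
by rewrite (inj_eq (@rshift_inj _ _)) mulr1 !mxE.
Qed.

Lemma row_mxl_line q (i : 'I_d) (x : E) t :
  row_mx (x + t *: ej R i) q = row_mx x q + (t * 1) *: ej R (lshift d i) :> E2.
Proof.
apply/rowP => k; rewrite -(fintype.splitK k); case: (fintype.split k) => l /=.
  rewrite row_mxEl [RHS]mxE row_mxEl [X in _ = _ + X]mxE [X in _ = _ + _ * X]mxE.
  by rewrite (inj_eq (@lshift_inj _ _)) mulr1 !mxE.
rewrite row_mxEr [RHS]mxE row_mxEr [X in _ = _ + X]mxE [X in _ = _ + _ * X]mxE.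
by rewrite eq_rlshift mulr0 addr0.
Qed.

Lemma smooth_section b q : smooth b ->
  smooth (fun y : E => b (row_mx q y)) /\
  forall s : seq 'I_d, cpartials s (fun y : E => b (row_mx q y)) =
    fun y => cpartials (map (@rshift d d) s) b (row_mx q y).
Proof.
move=> sb.
have [h1 h2] := smooth_rescale (row_mxr_line q) (@continuous_row_mxr q) sb.
by split=> // s; rewrite h2; apply/funext => y; rewrite expr1n mul1r.
Qed.

Lemma dbound_section b q N B : smooth b -> 0 <= B -> dbound N (fun z => B * weight z) b ->
  dbound N (fun y => B * weight y) (fun y : E => b (row_mx q y)).
Proof.
move=> sb B0 bB s sN y; rewrite (smooth_section q sb).2.
apply: (le_trans (bB _ _ _)); first by rewrite size_map.
by rewrite weight_row_mx; apply: ler_wpM2l => //; rewrite ler_piMl ?weight_ge0 ?weight_le1.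
Qed.

(** Fourier transform of the symbol in the momentum variable alone. Up to scaling it is the kernel
    of the Weyl operator in the variables midpoint and difference, see [kern_symb_ft]. *)
Definition symb_ft b q s : R[i] :=
  cintegral (fun eta : E => expi (- dotv s eta) * b (row_mx q eta)).

Lemma symb_ftE b q s : symb_ft b q s = fourier (fun eta => b (row_mx q eta)) (- s).
Proof. by apply: cintegral_eq => eta; rewrite dotvNr dotvC. Qed.

Lemma symb_ft_decay N b B q s : smooth b -> 0 <= B ->
  dbound N.+1 (fun z => B * weight z) b ->
  modulus (symb_ft b q s) <= B * (weight_mass R d * d.+1%:R ^+ N) * japanese s ^- N.
Proof.
move=> sb B0 bB; rewrite symb_ftE -[japanese s]japaneseN.
by apply: fourier_decay; [case: (smooth_section q sb)|exact: dbound_section].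
Qed.

Lemma cmeasurable_symb_ft d' (T : measurableType d') b (Q S : T -> E) : cmeasurable b ->
  measurable_fun [set: T] Q -> measurable_fun [set: T] S ->
  cmeasurable (fun t => symb_ft b (Q t) (S t)).
Proof.
move=> mb mQ mS; apply: cmeasurable_cintegral; apply: cmeasurableM.
  apply: cmeasurable_expi; apply: measurable_funN; apply: measurable_dotv => //.
  exact: (measurableT_comp mS measurable_fst).
apply: (cmeasurable_comp mb); apply: measurable_row_mx => //.
exact: (measurableT_comp mQ measurable_fst).
Qed.

Definition dpos (s : seq 'I_d) b := cpartials (map (@lshift d d) s) b.

Lemma dpos_cons j (s : seq 'I_d) b : dpos (j :: s) b = dpos [:: j] (dpos s b).
Proof. by rewrite /dpos -cpartials_cat. Qed.

Lemma smooth_dpos (s : seq 'I_d) b : smooth b -> smooth (dpos s b).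
Proof. exact: smooth_cpartials. Qed.

Lemma dbound_dpos N (s : seq 'I_d) b (A : E2 -> R) : dbound (N + size s) A b -> dbound N A (dpos s b).
Proof.
move=> bA t tN z; rewrite /dpos -cpartials_cat; apply: bA.
by rewrite size_cat size_map leq_add2r.
Qed.

Lemma cderive_symb_ft b B s j : smooth b -> 0 <= B -> dbound 2 (fun z => B * weight z) b ->
  cderive j (symb_ft b ^~ s) (symb_ft (dpos [:: j] b) ^~ s).
Proof.
move=> sb B0 bB.
have dsec c t (eta : E) : smooth c -> cderive j (fun x => expi (- dotv t eta) * c (row_mx x eta))
    (fun x => expi (- dotv t eta) * dpos [:: j] c (row_mx x eta)).
  move=> sc; apply: cderiveZ.
  have dc := smooth_cderive sc [::] (lshift d j); rewrite cpartials_nil in dc.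
  have := cderive_rescale (row_mxl_line eta j) dc.
  by congr cderive; apply/funext => x; rewrite mul1r.
have wsec c x : smooth c -> (forall z, modulus (c z) <= B * weight z) ->
    weighted (fun eta : E => expi (- dotv s eta) * c (row_mx x eta)).
  move=> sc cB; have sc' := (smooth_section x sc).1.
  have wc : weighted (fun eta : E => c (row_mx x eta)).
    split; first exact: smooth_cmeasurable.
    exists B => eta; apply: (le_trans (cB _)); rewrite weight_row_mx.
    by apply: ler_wpM2l => //; rewrite ler_piMl ?weight_ge0 ?weight_le1.
  have := weighted_expi (- s) wc; congr weighted; apply/funext => eta.
  by rewrite dotvNr dotvC.
have sb1 : smooth (dpos [:: j] b) by exact: smooth_dpos.
apply: (@cderive_cintegral R d d j _ _
  (fun x eta => expi (- dotv s eta) * dpos [:: j] (dpos [:: j] b) (row_mx x eta)) B).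
- by move=> eta; exact: dsec.
- by move=> eta; exact: dsec.
- by move=> x; apply: wsec => // z; exact: dbound0 bB.
- by move=> x; apply: wsec => // z; exact: (bB [:: lshift d j]).
- move=> x eta; rewrite modulusM modulus_expi mul1r -dpos_cons.
  apply: (le_trans (bB [:: lshift d j; lshift d j] isT _)); rewrite weight_row_mx.
  by apply: ler_wpM2l => //; rewrite ler_piMl ?weight_ge0 ?weight_le1.
Qed.

End partial_fourier.

(** * The Weyl operator after rescaling *)

Section weyl_operator.
Variables (R : realType) (d : nat).
Local Notation E := 'rV[R]_d.
Local Notation E2 := 'rV[R]_(d + d).
Implicit Types (b : E2 -> R[i]) (psi : E -> R[i]) (q s x : E) (h : R).

(* [wop b h w1 w2] is the Weyl operator with symbol [z |-> b (h z + w)], up to a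
   constant factor: the substitutions [y = x + h s], [eta = h xi + w2] leave an
   absolutely convergent integral, which makes sense even at [h = 0]. *)
Definition wint b h (w1 w2 : E) psi x s : R[i] :=
  symb_ft b ((h ^+ 2 / 2) *: s + w1 + h *: x) s * expi (dotv s w2) * psi (x + h *: s).

Definition wop b h (w1 w2 : E) psi x : R[i] := cintegral (wint b h w1 w2 psi x).

Lemma cmeasurable_wint b h w1 w2 psi x : cmeasurable b -> cmeasurable psi ->
  cmeasurable (wint b h w1 w2 psi x).
Proof.
move=> mb mpsi; apply: cmeasurableM; last first.
  by apply: (cmeasurable_comp mpsi); exact: measurable_affine_rV.
apply: cmeasurableM; last exact: cmeasurable_expi_dotv.
apply: cmeasurable_symb_ft => //; apply: measurable_rVD => //.
by apply: measurable_rVD => //; exact: measurable_rVZ.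
Qed.

Lemma japanese_shift_scale x s h : 0 <= h <= 1 ->
  japanese x <= 2 * (japanese (x + h *: s) * japanese s).
Proof.
move=> /andP[h0 h1]; rewrite -{1}(addrK (h *: s) x).
apply: (le_trans (japaneseD _ _)); apply: ler_wpM2l => //.
apply: ler_wpM2l; first exact: japanese_ge0.
by rewrite japaneseN japanese_scale// ger0_norm.
Qed.

(* Peetre's inequality trades decay in [x] for decay in the symbol. *)
Lemma wint_bound (k : nat) : exists2 C, 0 <= C & forall b B psi A h w1 w2 x s,
  smooth b -> 0 <= B -> dbound (2 * d + k).+1 (fun z => B * weight z) b -> 0 <= h <= 1 ->
  modulus (psi (x + h *: s)) <= A * japanese (x + h *: s) ^- k ->
  modulus (wint b h w1 w2 psi x s) <= C * B * A * japanese x ^- k * weight s.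
Proof.
pose C0 := weight_mass R d * d.+1%:R ^+ (2 * d + k).
have C00 : 0 <= C0.
  by apply: mulr_ge0; [exact/ltW/weight_mass_gt0|exact: exprn_ge0].
exists (C0 * 2 ^+ k); first by rewrite mulr_ge0 ?exprn_ge0.
move=> b B psi A h w1 w2 x s sb B0 bB h01 psiA.
rewrite /wint !modulusM modulus_expi mulr1.
have h1 := symb_ft_decay ((h ^+ 2 / 2) *: s + w1 + h *: x) s sb B0 bB.
apply: (le_trans (ler_pM (modulus_ge0 _) (modulus_ge0 _) h1 psiA)).
have A0 : 0 <= A.
  by have := le_trans (modulus_ge0 _) psiA; rewrite pmulr_lge0// invr_gt0 japaneseX_gt0.
set y := x + h *: s.
have hx : japanese s ^- k * japanese y ^- k <= 2 ^+ k * japanese x ^- k.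
  rewrite -invfM ler_pdivlMr ?japaneseX_gt0// mulrC ler_pdivrMr; last first.
    by rewrite mulr_gt0 ?japaneseX_gt0.
  rewrite [japanese s ^+ k * _]mulrC -!exprMn.
  apply: lerXn2r; rewrite ?nnegrE ?mulr_ge0 ?japanese_ge0//.
  exact: japanese_shift_scale.
rewrite -/C0 exprD invfM.
rewrite (_ : _ * (A * _) = B * C0 * A * (japanese s ^- k * japanese y ^- k * japanese s ^- (2 * d))); last by ring.
rewrite (_ : C0 * 2 ^+ k * B * A * _ * _ = B * C0 * A * (2 ^+ k * japanese x ^- k * weight s)); last by ring.
apply: ler_wpM2l; first by apply: mulr_ge0 => //; exact: mulr_ge0.
apply: ler_pM => //; last exact: japanese_weight.
- by rewrite mulr_ge0// invr_ge0 exprn_ge0// japanese_ge0.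
- by rewrite invr_ge0 exprn_ge0// japanese_ge0.
Qed.

Definition symbol b := smooth b /\ exists rho, supported rho b.

Lemma symbol_dbound b N : symbol b ->
  exists2 B, 0 <= B & dbound N (fun z => B * weight z) b.
Proof. by move=> [sb [rho rb]]; exact: supported_dbound_weight rb. Qed.

Lemma symbol_dpos b (s : seq 'I_d) : symbol b -> symbol (dpos s b).
Proof.
move=> [sb [rho rb]]; split; first exact: smooth_dpos.
by exists rho; exact: supported_cpartials.
Qed.

Lemma wint_weighted b h w1 w2 psi : symbol b -> 0 <= h <= 1 -> schwartz psi ->
  exists C, forall x s, modulus (wint b h w1 w2 psi x s) <= C * weight s.
Proof.
move=> yb h01 spsi; have [B B0 bB] := symbol_dbound (2 * d + 0).+1 yb.
have [A A0 HA] := schwartz_dbound 0 0 spsi.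
have [C C0 HC] := wint_bound 0.
exists (C * B * A) => x s.
have := HC b B psi A h w1 w2 x s yb.1 B0 bB h01 (dbound0 _ HA).
by rewrite expr0 invr1 mulr1.
Qed.

Lemma weighted_wint b h w1 w2 psi x : symbol b -> 0 <= h <= 1 -> schwartz psi ->
  weighted (wint b h w1 w2 psi x).
Proof.
move=> yb h01 spsi; split; last first.
  by have [C HC] := wint_weighted w1 w2 yb h01 spsi; exists C.
by apply: cmeasurable_wint; apply: smooth_cmeasurable; [case: yb|exact: schwartz_smooth].
Qed.

Lemma schwartz_cpartials psi t : schwartz psi -> schwartz (cpartials t psi).
Proof.
move=> spsi; have sp := schwartz_smooth spsi.
apply/schwartzP; split; first exact: smooth_cpartials.
move=> N k; have [C _ HC] := schwartz_dbound (N + size t) k spsi.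
exists C => s sN x; rewrite -cpartials_cat; apply: HC.
by rewrite size_cat leq_add2r.
Qed.

(** A derivative that falls on the symbol brings a factor [h], one that falls on [psi] brings none;
    this is the slow variation of the symbol. *)
Lemma cderive_wint b h w1 w2 psi s j : symbol b -> smooth psi ->
  cderive j (fun x => wint b h w1 w2 psi x s)
    (fun x => h%:C * wint (dpos [:: j] b) h w1 w2 psi x s +
      wint b h w1 w2 (cpartials [:: j] psi) x s).
Proof.
move=> yb spsi; have [B B0 bB] := symbol_dbound 2 yb.
have d1 := cderive_symb_ft s j yb.1 B0 bB.
have d2 := smooth_cderive spsi [::] j; rewrite cpartials_nil in d2.
have HA1 x t : (h ^+ 2 / 2) *: s + w1 + h *: (x + t *: ej R j) =
    (h ^+ 2 / 2) *: s + w1 + h *: x + (t * h) *: ej R j.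
  by rewrite scalerDr addrA scalerA [h * t]mulrC.
have HA2 x t : (x + t *: ej R j) + h *: s = (x + h *: s) + (t * 1) *: ej R j.
  by rewrite mulr1 addrAC.
have e1 := cderive_rescale HA1 d1; have e2 := cderive_rescale HA2 d2.
have := cderiveM (cderiveM e1 (cderive_cst j (expi (dotv s w2)))) e2.
by congr cderive; apply/funext => x; rewrite /wint; ring.
Qed.

Lemma cderive_wop b h w1 w2 psi j : symbol b -> 0 <= h <= 1 -> schwartz psi ->
  cderive j (wop b h w1 w2 psi)
    (fun x => h%:C * wop (dpos [:: j] b) h w1 w2 psi x +
      wop b h w1 w2 (cpartials [:: j] psi) x).
Proof.
move=> yb h01 spsi; have sp := schwartz_smooth spsi.
have yb1 : symbol (dpos [:: j] b) by exact: symbol_dpos.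
have yb2 : symbol (dpos [:: j] (dpos [:: j] b)) by exact: symbol_dpos.
have sp1 : schwartz (cpartials [:: j] psi) by exact: schwartz_cpartials.
have sp2 : schwartz (cpartials [:: j] (cpartials [:: j] psi)) by exact: schwartz_cpartials.
have w := fun c (yc : symbol c) f (sf : schwartz f) x => weighted_wint w1 w2 x yc h01 sf.
have [C1 HC1] := wint_weighted w1 w2 yb2 h01 spsi.
have [C2 HC2] := wint_weighted w1 w2 yb1 h01 sp1.
have [C3 HC3] := wint_weighted w1 w2 yb h01 sp2.
pose G' x s := h%:C * wint (dpos [:: j] b) h w1 w2 psi x s +
      wint b h w1 w2 (cpartials [:: j] psi) x s.
rewrite (_ : (fun x => _ + _) = fun x => cintegral (G' x)); last first.
  apply/funext => x; rewrite /G' cintegralD; last 2 first.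
  - by apply: weightedZ; exact: w.
  - exact: w.
  by rewrite (cintegralZ _ (w _ yb1 _ spsi x)).
pose G'' x s := h%:C * (h%:C * wint (dpos [:: j] (dpos [:: j] b)) h w1 w2 psi x s +
      wint (dpos [:: j] b) h w1 w2 (cpartials [:: j] psi) x s) +
      (h%:C * wint (dpos [:: j] b) h w1 w2 (cpartials [:: j] psi) x s +
      wint b h w1 w2 (cpartials [:: j] (cpartials [:: j] psi)) x s).
apply: (@cderive_cintegral R d d j _ _ G'' (C1 + C2 + (C2 + C3))).
- by move=> s; exact: cderive_wint.
- move=> s; apply: cderiveD; last exact: cderive_wint (smooth_cpartials _ sp).
  by apply: cderiveZ; exact: cderive_wint.
- by move=> x; exact: w.
- by move=> x; apply: weightedD; [apply: weightedZ|]; exact: w.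
- have hm z : modulus (h%:C * z) <= modulus z.
    move: h01 => /andP[h0 h1].
    by rewrite modulusM modulus_real ger0_norm// ler_piMl ?modulus_ge0.
  move=> x s; rewrite !mulrDl /G''.
  apply: (le_trans (modulusD _ _)); apply: lerD.
    apply: (le_trans (hm _)); apply: (le_trans (modulusD _ _)); apply: lerD => //.
    exact: le_trans (hm _) _.
  apply: (le_trans (modulusD _ _)); apply: lerD => //.
  exact: le_trans (hm _) _.
Qed.

Lemma wop_bounded b h w1 w2 psi : symbol b -> 0 <= h <= 1 -> schwartz psi ->
  exists M, forall x, modulus (wop b h w1 w2 psi x) <= M.
Proof.
move=> yb h01 spsi; have [C HC] := wint_weighted w1 w2 yb h01 spsi.
exists (C * weight_mass R d) => x; apply: cintegral_le => //.
by have [] := weighted_wint w1 w2 x yb h01 spsi.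
Qed.

Lemma wop_cpartials b h w1 w2 psi : symbol b -> 0 <= h <= 1 -> schwartz psi ->
  smooth (wop b h w1 w2 psi) /\ forall t, cpartials t (wop b h w1 w2 psi) =
  fun x => \sum_(p <- splits t)
    (h ^+ size p.1)%:C * wop (dpos p.1 b) h w1 w2 (cpartials p.2 psi) x.
Proof.
move=> yb h01 spsi.
pose D t x := \sum_(p <- splits t)
    (h ^+ size p.1)%:C * wop (dpos p.1 b) h w1 w2 (cpartials p.2 psi) x.
have D0 : D [::] = wop b h w1 w2 psi.
  by apply/funext => x; rewrite /D /= big_seq1 /= expr0 mul1r /dpos /= !cpartials_nil.
have dD t j : cderive j (D t) (D (j :: t)).
  have -> : D (j :: t) = fun x => \sum_(p <- splits t)
      (h ^+ size p.1)%:C * (h%:C * wop (dpos [:: j] (dpos p.1 b)) h w1 w2 (cpartials p.2 psi) x +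
       wop (dpos p.1 b) h w1 w2 (cpartials [:: j] (cpartials p.2 psi)) x).
    apply/funext => x; rewrite /D /= big_cat !big_map /=.
    under [RHS]eq_bigr do rewrite mulrDr.
    rewrite big_split /=; congr (_ + _); apply: eq_bigr => p _.
    by rewrite -dpos_cons exprSr real_complexM mulrA.
  apply: cderive_sum => p; apply: cderiveZ; apply: cderive_wop => //.
    exact: symbol_dpos.
  exact: schwartz_cpartials.
rewrite -D0; apply: smooth_family => // t.
have bD t' : exists M, forall x, modulus (D t' x) <= M.
  rewrite /D; elim: (splits t') => [|p r [M HM]].
    by exists 0 => x; rewrite big_nil modulus0.
  have [M' HM'] := wop_bounded w1 w2 (symbol_dpos p.1 yb) h01 (schwartz_cpartials p.2 spsi).
  exists (`|h ^+ size p.1| * M' + M) => x; rewrite big_cons.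
  rewrite (le_trans (modulusD _ _))// lerD// modulusM modulus_real.
  by apply: ler_wpM2l.
have /choice [M HM] : forall j, exists M, forall x, modulus (D (j :: t) x) <= M.
  by move=> j; exact: bD.
have M0 j : 0 <= M j := le_trans (modulus_ge0 _) (HM j 0).
apply: (bounded_cderive_continuous (dD t) (M := \sum_j M j)) => j p.
by rewrite (le_trans (HM j p))// (bigD1 j)//= lerDl sumr_ge0.
Qed.

End weyl_operator.

(** * Seminorm bounds and the principal part of the Weyl operator *)

Section weyl_estimates.
Variables (R : realType) (d : nat).
Local Notation E := 'rV[R]_d.
Local Notation E2 := 'rV[R]_(d + d).
Implicit Types (b : E2 -> R[i]) (psi : E -> R[i]) (q s x : E) (h : R).

Lemma wop_bound (k : nat) : exists2 C, 0 <= C & forall b B psi A h (w1 w2 : E) x,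
  smooth b -> 0 <= B -> dbound (2 * d + k).+1 (fun z => B * weight z) b -> 0 <= h <= 1 ->
  cmeasurable psi -> (forall y, modulus (psi y) <= A * japanese y ^- k) ->
  modulus (wop b h w1 w2 psi x) <= C * B * A * japanese x ^- k.
Proof.
have [C C0 HC] := wint_bound R d k.
exists (C * weight_mass R d); first by apply: mulr_ge0 => //; exact/ltW/weight_mass_gt0.
move=> b B psi A h w1 w2 x sb B0 bB h01 mpsi psiA.
have -> : C * weight_mass R d * B * A * japanese x ^- k =
  (C * B * A * japanese x ^- k) * weight_mass R d by ring.
apply: cintegral_le; first by apply: cmeasurable_wint => //; exact: smooth_cmeasurable.
by move=> s; exact: HC.
Qed.

(** In the Leibniz rule for [wop], exactly one term gives all derivations to [psi]; it is the only
    one without a power of [h]. *)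
Lemma splits_nil (T : zmodType) (t : seq 'I_d) (F : seq 'I_d * seq 'I_d -> T) :
  \sum_(p <- splits t | p.1 == [::]) F p = F ([::], t).
Proof.
elim: t F => [|j t IH] F /=; first by rewrite big_cons big_nil addr0.
rewrite big_cat !big_map /= big_pred0_eq add0r.
exact: (IH (fun p => F (p.1, j :: p.2))).
Qed.

Lemma expr_le_nonneg h m : 0 <= h <= 1 -> `|h ^+ m| <= 1.
Proof. by move=> /andP[h0 h1]; rewrite ger0_norm ?exprn_ge0// exprn_ile1. Qed.

Lemma wop_dbound N k b : symbol b -> exists2 C, 0 <= C &
  forall h (w1 w2 : E) psi A, 0 <= h <= 1 -> schwartz psi ->
  dbound N (fun x => A * japanese x ^- k) psi ->
  dbound N (fun x => C * A * japanese x ^- k) (wop b h w1 w2 psi).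
Proof.
move=> yb; have [B B0 bB] := symbol_dbound ((2 * d + k).+1 + N) yb.
have [C C0 HC] := wop_bound k.
exists (2 ^+ N * (C * B)); first by rewrite !mulr_ge0// exprn_ge0.
move=> h w1 w2 psi A h01 spsi psiA t tN x.
rewrite (wop_cpartials w1 w2 yb h01 spsi).2 (le_trans (modulus_sum _ _ _))//.
have A0 : 0 <= A.
  by have := dbound_ge0 x psiA; rewrite pmulr_lge0// invr_gt0 japaneseX_gt0.
have X0 : 0 <= C * B * A * japanese x ^- k.
  by rewrite !mulr_ge0// invr_ge0 exprn_ge0// japanese_ge0.
apply: (@le_trans _ _ (\sum_(p <- splits t) (C * B * A * japanese x ^- k))).
  rewrite big_seq [leRHS]big_seq; apply: ler_sum => p /splits_size [h1 h2].
  rewrite modulusM modulus_real -[leRHS]mul1r.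
  apply: ler_pM; rewrite ?modulus_ge0// ?expr_le_nonneg//.
  apply: HC => //.
  - exact: smooth_dpos yb.1.
  - by apply: dbound_dpos; apply: dbound_leq bB; rewrite leq_add2l (leq_trans h1).
  - exact: smooth_measurable (schwartz_smooth spsi).
  - by move=> y; apply: psiA; exact: leq_trans h2 tN.
rewrite big_const_seq count_predT size_splits iter_addr_0 -[leLHS]mulr_natl natrX.
rewrite -!mulrA; apply: ler_wpM2r; first by rewrite !mulrA.
by rewrite ler_weXn2l// ler1n.
Qed.

Lemma wop_schwartz b h (w1 w2 : E) psi : symbol b -> 0 <= h <= 1 -> schwartz psi ->
  schwartz (wop b h w1 w2 psi).
Proof.
move=> yb h01 spsi; apply/schwartzP; split; first by case: (wop_cpartials w1 w2 yb h01 spsi).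
move=> N k; have [C C0 HC] := wop_dbound N k yb.
have [A A0 HA] := schwartz_dbound N k spsi.
by exists (C * A); exact: HC.
Qed.

Lemma nice_section b q : symbol b -> nice (fun eta : E => b (row_mx q eta)).
Proof.
move=> yb; split; first by case: (smooth_section q yb.1).
by have [B B0 bB] := symbol_dbound (2 * d).+2 yb; exists B; exact: dbound_section yb.1 B0 bB.
Qed.

Lemma weighted_symb_ft b q : symbol b -> weighted (symb_ft b q).
Proof.
move=> yb; have n1 : (-1 : R) != 0 by rewrite oppr_eq0 oner_neq0.
have := weighted_affine 0 n1 (weighted_fourier (nice_section q yb)).
by congr weighted; apply/funext => s; rewrite symb_ftE add0r scaleN1r.
Qed.

Section error.
Variable K : R[i].
Hypothesis HK : forall (f : E -> R[i]) x, nice f ->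
  cintegral (fun s => fourier f s * expi (- dotv x s)) = K * f x.

(** At [h = 0] the integrand of [wop] is the one on the left times [psi x], so the operator becomes
    multiplication by [K] times the symbol at the base point. *)
Lemma symb_ft_inversion b q (w : E) : symbol b ->
  cintegral (fun s => symb_ft b q s * expi (dotv s w)) = K * b (row_mx q w).
Proof.
move=> yb; have nb := nice_section q yb.
rewrite -(HK w nb).
have wf : weighted (fun s => fourier (fun eta : E => b (row_mx q eta)) s * expi (- dotv w s)).
  have := weighted_expi (- w) (weighted_fourier nb).
  by congr weighted; apply/funext => s; rewrite dotvNr dotvC mulrC.
have n1 : (-1 : R) != 0 by rewrite oppr_eq0 oner_neq0.
have := cintegral_affine 0 n1 wf; rewrite normrN1 expr1n invr1 mul1r => <-.
apply: cintegral_eq => s.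
by rewrite add0r scaleN1r symb_ftE dotvNr opprK [dotv w s]dotvC.
Qed.

(** Peetre's inequality for the points met by [lipschitz_path]. *)
Lemma japaneseVX_path k x (p v : E) : (forall i, `|p ord0 i - x ord0 i| <= `|v ord0 i|) ->
  japanese p ^- k <= 2 ^+ k * japanese v ^+ k * japanese x ^- k.
Proof.
move=> px; rewrite ler_pdivlMr ?japaneseX_gt0// mulrC ler_pdivrMr ?japaneseX_gt0//.
rewrite -!exprMn; apply: lerXn2r; rewrite ?nnegrE ?mulr_ge0 ?japanese_ge0//.
have h : japanese (x - p) <= 1 * japanese v.
  by apply: japanese_entrywise => // i; rewrite !mxE mul1r distrC.
rewrite mul1r in h.
rewrite -{1}(subrK p x) addrC; apply: (le_trans (japaneseD _ _)).
rewrite -mulrA [japanese v * _]mulrC.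
by apply: ler_wpM2l => //; apply: ler_wpM2l => //; exact: japanese_ge0.
Qed.

(** The integrand is compared with its value at [h = 0]. Both the symbol and [psi] move by [O(h)];
    the position in the symbol moves by [h *: (x + (h / 2) *: s)], which grows with [x], hence the
    loss of one power of decay. *)
Lemma wop_error0 (k : nat) : exists2 C, 0 <= C & forall b B psi A h (w1 w2 : E) x,
  symbol b -> 0 <= B -> dbound (2 * d + k + 4) (fun z => B * weight z) b -> 0 <= h <= 1 ->
  schwartz psi -> dbound 1 (fun y => A * japanese y ^- k.+1) psi ->
  modulus (- (K * b (row_mx w1 w2)) * psi x + wop b h w1 w2 psi x) <=
    h * (C * B * A * japanese x ^- k).
Proof.
(* Powers of [japanese s] to be absorbed: [2 * d] for integrability, [k + 1] for moving the decay of
   [psi] back to [x], and 1 for the displacement of the symbol. *)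
pose N := (2 * d + k + 2)%N.
pose c := weight_mass R d * d.+1%:R ^+ N.
have c0 : 0 <= c by apply: mulr_ge0; [exact/ltW/weight_mass_gt0|exact: exprn_ge0].
pose C1 : R := 4 * d%:R * 2 ^+ k.+1 * c; pose C2 : R := 2 * d%:R * 2 ^+ k * c.
have C10 : 0 <= C1.
  exact: mulr_ge0.
have C20 : 0 <= C2.
  exact: mulr_ge0.
exists ((C1 + C2) * weight_mass R d).
  by apply: mulr_ge0; [exact: addr_ge0|exact/ltW/weight_mass_gt0].
move=> b B psi A h w1 w2 x yb B0 bB h01 spsi psiA.
have [h0 h1] := andP h01.
have A0 : 0 <= A.
  by have := dbound_ge0 x psiA; rewrite pmulr_lge0// invr_gt0 japaneseX_gt0.
pose X s := symb_ft b ((h ^+ 2 / 2) *: s + w1 + h *: x) s.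
pose Y s := symb_ft b w1 s.
have wX : weighted (wint b h w1 w2 psi x) by exact: weighted_wint.
have wY : weighted (fun s => Y s * expi (dotv s w2)).
  have := weighted_expi w2 (weighted_symb_ft w1 yb).
  by congr weighted; apply/funext => s; rewrite mulrC.
have -> : - (K * b (row_mx w1 w2)) * psi x + wop b h w1 w2 psi x =
    cintegral (fun s => wint b h w1 w2 psi x s - Y s * expi (dotv s w2) * psi x).
  rewrite cintegralB//; last first.
    by have := weightedZ (psi x) wY; congr weighted; apply/funext => s; rewrite mulrC.
  by rewrite cintegralZr// symb_ft_inversion// mulNr addrC.
rewrite (_ : h * _ = (h * ((C1 + C2) * B * A * japanese x ^- k)) * weight_mass R d); last by ring.
apply: cintegral_le.
  have w : weighted (fun s => Y s * expi (dotv s w2) * psi x).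
    by have := weightedZ (psi x) wY; congr weighted; apply/funext => s; rewrite mulrC.
  by have [] := weightedB wX w.
move=> s; set y := x + h *: s.
have -> : wint b h w1 w2 psi x s - Y s * expi (dotv s w2) * psi x =
    expi (dotv s w2) * ((X s - Y s) * psi y + Y s * (psi y - psi x)).
  by rewrite /wint -/(X s) -/y; ring.
rewrite modulusM modulus_expi mul1r.
apply: (le_trans (modulusD _ _)); rewrite !modulusM.
have js : 0 < japanese s ^- N by rewrite invr_gt0 japaneseX_gt0.
have bN : dbound N.+1 (fun z => B * weight z) b.
  by apply: dbound_leq bB; rewrite /N -addn1 -addnA leq_add2l.
have HY : modulus (Y s) <= B * c * japanese s ^- N by exact: symb_ft_decay yb.1 B0 bN.
have d2 : dbound 2 (fun z => B * weight z) b.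
  by apply: dbound_leq bB; rewrite addnC.
pose v := h *: (x + (h / 2) *: s).
have qE : (h ^+ 2 / 2) *: s + w1 + h *: x = w1 + v.
  rewrite /v scalerDr scalerA mulrA -expr2 addrA [in RHS]addrAC.
  by congr (_ + _); rewrite addrC.
have HXY : modulus (X s - Y s) <= 2 * (B * c * japanese s ^- N) * \sum_i `|v ord0 i|.
  rewrite /X qE; apply: (lipschitz_path (f := symb_ft b ^~ s)
    (fun j => cderive_symb_ft s j yb.1 B0 d2)) => j p _.
  apply: symb_ft_decay => //; first exact: smooth_dpos yb.1.
  by apply: dbound_dpos; apply: dbound_leq bB; rewrite /N /= addn1 -addn2 -addnA.
have Hv : \sum_i `|v ord0 i| <= h * (d%:R * (2 * (japanese x * japanese s))).
  rewrite (_ : \sum_i _ = h * \sum_i `|(x + (h / 2) *: s) ord0 i|); last first.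
    by rewrite mulr_sumr; apply: eq_bigr => i _; rewrite mxE normrM ger0_norm.
  apply: ler_wpM2l => //; apply: (le_trans (sum_entries_le _)); apply: ler_wpM2l => //.
  apply: (le_trans (japaneseD _ _)); apply: ler_wpM2l => //.
  apply: ler_wpM2l; first exact: japanese_ge0.
  by apply: japanese_scale; rewrite ger0_norm ?divr_ge0//; lra.
have yxs i : `|y ord0 i - x ord0 i| <= `|s ord0 i|.
  rewrite !mxE addrC addKr normrM ger0_norm//.
  by rewrite ler_piMl.
have Hpsi : modulus (psi y) <= A * (2 ^+ k.+1 * japanese s ^+ k.+1 * japanese x ^- k.+1).
  apply: (le_trans (dbound0 y psiA)); apply: ler_wpM2l => //.
  exact: japaneseVX_path yxs.
have Hdpsi : modulus (psi y - psi x) <=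
    2 * (A * (2 ^+ k * japanese s ^+ k * japanese x ^- k)) * \sum_i `|(h *: s) ord0 i|.
  apply: (lipschitz_path (f' := fun j => cpartials [:: j] psi)).
    by move=> j; have := smooth_cderive (schwartz_smooth spsi) [::] j; rewrite cpartials_nil.
  move=> j p px; apply: (le_trans (psiA [:: j] isT p)).
  apply: ler_wpM2l => //; apply: (le_trans (japaneseVX_le p (leqnSn k))).
  apply: japaneseVX_path => i; apply: (le_trans (px i)).
  by rewrite mxE normrM ger0_norm// ler_piMl.
have Hs : \sum_i `|(h *: s) ord0 i| <= h * (d%:R * japanese s).
  rewrite (_ : \sum_i _ = h * \sum_i `|s ord0 i|); last first.
    by rewrite mulr_sumr; apply: eq_bigr => i _; rewrite mxE normrM ger0_norm.
  by apply: ler_wpM2l => //; exact: sum_entries_le.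
have jx0 := japaneseX_gt0 x; have js0 := japaneseX_gt0 s.
have jx1 := japanese_gt0 x; have js1 := japanese_gt0 s.
have BcN0 : 0 <= B * c * japanese s ^- N by rewrite mulr_ge0 ?(ltW js)// mulr_ge0.
have wts : japanese s ^- (2 * d) <= weight s := japanese_weight s.
have P0 (Z : R) : 0 <= Z -> 0 <= h * (Z * B * A * japanese x ^- k).
  move=> Z0; apply: mulr_ge0 => //; apply: mulr_ge0; last by rewrite invr_ge0 ltW.
  by apply: mulr_ge0 => //; exact: mulr_ge0.
have T1 : modulus (X s - Y s) * modulus (psi y) <=
    h * (C1 * B * A * japanese x ^- k) * weight s.
  apply: (@le_trans _ _ ((2 * (B * c * japanese s ^- N) *
      (h * (d%:R * (2 * (japanese x * japanese s))))) *
      (A * (2 ^+ k.+1 * japanese s ^+ k.+1 * japanese x ^- k.+1)))).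
    apply: ler_pM; rewrite ?modulus_ge0//.
    apply: (le_trans HXY); apply: ler_wpM2l => //.
    exact: mulr_ge0.
  rewrite [leLHS](_ : _ = h * (C1 * B * A * japanese x ^- k) *
      japanese s ^- (2 * d)); last first.
        rewrite /C1 /N exprD [japanese s ^+ (2 * d + k)]exprD !invfM [japanese s ^+ k.+1]exprSr [japanese x ^+ k.+1]exprSr.
    by field; rewrite !gt_eqF.
  by apply: ler_wpM2l => //; exact: P0.
have T2 : modulus (Y s) * modulus (psi y - psi x) <=
    h * (C2 * B * A * japanese x ^- k) * weight s.
  apply: (@le_trans _ _ ((B * c * japanese s ^- N) *
      (2 * (A * (2 ^+ k * japanese s ^+ k * japanese x ^- k)) * (h * (d%:R * japanese s))))).
    apply: ler_pM; rewrite ?modulus_ge0//.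
    apply: (le_trans Hdpsi); apply: ler_wpM2l => //.
    by rewrite !mulr_ge0// ?invr_ge0 ?exprn_ge0 ?ltW.
  rewrite [leLHS](_ : _ = h * (C2 * B * A * japanese x ^- k) *
      (japanese s ^- (2 * d) * (japanese s)^-1)); last first.
    rewrite /C2 /N exprD [japanese s ^+ (2 * d + k)]exprD !invfM.
    by field; rewrite !gt_eqF.
  apply: ler_wpM2l; first exact: P0.
  apply: le_trans wts; apply: ler_piMr.
    by rewrite invr_ge0 exprn_ge0 ?japanese_ge0.
  by rewrite invf_le1// japanese_ge1.
apply: (le_trans (lerD T1 T2)).
by rewrite -mulrDl -mulrDr -!mulrDl.
Qed.

Lemma wop_error N k b : symbol b -> exists2 C, 0 <= C &
  forall h (w1 w2 : E) psi A, 0 <= h <= 1 -> schwartz psi ->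
  dbound N.+1 (fun x => A * japanese x ^- k.+1) psi ->
  dbound N (fun x => h * (C * A * japanese x ^- k))
    (fun x => - (K * b (row_mx w1 w2)) * psi x + wop b h w1 w2 psi x).
Proof.
move=> yb; have [B B0 bB] := symbol_dbound ((2 * d + k + 4) + N) yb.
have [C C0 HC] := wop_bound k; have [C' C'0 HC'] := wop_error0 k.
exists (2 ^+ N * (C * B) + C' * B).
  by rewrite addr_ge0 ?mulr_ge0// exprn_ge0.
move=> h w1 w2 psi A h01 spsi psiA t tN x.
have sp := schwartz_smooth spsi.
have [h0 h1] := andP h01.
have A0 : 0 <= A.
  by have := dbound_ge0 x psiA; rewrite pmulr_lge0// invr_gt0 japaneseX_gt0.
have [sw cw] := wop_cpartials w1 w2 yb h01 spsi.
rewrite (smooth_lincomb _ sp sw).2 cw.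
(* The term with all derivations on [psi] joins the principal part and is estimated by [wop_error0];
   every other term has at least one factor [h]. *)
rewrite (bigID (fun p => p.1 == [::])) /= splits_nil /= expr0 mul1r.
rewrite (_ : dpos [::] b = b); last by rewrite /dpos /= cpartials_nil.
rewrite addrA (le_trans (modulusD _ _))//.
have -> : h * ((2 ^+ N * (C * B) + C' * B) * A * japanese x ^- k) =
  h * (C' * B * A * japanese x ^- k) + 2 ^+ N * (h * (C * B * A * japanese x ^- k)) by ring.
apply: lerD.
  apply: HC'; [exact: yb|exact: B0| |exact: h01| | ].
  - by apply: dbound_leq bB; exact: leq_addr.
  - exact: schwartz_cpartials.
  - move=> u u1 y; rewrite -cpartials_cat; apply: psiA.
    by rewrite size_cat (leq_trans (leq_add u1 tN)).
rewrite (le_trans (modulus_sum _ _ _))//.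
have X0 : 0 <= h * (C * B * A * japanese x ^- k).
  by rewrite !mulr_ge0// invr_ge0 exprn_ge0// japanese_ge0.
apply: (@le_trans _ _ (\sum_(p <- splits t) (h * (C * B * A * japanese x ^- k)))).
  rewrite big_mkcond big_seq [leRHS]big_seq; apply: ler_sum => p /splits_size [h1' h2'].
  case: ifP => // p1.
  rewrite modulusM modulus_real; apply: ler_pM; rewrite ?modulus_ge0//.
    rewrite ger0_norm ?exprn_ge0//; case: (size p.1) (size_eq0 p.1) => [|m _].
      by rewrite eqxx (negbTE p1).
    by rewrite exprS ler_piMr// exprn_ile1.
  apply: HC => //.
  - exact: smooth_dpos yb.1.
  - apply: dbound_dpos; apply: dbound_leq bB.
    by apply: leq_add; [rewrite addnS ltnS leq_addr|exact: leq_trans h1' tN].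
  - exact: smooth_measurable sp.
  - move=> y; apply: (le_trans (psiA _ _ _)).
      by rewrite (leq_trans h2')// (leq_trans tN).
    by apply: ler_wpM2l => //; apply: japaneseVX_le.
rewrite big_const_seq count_predT size_splits iter_addr_0 -[leLHS]mulr_natl natrX.
apply: ler_wpM2r => //; by rewrite ler_weXn2l// ler1n.
Qed.

End error.

End weyl_estimates.

(** * Kernels and time-frequency covariance *)

Section weyl_kernel.
Variables (R : realType) (d : nat).
Local Notation E := 'rV[R]_d.
Local Notation E2 := 'rV[R]_(d + d).
Implicit Types (b : E2 -> R[i]) (psi : E -> R[i]) (h : R).

Definition kern b h (x y : E) : R[i] :=
  cintegral (fun xi : E => expi (dotv (x - y) xi) * b (h *: row_mx (2^-1 *: (x + y)) xi)).

Lemma symbol_bound b : symbol b -> exists2 B, 0 <= B & forall z, modulus (b z) <= B * weight z.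
Proof.
move=> yb; have [B B0 bB] := symbol_dbound 0 yb.
by exists B => // z; exact: dbound0 bB.
Qed.

Lemma symbol_dilation_bound b h : symbol b -> h != 0 ->
  exists2 B, 0 <= B & forall (q xi : E), modulus (b (h *: row_mx q xi)) <= B * weight xi.
Proof.
move=> yb h0; have [B B0 bB] := symbol_bound yb.
have [K K0 HK] := weighted_shift_bound (0 : E) h0.
exists (B * K); first by rewrite mulr_ge0// ltW.
move=> q xi; apply: (le_trans (bB _)); rewrite scale_row_mx weight_row_mx -mulrA.
apply: ler_wpM2l => //.
apply: (@le_trans _ _ (1 * weight (h *: xi))).
  by apply: ler_wpM2r; [exact: weight_ge0|exact: weight_le1].
by rewrite mul1r; have := HK xi; rewrite add0r.
Qed.

Lemma cmeasurable_kern_integrand d' (T : measurableType d') b h (X Y XI : T -> E) :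
  cmeasurable b -> measurable_fun [set: T] X -> measurable_fun [set: T] Y ->
  measurable_fun [set: T] XI ->
  cmeasurable (fun t => expi (dotv (X t - Y t) (XI t)) *
    b (h *: row_mx (2^-1 *: (X t + Y t)) (XI t))).
Proof.
move=> mb mX mY mXI; apply: cmeasurableM.
  by apply: cmeasurable_expi; apply: measurable_dotv => //; exact: measurable_rVB.
apply: (cmeasurable_comp mb); apply: measurable_rVZ; apply: measurable_row_mx => //.
by apply: measurable_rVZ; exact: measurable_rVD.
Qed.

Lemma symbol_cmeasurable b : symbol b -> cmeasurable b.
Proof. by move=> [sb _]; exact: smooth_cmeasurable. Qed.

Lemma weyl_kernel b h psi : symbol b -> h != 0 -> schwartz psi ->
  weyl (dilation h b) psi =
  fun x => ((2 * pi) ^- d)%:C * cintegral (fun y => kern b h x y * psi y).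
Proof.
move=> yb h0 spsi; apply/funext => x; rewrite /weyl; congr (_ * _).
have [B B0 HB] := symbol_dilation_bound yb h0.
have [mpsi [A HA]] := schwartz_weighted spsi.
have A0 : 0 <= A.
  by have := le_trans (modulus_ge0 _) (HA 0); rewrite pmulr_lge0// weight_gt0.
rewrite cintegral_row_mx.
  apply: cintegral_eq => y; rewrite /kern -cintegralZr.
    by apply: cintegral_eq => xi; rewrite row_mxKl row_mxKr.
  split; first by apply: cmeasurable_kern_integrand => //; exact: symbol_cmeasurable.
  by exists B => xi; rewrite modulusM modulus_expi mul1r.
split.
  apply: cmeasurableM.
    apply: (@cmeasurable_kern_integrand _ _ b h (fun=> x)) => //.
    - exact: symbol_cmeasurable.
    - exact: measurable_lsubmx.
    - exact: measurable_rsubmx.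
  by apply: (cmeasurable_comp mpsi); exact: measurable_lsubmx.
exists (B * A) => p; rewrite !modulusM modulus_expi mul1r.
rewrite -[in weight p](hsubmxK p) weight_row_mx [weight _ * weight _]mulrC mulrACA.
by apply: ler_pM; rewrite ?modulus_ge0//; exact: HB.
Qed.

Lemma kern_symb_ft b h x y : symbol b -> 0 < h ->
  kern b h x y = (h ^- d)%:C * symb_ft b ((h / 2) *: (x + y)) (h^-1 *: (y - x)).
Proof.
move=> yb hp; have h0 : h != 0 by rewrite gt_eqF.
have [B B0 HB] := symbol_bound yb.
pose g (eta : E) := expi (- dotv (h^-1 *: (y - x)) eta) * b (row_mx ((h / 2) *: (x + y)) eta).
have wg : weighted g.
  split.
    apply: cmeasurableM.
      by apply: cmeasurable_expi; apply: measurable_funN; exact: measurable_dotv.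
    by apply: (cmeasurable_comp (symbol_cmeasurable yb)); exact: measurable_row_mx.
  exists B => eta; rewrite modulusM modulus_expi mul1r; apply: (le_trans (HB _)).
  rewrite weight_row_mx; apply: ler_wpM2l => //.
  by rewrite ler_piMl ?weight_ge0 ?weight_le1.
have := cintegral_affine 0 h0 wg; rewrite gtr0_norm// => <-.
apply: cintegral_eq => xi; rewrite /g add0r scale_row_mx !scalerA.
rewrite dotvZl dotvZr mulrA mulVf// mul1r -dotvNl opprB; congr (_ * b (row_mx _ _)).
Qed.

Lemma weyl_wop b h psi : symbol b -> 0 < h -> h <= 1 -> schwartz psi ->
  weyl (dilation h b) psi = fun x => ((2 * pi) ^- d)%:C * wop b h 0 0 psi x.
Proof.
move=> yb hp h1 spsi; have h0 : h != 0 by rewrite gt_eqF.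
have h01 : 0 <= h <= 1 by rewrite ltW.
rewrite weyl_kernel//; apply/funext => x; congr (_ * _).
pose G y := symb_ft b ((h / 2) *: (x + y)) (h^-1 *: (y - x)) * psi y.
have hV0 : h^-1 != 0 by rewrite invr_eq0.
have GE s : G (x + h *: s) = wint b h 0 0 psi x s.
  have e1 : h^-1 *: (x + h *: s - x) = s.
    by rewrite [x + _]addrC addrK scalerA mulVf// scale1r.
  have e2 : (h / 2) *: (x + (x + h *: s)) = (h ^+ 2 / 2) *: s + 0 + h *: x.
    by apply/rowP => i; rewrite !mxE; field.
  by rewrite /G /wint e1 e2 dotv0r expi0 mulr1.
have wG : weighted G.
  have := weighted_affine (- (h^-1 *: x)) hV0 (weighted_wint 0 0 x yb h01 spsi).
  congr weighted; apply/funext => y; rewrite -GE; congr G.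
  by apply/rowP => i; rewrite !mxE; field.
transitivity ((h ^- d)%:C * cintegral G).
  rewrite -cintegralZ//; apply: cintegral_eq => y.
  by rewrite kern_symb_ft// mulrA.
have := cintegral_affine x h0 wG; rewrite gtr0_norm// => <-.
by apply: cintegral_eq => s; rewrite GE.
Qed.

Definition tfshift (z : E2) psi : E -> R[i] :=
  modulation (rsubmx z) (translation (lsubmx z) psi).

(** An exact identity: translation moves the base point in the position of the symbol, and the phase
    [expi (dotv (x + h *: s) xi)] splits into the modulation at [x] and the shift of the momentum by
    [h *: xi]. *)
Lemma wop_tfshift b h (z : E2) psi : symbol b -> 0 <= h <= 1 -> schwartz psi ->
  wop b h 0 0 (tfshift z psi) =
  tfshift z (wop b h (lsubmx (h *: z)) (rsubmx (h *: z)) psi).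
Proof.
move=> yb h01 spsi; apply/funext => x.
have zl : lsubmx (h *: z) = h *: lsubmx z by apply/rowP => i; rewrite !mxE.
have zr : rsubmx (h *: z) = h *: rsubmx z by apply/rowP => i; rewrite !mxE.
rewrite /tfshift /modulation /translation zl zr /wop -cintegralZ; last first.
  exact: weighted_wint.
apply: cintegral_eq => s; rewrite /wint dotv0r expi0 mulr1.
have -> : (h ^+ 2 / 2) *: s + 0 + h *: x =
    (h ^+ 2 / 2) *: s + h *: lsubmx z + h *: (x - lsubmx z).
  by apply/rowP => i; rewrite !mxE; field.
have -> : x + h *: s - lsubmx z = x - lsubmx z + h *: s by rewrite addrAC.
rewrite dotvDl dotvZl dotvZr expiD.
by ring.
Qed.

Lemma smooth_tfshift (z : E2) psi : smooth psi -> smooth (tfshift z psi).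
Proof.
move=> sp; rewrite /tfshift; apply: smoothM; first by case: (smooth_expi (rsubmx z)).
have [h1 _] := smooth_affine (- lsubmx z) 1 sp.
move: h1; congr smooth; apply/funext => x.
by rewrite /translation scale1r addrC.
Qed.

Lemma dbound_translation N k A (x0 : E) psi : smooth psi ->
  dbound N (fun x => A * japanese x ^- k) psi ->
  dbound N (fun x => A * (2 ^+ k * japanese x0 ^+ k * japanese x ^- k))
    (translation x0 psi).
Proof.
move=> sp psiA.
have A0 : 0 <= A.
  by have := dbound_ge0 0 psiA; rewrite pmulr_lge0// invr_gt0 japaneseX_gt0.
have -> : translation x0 psi = fun x => psi (- x0 + 1 *: x).
  by apply/funext => x; rewrite /translation scale1r addrC.
apply: dbound_le (dbound_affine (- x0) sp _ psiA); last by rewrite normr1.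
move=> x; apply: ler_wpM2l => //; rewrite scale1r [- x0 + x]addrC.
by apply: japaneseVX_path => i; rewrite !mxE addrAC subrr add0r normrN.
Qed.

(** Of the exponent [2 * k], one [k] comes from differentiating the modulation and the other from
    moving the bracket across the translation. *)
Lemma tfshift_dbound k : exists2 C, 0 <= C & forall (z : E2) A psi, smooth psi ->
  dbound k (fun x => A * japanese x ^- k) psi ->
  dbound k (fun x => C * japanese z ^+ (2 * k) * A * japanese x ^- k) (tfshift z psi).
Proof.
exists (2 ^+ k * 2 ^+ k); first by rewrite mulr_ge0// exprn_ge0.
move=> z A psi sp psiA.
have A0 : 0 <= A.
  by have := dbound_ge0 0 psiA; rewrite pmulr_lge0// invr_gt0 japaneseX_gt0.
have st : smooth (translation (lsubmx z) psi).
  have [h1 _] := smooth_affine (- lsubmx z) 1 sp.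
  by move: h1; congr smooth; apply/funext => x; rewrite /translation scale1r addrC.
have [se _] := smooth_expi (rsubmx z).
have H := dboundM se st (@dbound_expi R d k (rsubmx z)) (dbound_translation (lsubmx z) sp psiA).
apply: (dbound_le _ H).
move=> x; have jx := japaneseX_gt0 x k.
have jl : japanese (lsubmx z) ^+ k <= japanese z ^+ k.
  apply: lerXn2r; rewrite ?nnegrE ?japanese_ge0//.
  by rewrite -[in leRHS](hsubmxK z) japanese_row_mxl.
have jr : japanese (rsubmx z) ^+ k <= japanese z ^+ k.
  apply: lerXn2r; rewrite ?nnegrE ?japanese_ge0//.
  by rewrite -[in leRHS](hsubmxK z) japanese_row_mxr.
have -> : 2 ^+ k * (japanese (rsubmx z) ^+ k *
   (A * (2 ^+ k * japanese (lsubmx z) ^+ k * japanese x ^- k))) =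
   2 ^+ k * 2 ^+ k * A * japanese x ^- k * (japanese (rsubmx z) ^+ k * japanese (lsubmx z) ^+ k).
  by ring.
rewrite mul2n -addnn exprD.
rewrite (_ : 2 ^+ k * 2 ^+ k * _ * A * _ = 2 ^+ k * 2 ^+ k * A * japanese x ^- k *
   (japanese z ^+ k * japanese z ^+ k)); last by ring.
apply: ler_wpM2l; first by rewrite !mulr_ge0 ?exprn_ge0// invr_ge0 ltW.
by apply: ler_pM => //; rewrite exprn_ge0// japanese_ge0.
Qed.

Lemma tfshift_schwartz (z : E2) psi : schwartz psi -> schwartz (tfshift z psi).
Proof.
move=> spsi; have sp := schwartz_smooth spsi; apply/schwartzP; split; first exact: smooth_tfshift.
move=> N k; pose m := maxn N k.
have [A A0 HA] := schwartz_dbound m m spsi; have [C C0 HC] := tfshift_dbound m.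
exists (C * japanese z ^+ (2 * m) * A).
apply: dbound_leq (leq_maxl N k) _; apply: dbound_le (HC z A psi sp HA) => x.
apply: ler_wpM2l; last exact/japaneseVX_le/leq_maxr.
by rewrite !mulr_ge0// exprn_ge0// japanese_ge0.
Qed.

Lemma STFT_bound u psi : tempered u -> schwartz psi ->
  exists C k, 0 <= C /\ forall z, modulus (STFT psi u z) <= C * japanese z ^+ k.
Proof.
move=> tu spsi; have [K [k [K0 HK]]] := tempered_bound tu.
have [A A0 HA] := schwartz_dbound k k spsi; have [C C0 HC] := tfshift_dbound k.
exists (K * (C * A)), (2 * k)%N; split; first by rewrite !mulr_ge0.
move=> z; have := HK _ _ (tfshift_schwartz z spsi) (HC z A psi (schwartz_smooth spsi) HA).
by rewrite (_ : K * (C * _ * A) = K * (C * A) * japanese z ^+ (2 * k)); last by ring.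
Qed.

End weyl_kernel.

(** * From the homogeneous to the Gabor wave front set *)

Section square_integrable.
Variable R : realType.

Lemma fun_L2norm_le n (f : 'rV[R]_n -> R[i]) c : 0 <= c ->
  (fun_L2norm f <= c%:E)%E <->
  (\int[lebesgue_rV R n]_x (modulus (f x) ^+ 2)%:E <= (c ^+ 2)%:E)%E.
Proof.
move=> c0; have p2 : (2 : R) != 0 by rewrite pnatr_eq0.
have := poweR_Lnorm (lebesgue_rV R n) (EFin \o @modulus R \o f) p2.
rewrite -/(fun_L2norm f).
have := Lnorm_ge0 (lebesgue_rV R n) 2%:E (EFin \o @modulus R \o f).
rewrite -/(fun_L2norm f).
under eq_integral => x _ do rewrite /= ger0_norm ?modulus_ge0// powR_mulrn ?modulus_ge0//.
case: (fun_L2norm f) => [r| |] //=.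
  rewrite !lee_fin => r0 <-; rewrite lee_fin powR_mulrn//.
  by rewrite ler_pXn2r ?nnegrE.
by move=> _; rewrite pnatr_eq0 /= => <-.
Qed.

Lemma Rintegral_norm_le n (g p : 'rV[R]_n -> R) C : measurable_fun setT g -> measurable_fun setT p ->
  (forall x, `|g x| <= p x) ->
  (\int[lebesgue_rV R n]_x (p x)%:E <= C%:E)%E ->
  `|\int[lebesgue_rV R n]_x g x| <= C.
Proof.
move=> mg mp gp pC; rewrite /Rintegral.
have mgE : measurable_fun [set: 'rV[R]_n] (EFin \o g) by exact/measurable_EFinP.
have H : (`| \int[lebesgue_rV R n]_x (g x)%:E | <= C%:E)%E.
  apply: (le_trans (le_abse_integral (lebesgue_rV R n) measurableT mgE)).
  apply: le_trans pC; apply: ge0_le_integral => //=.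
  - by apply/measurable_EFinP; apply: measurableT_comp.
  - exact/measurable_EFinP.
  - by move=> x _; rewrite lee_fin.
have fineP (y : \bar R) : (`|y| <= C%:E)%E -> `|fine y| <= C by case: y => [r| |].
exact: fineP.
Qed.

(* Cauchy-Schwarz in its AM-GM form: [t] is a power of [h] in the application. *)
Lemma cintegral_pairing_le n (f g : 'rV[R]_n -> R[i]) A B t : cmeasurable f -> cmeasurable g ->
  0 < t ->
  (\int[lebesgue_rV R n]_x (modulus (f x) ^+ 2)%:E <= A%:E)%E ->
  (\int[lebesgue_rV R n]_x (modulus (g x) ^+ 2)%:E <= B%:E)%E ->
  modulus (cintegral (fun x => f x * conjc (g x))) <= t^-1 * A + t * B.
Proof.
move=> mf mg t0 fA gB.
have mfg : cmeasurable (fun x => f x * conjc (g x)) by apply: cmeasurableM => //; exact: cmeasurable_conj.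
pose p x := 2^-1 * t^-1 * modulus (f x) ^+ 2 + 2^-1 * t * modulus (g x) ^+ 2.
have mf2 : measurable_fun setT (fun x => modulus (f x) ^+ 2).
  by apply: measurable_funX; exact: measurable_modulus.
have mg2 : measurable_fun setT (fun x => modulus (g x) ^+ 2).
  by apply: measurable_funX; exact: measurable_modulus.
have mp : measurable_fun setT p.
  by apply: measurable_funD; apply: measurable_funM => //; exact: measurable_cst.
have tV0 : 0 < t^-1 by rewrite invr_gt0.
have c1 : 0 <= 2^-1 * t^-1 by rewrite mulr_ge0// ltW.
have c2 : 0 <= 2^-1 * t by rewrite mulr_ge0// ltW.
have pI : (\int[lebesgue_rV R n]_x (p x)%:E <= (2^-1 * (t^-1 * A + t * B))%:E)%E.
  rewrite /p; under eq_integral => x _ do rewrite EFinD (EFinM (2^-1 * t^-1)) (EFinM (2^-1 * t)).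
  rewrite ge0_integralD//=; last 4 first.
  - by move=> x _; rewrite -EFinM lee_fin mulr_ge0// exprn_ge0// modulus_ge0.
  - by apply/measurable_EFinP; apply: measurable_funM => //; exact: measurable_cst.
  - by move=> x _; rewrite -EFinM lee_fin mulr_ge0// exprn_ge0// modulus_ge0.
  - by apply/measurable_EFinP; apply: measurable_funM => //; exact: measurable_cst.
  rewrite ge0_integralZl//=; last 2 first.
  - exact/measurable_EFinP.
  - by move=> x _; rewrite lee_fin exprn_ge0// modulus_ge0.
  rewrite ge0_integralZl//=; last 2 first.
  - exact/measurable_EFinP.
  - by move=> x _; rewrite lee_fin exprn_ge0// modulus_ge0.
  rewrite mulrDr !mulrA EFinD (EFinM _ A) (EFinM _ B); apply: leeD; apply: lee_wpmul2l => //.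
have bound x : modulus (f x * conjc (g x)) <= p x.
  rewrite modulusM modulus_conj /p.
  move: (modulus (f x)) (modulus (g x)) => a b; rewrite -subr_ge0.
  rewrite (_ : _ - _ = 2^-1 * t^-1 * (a - t * b) ^+ 2); last by field; rewrite gt_eqF.
  by rewrite mulr_ge0// sqr_ge0.
have [mRe mIm] := mfg.
apply: (le_trans (modulus_le _)) => /=.
have hR := Rintegral_norm_le mRe mp (fun x => le_trans (Re_le_modulus _) (bound x)) pI.
have hI := Rintegral_norm_le mIm mp (fun x => le_trans (Im_le_modulus _) (bound x)) pI.
apply: (le_trans (lerD hR hI)); rewrite -mulrDl.
by rewrite (_ : 2^-1 + 2^-1 = 1) ?mul1r//; field.
Qed.

(** [L2norm] is an infimum over representatives; for each [h] this picks one whose norm obeys the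
    bound with a constant independent of [h]. *)
Lemma Ohinfty_representative n (U : R -> ('rV[R]_n -> R[i]) -> R[i]) (M : nat) :
  Ohinfty (fun h => L2norm (U h)) ->
  exists2 c, 0 <= c & forall h, 0 < h -> h <= 1 -> exists f, [/\ cmeasurable f,
    (\int[lebesgue_rV R n]_x (modulus (f x) ^+ 2)%:E <= ((c * h ^+ M) ^+ 2)%:E)%E &
    represents f (U h)].
Proof.
move=> /(_ M); set S := [set _ | _ in _] => Soo.
(* The constant lies strictly above the supremum, since an element of the set is obtained only from
   a strict bound on its infimum. *)
have [c c0 Sc] : exists2 c, 0 <= c & (ereal_sup S < c%:E)%E.
  case: (ereal_sup S) Soo => [r| |] // _; last by exists 0 => //; exact: ltNyr.
  by exists (`|r| + 1); rewrite ?addr_ge0// lte_fin (le_lt_trans (ler_norm _))// ltrDl.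
exists c => // h h0 h1.
have hM : 0 < h ^+ M by rewrite exprn_gt0.
have : ((h ^- M)%:E * L2norm (U h) < c%:E)%E.
  apply: le_lt_trans Sc; apply: ereal_sup_ubound; exists h => //=; by rewrite h0.
rewrite muleC -lte_pdivlMr ?invr_gt0// invrK mulrC => /ereal_inf_lt[_ [f [[mR mI _] rep] <-]] fc.
exists f; split => //.
apply/fun_L2norm_le; first by rewrite mulr_ge0// ltW.
by rewrite mulrC; exact: ltW.
Qed.

End square_integrable.

(** * The Neumann series on a window *)

Section parametrix.
Variables (R : realType) (d : nat).
Local Notation E := 'rV[R]_d.
Local Notation E2 := 'rV[R]_(d + d).
Implicit Types (a b : E2 -> R[i]) (psi phi : E -> R[i]) (h : R) (z : E2).

Lemma dboundZ n N A (f : 'rV[R]_n -> R[i]) (c : R[i]) : smooth f -> dbound N A f ->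
  dbound N (fun x => modulus c * A x) (fun x => c * f x).
Proof.
move=> sf fA s sN x; have [s0 c0] := smooth_cst n (0 : R[i]).
have -> : (fun x => c * f x) = (fun x => c * f x + 0) by apply/funext => y; rewrite addr0.
rewrite (smooth_lincomb c sf s0).2 c0.
rewrite [in leLHS](_ : _ + _ = c * cpartials s f x); last by case: s {sN} => [|? ?] /=; rewrite addr0.
by rewrite modulusM; apply: ler_wpM2l; rewrite ?modulus_ge0// fA.
Qed.

Lemma temperedZ u (c : R[i]) psi : tempered u -> schwartz psi ->
  u (fun x => c * psi x) = conjc c * u psi.
Proof.
move=> tu sp; have := tempered_sum [:: tt] (fun=> c) tu (fun=> sp).
rewrite big_seq1 => <-; congr u.
by apply/funext => x; rewrite big_seq1.
Qed.

Lemma tfshift_lincomb z (c : R[i]) psi phi :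
  tfshift z (fun x => c * psi x + phi x) = fun x => c * tfshift z psi x + tfshift z phi x.
Proof.
by apply/funext => x; rewrite /tfshift /modulation /translation; ring.
Qed.

Lemma tfshift_integral psi A z : cmeasurable psi -> 0 <= A ->
  (forall x, modulus (psi x) <= A * weight x) ->
  (\int[lebesgue_rV R d]_x (modulus (tfshift z psi x) ^+ 2)%:E <= (A ^+ 2 * pi ^+ d)%:E)%E.
Proof.
move=> mpsi A0 psiA.
pose g (x : E) := (modulus (psi x) ^+ 2)%:E.
have mg : measurable_fun setT g.
  by apply/measurable_EFinP; apply: measurable_funX; exact: measurable_modulus.
have n1 : (1 : R) != 0 by exact: oner_neq0.
have g0 x : (0 <= g x)%E by rewrite lee_fin exprn_ge0// modulus_ge0.
have := ge0_integral_affine_rV (- lsubmx z) n1 mg g0.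
rewrite normr1 expr1n invr1 mul1e => E1.
rewrite [leLHS](_ : _ = \int[lebesgue_rV R d]_x g x)%E; last first.
  rewrite -E1; apply: eq_integral => x _; rewrite /g /tfshift /modulation modulusM modulus_expi mul1r.
  by rewrite /translation scale1r addrC.
rewrite EFinM -integral_weight.
have mw : measurable_fun [set: E] (fun x => (weight x)%:E).
  by apply/measurable_EFinP; exact: measurable_weight.
rewrite -ge0_integralZl//=; last 2 first.
- by move=> x _; rewrite lee_fin weight_ge0.
- by rewrite lee_fin exprn_ge0.
apply: ge0_le_integral => //=.
  by apply: emeasurable_funM => //; exact: measurable_cst.
move=> x _; rewrite /g -EFinM lee_fin.
apply: (@le_trans _ _ ((A * weight x) ^+ 2)).
  by rewrite ler_pXn2r ?nnegrE ?modulus_ge0// mulr_ge0// weight_ge0.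
rewrite exprMn; apply: ler_wpM2l; first exact: exprn_ge0.
by rewrite expr2 ler_piMr ?weight_ge0 ?weight_le1.
Qed.

Lemma symbol_conj a : symbol a -> symbol (@conjc R \o a).
Proof.
move=> [sa [rho ra]]; split; first by case: (smooth_conj sa).
by exists rho => x i xi; rewrite /= (ra x i xi) rmorph0.
Qed.

Variable K : R[i].
Hypothesis K0 : K != 0.
Hypothesis HK : forall (f : E -> R[i]) x, nice f ->
  cintegral (fun s => fourier f s * expi (- dotv x s)) = K * f x.

(* [K * b (h *: z)] is the principal part of [wop]: see [wop_error]. *)
Definition remainder b h z psi : E -> R[i] := fun x =>
  psi x - (K * b (h *: z))^-1 * wop b h (lsubmx (h *: z)) (rsubmx (h *: z)) psi x.

Lemma schwartz_remainder b h z psi : symbol b -> 0 <= h <= 1 -> schwartz psi ->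
  schwartz (remainder b h z psi).
Proof.
move=> yb h01 sp.
have := schwartz_lincomb (- (K * b (h *: z))^-1)
  (wop_schwartz (lsubmx (h *: z)) (rsubmx (h *: z)) yb h01 sp) sp.
by congr schwartz; apply/funext => x; rewrite /remainder addrC mulNr.
Qed.

Lemma schwartz_iter_remainder b h z psi j : symbol b -> 0 <= h <= 1 -> schwartz psi ->
  schwartz (iter j (remainder b h z) psi).
Proof. by move=> yb h01 sp; elim: j => //= j IH; exact: schwartz_remainder. Qed.

Lemma iter_remainder_dbound b phi : symbol b -> schwartz phi -> forall j N k,
  exists2 C, 0 <= C & forall h z, 0 <= h <= 1 -> 2^-1 <= modulus (b (h *: z)) ->
  dbound N (fun x => C * h ^+ j * japanese x ^- k) (iter j (remainder b h z) phi).
Proof.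
move=> yb sphi; elim=> [|j IH] N k.
  have [C C0 HC] := schwartz_dbound N k sphi; exists C => // h z _ _.
  by apply: dbound_le HC => x; rewrite expr0 mulr1.
have [C C0 HC] := IH N.+1 k.+1; have [D D0 HD] := wop_error HK N k yb.
have mK : 0 < modulus K by rewrite modulus_gt0.
exists ((modulus K)^-1 * 2 * (D * C)).
  by rewrite !mulr_ge0 ?invr_ge0// ltW.
move=> h z h01 bz; have [h0 h1] := andP h01.
set psi := iter j (remainder b h z) phi.
have spsi : schwartz psi by exact: schwartz_iter_remainder.
have H := HD h (lsubmx (h *: z)) (rsubmx (h *: z)) psi _ h01 spsi (HC h z h01 bz).
have bz0 : b (h *: z) != 0.
  by rewrite -modulus_gt0 (lt_le_trans _ bz)// invr_gt0.
move: H; rewrite hsubmxK => H.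
have b0 : K * b (h *: z) != 0 by rewrite mulf_neq0.
have -> : iter j.+1 (remainder b h z) phi = fun x => - (K * b (h *: z))^-1 *
   (- (K * b (h *: z)) * psi x + wop b h (lsubmx (h *: z)) (rsubmx (h *: z)) psi x).
  by apply/funext => x; rewrite iterS -/psi /remainder; field; rewrite bz0 K0.
have sw := schwartz_smooth (wop_schwartz (lsubmx (h *: z)) (rsubmx (h *: z)) yb h01 spsi).
have [s1 _] := smooth_lincomb (- (K * b (h *: z))) (schwartz_smooth spsi) sw.
apply: dbound_le (dboundZ (- (K * b (h *: z))^-1) s1 H) => x.
rewrite modulusN modulusV modulusM invfM.
have jx := japaneseX_gt0 x k; have hj : 0 <= h ^+ j by exact: exprn_ge0.
have bV : (modulus (b (h *: z)))^-1 <= 2.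
  by rewrite -[leRHS]invrK lef_pV2 ?posrE ?invr_gt0// (lt_le_trans _ bz)// invr_gt0.
rewrite (_ : _ / _ * _ = (modulus K)^-1 * (modulus (b (h *: z)))^-1 *
  (D * C * h ^+ j.+1 * japanese x ^- k)); last by rewrite exprS; ring.
rewrite [leRHS](_ : _ = (modulus K)^-1 * 2 * (D * C * h ^+ j.+1 * japanese x ^- k)); last by ring.
apply: ler_wpM2r.
  by rewrite !mulr_ge0 ?exprn_ge0// invr_ge0 ltW.
by apply: ler_wpM2l => //; rewrite invr_ge0 ltW.
Qed.

(** One exact step of the series, carried to [u]. The factor [(2 * pi) ^+ d] undoes the
    normalization of [weyl], and the conjugate comes from the antilinearity of [u]. *)
Lemma remainder_step u b h z psi : tempered u -> symbol b -> 0 < h <= 1 -> schwartz psi ->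
  u (tfshift z psi) = conjc ((K * b (h *: z))^-1 * ((2 * pi) ^+ d)%:C) *
    u (weyl (dilation h b) (tfshift z psi)) + u (tfshift z (remainder b h z psi)).
Proof.
move=> tu yb /andP[h0 h1] spsi; have h01 : 0 <= h <= 1 by rewrite ltW.
have st := tfshift_schwartz z spsi.
have sW : schwartz (weyl (dilation h b) (tfshift z psi)).
  by rewrite weyl_wop//; apply: schwartzZ; exact: wop_schwartz.
rewrite -(tempered_antilinear tu)//; last by apply: tfshift_schwartz; exact: schwartz_remainder.
congr u; rewrite weyl_wop// wop_tfshift//; apply/funext => x.
rewrite mulrA -[_^-1 * _ * _]mulrA -real_complexM divff; last first.
  by rewrite expf_neq0// mulf_neq0// ?pnatr_eq0// gt_eqF// pi_gt0.
rewrite mulr1 -[RHS]/((fun x => _ * _ + _) x) -tfshift_lincomb.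
by congr (tfshift z _ _); apply/funext => y; rewrite /remainder addrC subrK.
Qed.

End parametrix.

(** The exchange rate between powers of [h] and powers of the bracket: where [h *: z] is bounded,
    [japanese z] is [O(1/h)]. *)
Lemma japanese_contract (R : realType) n (z : 'rV[R]_n) h : 0 < h <= 1 ->
  h * japanese z <= japanese (h *: z).
Proof.
move=> /andP[h0 h1].
have h0' := ltW h0.
rewrite -(@ler_pXn2r _ 2)// ?nnegrE ?mulr_ge0 ?japanese_ge0//.
rewrite exprMn !japanese_sqr dotvZl dotvZr mulrDr mulr1 mulrA -expr2 lerD2r.
by rewrite exprn_ile1.
Qed.

(** * Smallness of the short-time Fourier transform at scale 1/h *)

Section semiclassical_to_Gabor.
Variables (R : realType) (d : nat) (u : ('rV[R]_d -> R[i]) -> R[i]).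
Local Notation E := 'rV[R]_d.
Local Notation E2 := 'rV[R]_(d + d).
Variables (a : E2 -> R[i]) (phi : E -> R[i]) (K : R[i]).
Hypothesis tu : tempered u.
Hypothesis ya : symbol a.
Hypothesis small : Ohinfty (fun h => L2norm (weyl_dual (dilation h a) u)).
Hypothesis sphi : schwartz phi.
Hypothesis K0 : K != 0.
Hypothesis HK : forall (f : E -> R[i]) x, nice f ->
  cintegral (fun s => fourier f s * expi (- dotv x s)) = K * f x.
Let b := @conjc R \o a.
Let yb : symbol b := symbol_conj ya.

Lemma weyl_tfshift_small j M : exists2 C, 0 <= C & forall h (z : E2), 0 < h <= 1 ->
  2^-1 <= modulus (b (h *: z)) ->
  modulus (u (weyl (dilation h b) (tfshift z (iter j (remainder K b h z) phi)))) <= C * h ^+ M.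
Proof.
have [c c0 Hc] := Ohinfty_representative M small.
have [A A0 HA] := iter_remainder_dbound K0 HK yb sphi j 0 (2 * d).
exists (c ^+ 2 + A ^+ 2 * pi ^+ d).
  by rewrite addr_ge0// ?exprn_ge0// mulr_ge0// exprn_ge0// ?pi_ge0.
move=> h z /andP[h0 h1] bz; have h01 : 0 <= h <= 1 by rewrite ltW.
have spsi := schwartz_iter_remainder K z j yb h01 sphi.
have [f [mf fL rf]] := Hc h h0 h1.
have st := tfshift_schwartz z spsi.
have -> : u (weyl (dilation h b) (tfshift z (iter j (remainder K b h z) phi))) =
    weyl_dual (dilation h a) u (tfshift z (iter j (remainder K b h z) phi)) by [].
rewrite rf//.
have hM : 0 < h ^+ M by rewrite exprn_gt0.
have L2 := @tfshift_integral _ _ (iter j (remainder K b h z) phi) A z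
  (smooth_cmeasurable (schwartz_smooth spsi)) A0.
(* With [t = h ^+ M] the representative, of square norm at most [(c * h ^+ M) ^+ 2], and the merely
   bounded test function both contribute [O(h ^+ M)]. *)
apply: (le_trans (cintegral_pairing_le mf (smooth_cmeasurable (schwartz_smooth st)) hM fL (L2 _))).
  move=> x; apply: (le_trans (dbound0 x (HA h z h01 bz))).
  apply: ler_pM; last exact: japanese_weight.
  - by rewrite mulr_ge0// exprn_ge0// ltW.
  - by rewrite invr_ge0 exprn_ge0// japanese_ge0.
  - by rewrite ler_piMr// exprn_ile1// ltW.
rewrite le_eqVlt; apply/orP; left; apply/eqP.
by field; rewrite gt_eqF.
Qed.

(** Each use of [remainder_step] splits off a term that [weyl_tfshift_small] bounds by [h ^+ M];
    only the last remainder is left. *)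
Lemma STFT_reduce j M : exists2 C, 0 <= C & forall h (z : E2), 0 < h <= 1 ->
  2^-1 <= modulus (b (h *: z)) ->
  modulus (u (tfshift z phi)) <=
  C * h ^+ M + modulus (u (tfshift z (iter j (remainder K b h z) phi))).
Proof.
elim: j => [|j [C C0 HC]]; first by exists 0 => // h z _ _; rewrite mul0r add0r.
have [D D0 HD] := weyl_tfshift_small j M.
have mK : 0 < modulus K by rewrite modulus_gt0.
pose c : R := modulus ((2 * pi) ^+ d)%:C; have c0 : 0 <= c by exact: modulus_ge0.
exists (C + (modulus K)^-1 * 2 * c * D).
  by rewrite addr_ge0 ?mulr_ge0 ?invr_ge0// ltW.
move=> h z h01 bz; have h01' : 0 <= h <= 1 by case/andP: h01 => /ltW -> ->.
apply: (le_trans (HC h z h01 bz)); rewrite mulrDl -addrA; apply: lerD => //.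
rewrite (remainder_step K z tu yb h01); last exact: schwartz_iter_remainder.
rewrite (le_trans (modulusD _ _))// lerD//.
rewrite modulusM modulus_conj modulusM modulusV modulusM invfM -/c.
have bV : (modulus (b (h *: z)))^-1 <= 2.
  by rewrite -[leRHS]invrK lef_pV2 ?posrE ?invr_gt0// (lt_le_trans _ bz)// invr_gt0.
rewrite -[leRHS]mulrA; apply: ler_pM; rewrite ?modulus_ge0 ?mulr_ge0 ?invr_ge0 ?modulus_ge0//.
- by apply: ler_wpM2r => //; apply: ler_wpM2l => //; rewrite invr_ge0 ltW.
- exact: HD.
Qed.

(** The series is run for [M + 2 * k] steps, where [k] is the order of [u]: the last remainder gains
    that many powers of [h], and [2 * k] of them compensate the growth of the seminorms of the
    shifted window. *)
Lemma STFT_small J M : 0 <= J -> exists2 C, 0 <= C & forall h (z : E2), 0 < h <= 1 ->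
  2^-1 <= modulus (b (h *: z)) -> japanese (h *: z) <= J ->
  modulus (u (tfshift z phi)) <= C * h ^+ M.
Proof.
move=> J0; have [B [k [B0 HB]]] := tempered_bound tu.
have [D D0 HD] := @tfshift_dbound R d k.
have [C C0 HC] := STFT_reduce (M + 2 * k) M.
have [A A0 HA] := iter_remainder_dbound K0 HK yb sphi (M + 2 * k) k k.
exists (C + B * (D * J ^+ (2 * k) * A)).
  by rewrite addr_ge0// !mulr_ge0// exprn_ge0.
move=> h z h01 bz zJ; have h01' : 0 <= h <= 1 by case/andP: h01 => /ltW -> ->.
have spsi := schwartz_iter_remainder K z (M + 2 * k) yb h01' sphi.
apply: (le_trans (HC h z h01 bz)); rewrite mulrDl lerD2l.
apply: (le_trans (HB _ _ (tfshift_schwartz z spsi) (HD z _ _ (schwartz_smooth spsi) (HA h z h01' bz)))).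
rewrite -!mulrA; apply: ler_wpM2l => //; apply: ler_wpM2l => //.
rewrite [leRHS]mulrCA [leLHS]mulrCA; apply: ler_wpM2l => //.
rewrite exprD mulrCA [leRHS]mulrC; apply: ler_wpM2l.
  by rewrite exprn_ge0//; case/andP: h01'.
rewrite mulrC -exprMn; apply: lerXn2r; rewrite ?nnegrE ?mulr_ge0 ?japanese_ge0//.
  by case/andP: h01'.
exact: le_trans (japanese_contract _ h01) zJ.
Qed.

End semiclassical_to_Gabor.

(** * Decay of the short-time Fourier transform in a cone *)

Section WFG_sub_HWF.
Variables (R : realType) (d : nat).
Local Notation E2 := 'rV[R]_(d + d).

(** The cone generated by a ball, written as a union of preimages under dilations so that openness
    follows from continuity. The parameter [t] serves as the semiclassical parameter [h]. *)
Definition conic (z0 : E2) (e : R) : set E2 :=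
  \bigcup_(t in [set t : R | 0 < t]) [set z | `|t *: z - z0| < e].

Lemma open_conic z0 e : open (conic z0 e).
Proof.
apply: bigcup_open => t _.
rewrite (_ : [set z | _] = (fun z : E2 => t *: z) @^-1` [set y | `|y - z0| < e]) //.
apply: open_comp.
  move=> x _; rewrite (_ : (fun z : E2 => _) = fun z => 0 + t *: z); first exact: continuous_affine_rV.
  by apply/funext => y; rewrite add0r.
rewrite (_ : [set y | _] = ball z0 e); first exact: ball_open.
by apply/seteqP; split => y; rewrite -ball_normE /= distrC.
Qed.

Lemma cone_conic (z0 : E2) e i : e <= `|z0 ord0 i| -> cone (conic z0 e).
Proof.
move=> ei; split.
  move=> z [t /= t0 tz]; apply/eqP => z00; move: tz; rewrite z00 scaler0 sub0r normrN.
  by apply/negP; rewrite -leNgt (le_trans ei)// entry_le_norm.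
move=> t z t0 [s /= s0 sz]; exists (s / t) => /=; first by rewrite divr_gt0.
by rewrite scalerA divfK ?gt_eqF.
Qed.

Lemma WFG_sub_HWF (u : ('rV[R]_d -> R[i]) -> R[i]) : tempered u -> WFG u `<=` HWF u.
Proof.
move=> tu z0 [z00 nW]; split=> // -[a [/cc_smoothP ya az0 small]]; apply: nW.
have [K K0 HK] := @fourier_inversion R d.
have [chi [schi chi_ge0 chi0 chi_supp]] := bump_exists (0 : 'rV[R]_d) ltr01.
pose phi x := (chi x)%:C.
have sphi : schwartz phi.
  apply: (@supported_schwartz _ _ 1) => // x i xi; rewrite /phi (chi_supp x i)//.
  by rewrite mxE subr0 ltW.
have /rV0Pn[i zi] := z00.
have [sa [rho ra]] := ya.
have [L L0 HL] := nice_lipschitz (schwartz_nice (supported_schwartz sa ra)).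
(* The first bound keeps the ball off the origin; the second, with the Lipschitz constant [L] of
   [a], keeps [a] within 1/2 of its value 1 at [z0]. *)
pose e := Num.min `|z0 ord0 i| (2 * (L * (d + d)%:R + 1))^-1.
have L1 : 0 < 2 * (L * (d + d)%:R + 1) by rewrite mulr_gt0// ltr_wpDl// mulr_ge0.
have e0 : 0 < e by rewrite lt_min normr_gt0 zi invr_gt0.
have near_z0 w : `|w - z0| < e -> 2^-1 <= modulus ((@conjc R \o a) w).
  move=> we; rewrite /= modulus_conj.
  have := HL z0 (w - z0); rewrite [z0 + _]addrC subrK az0 => Hw.
  have : 1 <= modulus (a w) + modulus (a w - 1).
    have := modulusB (a w) (a w - 1).
    by rewrite subKr modulus1.
  have : L * (\sum_j `|(w - z0) ord0 j|) <= 2^-1.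
    apply: (@le_trans _ _ (L * ((d + d)%:R * e))).
      apply: ler_wpM2l => //; rewrite mulr_natl -[X in e *+ X]card_ord -sumr_const.
      by apply: ler_sum => j _; rewrite (le_trans _ (ltW we))// entry_le_norm.
    have e1 : (2 * (L * (d + d)%:R + 1)) * e <= 1.
      by rewrite mulrC -ler_pdivlMr// div1r ge_min lexx orbT.
    by clear -e1 e0 L0; move: e1 e0 L0; clearbody e; move: ((d + d)%:R) => q; nra.
  lra.
have [J J1 HJ] : exists2 J, 1 <= J & forall w, `|w - z0| < e -> japanese w <= J.
  exists ((d + d).+1%:R * (1 + `|z0| + e)).
    by apply: mulr_ege1; rewrite ?ler1n// -addrA lerDl addr_ge0// ltW.
  move=> w we; apply: japanese_le_max => [|j]; first by rewrite -addrA lerDl addr_ge0// ltW.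
  apply: (le_trans (entry_le_norm _ _)); rewrite -(subrK z0 w) (le_trans (ler_normD _ _))//.
  by move: (normr_ge0 z0); lra.
have J0 : 0 <= J by exact: le_trans J1.
exists phi; split => //; first by exists 0; rewrite /phi chi0 oner_neq0.
exists (conic z0 e); split; [exact: open_conic| | |].
- by apply: (@cone_conic _ _ i); rewrite ge_min lexx.
- by exists 1 => /=; rewrite ?ltr01// scale1r subrr normr0.
move=> N.
have [A [k [A0 HA]]] := STFT_bound tu sphi.
have [C C0 HC] := STFT_small tu ya small sphi K0 HK N J0.
exists (J ^+ N * (A * J ^+ k) + C * J ^+ N) => _ [z [t /= t0 tz] <-].
have jz := japanese_ge0 z; have mu0 := modulus_ge0 (STFT phi u z).
have p1 : 0 <= J ^+ N * (A * J ^+ k) by rewrite !mulr_ge0 ?exprn_ge0.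
have p2 : 0 <= C * J ^+ N by rewrite mulr_ge0 ?exprn_ge0.
(* For [t <= 1] the estimate is [STFT_small] at [h = t]. For [t > 1] the point [z] is shorter than
   [t *: z], hence bounded, and the polynomial bound on the transform suffices. *)
have [t1|t1] := leP t 1.
  have t01 : 0 < t <= 1 by rewrite t0.
  apply: (@le_trans _ _ (C * J ^+ N)); last by rewrite lerDr.
  apply: (@le_trans _ _ (japanese z ^+ N * (C * t ^+ N))).
    by apply: ler_wpM2l; [exact: exprn_ge0|apply: HC => //; [exact: near_z0|exact: HJ]].
  rewrite mulrCA -exprMn; apply: ler_wpM2l => //.
  apply: lerXn2r; rewrite ?nnegrE// ?mulr_ge0 ?(ltW t0)//.
  by rewrite mulrC (le_trans (japanese_contract _ t01))// HJ.
apply: (@le_trans _ _ (J ^+ N * (A * J ^+ k))); last by rewrite lerDl.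
have zJ : japanese z <= J.
  have -> : z = t^-1 *: (t *: z) by rewrite scalerA mulVf ?scale1r// gt_eqF.
  apply: le_trans (HJ _ tz); apply: japanese_scale.
  by rewrite ger0_norm ?invr_ge0 ?invf_le1// ltW.
apply: ler_pM => //; first exact: exprn_ge0.
  by apply: lerXn2r.
by apply: (le_trans (HA z)); apply: ler_wpM2l => //; apply: lerXn2r.
Qed.

End WFG_sub_HWF.

(** * Tempered distributions on superpositions *)

Section grid.
Variable R : realType.

(* The functions [chi v] are the indicators of the cells, of side [1/(n+1)], of a
   grid covering a box of half-side [n+1]. *)
Lemma grid_exists (p n : nat) : exists (I : finType) (P : I -> 'rV[R]_p) (chi : I -> 'rV[R]_p -> R),
  [/\ forall v, measurable_fun [set: 'rV[R]_p] (chi v), forall v w, 0 <= chi v w <= 1 &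
  forall w, (exists2 v0, chi v0 w = 1 /\ (forall i, `|w ord0 i - P v0 ord0 i| <= n.+1%:R^-1) &
       forall v, v != v0 -> chi v w = 0) \/
     ((forall v, chi v w = 0) /\ n.+1%:R <= japanese w)].
Proof.
pose q : R := n.+1%:R; have q0 : 0 < q by rewrite ltr0n.
(* A side of the box has length [2 * n.+1] and is cut into cells of length [1/(n+1)]. The index type
   has one more element, for points whose integer part reaches [N]. *)
pose N := (2 * n.+1 * n.+1)%N.
pose I : finType := {ffun 'I_p -> 'I_N.+1}.
pose lo (v : I) i : R := (v i)%:R / q - q.
pose cell (v : I) i : set R := `[lo v i, lo v i + q^-1[%classic.
pose chi (v : I) (w : 'rV[R]_p) : R := \prod_(i < p) \1_(cell v i) (w ord0 i).
(* The index of a cell is the integer part of [(t + q) * q]: this gives disjointness of the cells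
   and a cell for every point of the box. *)
have cellP v i t : cell v i t <-> (v i)%:R <= (t + q) * q < (v i).+1%:R.
  rewrite /cell /= in_itv /= /lo -ltrBlDr.
  rewrite -(ler_pM2r q0) -[(_ - _ < _)](ltr_pM2r q0).
  rewrite !mulrBl mulfVK ?gt_eqF// mulVf ?gt_eqF// mulrDl -natr1.
  split => /andP[h1 h2]; apply/andP; split; lra.
exists I, (fun v => \row_i lo v i), chi; split.
- move=> v; apply: measurable_prod => i _.
  apply: (measurableT_comp (f := (\1_(cell v i) : R -> R))); last exact: measurable_rV_coord.
  by apply: measurable_indic; exact: measurable_itv.
- move=> v w; rewrite /chi; elim/big_ind: _ => [|x y /andP[x0 x1] /andP[y0 y1]|i _].
  + by rewrite ler01 lexx.
  + by rewrite mulr_ge0//= mulr_ile1.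
  + by rewrite indicE ler0n lern1 leq_b1.
move=> w.
have [[v0 H]|H] := pselect (exists v0, forall i, cell v0 i (w ord0 i)); [left|right].
  exists v0 => [|v vv0].
    split=> [|i].
      by rewrite /chi big1// => i _; rewrite indicE mem_set.
    have := H i; rewrite /cell /= in_itv /= mxE => /andP[h1 h2].
    by rewrite ger0_norm ?subr_ge0// lerBlDl ltW.
  rewrite /chi; have /existsP[i vi] : [exists i, v i != v0 i].
    by apply/existsPn => H'; move/eqP: vv0; apply; apply/ffunP => i; apply/eqP/negPn/H'.
  rewrite (bigD1 i)//= indicE memNset ?mul0r// => /cellP/truncn_def.
  have /cellP/truncn_def -> := H i => /ord_inj vv.
  by rewrite vv eqxx in vi.
have chiz v : chi v w = 0.
  have [i wi] : exists i, ~ cell v i (w ord0 i).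
    by apply: contrapT => H'; apply: H; exists v => i; apply: contrapT => Hi; apply: H'; exists i.
  by rewrite /chi (bigD1 i)//= indicE memNset// mul0r.
split=> //; rewrite leNgt; apply/negP => wq; apply: H.
exists [ffun i => inord (Num.truncn ((w ord0 i + q) * q))] => i.
have wi := le_lt_trans (entry_le_japanese w i) wq.
have wi0 : 0 <= w ord0 i + q.
  by move: wi; rewrite ltr_norml => /andP[h _]; rewrite -lerBlDr sub0r ltW.
have t0 : 0 <= (w ord0 i + q) * q by rewrite mulr_ge0// ltW.
apply/cellP; rewrite ffunE inordK; first exact: truncn_itv.
rewrite ltnS -(ler_nat R); have /andP[h _] := truncn_itv t0; apply: (le_trans h).
rewrite /N -mulnA mul2n -addnn natrD natrM -/q -mulrDl ler_pM2r//.
by rewrite lerD2r ltW// (le_lt_trans (ler_norm _)).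
Qed.

End grid.

(** * Superpositions with rapidly decreasing coefficients *)

Section superposition.
Variables (R : realType) (d p : nat).
Local Notation E := 'rV[R]_d.
Local Notation P := 'rV[R]_p.

Lemma smooth_sum (I : Type) (r : seq I) (c : I -> R[i]) (F : I -> E -> R[i]) :
  (forall i, smooth (F i)) -> smooth (fun x => \sum_(i <- r) c i * F i x) /\
  forall s, cpartials s (fun x => \sum_(i <- r) c i * F i x) =
    fun x => \sum_(i <- r) c i * cpartials s (F i) x.
Proof.
move=> sF; elim: r => [|i r [IH1 IH2]].
  have [s0 c0] := smooth_cst d (0 : R[i]).
  have e : (fun x : E => \sum_(i <- [::]) c i * F i x) = fun=> 0.
    by apply/funext => x; rewrite big_nil.
  rewrite e; split => // s; rewrite c0; apply/funext => x; rewrite big_nil.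
  by case: s.
have [h1 h2] := smooth_lincomb (c i) (sF i) IH1.
have e : (fun x : E => \sum_(i <- i :: r) c i * F i x) =
    fun x => c i * F i x + \sum_(i <- r) c i * F i x.
  by apply/funext => x; rewrite big_cons.
rewrite e; split=> // s; rewrite h2 IH2; apply/funext => x.
by rewrite big_cons.
Qed.

Definition rapid (m : P -> R[i]) := cmeasurable m /\
  forall N, exists C, forall w, modulus (m w) <= C * japanese w ^- N.

Lemma rapid_weight (m : P -> R[i]) q : rapid m ->
  exists2 A, 0 <= A & forall w, modulus (m w) * japanese w ^+ q <= A * weight w.
Proof.
move=> [_ /(_ (2 * p + q)%N) [C HC]].
have C0 : 0 <= C.
  by have := le_trans (modulus_ge0 _) (HC 0); rewrite pmulr_lge0// invr_gt0 japaneseX_gt0.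
exists C => // w; apply: (le_trans (ler_wpM2r _ (HC w))).
  by rewrite exprn_ge0// japanese_ge0.
rewrite exprD invfM mulrA mulfVK ?gt_eqF ?japaneseX_gt0//.
by apply: ler_wpM2l => //; exact: japanese_weight.
Qed.

Variable m : P -> R[i].
Hypothesis rm : rapid m.

(** The constant [M] is chosen before the family [Phi], because the family will be the error of a
    Riemann sum and will change with the grid. Growth of order [q] in [w] is absorbed by [m]. *)
Lemma superposition_dbound (q : nat) : exists2 M, 0 <= M & forall (Phi : P -> E -> R[i]),
  (forall w, smooth (Phi w)) ->
  (forall s x, cmeasurable (fun w => cpartials s (Phi w) x)) ->
  (forall k, exists C q, forall w,
    dbound k (fun x => C * japanese w ^+ q * japanese x ^- k) (Phi w)) ->
  smooth (fun x => cintegral (fun w => m w * Phi w x)) /\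
  forall k C, (forall w, dbound k (fun x => C * japanese w ^+ q * japanese x ^- k) (Phi w)) ->
  dbound k (fun x => M * C * japanese x ^- k) (fun x => cintegral (fun w => m w * Phi w x)).
Proof.
have [A A0 HA] := rapid_weight q rm.
have [mm _] := rm.
exists (A * weight_mass R p).
  by apply: mulr_ge0 => //; exact/ltW/weight_mass_gt0.
move=> Phi sPhi mPhi bPhi.
have [||s|sI cI] := @smooth_cintegral R p d (fun s x w => m w * cpartials s (Phi w) x).
- move=> w s j; exact: cderiveZ (smooth_cderive (sPhi w) s j).
- by move=> s x; apply: cmeasurableM.
- have [C [r HC]] := bPhi (size s).
  have C0 : 0 <= C.
    have := dbound_ge0 0 (HC 0); rewrite -mulrA pmulr_lge0//.
    by rewrite mulr_gt0// ?invr_gt0 japaneseX_gt0.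
  have [B B0 HB] := rapid_weight r rm.
  exists (C * B) => x w; rewrite modulusM.
  apply: (le_trans (ler_wpM2l (modulus_ge0 _) (HC w s (leqnn _) x))).
  apply: (@le_trans _ _ (C * (modulus (m w) * japanese w ^+ r))).
    rewrite mulrCA -[C * _ * _]mulrA; apply: ler_wpM2l => //.
    rewrite mulrCA ler_wpM2l ?modulus_ge0//.
    rewrite mulrC ler_piMl ?exprn_ge0 ?japanese_ge0//.
    by rewrite invf_le1 ?japaneseX_gt0// japaneseX_ge1.
  by rewrite -mulrA; apply: ler_wpM2l.
have e0 : (fun x => cintegral (fun w => m w * cpartials [::] (Phi w) x)) =
   fun x => cintegral (fun w => m w * Phi w x).
  by apply/funext => x; apply: cintegral_eq => w; rewrite cpartials_nil.
rewrite -e0; split=> // k C HC s sk x; rewrite cI.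
have C0 : 0 <= C.
  have := dbound_ge0 0 (HC 0); rewrite -mulrA pmulr_lge0//.
  by rewrite mulr_gt0// ?invr_gt0 japaneseX_gt0.
rewrite (_ : A * _ * C * _ = (A * C * japanese x ^- k) * weight_mass R p); last by ring.
apply: cintegral_le; first by apply: cmeasurableM.
move=> w; rewrite modulusM.
apply: (le_trans (ler_wpM2l (modulus_ge0 _) (HC w s sk x))).
rewrite (_ : modulus (m w) * _ = (modulus (m w) * japanese w ^+ q) * (C * japanese x ^- k)); last by ring.
rewrite (_ : A * C * _ * _ = (A * weight w) * (C * japanese x ^- k)); last by ring.
by apply: ler_wpM2r => //; rewrite mulr_ge0// invr_ge0 ltW ?japaneseX_gt0.
Qed.

End superposition.

Section lipschitz.
Variables (R : realType) (p : nat).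
Local Notation P := 'rV[R]_p.

Lemma locally_lipschitz_continuous (f : P -> R[i]) :
  (forall w : P, exists C, forall (w' : P) delta, 0 <= delta <= 1 ->
    (forall i, `|w ord0 i - w' ord0 i| <= delta) -> modulus (f w - f w') <= C * delta) ->
  ccontinuous f.
Proof.
move=> Lf.
have key (g : P -> R) : (forall w : P, exists C, forall (w' : P) delta, 0 <= delta <= 1 ->
    (forall i, `|w ord0 i - w' ord0 i| <= delta) -> `|g w - g w'| <= C * delta) -> continuous g.
  move=> Lg x; apply/(@cvgrPdist_le _ _ _ _ (nbhs_filter x)) => e e0.
  have [C HC] := Lg x; pose K := `|C| + 1.
  have K0 : 0 < K by rewrite ltr_wpDl.
  pose r := Num.min 1 (e / K); have r0 : 0 < r by rewrite lt_min ltr01 divr_gt0.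
  suff H : \forall y \near x, `|g x - g y| <= e by exact: H.
  apply/nbhs_normP; exists r => //= y xy.
  have := HC y r; rewrite (ltW r0) ge_min lexx => /(_ isT).
  have xyi i : `|x ord0 i - y ord0 i| <= r.
    by apply: le_trans (ltW xy); have := entry_le_norm (x - y) i; rewrite !mxE.
  move=> /(_ xyi) H; apply: (le_trans H).
  apply: (@le_trans _ _ (K * r)).
    by apply: ler_wpM2r; [exact: ltW|rewrite (le_trans (ler_norm _))// lerDl].
  by rewrite mulrC -ler_pdivlMr// ge_min lexx orbT.
split; apply: key => w; have [C HC] := Lf w; exists C => w' delta d01 ww';
  apply: le_trans (HC w' delta d01 ww').
- by apply: le_trans (Re_le_modulus _); rewrite Re_add Re_opp.
- by apply: le_trans (Im_le_modulus _); rewrite Im_add Im_opp.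
Qed.

End lipschitz.

(** * Exchange of a tempered distribution with an integral *)

Section exchange.
Variables (R : realType) (d p : nat).
Local Notation E := 'rV[R]_d.
Local Notation P := 'rV[R]_p.
Variable u : (E -> R[i]) -> R[i].
Hypothesis tu : tempered u.
Variable Psi : P -> E -> R[i].
Hypothesis sPsi : forall w, schwartz (Psi w).
Hypothesis Psi_bound : forall k, exists C q, 0 <= C /\ forall w,
  dbound k (fun x => C * japanese w ^+ q * japanese x ^- k) (Psi w).
Hypothesis Psi_lipschitz : forall k, exists C q, 0 <= C /\ forall (w w' : P) delta, 0 <= delta <= 1 ->
  (forall i, `|w ord0 i - w' ord0 i| <= delta) ->
  dbound k (fun x => C * delta * japanese w ^+ q * japanese x ^- k) (fun x => Psi w x - Psi w' x).

Lemma cpartialsB n (f g : 'rV[R]_n -> R[i]) s : smooth f -> smooth g ->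
  cpartials s (fun x => f x - g x) = fun x => cpartials s f x - cpartials s g x.
Proof.
move=> sf sg; have := (smooth_lincomb (-1) sg sf).2 s.
rewrite (_ : (fun x => -1 * g x + f x) = fun x => f x - g x); last first.
  by apply/funext => x; rewrite mulN1r addrC.
by move=> ->; apply/funext => x; rewrite mulN1r addrC.
Qed.

Lemma cmeasurable_family s x : cmeasurable (fun w => cpartials s (Psi w) x).
Proof.
apply/ccontinuous_measurable/locally_lipschitz_continuous => w.
have [C [q [C0 HC]]] := Psi_lipschitz (size s).
exists (C * japanese w ^+ q) => w' delta d01 ww'.
have := HC w w' delta d01 ww' s (leqnn _) x.
rewrite cpartialsB; [|exact/schwartz_smooth|exact/schwartz_smooth] => H.
apply: (le_trans H); rewrite [C * delta * _]mulrAC.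
rewrite -[leRHS]mulr1; apply: ler_wpM2l.
  by case/andP: d01 => d0 _; rewrite !mulr_ge0// exprn_ge0// japanese_ge0.
by rewrite invf_le1 ?japaneseX_gt0// japaneseX_ge1.
Qed.

Lemma schwartzB (f g : E -> R[i]) : schwartz f -> schwartz g -> schwartz (fun x => f x - g x).
Proof.
move=> sf sg; have := schwartz_lincomb (-1) sg sf.
by congr schwartz; apply/funext => x; rewrite mulN1r addrC.
Qed.

Lemma temperedB (f g : E -> R[i]) : schwartz f -> schwartz g ->
  u (fun x => f x - g x) = u f - u g.
Proof.
move=> sf sg; have := tempered_antilinear tu (-1) sg sf.
rewrite rmorphN rmorph1 mulN1r addrC => <-.
by congr u; apply/funext => x; rewrite mulN1r addrC.
Qed.

Lemma cmeasurable_tempered_family : cmeasurable (fun w => u (Psi w)).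
Proof.
have [K [k [K0 HK]]] := tempered_bound tu.
apply/ccontinuous_measurable/locally_lipschitz_continuous => w.
have [C [q [C0 HC]]] := Psi_lipschitz k.
exists (K * (C * japanese w ^+ q)) => w' delta d01 ww'.
rewrite -temperedB//.
apply: (le_trans (HK _ _ (schwartzB (sPsi w) (sPsi w')) (HC w w' delta d01 ww'))).
by rewrite [C * delta * _]mulrAC [leLHS]mulrA.
Qed.

Lemma tempered_family_bound : exists C q, 0 <= C /\ forall w,
  modulus (u (Psi w)) <= C * japanese w ^+ q.
Proof.
have [K [k [K0 HK]]] := tempered_bound tu; have [C [q [C0 HC]]] := Psi_bound k.
exists (K * C), q; split; first exact: mulr_ge0.
by move=> w; rewrite -mulrA; exact: HK.
Qed.

Section step_approximation.
Variables (I : finType) (pt : I -> P) (chi : I -> P -> R) (n : nat).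
Hypothesis mchi : forall v, measurable_fun [set: P] (chi v).
Hypothesis chi01 : forall v (w : P), 0 <= chi v w <= 1.
Hypothesis chiP : forall w : P,
  (exists2 v0, chi v0 w = 1 /\ (forall i, `|w ord0 i - pt v0 ord0 i| <= n.+1%:R^-1) &
       forall v, v != v0 -> chi v w = 0) \/
     ((forall v, chi v w = 0) /\ n.+1%:R <= japanese w).

Definition step_error w (x : E) := Psi w x - \sum_v (chi v w)%:C * Psi (pt v) x.

Lemma step_error_cases w : (exists2 v, step_error w = (fun x => Psi w x - Psi (pt v) x) &
    forall i, `|w ord0 i - pt v ord0 i| <= n.+1%:R^-1) \/
  (step_error w = Psi w /\ n.+1%:R <= japanese w).
Proof.
have [[v0 [c1 wv] c0]|[c0 jw]] := chiP w; [left|right].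
  exists v0 => //; apply/funext => x; rewrite /step_error (bigD1 v0)//= big1 ?addr0.
    by rewrite c1 mul1r.
  by move=> v /c0 ->; rewrite mul0r.
split=> //; apply/funext => x; rewrite /step_error big1 ?subr0// => v _.
by rewrite c0 mul0r.
Qed.

Lemma schwartz_step_sum w : schwartz (fun x => \sum_v (chi v w)%:C * Psi (pt v) x).
Proof. by apply: schwartz_sum => v; exact: schwartzZ. Qed.

Lemma schwartz_step_error w : schwartz (step_error w).
Proof. exact: schwartzB (sPsi w) (schwartz_step_sum w). Qed.

Lemma cmeasurable_step_error s x : cmeasurable (fun w => cpartials s (step_error w) x).
Proof.
rewrite (_ : (fun w => _) = fun w => cpartials s (Psi w) x -
    \sum_v (chi v w)%:C * cpartials s (Psi (pt v)) x).
  apply: cmeasurableB; first exact: cmeasurable_family.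
  apply: cmeasurable_sum => v; apply: cmeasurableM; last exact: cmeasurable_cst.
  exact: cmeasurable_real.
apply/funext => w; rewrite cpartialsB; last 2 first.
- exact/schwartz_smooth.
- exact/schwartz_smooth/schwartz_step_sum.
by rewrite (smooth_sum _ _ (fun v => schwartz_smooth (sPsi (pt v)))).2.
Qed.

End step_approximation.

(** Inside the grid the Lipschitz estimate gives the factor [1/(n+1)]. Outside it,
    [1 <= japanese w / (n+1)], so the same factor is bought with one more power of [japanese w],
    hence [q.+1]. *)
Lemma step_error_dbound k : exists C q, 0 <= C /\
  forall (I : finType) (pt : I -> P) (chi : I -> P -> R) n,
  (forall w : P,
  (exists2 v0, chi v0 w = 1 /\ (forall i, `|w ord0 i - pt v0 ord0 i| <= n.+1%:R^-1) &
       forall v, v != v0 -> chi v w = 0) \/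
     ((forall v, chi v w = 0) /\ n.+1%:R <= japanese w)) ->
  forall w, dbound k (fun x => C * n.+1%:R^-1 * japanese w ^+ q * japanese x ^- k)
    (step_error pt chi w).
Proof.
have [C [q [C0 HC]]] := Psi_bound k; have [L [r [L0 HL]]] := Psi_lipschitz k.
exists (C + L), (maxn q.+1 r); split; first exact: addr_ge0.
move=> I pt chi n chiP w.
have n0 : 0 < (n.+1%:R : R)^-1 by rewrite invr_gt0.
have n1 : (n.+1%:R : R)^-1 <= 1 by rewrite invf_le1// ler1n.
have [[v -> wv]|[-> jw]] := step_error_cases chiP w.
  apply: dbound_le (HL w (pt v) n.+1%:R^-1 _ wv); last by rewrite ltW.
  move=> x; apply: ler_wpM2r; first by rewrite invr_ge0 ltW ?japaneseX_gt0.
  apply: ler_pM; rewrite ?mulr_ge0 ?exprn_ge0 ?japanese_ge0 ?(ltW n0)//.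
    by apply: ler_wpM2r; rewrite ?(ltW n0)// lerDr.
  by apply: japaneseX_le; exact: leq_maxr.
apply: dbound_le (HC w) => x.
apply: ler_wpM2r; first by rewrite invr_ge0 ltW ?japaneseX_gt0.
rewrite -mulrA; apply: ler_pM; rewrite ?exprn_ge0 ?japanese_ge0 ?lerDl//.
apply: (@le_trans _ _ (n.+1%:R^-1 * japanese w ^+ q.+1)); last first.
  by apply: ler_wpM2l; [exact: ltW|apply: japaneseX_le; exact: leq_maxl].
rewrite exprS mulrA ler_peMl ?exprn_ge0 ?japanese_ge0//.
by rewrite ler_pdivlMl ?mulr1// ltr0n.
Qed.

Lemma weighted_rapid (m f : P -> R[i]) C q : rapid m -> cmeasurable f ->
  (forall w, modulus (f w) <= C * japanese w ^+ q) -> weighted (fun w => m w * f w).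
Proof.
move=> rm mf fC; have [A A0 HA] := rapid_weight q rm; have [mm _] := rm.
have C0 : 0 <= C.
  by have := le_trans (modulus_ge0 _) (fC 0); rewrite pmulr_lge0// japaneseX_gt0.
split; first exact: cmeasurableM.
exists (C * A) => w; rewrite modulusM.
apply: (le_trans (ler_wpM2l (modulus_ge0 _) (fC w))).
by rewrite mulrCA -mulrA; apply: ler_wpM2l.
Qed.

Lemma rapid_conj (m : P -> R[i]) : rapid m -> rapid (fun w => conjc (m w)).
Proof.
move=> [mm rm]; split; first exact: cmeasurable_conj.
by move=> N; have [C HC] := rm N; exists C => w; rewrite modulus_conj.
Qed.

Lemma weightedZr n (f : 'rV[R]_n -> R[i]) (c : R[i]) : weighted f -> weighted (fun x => f x * c).
Proof. by move=> /(weightedZ c); congr weighted; apply/funext => x; rewrite mulrC. Qed.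

Variable m : P -> R[i].
Hypothesis rm : rapid m.

Lemma schwartz_superposition (Phi : P -> E -> R[i]) :
  (forall w, smooth (Phi w)) ->
  (forall s x, cmeasurable (fun w => cpartials s (Phi w) x)) ->
  (forall k, exists C q, forall w,
    dbound k (fun x => C * japanese w ^+ q * japanese x ^- k) (Phi w)) ->
  schwartz (fun x => cintegral (fun w => m w * Phi w x)).
Proof.
move=> sPhi mPhi bPhi; apply/schwartzP; split.
  have [M M0 HM] := superposition_dbound d rm 0.
  by have [] := HM Phi sPhi mPhi bPhi.
move=> N k; have [C [q HC]] := bPhi (maxn N k).
have [M M0 HM] := superposition_dbound d rm q.
have [_ /(_ _ _ HC) H] := HM Phi sPhi mPhi bPhi.
exists (M * C); apply: dbound_leq (leq_maxl N k) _; apply: dbound_le H => x.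
have C0 : 0 <= C.
  have := dbound_ge0 0 (HC 0); rewrite -mulrA pmulr_lge0//.
  by rewrite mulr_gt0// ?invr_gt0 japaneseX_gt0.
by apply: ler_wpM2l; [exact: mulr_ge0|exact/japaneseVX_le/leq_maxr].
Qed.

(* Riemann sums over the grid; their error is [O(1/(n+1))] in every seminorm. *)
Lemma tempered_superposition :
  u (fun x => cintegral (fun w => m w * Psi w x)) = cintegral (fun w => conjc (m w) * u (Psi w)).
Proof.
have [K [k [K0 HK]]] := tempered_bound tu.
have [C [q [C0 HC]]] := step_error_dbound k.
have [M M0 HM] := superposition_dbound d rm q.
have [A A0 HA] := rapid_weight q rm; have [mm _] := rm.
have [B [r [B0 HB]]] := tempered_family_bound.
have sP w := schwartz_smooth (sPsi w).
have bP : forall k, exists C q, forall w,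
    dbound k (fun x => C * japanese w ^+ q * japanese x ^- k) (Psi w).
  by move=> k'; have [C' [q' [_ H]]] := Psi_bound k'; exists C', q'.
set lhs := u _; set rhs := cintegral _.
pose D := K * (M * C) + K * C * A * weight_mass R p.
suff key n : modulus (lhs - rhs) <= D * n.+1%:R^-1.
  apply/eqP; rewrite -subr_eq0 -modulus_eq0 eq_le modulus_ge0 andbT leNgt; apply/negP => e0.
  move: key; set e := modulus _ in e0 *; move=> key.
  have D0 : 0 <= D.
    have := le_trans (ltW e0) (key 0%N); by rewrite invr1 mulr1.
  have [n Hn] : exists n, D / e < n.+1%:R.
    exists (Num.truncn (D / e)); have /andP[_ h] := truncn_itv (divr_ge0 D0 (ltW e0)); exact: h.
  have := key n; rewrite ler_pdivlMr ?ltr0n// leNgt => /negP; apply.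
  by rewrite mulrC -ltr_pdivrMr.
have [I [pt [chi [mchi chi01 chiP]]]] := grid_exists R p n.
have sE := schwartz_step_error pt chi.
have bE : forall k, exists C q, forall w,
    dbound k (fun x => C * japanese w ^+ q * japanese x ^- k) (step_error pt chi w).
  move=> k'; have [C' [q' [_ H]]] := step_error_dbound k'.
  by exists (C' * n.+1%:R^-1), q' => w; exact: H chiP w.
have mE := cmeasurable_step_error pt mchi.
have sI := schwartz_superposition (fun w => schwartz_smooth (sE w)) mE bE.
have [_ /(_ _ _ (HC _ _ _ _ chiP)) dE] := HM _ (fun w => schwartz_smooth (sE w)) mE bE.
pose c v := cintegral (fun w => m w * (chi v w)%:C).
have wchi v : weighted (fun w => m w * (chi v w)%:C).
  apply: (@weighted_rapid _ _ 1 0) => //; first exact: cmeasurable_real.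
  move=> w; rewrite modulus_real expr0 mulr1; have /andP[h0 h1] := chi01 v w.
  by rewrite ger0_norm.
have wE x : weighted (fun w => m w * step_error pt chi w x).
  have [C' [q' H]] := bE 0%N.
  apply: (@weighted_rapid _ _ (C' * japanese x ^- 0) q') => //.
    by have := mE [::] x; under eq_fun do rewrite cpartials_nil.
  by move=> w; rewrite mulrAC; exact: dbound0 (H w).
(* A finite sum, on which [u] acts by antilinearity, plus an error; [c v] is the integral of [m]
   over the cell [v]. *)
have decomp : (fun x => cintegral (fun w => m w * Psi w x)) =
    fun x => 1 * cintegral (fun w => m w * step_error pt chi w x) +
      \sum_v c v * Psi (pt v) x.
  apply/funext => x; rewrite mul1r.
  under [X in _ + X]eq_bigr => v _ do rewrite -cintegralZr//.
  rewrite -cintegral_sum; last by move=> v; exact: weightedZr.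
  rewrite -cintegralD//; last first.
    by apply: weighted_sum => v; exact: weightedZr.
  apply: cintegral_eq => w; rewrite /step_error mulrBr mulr_sumr.
  rewrite (eq_bigr (fun v => m w * (chi v w)%:C * Psi (pt v) x)) ?subrK// => v _.
  by rewrite mulrA.
have wPsi : weighted (fun w => conjc (m w) * u (Psi w)).
  by apply: (weighted_rapid (rapid_conj rm)) HB; exact: cmeasurable_tempered_family.
have lhsE : lhs = u (fun x => cintegral (fun w => m w * step_error pt chi w x)) +
    \sum_v conjc (c v) * u (Psi (pt v)).
  rewrite /lhs decomp (tempered_antilinear tu)//; last first.
    by apply: schwartz_sum => v; exact: schwartzZ.
  by rewrite rmorph1 mul1r tempered_sum.
have uE w : u (step_error pt chi w) = u (Psi w) - \sum_v (chi v w)%:C * u (Psi (pt v)).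
  rewrite temperedB//; last exact: schwartz_step_sum.
  rewrite tempered_sum//; congr (_ - _); apply: eq_bigr => v _.
  by rewrite -[conjc _]/((_)^*)%C conjc_real.
have cE v : conjc (c v) = cintegral (fun w => conjc (m w) * (chi v w)%:C).
  rewrite -cintegral_conj//; apply: cintegral_eq => w.
  by rewrite conjcM conjc_real.
have wcchi v : weighted (fun w => conjc (m w) * (chi v w)%:C).
  have := weighted_conj (wchi v); congr weighted; apply/funext => w.
  by rewrite conjcM conjc_real.
have sumE : \sum_v conjc (c v) * u (Psi (pt v)) =
    cintegral (fun w => \sum_v conjc (m w) * (chi v w)%:C * u (Psi (pt v))).
  rewrite cintegral_sum; last by move=> v; exact: weightedZr.
  by apply: eq_bigr => v _; rewrite cE cintegralZr.
(* The finite sums cancel. Of the two errors left, one is inside [u] and the other inside the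
   integral; both are [O(1/(n+1))] by the uniform seminorm bound. *)
have -> : lhs - rhs = u (fun x => cintegral (fun w => m w * step_error pt chi w x)) -
    cintegral (fun w => conjc (m w) * u (step_error pt chi w)).
  rewrite lhsE -addrA; congr (_ + _); rewrite sumE /rhs -opprB; congr (- _).
  rewrite -cintegralB//; last by apply: weighted_sum => v; exact: weightedZr.
  apply: cintegral_eq => w; rewrite uE mulrBr mulr_sumr; congr (_ - _).
  by apply: eq_bigr => v _; rewrite mulrA.
apply: (le_trans (modulusB _ _)); rewrite /D mulrDl; apply: lerD.
  apply: (le_trans (HK _ _ sI dE)).
  by rewrite !mulrA.
rewrite [leRHS]mulrAC; apply: cintegral_le.
  have wuE : weighted (fun w => conjc (m w) * u (step_error pt chi w)).
    rewrite (_ : (fun w => _) = fun w => conjc (m w) * u (Psi w) -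
      \sum_v conjc (m w) * (chi v w)%:C * u (Psi (pt v))).
      by apply: weightedB => //; apply: weighted_sum => v; exact: weightedZr.
    apply/funext => w; rewrite uE mulrBr mulr_sumr; congr (_ - _).
    by apply: eq_bigr => v _; rewrite mulrA.
  by have [] := wuE.
move=> w; rewrite modulusM modulus_conj.
apply: (le_trans (ler_wpM2l (modulus_ge0 _) (HK _ _ (sE w) (HC _ _ _ _ chiP w)))).
rewrite (_ : modulus (m w) * _ = (K * C * n.+1%:R^-1) * (modulus (m w) * japanese w ^+ q)); last by ring.
rewrite (_ : _ * weight w = (K * C * n.+1%:R^-1) * (A * weight w)); last by ring.
by apply: ler_wpM2l => //; rewrite mulr_ge0 ?mulr_ge0// invr_ge0.
Qed.

End exchange.

(** * Inversion of the short-time Fourier transform *)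

Section tfshift_family.
Variables (R : realType) (d : nat).
Local Notation E := 'rV[R]_d.
Local Notation E2 := 'rV[R]_(d + d).
Implicit Types (phi psi : E -> R[i]) (w : E2).

Lemma smooth_translation v phi : smooth phi -> smooth (translation v phi) /\
  forall s, cpartials s (translation v phi) = translation v (cpartials s phi).
Proof.
move=> sp; have [h1 h2] := smooth_affine (- v) 1 sp.
have e (f : E -> R[i]) : translation v f = fun x => f (- v + 1 *: x).
  by apply/funext => x; rewrite /translation scale1r addrC.
split=> [|s]; first by rewrite e.
by rewrite e h2; apply/funext => x; rewrite expr1n mul1r e.
Qed.

Lemma translation_lipschitz phi k : schwartz phi -> exists2 C, 0 <= C &
  forall (v : E) delta, 0 <= delta <= 1 -> (forall i, `|v ord0 i| <= delta) ->
  dbound k (fun x => C * delta * japanese x ^- k) (fun x => translation v phi x - phi x).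
Proof.
move=> sp; have [A A0 HA] := schwartz_dbound k.+1 k sp.
have sm := schwartz_smooth sp.
exists (2 * (A * (2 ^+ k * d.+1%:R ^+ k)) * d%:R).
  by rewrite !mulr_ge0// exprn_ge0.
move=> v delta /andP[d0 d1] vd s sk x.
have [st ct] := smooth_translation v sm.
rewrite cpartialsB// ct /translation.
have jv : japanese (- v) <= d.+1%:R.
  rewrite japaneseN -[leRHS]mulr1; apply: japanese_le_max => // i; exact: le_trans (vd i) d1.
have := lipschitz_path (f := cpartials s phi) (f' := fun j => cpartials (j :: s) phi)
  (x := x) (v := - v) (M := A * (2 ^+ k * d.+1%:R ^+ k) * japanese x ^- k)
  (fun j => smooth_cderive sm s j).
have H : forall j (p : E), (forall i, `|p ord0 i - x ord0 i| <= `|(- v) ord0 i|) ->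
    modulus (cpartials (j :: s) phi p) <= A * (2 ^+ k * d.+1%:R ^+ k) * japanese x ^- k.
  move=> j p px; apply: (le_trans (HA (j :: s) _ p)) => //; rewrite -mulrA; apply: ler_wpM2l => //.
  apply: (le_trans (japaneseVX_path k px)).
  apply: ler_wpM2r; first by rewrite invr_ge0 ltW ?japaneseX_gt0.
  by apply: ler_wpM2l; rewrite ?exprn_ge0//; apply: lerXn2r; rewrite ?nnegrE ?japanese_ge0.
move=> /(_ H) {}H; apply: (le_trans H).
rewrite [leRHS](_ : _ = 2 * (A * (2 ^+ k * d.+1%:R ^+ k) * japanese x ^- k) * (d%:R * delta)); last by ring.
apply: ler_wpM2l.
  by rewrite !mulr_ge0 ?exprn_ge0// invr_ge0 ltW ?japaneseX_gt0.
rewrite mulr_natl -[X in delta *+ X]card_ord -sumr_const; apply: ler_sum => i _.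
by rewrite mxE normrN.
Qed.

(** The function itself is small only at the cost of [japanese x]; in its derivatives an entry of
    [v] comes out as a factor. *)
Lemma expi_sub1_dbound k (v : E) delta : 0 <= delta <= 1 -> (forall i, `|v ord0 i| <= delta) ->
  smooth (fun x => expi (dotv x v) - 1) /\
  dbound k (fun x => (2 * d%:R + 1) * delta * japanese x) (fun x => expi (dotv x v) - 1).
Proof.
move=> /andP[d0 d1] vd.
have [se ce] := smooth_expi v; have [s1 c1] := smooth_cst d (1 : R[i]).
have e : (fun x : E => expi (dotv x v) - 1) = fun x => (-1) * 1 + expi (dotv x v).
  by apply/funext => x; rewrite mulr1 addrC.
have [sl cl] := smooth_lincomb (-1) s1 se.
rewrite e; split=> // s sk x; rewrite cl c1 ce.
case: s sk => [|j s] sk.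
  rewrite big_nil mul1r mulr1 addrC.
  have := expi_lipschitz x 0 v; rewrite add0r dotv0l expi0 dotvC => H.
  apply: (le_trans H).
  have -> : (2 * d%:R + 1) * delta * japanese x = 2 * japanese x * (d%:R * delta) + delta * japanese x by ring.
  rewrite ler_wpDr//; first by rewrite mulr_ge0// japanese_ge0.
  apply: ler_wpM2l; first by rewrite mulr_ge0// japanese_ge0.
  rewrite mulr_natl -[X in delta *+ X]card_ord -sumr_const; exact: ler_sum.
rewrite mulr0 add0r modulusM modulus_expi mulr1 big_cons modulusM modulus_i.
apply: (@le_trans _ _ (delta * 1)).
  apply: ler_pM; rewrite ?modulus_ge0//.
  elim: s {sk} => [|i s IH]; first by rewrite big_nil modulus1.
  rewrite big_cons modulusM modulus_i -[leRHS]mulr1; apply: ler_pM; rewrite ?modulus_ge0//.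
  exact: le_trans (vd i) d1.
rewrite mulrAC [leRHS]mulrC; apply: ler_wpM2l => //.
by rewrite -[leLHS]mulr1 ler_pM ?japanese_ge1// lerDr mulr_ge0.
Qed.

(** The difference is written as one shift by [w] of a function [psi] that is small in every
    seminorm, so that [tfshift_dbound] applies. *)
Lemma tfshift_lipschitz phi k : schwartz phi -> exists C q, 0 <= C /\
  forall w w' delta, 0 <= delta <= 1 -> (forall i, `|w ord0 i - w' ord0 i| <= delta) ->
  dbound k (fun x => C * delta * japanese w ^+ q * japanese x ^- k)
    (fun x => tfshift w phi x - tfshift w' phi x).
Proof.
move=> sp; have sm := schwartz_smooth sp.
have [L L0 HL] := translation_lipschitz k sp.
have [D D0 HD] := @tfshift_dbound R d k.
have [A A0 HA] := schwartz_dbound k.+1 k.+1 sp.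
pose B := 2 ^+ k * ((2 * d%:R + 1) * (A * (2 ^+ k.+1 * d.+1%:R ^+ k.+1))) +
  (2 * d%:R * (A * (2 ^+ k.+1 * d.+1%:R ^+ k.+1)) + L).
have B0 : 0 <= B by rewrite !addr_ge0 ?mulr_ge0 ?addr_ge0 ?mulr_ge0 ?exprn_ge0.
exists (D * B), (2 * k).+1; split; first exact: mulr_ge0.
move=> w w' delta d01 ww'; have [d0 d1] := andP d01.
pose v1 := lsubmx (w' - w); pose v2 := rsubmx (w' - w).
have v1d i : `|v1 ord0 i| <= delta.
  by have := ww' (lshift d i); rewrite distrC /v1 !mxE.
have v2d i : `|v2 ord0 i| <= delta.
  by have := ww' (rshift d i); rewrite distrC /v2 !mxE.
pose T := translation v1 phi; pose c := expi (dotv (lsubmx w) v2).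
have [sT _] := smooth_translation v1 sm; rewrite -/T in sT.
have [sE bE] := expi_sub1_dbound k d01 v2d.
have jv : japanese v1 <= d.+1%:R.
  rewrite -[leRHS]mulr1; apply: japanese_le_max => // i; exact: le_trans (v1d i) d1.
have TA : dbound k.+1 (fun x => (A * (2 ^+ k.+1 * d.+1%:R ^+ k.+1)) * japanese x ^- k.+1) T.
  apply: dbound_le (dbound_translation v1 sm HA) => x.
  rewrite [leLHS]mulrA; apply: ler_wpM2r; first by rewrite invr_ge0 ltW ?japaneseX_gt0.
  apply: ler_wpM2l => //; apply: ler_wpM2l; first exact: exprn_ge0.
  by apply: lerXn2r; rewrite ?nnegrE ?japanese_ge0.
have sET := smoothM sE sT.
have b1 := dboundM sE sT bE (dbound_leq (leqnSn k) TA).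
have sd : smooth (fun x => (-1) * T x + phi x) by case: (smooth_lincomb (-1) sT sm).
have b3 : dbound k (fun x => L * delta * japanese x ^- k) (fun x => (-1) * T x + phi x).
  have := dboundZ (-1) _ (HL v1 delta d01 v1d).
  have [sd' _] := smooth_lincomb (-1) sm sT.
  have e : (fun x => translation v1 phi x - phi x) = fun x => -1 * phi x + T x.
    by apply/funext => x; rewrite mulN1r addrC.
  rewrite {1}e => /(_ sd').
  rewrite modulusN modulus1; under [X in dbound _ X _ -> _]eq_fun do rewrite mul1r.
  by congr dbound; apply/funext => x; rewrite !mulN1r opprB addrC.
(* This is [phi x - c * expi (dotv x v2) * T x], arranged so that each summand has a small factor.
   The first one loses a power of decay in [x], and [1 - c] costs one power of [japanese w]. *)
pose psi x := (- c) * ((expi (dotv x v2) - 1) * T x) + ((1 - c) * T x + ((-1) * T x + phi x)).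
have [s2 _] := smooth_lincomb (1 - c) sT sd.
have [spsi _] := smooth_lincomb (- c) sET s2.
have b2 := dbound_lincomb (1 - c) sT sd (dbound_leq (leqnSn k) TA) b3.
have bpsi := dbound_lincomb (- c) sET s2 b1 b2.
have -> : (fun x => tfshift w phi x - tfshift w' phi x) = tfshift w psi.
  apply/funext => x; rewrite /tfshift /modulation /translation.
  rewrite /psi /T /c /translation.
  have -> : rsubmx w' = rsubmx w + v2 by apply/rowP => i; rewrite !mxE; ring.
  have -> : lsubmx w' = lsubmx w + v1 by apply/rowP => i; rewrite !mxE; ring.
  have -> : dotv x (rsubmx w + v2) = dotv x (rsubmx w) + (dotv (lsubmx w) v2 + dotv (x - lsubmx w) v2).
    by rewrite -dotvDl [lsubmx w + _]addrC subrK dotvDr.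
  rewrite 2!expiD opprD [x + (_ + _)]addrA; by ring.
have {}bpsi : dbound k (fun x => B * delta * japanese w * japanese x ^- k) psi.
  apply: dbound_le bpsi => x.
  have jx := japaneseX_gt0 x k.
  have jw := japanese_ge1 w.
  have cE : modulus (1 - c) <= 2 * d%:R * delta * japanese w.
    have := expi_lipschitz (lsubmx w) 0 v2; rewrite add0r dotv0l expi0 [dotv v2 _]dotvC modulus_distC -/c => H.
    apply: (le_trans H).
    have -> : 2 * d%:R * delta * japanese w = 2 * japanese w * (d%:R * delta) by ring.
    apply: ler_pM; rewrite ?mulr_ge0 ?japanese_ge0 ?sumr_ge0//.
      by apply: ler_wpM2l => //; rewrite -[in leRHS](hsubmxK w) japanese_row_mxl.
    rewrite mulr_natl -[X in delta *+ X]card_ord -sumr_const; exact: ler_sum.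
  rewrite modulusN modulus_expi mul1r /B.
  set q := A * (2 ^+ k.+1 * _).
  have q0 : 0 <= q by rewrite /q !mulr_ge0 ?exprn_ge0.
  have -> : japanese x ^- k.+1 = (japanese x)^-1 * japanese x ^- k by rewrite exprS invfM.
  have jxV1 : (japanese x)^-1 <= 1 by rewrite invf_le1 ?japanese_gt0// japanese_ge1.
  have jxV0 : 0 < (japanese x)^-1 by rewrite invr_gt0 japanese_gt0.
  have jx0 : 0 < japanese x ^- k by rewrite invr_gt0.
  have -> : 2 ^+ k * ((2 * d%:R + 1) * delta * japanese x * (q * ((japanese x)^-1 * japanese x ^- k))) =
     (2 ^+ k * ((2 * d%:R + 1) * q)) * delta * (japanese x * (japanese x)^-1) * japanese x ^- k.
    by ring.
  rewrite mulfV ?gt_eqF ?japanese_gt0//.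
  have p0 : 0 <= 2 ^+ k * ((2 * d%:R + 1) * q) by rewrite !mulr_ge0 ?exprn_ge0 ?addr_ge0 ?mulr_ge0.
  move: (2 ^+ k * ((2 * d%:R + 1) * q)) p0 => r r0.
  rewrite [leRHS](_ : _ = r * delta * japanese w * japanese x ^- k +
    (2 * d%:R * q * delta * japanese w * japanese x ^- k + L * delta * japanese w * japanese x ^- k)); last by ring.
  apply: lerD.
    apply: ler_wpM2r; first exact: ltW.
    by apply: ler_wpM2l => //; exact: mulr_ge0.
  apply: lerD.
    rewrite mulrA; apply: (@le_trans _ _ (modulus (1 - c) * q * (1 * japanese x ^- k))).
      apply: ler_wpM2l; first by rewrite mulr_ge0 ?modulus_ge0.
      by apply: ler_wpM2r => //; exact: ltW.
    rewrite mul1r; apply: ler_wpM2r; first exact: ltW.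
    rewrite [leRHS](_ : _ = (2 * d%:R * delta * japanese w) * q); last by ring.
    exact: ler_wpM2r.
  apply: ler_wpM2r; first exact: ltW.
  by rewrite -[leLHS]mulr1; apply: ler_wpM2l => //; exact: mulr_ge0.
have := HD w (B * delta * japanese w) psi spsi bpsi.
apply: dbound_le => x.
by rewrite le_eqVlt; apply/orP; left; apply/eqP; rewrite exprS; ring.
Qed.

End tfshift_family.

(** * Decay of the coefficients and the inversion formula *)

Section STFT_inversion.
Variables (R : realType) (d : nat).
Local Notation E := 'rV[R]_d.
Local Notation E2 := 'rV[R]_(d + d).
Implicit Types (phi psi g : E -> R[i]) (w : E2).

Lemma mulzC_conj (z : R[i]) : z * conjc z = (modulus z ^+ 2)%:C.
Proof.
case: z => a b; rewrite /modulus /Normc.normc sqr_sqrtr ?addr_ge0 ?sqr_ge0//.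
by apply: complex_ext => /=; ring.
Qed.

Lemma energy_neq0 phi x1 : schwartz phi -> phi x1 != 0 ->
  cintegral (fun y => phi y * conjc (phi y)) != 0.
Proof.
move=> sphi p0; have m0 : 0 < modulus (phi x1) by rewrite modulus_gt0.
have [L L0 HL] := nice_lipschitz (schwartz_nice sphi).
have [mphi [C HC]] := schwartz_weighted sphi.
(* On the box of half-side [delta] around [x1], [phi] varies by at most half of its modulus at
   [x1]. *)
pose delta := modulus (phi x1) / (2 * (L * d%:R + 1)).
have Ld : 0 <= L * d%:R by rewrite mulr_ge0.
have L1 : 0 < 2 * (L * d%:R + 1) by rewrite mulr_gt0// ltr_wpDl.
have delta0 : 0 < delta by rewrite divr_gt0.
have C0 : 0 <= C.
  by have := le_trans (modulus_ge0 _) (HC 0); rewrite pmulr_lge0// weight_gt0.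
have H : 0 < \int[lebesgue_rV R d]_x (modulus (phi x) ^+ 2).
  apply: (@Rintegral_gt0 _ _ _ (C ^+ 2) ((modulus (phi x1) / 2) ^+ 2) delta x1) => //.
  - by apply: measurable_funX; exact: measurable_modulus.
  - by move=> x; rewrite exprn_ge0// modulus_ge0.
  - move=> x; apply: (@le_trans _ _ ((C * weight x) ^+ 2)).
      by apply: lerXn2r; rewrite ?nnegrE ?modulus_ge0 ?mulr_ge0 ?weight_ge0.
    rewrite exprMn; apply: ler_wpM2l; first exact: exprn_ge0.
    by rewrite expr2 ler_piMr ?weight_ge0 ?weight_le1.
  - by rewrite exprn_gt0// divr_gt0.
  move=> x xd; apply: lerXn2r; rewrite ?nnegrE ?modulus_ge0 ?divr_ge0 ?(ltW m0)//.
  have := HL x1 (x - x1); rewrite [x1 + _]addrC subrK => h.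
  have h1 := modulusB (phi x) (phi x - phi x1); rewrite subKr in h1.
  have h2 : L * (\sum_i `|(x - x1) ord0 i|) <= L * (d%:R * delta).
    apply: ler_wpM2l => //; rewrite mulr_natl -[X in delta *+ X]card_ord -sumr_const.
    by apply: ler_sum => i _; rewrite !mxE.
  have h3 : delta * (2 * (L * d%:R + 1)) = modulus (phi x1) by rewrite mulfVK// gt_eqF.
  rewrite mulrA in h2.
  move: h h1 h2 h3; move: (modulus (phi x)) (modulus _) (\sum_i _) => a b s.
  by move=> *; nra.
apply/eqP => /(congr1 (@complex.Re R)) /=.
under eq_Rintegral do rewrite mulzC_conj /=.
by move=> e; rewrite e ltxx in H.
Qed.

Lemma cmeasurable_tfshift d' (T : measurableType d') psi (Z : T -> E2) (Y : T -> E) :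
  cmeasurable psi -> measurable_fun [set: T] Z -> measurable_fun [set: T] Y ->
  cmeasurable (fun t => tfshift (Z t) psi (Y t)).
Proof.
move=> mpsi mZ mY; rewrite /tfshift /modulation /translation; apply: cmeasurableM.
  apply: cmeasurable_expi; apply: measurable_dotv => //.
  by apply: (measurableT_comp (f := (@rsubmx R 1 d d))) => //; exact: measurable_rsubmx.
apply: (cmeasurable_comp mpsi); apply: measurable_rVB => //.
by apply: (measurableT_comp (f := (@lsubmx R 1 d d))) => //; exact: measurable_lsubmx.
Qed.

(** The short-time Fourier transform of a function [g], as opposed to that of a distribution. *)
Definition STFT_coeff phi g w := cintegral (fun y => g y * conjc (tfshift w phi y)).

Lemma STFT_coeff_fourier phi g w : STFT_coeff phi g w =
  fourier (fun y => g y * conjc (translation (lsubmx w) phi y)) (- rsubmx w).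
Proof.
apply: cintegral_eq => y; rewrite /tfshift /modulation conjcM dotvNr expiN.
by ring.
Qed.

Lemma windowed_dbound phi g N M : schwartz phi -> schwartz g -> exists2 C, 0 <= C &
  forall x0, dbound N (fun y => C * japanese x0 ^- M * weight y)
    (fun y => g y * conjc (translation x0 phi y)).
Proof.
move=> sphi sg; have sm := schwartz_smooth sphi.
have [A A0 HA] := schwartz_dbound N (2 * d + M) sg.
have [B B0 HB] := schwartz_dbound N M sphi.
exists (2 ^+ N * (A * (B * 2 ^+ M))); first by rewrite !mulr_ge0 ?exprn_ge0.
move=> x0; have [st ct] := smooth_translation x0 sm.
have [sc cc] := smooth_conj st.
have bc : dbound N (fun x => B * japanese (x - x0) ^- M) (fun y => conjc (translation x0 phi y)).
  by move=> s sN x; rewrite cc modulus_conj ct; exact: HB.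
apply: dbound_le (dboundM (schwartz_smooth sg) sc HA bc) => x.
rewrite -!mulrA; apply: ler_wpM2l; first exact: exprn_ge0.
apply: ler_wpM2l => //; rewrite mulrCA; apply: ler_wpM2l => //.
rewrite exprD invfM.
have P : japanese (x - x0) ^- M <= 2 ^+ M * japanese x ^+ M * japanese x0 ^- M.
  rewrite ler_pdivlMr ?japaneseX_gt0// mulrC ler_pdivrMr ?japaneseX_gt0//.
  rewrite -!exprMn; apply: lerXn2r; rewrite ?nnegrE ?mulr_ge0 ?japanese_ge0//.
  by rewrite -{1}(subKr x x0) (le_trans (japaneseD _ _))// japaneseN mulrA.
apply: (@le_trans _ _ (japanese x ^- (2 * d) * japanese x ^- M *
    (2 ^+ M * japanese x ^+ M * japanese x0 ^- M))).
  by apply: ler_wpM2l => //; rewrite mulr_ge0// invr_ge0 ltW ?japaneseX_gt0.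
rewrite [leLHS](_ : _ = 2 ^+ M * (japanese x0 ^- M * japanese x ^- (2 * d))); last first.
  by field; rewrite !expf_neq0// gt_eqF// japanese_gt0.
apply: ler_wpM2l; first exact: exprn_ge0.
by apply: ler_wpM2l; [rewrite invr_ge0 ltW ?japaneseX_gt0|exact: japanese_weight].
Qed.

(** The product of [g] with a translated window is small when the two are far apart, and the Fourier
    transform of that product decays in the frequency; the two brackets together dominate
    [japanese w]. *)
Lemma rapid_STFT_coeff phi g : schwartz phi -> schwartz g -> rapid (STFT_coeff phi g).
Proof.
move=> sphi sg; have sm := schwartz_smooth sphi; split.
  apply: cmeasurable_cintegral; apply: cmeasurableM.
    apply: (cmeasurable_comp (f := g)); last exact: measurable_snd.
    exact/smooth_cmeasurable/schwartz_smooth.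
  apply: cmeasurable_conj; apply: cmeasurable_tfshift.
  - exact: smooth_cmeasurable.
  - exact: measurable_fst.
  - exact: measurable_snd.
move=> N; have [C C0 HC] := windowed_dbound N.+1 N sphi sg.
exists (C * (weight_mass R d * d.+1%:R ^+ N)) => w; rewrite STFT_coeff_fourier.
have sw : smooth (fun y => g y * conjc (translation (lsubmx w) phi y)).
  apply: smoothM; first exact: schwartz_smooth.
  by have [h _] := smooth_translation (lsubmx w) sm; case: (smooth_conj h).
apply: (le_trans (fourier_decay _ sw (HC (lsubmx w)))); rewrite japaneseN.
rewrite (_ : C * _ * _ * _ = C * (weight_mass R d * d.+1%:R ^+ N) *
  (japanese (lsubmx w) ^- N * japanese (rsubmx w) ^- N)); last by ring.
apply: ler_wpM2l.
  by apply: mulr_ge0 => //; apply: mulr_ge0; [exact/ltW/weight_mass_gt0|exact: exprn_ge0].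
rewrite -invfM lef_pV2 ?posrE ?mulr_gt0 ?japaneseX_gt0// -exprMn.
apply: lerXn2r; rewrite ?nnegrE ?mulr_ge0 ?japanese_ge0//.
by rewrite -[in leLHS](hsubmxK w); exact: japanese_row_mx.
Qed.

Lemma tfshift_modulus phi w : schwartz phi -> exists C, forall w x, modulus (tfshift w phi x) <= C.
Proof.
move=> sphi; have [mphi [C HC]] := schwartz_weighted sphi; exists C => w' x.
rewrite /tfshift /modulation modulusM modulus_expi mul1r (le_trans (HC _))//.
rewrite ler_piMr ?weight_le1//.
by have := le_trans (modulus_ge0 _) (HC 0); rewrite pmulr_lge0// weight_gt0.
Qed.

Variable K : R[i].
Hypothesis HK : forall (f : E -> R[i]) x, nice f ->
  cintegral (fun s => fourier f s * expi (- dotv x s)) = K * f x.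

(** Integration in the frequency first: Fourier inversion at [x] leaves the squared modulus of the
    window at [x - x0], and the integral over the position [x0] gives its energy. *)
Lemma STFT_inversion phi g x : schwartz phi -> schwartz g ->
  cintegral (fun w => STFT_coeff phi g w * tfshift w phi x) =
  K * cintegral (fun y => phi y * conjc (phi y)) * g x.
Proof.
move=> sphi sg; have sm := schwartz_smooth sphi.
have [C HC] := tfshift_modulus (0 : E2) sphi.
have n1 : (-1 : R) != 0 by rewrite oppr_eq0 oner_neq0.
have mphi := smooth_cmeasurable sm.
rewrite cintegral_row_mx; last first.
  apply: (@weighted_rapid _ _ _ _ C 0); first exact: rapid_STFT_coeff.
    by apply: cmeasurable_tfshift => //; exact: measurable_cst.
  by move=> w; rewrite mulr1.
pose f x0 y := g y * conjc (translation x0 phi y).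
have nf x0 : nice (f x0).
  have [A A0 HA] := windowed_dbound (2 * d).+2 0 sphi sg; split.
    apply: smoothM; first exact: schwartz_smooth.
    by have [h _] := smooth_translation x0 sm; case: (smooth_conj h).
  by exists (A * japanese x0 ^- 0); exact: HA.
transitivity (cintegral (fun x0 => K * (phi (x - x0) * conjc (phi (x - x0))) * g x)).
  apply: cintegral_eq => x0.
  transitivity (cintegral (fun w2 : E => fourier (f x0) (0 + (-1) *: w2) * expi (- dotv x (0 + (-1) *: w2))) * phi (x - x0)).
    rewrite -cintegralZr; last first.
      have h := weighted_affine 0 n1 (weighted_expi (- x) (weighted_fourier (nf x0))).
      move: h; congr weighted; apply/funext => w2.
      by rewrite mulrC; congr (_ * expi _); rewrite dotvNr dotvC.
    apply: cintegral_eq => w2; rewrite STFT_coeff_fourier /tfshift /modulation /translation.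
    rewrite !row_mxKl !row_mxKr add0r scaleN1r dotvNr opprK -mulrA; congr (_ * _).
  rewrite (@cintegral_affine _ _ 0 (-1) (fun s => fourier (f x0) s * expi (- dotv x s)))//; last first.
    have h := weighted_expi (- x) (weighted_fourier (nf x0)).
    move: h; congr weighted; apply/funext => w2.
    by rewrite mulrC; congr (_ * expi _); rewrite dotvNr dotvC.
  rewrite normrN1 expr1n invr1 mul1r HK// /f /translation; by ring.
pose q y := phi y * conjc (phi y).
have wq : weighted q.
  have := weightedM (K := C) (schwartz_weighted sphi) (cmeasurable_conj mphi) _.
  move=> /(_ _)-h.
  have {}h : weighted (fun x => conjc (phi x) * phi x).
    apply: h => y; rewrite modulus_conj; have := HC 0 y.
    by rewrite /tfshift /modulation /translation modulusM modulus_expi mul1r linear0 subr0.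
  by move: h; congr weighted; apply/funext => y; rewrite mulrC.
transitivity (cintegral (fun x0 => K * g x * q (x + (-1) *: x0))).
  by apply: cintegral_eq => x0; rewrite scaleN1r /q; ring.
rewrite cintegralZ; last exact: weighted_affine.
rewrite cintegral_affine// normrN1 expr1n invr1 mul1r; by ring.
Qed.

(** [u] applied to the inversion formula for [g] and moved inside the integral by
    [tempered_superposition]; a distribution is thereby recovered from its transform. *)
Lemma tempered_STFT u phi g : tempered u -> schwartz phi -> schwartz g ->
  conjc (K * cintegral (fun y => phi y * conjc (phi y))) * u g =
  cintegral (fun w => conjc (STFT_coeff phi g w) * STFT phi u w).
Proof.
move=> tu sphi sg; rewrite -temperedZ//.
have HT k : exists C q, 0 <= C /\ forall w,
    dbound k (fun x => C * japanese w ^+ q * japanese x ^- k) (tfshift w phi).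
  have [C C0 HC] := @tfshift_dbound R d k; have [A A0 HA] := schwartz_dbound k k sphi.
  exists (C * A), (2 * k)%N; split; first exact: mulr_ge0.
  move=> w; rewrite [C * A * _]mulrAC; exact: HC (schwartz_smooth sphi) HA.
have := tempered_superposition tu (fun w => tfshift_schwartz w sphi) HT
  (fun k => tfshift_lipschitz k sphi) (rapid_STFT_coeff sphi sg).
move=> <-; congr u; apply/funext => x; exact/esym/STFT_inversion.
Qed.

End STFT_inversion.

(** * From the Gabor to the homogeneous wave front set *)

Section weyl_adjoint.
Variables (R : realType) (d : nat).
Local Notation E := 'rV[R]_d.
Local Notation E2 := 'rV[R]_(d + d).
Implicit Types (a b : E2 -> R[i]) (phi psi g : E -> R[i]) (h : R) (w : E2).

Lemma weighted_kern_integrand a h x y : symbol a -> h != 0 ->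
  weighted (fun xi : E => expi (dotv (x - y) xi) * a (h *: row_mx (2^-1 *: (x + y)) xi)).
Proof.
move=> ya h0; split; first by apply: cmeasurable_kern_integrand => //; exact: symbol_cmeasurable.
have [B B0 HB] := symbol_dilation_bound ya h0.
by exists B => xi; rewrite modulusM modulus_expi mul1r.
Qed.

Lemma conj_kern a h x y : symbol a -> h != 0 ->
  conjc (kern a h x y) = kern (@conjc R \o a) h y x.
Proof.
move=> ya h0; rewrite -cintegral_conj; last exact: weighted_kern_integrand.
apply: cintegral_eq => xi.
by rewrite conjcM -expiN -dotvNl opprB [x + y]addrC.
Qed.

Lemma kern_bounded a h : symbol a -> h != 0 -> exists2 C, 0 <= C & forall x y, modulus (kern a h x y) <= C.
Proof.
move=> ya h0; have [B B0 HB] := symbol_dilation_bound ya h0.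
exists (B * weight_mass R d); first by apply: mulr_ge0 => //; exact/ltW/weight_mass_gt0.
move=> x y; apply: cintegral_le; first by have [] := weighted_kern_integrand x y ya h0.
by move=> xi; rewrite modulusM modulus_expi mul1r.
Qed.

Lemma cmeasurable_kern d' (T : measurableType d') a h (X Y : T -> E) : symbol a ->
  measurable_fun [set: T] X -> measurable_fun [set: T] Y ->
  cmeasurable (fun t => kern a h (X t) (Y t)).
Proof.
move=> ya mX mY; apply: cmeasurable_cintegral.
apply: (@cmeasurable_kern_integrand R d _ _ a h (X \o fst) (Y \o fst) snd).
- exact: symbol_cmeasurable.
- by apply: measurableT_comp.
- by apply: measurableT_comp.
- exact: measurable_snd.
Qed.

Lemma cmeasurable_weyl_tfshift a h phi : symbol a -> cmeasurable phi ->
  cmeasurable (fun p : E2 * E => weyl (dilation h a) (tfshift p.1 phi) p.2).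
Proof.
move=> ya mphi; rewrite /weyl; apply: cmeasurableM; first exact: cmeasurable_cst.
apply: (@cmeasurable_cintegral R _ _ _ (fun (p : E2 * E) (q : E2) =>
  expi (dotv (p.2 - lsubmx q) (rsubmx q)) * dilation h a (row_mx (2^-1 *: (p.2 + lsubmx q)) (rsubmx q)) *
  tfshift p.1 phi (lsubmx q))).
have m1 : measurable_fun setT (fun t : (E2 * E) * E2 => t.1.1).
  exact: (measurableT_comp measurable_fst measurable_fst).
have m2 : measurable_fun setT (fun t : (E2 * E) * E2 => t.1.2).
  exact: (measurableT_comp measurable_snd measurable_fst).
have m3 : measurable_fun setT (fun t : (E2 * E) * E2 => (lsubmx t.2 : E)).
  by apply: (measurableT_comp (f := (@lsubmx R 1 d d))); [exact: measurable_lsubmx|exact: measurable_snd].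
have m4 : measurable_fun setT (fun t : (E2 * E) * E2 => (rsubmx t.2 : E)).
  by apply: (measurableT_comp (f := (@rsubmx R 1 d d))); [exact: measurable_rsubmx|exact: measurable_snd].
apply: cmeasurableM; last exact: cmeasurable_tfshift.
have := cmeasurable_kern_integrand h (symbol_cmeasurable ya) m2 m3 m4.
by [].
Qed.

(** The midpoint is symmetric in [x] and [y], so conjugating the kernel amounts to conjugating the
    symbol and exchanging the variables; the rest is Fubini's theorem. *)
Lemma weyl_adjoint a h g psi : symbol a -> h != 0 -> schwartz g -> schwartz psi ->
  cintegral (fun y => weyl (dilation h (@conjc R \o a)) g y * conjc (psi y)) =
  cintegral (fun x => g x * conjc (weyl (dilation h a) psi x)).
Proof.
move=> ya h0 sg sp; have yb := symbol_conj ya.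
rewrite (weyl_kernel yb h0 sg) (weyl_kernel ya h0 sp).
set c := (_ %:C); have cR : conjc c = c by rewrite /c conjc_real.
have [mg [G HG]] := schwartz_weighted sg; have [mp [P HP]] := schwartz_weighted sp.
have G0 : 0 <= G by have := le_trans (modulus_ge0 _) (HG 0); rewrite pmulr_lge0// weight_gt0.
have P0 : 0 <= P by have := le_trans (modulus_ge0 _) (HP 0); rewrite pmulr_lge0// weight_gt0.
have [C C0 HC] := kern_bounded yb h0; have [D D0 HD] := kern_bounded ya h0.
pose F (y x : E) := c * (kern (@conjc R \o a) h y x * g x * conjc (psi y)).
have mF : cmeasurable (fun p : E * E => F p.1 p.2).
  apply: cmeasurableM; first exact: cmeasurable_cst.
  apply: cmeasurableM; last first.
    by apply: cmeasurable_conj; apply: (cmeasurable_comp mp); exact: measurable_fst.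
  apply: cmeasurableM; last by apply: (cmeasurable_comp mg); exact: measurable_snd.
  by apply: cmeasurable_kern; [exact: yb|exact: measurable_fst|exact: measurable_snd].
have FC y x : modulus (F y x) <= (modulus c * (C * G * P)) * (weight y * weight x).
  rewrite /F modulusM -[leRHS]mulrA; apply: ler_wpM2l; first exact: modulus_ge0.
  rewrite !modulusM modulus_conj.
  rewrite [leRHS](_ : _ = C * (G * weight x) * (P * weight y)); last by ring.
  apply: ler_pM; rewrite ?mulr_ge0 ?modulus_ge0//.
  by apply: ler_pM; rewrite ?modulus_ge0.
have wk x psi' P' : cmeasurable psi' -> (forall y, modulus (psi' y) <= P' * weight y) ->
    0 <= P' -> weighted (fun y => kern a h x y * psi' y).
  move=> mp' HP' P'0; split.
    apply: cmeasurableM => //; apply: (@cmeasurable_kern _ _ a h (fun=> x) id) => //.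
  exists (D * P') => y; rewrite modulusM -mulrA.
  by apply: ler_pM; rewrite ?modulus_ge0.
have wkb x psi' P' : cmeasurable psi' -> (forall y, modulus (psi' y) <= P' * weight y) ->
    0 <= P' -> weighted (fun y => kern (@conjc R \o a) h x y * psi' y).
  move=> mp' HP' P'0; split.
    apply: cmeasurableM => //; apply: (@cmeasurable_kern _ _ _ h (fun=> x) id) => //.
  exists (C * P') => y; rewrite modulusM -mulrA.
  by apply: ler_pM; rewrite ?modulus_ge0.
transitivity (cintegral (fun y => cintegral (F y))).
  apply: cintegral_eq => y; rewrite /F.
  rewrite cintegralZ; last by apply: weightedZr; exact: wkb HG G0.
  by rewrite cintegralZr; [rewrite mulrA|exact: wkb HG G0].
rewrite (cintegral_exchange mF FC); apply: cintegral_eq => x.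
rewrite /F cintegralZ; last first.
  have := weighted_conj (weightedZ (conjc (g x)) (wk x _ _ mp HP P0)).
  congr weighted; apply/funext => y.
  by rewrite !conjcM conj_kern// conjcK; ring.
rewrite conjcM cR mulrCA; congr (_ * _).
rewrite -cintegral_conj; last exact: wk HP P0.
rewrite -cintegralZ; last by apply: weighted_conj; exact: wk HP P0.
by apply: cintegral_eq => y; rewrite conjcM conj_kern//; ring.
Qed.

Variables (u : (E -> R[i]) -> R[i]) (K : R[i]) (phi : E -> R[i]).
Hypothesis tu : tempered u.
Hypothesis sphi : schwartz phi.
Hypothesis K0 : K != 0.
Hypothesis HK : forall (f : E -> R[i]) x, nice f ->
  cintegral (fun s => fourier f s * expi (- dotv x s)) = K * f x.
Hypothesis phi0 : cintegral (fun y => phi y * conjc (phi y)) != 0.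

(** The hypothesis makes the superposition of the functions [weyl (dilation h a) (tfshift w phi)]
    with coefficients [STFT phi u w] absolutely convergent and bounded by a multiple of [weight],
    hence an explicit representative in L^2. *)
Lemma L2norm_weyl_dual_le : exists2 c, 0 <= c & forall a h A, symbol a -> 0 < h <= 1 -> 0 <= A ->
  (forall w x, modulus (weyl (dilation h a) (tfshift w phi) x) * modulus (STFT phi u w) <=
     A * (weight w * weight x)) ->
  (L2norm (weyl_dual (dilation h a) u) <= (c * A)%:E)%E.
Proof.
pose p := cintegral (fun y => phi y * conjc (phi y)); have p0 : p != 0 := phi0.
pose k := conjc (K * p); have k0 : k != 0 by rewrite conjc_eq0 mulf_neq0.
have k1 : 0 <= (modulus k)^-1 by rewrite invr_ge0 modulus_ge0.
have wm : 0 <= weight_mass R (d + d) by exact/ltW/weight_mass_gt0.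
have pd : 0 <= pi ^+ d :> R by rewrite exprn_ge0// pi_ge0.
(* The factor [pi ^+ d + 1] stands in for the square root of [pi ^+ d]: its square exceeds
   [pi ^+ d]. *)
exists ((modulus k)^-1 * weight_mass R (d + d) * (pi ^+ d + 1)).
  by apply: mulr_ge0; [exact: mulr_ge0|exact: addr_ge0].
move=> a h A ya /andP[h0 h1] A0 HA; have hn0 : h != 0 by rewrite gt_eqF.
have yb := symbol_conj ya.
have mphi := smooth_cmeasurable (schwartz_smooth sphi).
have HT k' : exists C q, 0 <= C /\ forall w w' delta, 0 <= delta <= 1 ->
    (forall i, `|w ord0 i - w' ord0 i| <= delta) ->
    dbound k' (fun x => C * delta * japanese w ^+ q * japanese x ^- k')
    (fun x => tfshift w phi x - tfshift w' phi x) by exact: tfshift_lipschitz.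
have mV : cmeasurable (STFT phi u).
  exact: (cmeasurable_tempered_family tu (fun w => tfshift_schwartz w sphi) HT).
pose F w x := weyl (dilation h a) (tfshift w phi) x * STFT phi u w.
have mF : cmeasurable (fun p : E2 * E => F p.1 p.2).
  apply: cmeasurableM; first exact: cmeasurable_weyl_tfshift.
  by apply: (cmeasurable_comp mV); exact: measurable_fst.
have FA w x : modulus (F w x) <= A * (weight w * weight x) by rewrite modulusM.
pose f x := k^-1 * cintegral (F^~ x).
have mf : cmeasurable f.
  apply: cmeasurableM; first exact: cmeasurable_cst.
  apply: (@cmeasurable_cintegral R _ _ _ (fun x w => F w x)).
  apply: (cmeasurable_comp mF (g := fun t : E * E2 => (t.2, t.1))).
  by apply: measurable_fun_pair; [exact: measurable_snd|exact: measurable_fst].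
have fb x : modulus (f x) <= ((modulus k)^-1 * weight_mass R (d + d) * A) * weight x.
  rewrite /f modulusM modulusV.
  rewrite [leRHS](_ : _ = (modulus k)^-1 * ((A * weight x) * weight_mass R (d + d))); last by ring.
  apply: ler_wpM2l => //; apply: (@cintegral_le _ _ (F^~ x)); first by have [] := weighted_section2 mF FA x.
  by move=> w; rewrite -mulrA [weight x * _]mulrC.
have c0 : 0 <= (modulus k)^-1 * weight_mass R (d + d) * A by rewrite mulr_ge0// mulr_ge0.
have fL : (fun_L2norm f <= ((modulus k)^-1 * weight_mass R (d + d) * (pi ^+ d + 1) * A)%:E)%E.
  apply/fun_L2norm_le; first by apply: mulr_ge0 => //; apply: mulr_ge0; [exact: mulr_ge0|exact: addr_ge0].
  have := @tfshift_integral _ _ f _ 0 mf c0 fb.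
  rewrite [X in (X <= _)%E](_ : _ = \int[lebesgue_rV R d]_x (modulus (f x) ^+ 2)%:E)%E; last first.
    apply: eq_integral => x _; rewrite /tfshift /modulation /translation modulusM modulus_expi mul1r.
    by rewrite linear0 subr0.
  move=> /le_trans; apply; rewrite lee_fin.
  rewrite [in leRHS](_ : _ * A = (modulus k)^-1 * weight_mass R (d + d) * A * (pi ^+ d + 1)); last by ring.
  rewrite [leRHS]exprMn; apply: ler_wpM2l; first exact: exprn_ge0.
  by move: pd; move: (pi ^+ d) => q q0; nra.
apply: (le_trans _ fL); apply: ereal_inf_lbound; exists f => //; split.
  have [m1 m2] := mf; split => //.
  by apply: le_lt_trans fL _; exact: ltry.
move=> g sg; apply: (mulfI k0).
have sW : schwartz (weyl (dilation h (@conjc R \o a)) g).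
  by rewrite weyl_wop//; apply: schwartzZ; apply: wop_schwartz => //; rewrite ltW.
rewrite -[weyl_dual _ _ g]/(u (weyl (dilation h (@conjc R \o a)) g)).
rewrite (tempered_STFT HK tu sphi sW).
have [mg [G HG]] := schwartz_weighted sg.
have G0 : 0 <= G by have := le_trans (modulus_ge0 _) (HG 0); rewrite pmulr_lge0// weight_gt0.
pose H w x := F w x * conjc (g x).
have mH : cmeasurable (fun p : E2 * E => H p.1 p.2).
  apply: cmeasurableM => //; apply: cmeasurable_conj; apply: (cmeasurable_comp mg); exact: measurable_snd.
have HC w x : modulus (H w x) <= (A * G) * (weight w * weight x).
  rewrite modulusM modulus_conj [leRHS](_ : _ = A * (weight w * weight x) * G); last by ring.
  apply: ler_pM; rewrite ?modulus_ge0// (le_trans (HG x))//.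
  by rewrite ler_piMr// weight_le1.
transitivity (cintegral (fun w => cintegral (H w))).
  apply: cintegral_eq => w; rewrite /STFT_coeff weyl_adjoint//; last exact: tfshift_schwartz.
  have sWt : schwartz (weyl (dilation h a) (tfshift w phi)).
    rewrite weyl_wop//; last exact: tfshift_schwartz.
    by apply: schwartzZ; apply: wop_schwartz => //; [rewrite ltW|exact: tfshift_schwartz].
  have wgc : weighted (fun x => g x * conjc (weyl (dilation h a) (tfshift w phi) x)).
    have [ms [S HS]] := schwartz_weighted sWt.
    have := @weightedM _ d (fun x => conjc (weyl (dilation h a) (tfshift w phi) x)) g S (schwartz_weighted sg).
    move=> /(_ (cmeasurable_conj ms))-h'.
    have {}h' : weighted (fun x => conjc (weyl (dilation h a) (tfshift w phi) x) * g x).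
      apply: h' => x; rewrite modulus_conj (le_trans (HS x))// ler_piMr ?weight_le1//.
      by have := le_trans (modulus_ge0 _) (HS 0); rewrite pmulr_lge0// weight_gt0.
    by move: h'; congr weighted; apply/funext => x; rewrite mulrC.
  rewrite -cintegral_conj// -cintegralZr; last exact: weighted_conj.
  by apply: cintegral_eq => x; rewrite conjcM conjcK /H /F; ring.
rewrite (cintegral_exchange mH HC) -cintegralZ; last first.
  split.
    apply: cmeasurableM => //; exact: cmeasurable_conj.
  exists (((modulus k)^-1 * weight_mass R (d + d) * A) * G) => x.
  rewrite modulusM modulus_conj -[leRHS]mulrA.
  apply: ler_pM; rewrite ?modulus_ge0//.
  by rewrite (le_trans (fb x))// ler_piMr// weight_le1.
apply: cintegral_eq => x; rewrite /H cintegralZr; last exact: weighted_section2 mF FA x.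
by rewrite /f -mulrA mulVKf.
Qed.

End weyl_adjoint.

(** * Decay from separation in position or in frequency *)

Section microlocal_decay.
Variables (R : realType) (d : nat).
Local Notation E := 'rV[R]_d.
Local Notation E2 := 'rV[R]_(d + d).
Implicit Types (a : E2 -> R[i]) (phi : E -> R[i]) (h : R).

(** The integrand decays like the product of the brackets to the power [-N]; where the symbol does
    not vanish, that product is at least [Y]. *)
Lemma wop_separated N a phi : symbol a -> schwartz phi -> exists2 C, 0 <= C &
  forall h (w1 w2 x : E) Y, 0 <= h <= 1 -> 0 < Y ->
  (forall s, symb_ft a ((h ^+ 2 / 2) *: s + w1 + h *: x) s != 0 ->
    Y <= japanese (x + h *: s) * japanese s) ->
  modulus (wop a h w1 w2 phi x) <= C * Y ^- N.
Proof.
move=> ya sphi; have [sa _] := ya.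
have [B B0 HB] := symbol_dbound (2 * d + N).+1 ya.
have [A A0 HA] := schwartz_dbound 0 N sphi.
have [mphi _] := schwartz_weighted sphi.
pose S := B * (weight_mass R d * d.+1%:R ^+ (2 * d + N)).
have S0 : 0 <= S.
  by apply: mulr_ge0 => //; apply: mulr_ge0; [exact/ltW/weight_mass_gt0|exact: exprn_ge0].
exists (S * A * weight_mass R d).
  by apply: mulr_ge0; [exact: mulr_ge0|exact/ltW/weight_mass_gt0].
move=> h w1 w2 x Y h01 Y0 HY.
rewrite [leRHS]mulrAC; apply: cintegral_le.
  by have [] := weighted_wint w1 w2 x ya h01 sphi.
move=> s; rewrite /wint !modulusM modulus_expi mulr1.
have SA : 0 <= S * A by exact: mulr_ge0.
have YN : 0 < Y ^- N by rewrite invr_gt0 exprn_gt0.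
have [->|/HY Ys] := eqVneq (symb_ft a ((h ^+ 2 / 2) *: s + w1 + h *: x) s) 0.
  rewrite modulus0 mul0r; apply: mulr_ge0; last exact: weight_ge0.
  by apply: mulr_ge0 => //; exact: ltW.
apply: (@le_trans _ _ (S * japanese s ^- (2 * d + N) * (A * japanese (x + h *: s) ^- N))).
  apply: ler_pM; rewrite ?modulus_ge0//.
    exact: symb_ft_decay sa B0 HB.
  exact: dbound0 HA.
rewrite exprD [leLHS](_ : _ = S * A * (japanese s ^- (2 * d) *
  (japanese (x + h *: s) * japanese s) ^- N)); last by rewrite invfM exprMn invfM; ring.
rewrite -[leRHS]mulrA; apply: ler_wpM2l => //; rewrite [leRHS]mulrC.
apply: ler_pM.
- by rewrite invr_ge0 ltW// japaneseX_gt0.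
- by rewrite invr_ge0 exprn_ge0// mulr_ge0// japanese_ge0.
- exact: japanese_weight.
- rewrite lef_pV2 ?posrE ?exprn_gt0 ?mulr_gt0 ?japanese_gt0//.
  by apply: lerXn2r; rewrite ?nnegrE ?mulr_ge0 ?japanese_ge0// ltW.
Qed.

Lemma smooth_sectionl a q : smooth a ->
  smooth (fun y : E => a (row_mx y q)) /\
  forall s : seq 'I_d, cpartials s (fun y : E => a (row_mx y q)) =
    fun y => dpos s a (row_mx y q).
Proof.
move=> sa.
have [h1 h2] := smooth_rescale (row_mxl_line q) (@continuous_row_mxl _ _ q) sa.
by split=> // s; rewrite h2; apply/funext => y; rewrite expr1n mul1r.
Qed.

(** The decay comes from the window alone; the symbol only has to be bounded, which makes the
    constant uniform in the base point. *)
Lemma windowed_symbol_dbound N a phi : symbol a -> schwartz phi -> exists2 C, 0 <= C &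
  forall (c q : E) t, `|t| <= 1 ->
  smooth (fun v : E => a (row_mx (c + t *: v) q) * phi v) /\
  dbound N (fun v => C * weight v) (fun v : E => a (row_mx (c + t *: v) q) * phi v).
Proof.
move=> ya sphi; have [sa _] := ya.
have [B B0 HB] := symbol_dbound N ya.
have [A A0 HA] := schwartz_dbound_weight N sphi.
exists (2 ^+ N * (B * A)); first by rewrite !mulr_ge0 ?exprn_ge0.
move=> c q t t1; have [s1 c1] := smooth_sectionl q sa.
have b1 : dbound N (fun=> B) (fun y : E => a (row_mx y q)).
  move=> s sN x; rewrite c1 (le_trans (HB _ _ _)) ?size_map// ler_piMr// weight_le1//.
have [s2 _] := smooth_affine c t s1.
have sp := schwartz_smooth sphi.
split; first exact: (smoothM s2 sp).
apply: dbound_le (dboundM s2 sp (dbound_affine c s1 t1 b1) HA) => v.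
by rewrite !mulrA.
Qed.

(** In [wop] the momentum has been integrated out, which suits separation in position. Here the
    position is integrated first and the momentum [xi] kept, so that separation in frequency shows
    as the argument [rsubmx w - xi] of a Fourier transform. *)
Lemma weyl_tfshift_fourier a h phi (w : E2) x : symbol a -> 0 < h <= 1 -> schwartz phi ->
  weyl (dilation h a) (tfshift w phi) x = ((2 * pi) ^- d)%:C * cintegral (fun xi : E =>
    expi (dotv (x - lsubmx w) xi + dotv (lsubmx w) (rsubmx w)) *
    fourier (fun v => a (row_mx ((h / 2) *: (x + lsubmx w) + (h / 2) *: v) (h *: xi)) * phi v)
      (rsubmx w - xi)).
Proof.
move=> ya /andP[hp h1] sphi; have h0 : h != 0 by rewrite gt_eqF.
have st := tfshift_schwartz w sphi.
have [ms [A HA]] := schwartz_weighted st.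
have A0 : 0 <= A by have := le_trans (modulus_ge0 _) (HA 0); rewrite pmulr_lge0// weight_gt0.
have [B B0 HB] := symbol_dilation_bound ya h0.
rewrite weyl_kernel//; congr (_ * _).
pose G (y xi : E) := expi (dotv (x - y) xi) * a (h *: row_mx (2^-1 *: (x + y)) xi) * tfshift w phi y.
have mG : cmeasurable (fun p : E * E => G p.1 p.2).
  apply: cmeasurableM; last by apply: (cmeasurable_comp ms); exact: measurable_fst.
  exact: (@cmeasurable_kern_integrand R d _ _ a h (fun=> x) fst snd (symbol_cmeasurable ya)).
have GC y xi : modulus (G y xi) <= (A * B) * (weight y * weight xi).
  rewrite modulusM [modulus (expi _ * a _)]modulusM modulus_expi mul1r.
  rewrite [leRHS](_ : _ = B * weight xi * (A * weight y)); last by ring.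
  by apply: ler_pM; [exact: modulus_ge0|exact: modulus_ge0|exact: HB|exact: HA].
transitivity (cintegral (fun y => cintegral (G y))).
  by apply: cintegral_eq => y; rewrite /kern -cintegralZr//; exact: weighted_kern_integrand.
rewrite (cintegral_exchange mG GC); apply: cintegral_eq => xi.
have wG := weighted_section2 mG GC xi.
rewrite -(cintegral_shift (lsubmx w) wG) /fourier -cintegralZ; last first.
  have [C C0 HC] := windowed_symbol_dbound 0 ya sphi.
  have h2 : `|h / 2| <= 1 by rewrite ger0_norm; [lra|rewrite divr_ge0// ltW].
  have [sm bd] := HC ((h / 2) *: (x + lsubmx w)) (h *: xi) (h / 2) h2.
  apply: weighted_expi; split; first exact: smooth_cmeasurable.
  by exists C => v; exact: dbound0 bd.
apply: cintegral_eq => v.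
rewrite /G /tfshift /modulation /translation addrK scale_row_mx scalerA.
have -> : (h * 2^-1) *: (x + (v + lsubmx w)) = (h / 2) *: (x + lsubmx w) + (h / 2) *: v.
  by rewrite -scalerDr; congr (_ *: _); rewrite [v + _]addrC addrA.
have e : expi (dotv (x - (v + lsubmx w)) xi) * expi (dotv (v + lsubmx w) (rsubmx w)) =
    expi (dotv (x - lsubmx w) xi + dotv (lsubmx w) (rsubmx w)) * expi (dotv v (rsubmx w - xi)).
  by rewrite -!expiD; congr expi; rewrite !(dotvBl, dotvBr, dotvDl); ring.
move: e; set A' := a _; set E1 := expi _; set E2' := expi _; set E3 := expi _; set E4 := expi _ => e.
by rewrite [LHS](_ : _ = (E1 * E2') * (A' * phi v)); [rewrite e; ring|ring].
Qed.

Lemma weyl_separated N a phi : symbol a -> schwartz phi -> exists2 C, 0 <= C &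
  forall h (w : E2) x Y, 0 < h <= 1 -> 0 < Y ->
  (forall q xi : E, a (row_mx q (h *: xi)) != 0 -> Y <= japanese (rsubmx w - xi)) ->
  modulus (weyl (dilation h a) (tfshift w phi) x) <= C * Y ^- N.
Proof.
move=> ya sphi.
have [D D0 HD] := windowed_symbol_dbound (2 * d + N).+1 ya sphi.
pose S := D * (weight_mass R d * d.+1%:R ^+ (2 * d + N)).
have S0 : 0 <= S.
  by apply: mulr_ge0 => //; apply: mulr_ge0; [exact/ltW/weight_mass_gt0|exact: exprn_ge0].
pose c : R[i] := ((2 * pi) ^- d)%:C.
exists (modulus c * (S * weight_mass R d)).
  by apply: mulr_ge0; [exact: modulus_ge0|apply: mulr_ge0 => //; exact/ltW/weight_mass_gt0].
move=> h w x Y h01 Y0 HY; have [h0 h1] := andP h01.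
rewrite weyl_tfshift_fourier// modulusM -/c -mulrA; apply: ler_wpM2l; first exact: modulus_ge0.
have h2 : `|h / 2| <= 1 by rewrite ger0_norm; [lra|rewrite divr_ge0// ltW].
pose F xi v := a (row_mx ((h / 2) *: (x + lsubmx w) + (h / 2) *: v) (h *: xi)) * phi v.
pose I xi := expi (dotv (x - lsubmx w) xi + dotv (lsubmx w) (rsubmx w)) * fourier (F xi) (rsubmx w - xi).
have IY xi : modulus (I xi) <= (S * Y ^- N) * weight (rsubmx w - xi).
  rewrite /I modulusM modulus_expi mul1r.
  have YN : 0 < Y ^- N by rewrite invr_gt0 exprn_gt0.
  have [F0|] := pselect (forall v, F xi v = 0).
    rewrite [leLHS](_ : _ = 0).
      by apply: mulr_ge0; [apply: mulr_ge0 => //; exact: ltW|exact: weight_ge0].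
    rewrite -[RHS](modulus0 R) -(@cintegral0 R d); congr modulus.
    by apply: cintegral_eq => v; rewrite F0 mulr0.
  move=> /existsNP[v /eqP]; rewrite mulf_eq0 negb_or => /andP[/HY Yw _].
  have [sF bF] := HD ((h / 2) *: (x + lsubmx w)) (h *: xi) (h / 2) h2.
  apply: (le_trans (fourier_decay _ sF bF)).
  rewrite -/S exprD invfM -mulrA; apply: ler_wpM2l => //; rewrite [leRHS]mulrC.
  apply: ler_pM; rewrite ?invr_ge0 ?exprn_ge0 ?japanese_ge0//.
    exact: japanese_weight.
  rewrite lef_pV2 ?posrE ?exprn_gt0 ?japanese_gt0//.
  by apply: lerXn2r; rewrite ?nnegrE ?japanese_ge0// ltW.
have SY : 0 <= S * Y ^- N by apply: mulr_ge0 => //; rewrite invr_ge0 exprn_ge0// ltW.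
have mI : cmeasurable I.
  apply: cmeasurableM.
    apply: cmeasurable_expi; apply: measurable_funD; last exact: measurable_cst.
    exact: measurable_dotv.
  apply: (@cmeasurable_cintegral R _ _ d (fun xi v : E => expi (dotv v (rsubmx w - xi)) * F xi v)).
  apply: cmeasurableM.
    by apply: cmeasurable_expi; apply: measurable_dotv => //; exact: measurable_rVB.
  apply: cmeasurableM; last first.
    apply: (cmeasurable_comp (f := phi)); last exact: measurable_snd.
    exact/smooth_cmeasurable/schwartz_smooth.
  apply: (cmeasurable_comp (symbol_cmeasurable ya)); apply: measurable_row_mx.
    by apply: measurable_rVD => //; apply: measurable_rVZ; exact: measurable_snd.
  by apply: measurable_rVZ; exact: measurable_fst.
have wI : weighted I.
  split=> //; have n1 : (-1 : R) != 0 by rewrite oppr_eq0 oner_neq0.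
  have [M M0 HM] := weighted_shift_bound (rsubmx w) n1.
  exists (S * Y ^- N * M) => xi; apply: (le_trans (IY xi)).
  by rewrite -[leRHS]mulrA; apply: ler_wpM2l => //; have := HM xi; rewrite scaleN1r.
rewrite -/(F _) -[cintegral _]/(cintegral I) -(cintegral_shift (rsubmx w) wI) mulrAC.
apply: cintegral_le; first by have [] := weighted_shift (rsubmx w) wI.
move=> xi; apply: (le_trans (IY _)); apply: ler_wpM2l => //.
rewrite opprD addrCA subrr addr0 /weight.
by under eq_bigr do rewrite mxE sqrrN.
Qed.

End microlocal_decay.

(** * Decay away from the support of the symbol *)

Section localized_symbol.
Variables (R : realType) (d : nat) (a : 'rV[R]_(d + d) -> R[i]) (z0 : 'rV[R]_(d + d)) (e : R).
Variable phi : 'rV[R]_d -> R[i].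
Local Notation E := 'rV[R]_d.
Local Notation E2 := 'rV[R]_(d + d).
Hypothesis e0 : 0 < e.
Hypothesis sa : smooth a.
Hypothesis az0 : forall (z : E2) i, e <= `|z ord0 i - z0 ord0 i| -> a z = 0.
Hypothesis sphi : schwartz phi.

Lemma localized_symbol : symbol a.
Proof.
split=> //; exists (`|z0| + e) => z i zi; apply: (@az0 z i).
have := ler_distD 0 (z ord0 i) (z0 ord0 i); rewrite !subr0 sub0r normrN => h.
have := entry_le_norm z0 i => h2.
have h3 : `|z ord0 i| <= `|z ord0 i - z0 ord0 i| + `|z0 ord0 i|.
  by rewrite -{1}(subrK (z0 ord0 i) (z ord0 i)) ler_normD.
lra.
Qed.
Let ya := localized_symbol.

Let J : R := `|z0| + e.

Lemma symb_ft_support q s i : symb_ft a q s != 0 -> `|q ord0 i - z0 ord0 (lshift d i)| < e.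
Proof.
move=> H; rewrite ltNge; apply: contra H => H; apply/eqP.
rewrite -[RHS](@cintegral0 R d); apply: cintegral_eq => eta.
by rewrite (@az0 _ (lshift d i)) ?mulr0// row_mxEl.
Qed.

Lemma symbol_support (q xi : E) i : a (row_mx q xi) != 0 -> `|xi ord0 i - z0 ord0 (rshift d i)| < e.
Proof.
move=> H; rewrite ltNge; apply: contra H => H; apply/eqP.
by rewrite (@az0 _ (rshift d i))// row_mxEr.
Qed.

Lemma weyl_tfshift_modulus h (w : E2) x : 0 < h <= 1 ->
  modulus (weyl (dilation h a) (tfshift w phi) x) =
  modulus (((2 * pi) ^- d)%:C : R[i]) *
  modulus (wop a h (h *: lsubmx w) (h *: rsubmx w) phi (x - lsubmx w)).
Proof.
move=> /andP[h0 h1]; have h01 : 0 <= h <= 1 by rewrite ltW.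
rewrite weyl_wop//; last exact: tfshift_schwartz.
rewrite modulusM wop_tfshift//; congr (_ * _).
rewrite /tfshift /modulation /translation modulusM modulus_expi mul1r.
by rewrite !linearZ.
Qed.

(** In the names, kappa denotes the kernel [weyl (dilation h a) (tfshift w phi) x] as a function of
    [w] and [x]. Here [q] is the position at which the symbol is evaluated, confined to the cube
    around [z0]. *)
Lemma kappa_position N : exists2 C, 0 <= C & forall h (w : E2) x Y, 0 < h <= 1 -> 0 < Y ->
  (forall s q : E, (forall i, `|q ord0 i - z0 ord0 (lshift d i)| < e) ->
     (forall i, q ord0 i = h ^+ 2 / 2 * s ord0 i + h * w ord0 (lshift d i) + h * (x - lsubmx w) ord0 i) ->
     Y <= japanese (x - lsubmx w + h *: s) * japanese s) ->
  modulus (weyl (dilation h a) (tfshift w phi) x) <= C * Y ^- N.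
Proof.
have [C C0 HC] := wop_separated N ya sphi.
exists (modulus (((2 * pi) ^- d)%:C : R[i]) * C).
  by apply: mulr_ge0 => //; exact: modulus_ge0.
move=> h w x Y h01 Y0 HY; rewrite weyl_tfshift_modulus// -mulrA.
apply: ler_wpM2l; first exact: modulus_ge0.
apply: HC => //; first by case/andP: h01 => /ltW -> ->.
move=> s sne; apply: (HY s _ (fun i => symb_ft_support i sne)) => i.
by rewrite !mxE.
Qed.

Lemma kappa_shift N : exists2 C, 0 <= C & forall h (w : E2) x, 0 < h <= 1 ->
  modulus (weyl (dilation h a) (tfshift w phi) x) <= C * japanese (x - lsubmx w) ^- N.
Proof.
have [C C0 HC] := kappa_position N.
exists (C * 2 ^+ N); first by rewrite mulr_ge0// exprn_ge0.
move=> h w x h01.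
have j0 := japanese_gt0 (x - lsubmx w).
apply: (le_trans (HC h w x (japanese (x - lsubmx w) / 2) h01 _ _)).
- by rewrite divr_gt0.
- move=> s q _ _; rewrite ler_pdivrMr// mulrC.
  by apply: japanese_shift_scale; case/andP: h01 => /ltW -> ->.
by rewrite expr_div_n invf_div mulrA.
Qed.

Lemma kappa_frequency N : exists2 C, 0 <= C & forall h (w : E2) x Y, 0 < h <= 1 -> 0 < Y ->
  (forall xi : E, (forall i, `|h * xi ord0 i - z0 ord0 (rshift d i)| < e) ->
     Y <= japanese (rsubmx w - xi)) ->
  modulus (weyl (dilation h a) (tfshift w phi) x) <= C * Y ^- N.
Proof.
have [C C0 HC] := weyl_separated N ya sphi.
exists C => // h w x Y h01 Y0 HY; apply: HC => // q xi ne; apply: HY => i.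
by have := symbol_support i ne; rewrite mxE.
Qed.

Let J0 : 0 <= J. Proof. by rewrite addr_ge0// ltW. Qed.

Lemma kappa_left N : exists2 C, 0 <= C & forall h (w : E2) x, 0 < h <= 1 ->
  modulus (weyl (dilation h a) (tfshift w phi) x) <= C * japanese (h *: lsubmx w) ^- N.
Proof.
have [C C0 HC] := kappa_position N.
(* An entry of [h *: lsubmx w] is at most [J], from the confinement of [q], plus one bracket for
   each of the two displacements; [d.+1] passes from entries to the bracket. *)
pose L : R := d.+1%:R * (J + 2); have L0 : 0 < L by rewrite mulr_gt0// ltr_wpDl.
exists (C * L ^+ N); first by rewrite mulr_ge0// exprn_ge0// ltW.
move=> h w x h01; have [h0 h1] := andP h01.
have j0 := japanese_gt0 (h *: lsubmx w).
apply: (le_trans (HC h w x (japanese (h *: lsubmx w) / L) h01 _ _));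
  [by rewrite divr_gt0| |by rewrite expr_div_n invf_div mulrA].
move=> s q qz qE; rewrite ler_pdivrMr// mulrC /L -mulrA.
set P := japanese _ * japanese s.
have p1 := japanese_ge1 (x - lsubmx w + h *: s); have p2 := japanese_ge1 s.
have P1 : 1 <= P by rewrite -[leLHS]mulr1 ler_pM.
have Pa : japanese (x - lsubmx w + h *: s) <= P.
  by rewrite -[leLHS]mulr1; apply: ler_wpM2l => //; exact: le_trans p1.
have Pb : japanese s <= P.
  by rewrite -[leLHS]mul1r; apply: ler_wpM2r => //; exact: le_trans p2.
apply: japanese_le_max => [|i].
  rewrite -[leLHS]mul1r; apply: ler_pM => //.
  by move: J0; lra.
have e1 := entry_le_japanese (x - lsubmx w + h *: s) i; have e2 := entry_le_japanese s i.
have zi := entry_le_norm z0 (lshift d i); have qi := qz i; have qi' := qE i.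
move: e1 e2 qi'; rewrite !mxE.
have P3 : J * 1 <= J * P by apply: ler_wpM2l.
have e1' := le_trans _ Pa; have e2' := le_trans _ Pb.
move=> /e1' {}e1 /e2' {}e2 qi'.
have hs : `|h * (x ord0 i - w ord0 (lshift d i) + h * s ord0 i)| <= P.
  rewrite normrM gtr0_norm// (le_trans _ e1)// ler_piMl//.
have hs2 : `|h ^+ 2 / 2 * s ord0 i| <= P.
  rewrite normrM ger0_norm ?divr_ge0 ?sqr_ge0// (le_trans _ e2)// ler_piMl//.
  have h2 : h ^+ 2 <= 1 by rewrite exprn_ile1// ltW.
  by lra.
(* The equation for [q] solved for [h] times the position of [w], grouped so that the argument
   [x - lsubmx w + h *: s] of the window appears. *)
rewrite [X in `|X|](_ : _ = q ord0 i - z0 ord0 (lshift d i) + z0 ord0 (lshift d i) -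
   h * (x ord0 i - w ord0 (lshift d i) + h * s ord0 i) + h ^+ 2 / 2 * s ord0 i); last first.
  by rewrite qi'; field.
rewrite (le_trans (ler_normD _ _))//.
rewrite (_ : (J + 2) * P = J * P + P + P); last by ring.
apply: lerD => //; rewrite (le_trans (ler_normB _ _))//; apply: lerD => //.
rewrite (le_trans (ler_normD _ _))//; apply: le_trans P3; rewrite mulr1 /J addrC.
by apply: lerD => //; exact: ltW.
Qed.

Lemma kappa_right N : exists2 C, 0 <= C & forall h (w : E2) x, 0 < h <= 1 ->
  modulus (weyl (dilation h a) (tfshift w phi) x) <= C * japanese (h *: rsubmx w) ^- N.
Proof.
have [C C0 HC] := kappa_frequency N.
pose L : R := d.+1%:R * (J + 1); have L0 : 0 < L by rewrite mulr_gt0// ltr_wpDl.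
exists (C * L ^+ N); first by rewrite mulr_ge0// exprn_ge0// ltW.
move=> h w x h01; have [h0 h1] := andP h01.
have j0 := japanese_gt0 (h *: rsubmx w).
apply: (le_trans (HC h w x (japanese (h *: rsubmx w) / L) h01 _ _));
  [by rewrite divr_gt0| |by rewrite expr_div_n invf_div mulrA].
move=> xi xiz; rewrite ler_pdivrMr// mulrC /L -mulrA.
set P := japanese (rsubmx w - xi); have P1 : 1 <= P := japanese_ge1 _.
have P3 : J * 1 <= J * P by apply: ler_wpM2l.
apply: japanese_le_max => [|i].
  by apply: mulr_ege1 => //; rewrite lerDr.
have e1 : `|(rsubmx w - xi) ord0 i| <= P := entry_le_japanese _ i.
have zi := entry_le_norm z0 (rshift d i); have qi := xiz i.
have hs : `|h * (rsubmx w - xi) ord0 i| <= P.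
  by rewrite normrM gtr0_norm// (le_trans _ e1)// ler_piMl.
move: hs; rewrite !mxE => hs.
rewrite [X in `|X|](_ : _ = h * xi ord0 i - z0 ord0 (rshift d i) + z0 ord0 (rshift d i) +
   h * (w ord0 (rshift d i) - xi ord0 i)); last by ring.
rewrite [leRHS](_ : _ = J * P + P); last by ring.
rewrite (le_trans (ler_normD _ _))//; apply: lerD => //.
rewrite (le_trans (ler_normD _ _))//; apply: le_trans P3; rewrite mulr1 /J addrC.
by apply: lerD => //; exact: ltW.
Qed.

(** The symbol lives within [e] of [z0] while [h *: w] is at least [2 * e] away in some coordinate;
    bridging the remaining [e] takes brackets of size at least [e / (2 * h)], that is,
    [Y = (L * h)^-1]. The coordinate decides between separation in position and in frequency. *)
Lemma kappa_far N : exists2 C, 0 <= C & forall h (w : E2) x i, 0 < h <= 1 ->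
  2 * e <= `|h * w ord0 i - z0 ord0 i| ->
  modulus (weyl (dilation h a) (tfshift w phi) x) <= C * h ^+ N.
Proof.
have [C C0 HC] := kappa_position N; have [D D0 HD] := kappa_frequency N.
pose L := 2 / e; have L0 : 0 < L by rewrite divr_gt0.
exists ((C + D) * L ^+ N); first by rewrite mulr_ge0 ?addr_ge0// exprn_ge0// ltW.
move=> h w x i h01 far; have [h0 h1] := andP h01.
have Y0 : 0 < (L * h)^-1 by rewrite invr_gt0 mulr_gt0.
have LE : (L * h)^-1 ^- N = L ^+ N * h ^+ N by rewrite exprVn invrK exprMn.
have LN : 0 <= L ^+ N * h ^+ N by rewrite mulr_ge0 ?exprn_ge0 ?ltW.
have small t : e <= 2 * h * t -> (L * h)^-1 <= t.
  move=> et; rewrite -div1r ler_pdivrMr /L; last by rewrite mulr_gt0.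
  by rewrite [leRHS](_ : _ = (2 * h * t) / e); [rewrite ler_pdivlMr// mul1r|ring].
rewrite [leRHS](_ : _ = (C + D) * (L * h)^-1 ^- N); last by rewrite LE mulrA.
move: far; rewrite -(fintype.splitK i); case: (fintype.split i) => k /= far.
  apply: (@le_trans _ _ (C * (L * h)^-1 ^- N)); last first.
    by rewrite LE; apply: ler_wpM2r => //; rewrite lerDl.
  apply: HC => // s q qz qE; apply: small.
  set P := japanese _ * japanese s.
  have p1 := japanese_ge1 (x - lsubmx w + h *: s); have p2 := japanese_ge1 s.
  have Pa : japanese (x - lsubmx w + h *: s) <= P.
    by rewrite -[leLHS]mulr1; apply: ler_wpM2l => //; exact: le_trans p1.
  have Pb : japanese s <= P.
    by rewrite -[leLHS]mul1r; apply: ler_wpM2r => //; exact: le_trans p2.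
  have e1 := le_trans (entry_le_japanese (x - lsubmx w + h *: s) k) Pa.
  have e2 := le_trans (entry_le_japanese s k) Pb.
  have qi := qz k; have qi' := qE k; move: e1 qi'; rewrite !mxE => e1 qi'.
  have hs : `|h * (x ord0 k - w ord0 (lshift d k) + h * s ord0 k)| <= h * P.
    by rewrite normrM gtr0_norm//; apply: ler_wpM2l => //; exact: ltW.
  have hs2 : `|h ^+ 2 / 2 * s ord0 k| <= h * P.
    rewrite normrM ger0_norm ?divr_ge0 ?sqr_ge0//; apply: ler_pM => //.
      by rewrite divr_ge0 ?sqr_ge0.
    by rewrite ler_pdivrMr// expr2; apply: ler_wpM2l; [exact: ltW|lra].
  move: far; rewrite [X in `|X|](_ : _ = q ord0 k - z0 ord0 (lshift d k) -
   h * (x ord0 k - w ord0 (lshift d k) + h * s ord0 k) + h ^+ 2 / 2 * s ord0 k); last first.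
    by rewrite qi'; field.
  have := ler_normD (q ord0 k - z0 ord0 (lshift d k) -
   h * (x ord0 k - w ord0 (lshift d k) + h * s ord0 k)) (h ^+ 2 / 2 * s ord0 k).
  have := ler_normB (q ord0 k - z0 ord0 (lshift d k)) 
   (h * (x ord0 k - w ord0 (lshift d k) + h * s ord0 k)).
  rewrite -[2 * h * P]mulrA; move: hs hs2 qi; move: (h * P) => hP.
  move: `|h * (x ord0 k - w ord0 (lshift d k) + h * s ord0 k)| `|h ^+ 2 / 2 * s ord0 k| => n1 n2.
  move: `|q ord0 k - z0 ord0 (lshift d k)| => n3; lra.
apply: (@le_trans _ _ (D * (L * h)^-1 ^- N)); last first.
  by rewrite LE; apply: ler_wpM2r => //; rewrite lerDr.
apply: HD => // xi xiz; apply: small.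
set P := japanese _.
have e1 : `|(rsubmx w - xi) ord0 k| <= P := entry_le_japanese _ k.
have hs : `|h * (rsubmx w - xi) ord0 k| <= h * P.
  by rewrite normrM gtr0_norm//; apply: ler_wpM2l => //; exact: ltW.
move: hs; rewrite !mxE => hs; have qi := xiz k.
move: far; rewrite [X in `|X|](_ : _ = h * xi ord0 k - z0 ord0 (rshift d k) +
   h * (w ord0 (rshift d k) - xi ord0 k)); last by ring.
have := ler_normD (h * xi ord0 k - z0 ord0 (rshift d k)) (h * (w ord0 (rshift d k) - xi ord0 k)).
have hP : 0 <= h * P by rewrite mulr_ge0 ?japanese_ge0 ?ltW.
rewrite -[2 * h * P]mulrA; move: hs hP qi; move: (h * P) => hP; lra.
Qed.

(* the four bounds are combined through their geometric mean *)
Lemma kappa_far_decay N : exists2 C, 0 <= C & forall h (w : E2) x i, 0 < h <= 1 ->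
  2 * e <= `|h * w ord0 i - z0 ord0 i| ->
  modulus (weyl (dilation h a) (tfshift w phi) x) <=
  C * (h ^+ N * (japanese (x - lsubmx w) ^- N * (japanese (h *: lsubmx w) ^- N *
    japanese (h *: rsubmx w) ^- N))).
Proof.
(* Each exponent is multiplied by 4, since a fourth root of the product of the four bounds is
   taken. *)
have [C1 C10 H1] := kappa_far (N * 4); have [C2 C20 H2] := kappa_shift (N * 4).
have [C3 C30 H3] := kappa_left (N * 4); have [C4 C40 H4] := kappa_right (N * 4).
pose C := C1 * (C2 * (C3 * C4)).
have C0 : 0 <= C by rewrite !mulr_ge0.
(* An upper bound for the fourth root of [C], as [C <= (1 + C) ^+ 4]. *)
exists (1 + C); first by rewrite addr_ge0.
move=> h w x i h01 far; have [h0 h1] := andP h01.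
have Q0 := modulus_ge0 (weyl (dilation h a) (tfshift w phi) x).
set Q := modulus _ in Q0 *.
have j1 := ltW (japaneseX_gt0 (x - lsubmx w) N); have j2 := ltW (japaneseX_gt0 (h *: lsubmx w) N).
have j3 := ltW (japaneseX_gt0 (h *: rsubmx w) N).
have hN : 0 <= h ^+ N by rewrite exprn_ge0// ltW.
have b1 : Q <= C1 * (h ^+ N) ^+ 4 by rewrite -exprM; exact: H1 far.
have b2 : Q <= C2 * (japanese (x - lsubmx w) ^- N) ^+ 4 by rewrite exprVn -exprM; exact: H2.
have b3 : Q <= C3 * (japanese (h *: lsubmx w) ^- N) ^+ 4 by rewrite exprVn -exprM; exact: H3.
have b4 : Q <= C4 * (japanese (h *: rsubmx w) ^- N) ^+ 4 by rewrite exprVn -exprM; exact: H4.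
rewrite -(@ler_pXn2r _ 4)// ?nnegrE; last first.
  by rewrite mulr_ge0 ?addr_ge0// mulr_ge0// mulr_ge0 ?invr_ge0// mulr_ge0 ?invr_ge0.
rewrite !exprMn.
apply: (@le_trans _ _ (C * ((h ^+ N) ^+ 4 * ((japanese (x - lsubmx w) ^- N) ^+ 4 *
  ((japanese (h *: lsubmx w) ^- N) ^+ 4 * (japanese (h *: rsubmx w) ^- N) ^+ 4))))).
  have QE : Q ^+ 4 = Q * (Q * (Q * Q)) by rewrite !exprS mulr1.
  rewrite QE [leRHS](_ : _ = (C1 * (h ^+ N) ^+ 4) * ((C2 * (japanese (x - lsubmx w) ^- N) ^+ 4) *
    ((C3 * (japanese (h *: lsubmx w) ^- N) ^+ 4) * (C4 * (japanese (h *: rsubmx w) ^- N) ^+ 4)))); last first.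
    by rewrite /C; ring.
  by apply: ler_pM; rewrite ?mulr_ge0//; apply: ler_pM; rewrite ?mulr_ge0//; apply: ler_pM.
apply: ler_wpM2r.
  do 3 (apply: mulr_ge0; first by rewrite exprn_ge0// invr_ge0).
  by rewrite exprn_ge0// invr_ge0.
have C1' : 1 <= 1 + C by rewrite lerDl.
apply: (@le_trans _ _ (1 + C)); first by rewrite lerDr.
by rewrite -[leLHS]expr1; apply: ler_weXn2l.
Qed.

End localized_symbol.

(** * Bookkeeping of exponents and the second inclusion *)

Section HWF_sub_WFG.
Variables (R : realType) (d : nat).
Local Notation E := 'rV[R]_d.
Local Notation E2 := 'rV[R]_(d + d).

Lemma invX_le (x y : R) n : 0 < x -> x <= y -> y ^- n <= x ^- n.
Proof.
move=> x0 xy; have y0 := lt_le_trans x0 xy.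
by rewrite lef_pV2 ?posrE ?exprn_gt0//; apply: lerXn2r => //; rewrite nnegrE ltW.
Qed.

(** In use, [p], [j] and [X] are the brackets of [x - lsubmx w], [w] and [x]: decay in the first two
    becomes decay in [x]. *)
Lemma japanese_trade (p j X : R) n : 0 < p -> 0 < j -> 0 < X -> X <= 2 * (p * j) ->
  p ^- n * j ^- n <= 2 ^+ n * X ^- n.
Proof.
move=> p0 j0 X0 H; have pj : 0 < p * j by exact: mulr_gt0.
rewrite -invfM -exprMn.
have X2 : 0 < X / 2 by rewrite divr_gt0.
apply: (le_trans (@invX_le (X / 2) (p * j) n X2 _)); first by rewrite ler_pdivrMr// mulrC.
by rewrite expr_div_n invf_div.
Qed.

(** In use, [al] and [be] are the brackets of the two halves of [h *: w]. Of the power of [h], [M]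
    is kept; the other [k + 3 * n] cancel against [(h * j) ^- (k + 3 * n)] and leave decay in [j],
    of which [k] absorbs the growth of the transform, [2 * n] remains, and [n] is traded for decay
    in [X]. *)
Lemma far_trade (h j p al be X : R) M k n : 0 < h -> h <= 1 -> 1 <= j -> 1 <= p ->
  1 <= al -> 1 <= be -> 0 < X -> h * j <= al * be -> X <= 2 * (p * j) ->
  h ^+ (M + (k + 3 * n)) * (p ^- (M + (k + 3 * n)) * (al ^- (M + (k + 3 * n)) *
    be ^- (M + (k + 3 * n)))) * j ^+ k <= 2 ^+ n * h ^+ M * (j ^- (2 * n) * X ^- n).
Proof.
move=> h0 h1 j1 p1 a1 b1 X0 hj Xp.
have j0 : 0 < j by exact: lt_le_trans j1.
have p0 : 0 < p by exact: lt_le_trans p1.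
have ab1 : 1 <= al * be by exact: mulr_ege1.
have hj0 : 0 < h * j by exact: mulr_gt0.
set r := (k + 3 * n)%N; set N := (M + r)%N.
have s1 : al ^- N * be ^- N <= (h * j) ^- r.
  rewrite -invfM -exprMn; apply: (@le_trans _ _ ((al * be) ^- r)); last exact: invX_le.
  rewrite lef_pV2 ?posrE ?exprn_gt0 ?(lt_le_trans _ ab1)//.
  by apply: ler_weXn2l => //; exact: leq_addl.
have s2 : p ^- N <= p ^- n.
  rewrite lef_pV2 ?posrE ?exprn_gt0//; apply: ler_weXn2l => //.
  by apply: leq_trans (leq_addl _ _); apply: leq_trans (leq_addl _ _); rewrite leq_pmull.
apply: (@le_trans _ _ (h ^+ N * (p ^- n * (h * j) ^- r) * j ^+ k)).
  apply: ler_wpM2r; first by rewrite exprn_ge0// ltW.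
  apply: ler_wpM2l; first by rewrite exprn_ge0// ltW.
  apply: ler_pM => //; first by rewrite invr_ge0 exprn_ge0// ltW.
  by apply: mulr_ge0; rewrite invr_ge0 exprn_ge0// (le_trans ler01).
rewrite [leLHS](_ : _ = h ^+ M * j ^- (2 * n) * (p ^- n * j ^- n)); last first.
  rewrite /N /r (exprD h) exprMn (mulnDl 2 1 n) mul1n !exprD.
  by field; rewrite !expf_neq0// ?gt_eqF.
rewrite [leRHS](_ : _ = h ^+ M * j ^- (2 * n) * (2 ^+ n * X ^- n)); last by ring.
apply: ler_wpM2l; first by rewrite mulr_ge0 ?invr_ge0 ?exprn_ge0// ltW.
exact: japanese_trade.
Qed.

Section product_bound.
Variables (u : (E -> R[i]) -> R[i]) (phi : E -> R[i]) (G : set E2) (z0 : E2) (e : R) (a : E2 -> R[i]).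
Variable i0 : 'I_(d + d).
Hypothesis tu : tempered u.
Hypothesis sphi : schwartz phi.
Hypothesis coneG : cone G.
Hypothesis rapidG : forall N, has_ubound [set japanese z ^+ N * modulus (STFT phi u z) | z in G].
Hypothesis e0 : 0 < e.
Hypothesis boxG : forall z : E2, (forall i, `|z ord0 i - z0 ord0 i| < 2 * e) -> G z.
Hypothesis ez0 : 3 * e <= `|z0 ord0 i0|.
Hypothesis sa : smooth a.
Hypothesis az0 : forall (z : E2) i, e <= `|z ord0 i - z0 ord0 i| -> a z = 0.

(* Far from [z0] the kernel is small; near [z0] the transform is. *)
Lemma kappa_STFT_bound M : exists2 A, 0 <= A & forall h w x, 0 < h <= 1 ->
  modulus (weyl (dilation h a) (tfshift w phi) x) * modulus (STFT phi u w) <=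
  A * h ^+ M * (weight w * weight x).
Proof.
have [D [k [D0 HD]]] := STFT_bound tu sphi.
(* Of the exponent, [M] becomes [h ^+ M], [2 * (2 * d)] gives [weight w] on phase space, and the
   last [2 * d], combined with the decay in [x - lsubmx w], gives [weight x]. *)
have [B B0 HB] : exists2 B, 0 <= B & forall w, G w ->
    modulus (STFT phi u w) <= B * japanese w ^- (M + 3 * (2 * d)).
  have [B HB] := rapidG (M + 3 * (2 * d)); exists `|B| => // w Gw.
  rewrite ler_pdivlMr ?japaneseX_gt0// mulrC (le_trans _ (ler_norm B))//.
  by apply: HB; exists w.
have [C1 C10 H1] := kappa_far_decay e0 sa az0 sphi (M + (k + 3 * (2 * d))).
have [C2 C20 H2] := kappa_shift sa az0 sphi (2 * d).
pose q : R := 2 ^+ (2 * d); have q0 : 0 <= q by rewrite exprn_ge0.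
exists (C1 * D * q + C2 * B * q * e ^- M).
  have eM : 0 <= e ^- M by rewrite invr_ge0 exprn_ge0// ltW.
  by apply: addr_ge0; do 2 (apply: mulr_ge0 => //); exact: mulr_ge0.
move=> h w x h01; have [h0 h1] := andP h01.
have j1 := japanese_ge1 w; have p1 := japanese_ge1 (x - lsubmx w).
have X0 := japanese_gt0 x.
have Xp : japanese x <= 2 * (japanese (x - lsubmx w) * japanese w).
  rewrite -{1}(subrK (lsubmx w) x); apply: (le_trans (japaneseD _ _)).
  apply: ler_wpM2l => //; apply: ler_wpM2l; first exact: japanese_ge0.
  by rewrite -[in leRHS](hsubmxK w) japanese_row_mxl.
have WW : japanese w ^- (2 * (2 * d)) * japanese x ^- (2 * d) <= weight w * weight x.
  apply: ler_pM; rewrite ?invr_ge0 ?exprn_ge0 ?japanese_ge0//; last exact: japanese_weight.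
  by rewrite (mul2n d) -addnn; exact: japanese_weight.
have hM : 0 <= h ^+ M by rewrite exprn_ge0// ltW.
have eM : 0 <= e ^- M by rewrite invr_ge0 exprn_ge0// ltW.
have ww : 0 <= weight w * weight x by rewrite mulr_ge0 ?weight_ge0.
rewrite !mulrDl.
have [[i far]|near] := pselect (exists i, 2 * e <= `|h * w ord0 i - z0 ord0 i|).
  apply: (@le_trans _ _ (C1 * D * q * h ^+ M * (weight w * weight x))); last first.
    by rewrite lerDl; do 2 (apply: mulr_ge0 => //); apply: mulr_ge0 => //; do 2 (apply: mulr_ge0 => //).
  have hj : h * japanese w <= japanese (h *: lsubmx w) * japanese (h *: rsubmx w).
    apply: (le_trans (japanese_contract w h01)).
    by rewrite -[in leLHS](hsubmxK w) scale_row_mx japanese_row_mx.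
  have T := far_trade M k (2 * d) h0 h1 j1 p1 (japanese_ge1 (h *: lsubmx w))
     (japanese_ge1 (h *: rsubmx w)) X0 hj Xp.
  apply: (le_trans (ler_pM (modulus_ge0 _) (modulus_ge0 _) (H1 h w x i h01 far) (HD w))).
  rewrite [leLHS](_ : _ = C1 * D * (h ^+ (M + (k + 3 * (2 * d))) *
    (japanese (x - lsubmx w) ^- (M + (k + 3 * (2 * d))) *
     (japanese (h *: lsubmx w) ^- (M + (k + 3 * (2 * d))) *
      japanese (h *: rsubmx w) ^- (M + (k + 3 * (2 * d))))) * japanese w ^+ k)); last by ring.
  rewrite [leRHS](_ : _ = C1 * D * (q * h ^+ M * (weight w * weight x))); last by ring.
  apply: ler_wpM2l; first exact: mulr_ge0.
  apply: (le_trans T); apply: ler_wpM2l => //; exact: mulr_ge0.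
apply: (@le_trans _ _ (C2 * B * q * e ^- M * h ^+ M * (weight w * weight x))); last first.
  by rewrite lerDr; do 2 (apply: mulr_ge0 => //); do 2 (apply: mulr_ge0 => //).
have near' i : `|h * w ord0 i - z0 ord0 i| < 2 * e.
  by rewrite ltNge; apply/negP => far; apply: near; exists i.
have Gw : G w.
  have -> : w = h^-1 *: (h *: w) by rewrite scalerA mulVf ?scale1r// gt_eqF.
  apply: coneG.2; first by rewrite invr_gt0.
  by apply: boxG => i; rewrite mxE.
(* The coordinate [i0] of [z0] is at least [3 * e] and that of [h *: w] differs from it by less than
   [2 * e]; thus [w] has size at least [e / h], which converts decay in [w] into powers of [h]. *)
have jw : e / h <= japanese w.
  rewrite ler_pdivrMr// mulrC; apply: (@le_trans _ _ (h * `|w ord0 i0|)); last first.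
    by apply: ler_wpM2l; [exact: ltW|exact: entry_le_japanese].
  rewrite -{1}(gtr0_norm h0) -normrM; have := near' i0.
  have := ler_normB (h * w ord0 i0) (h * w ord0 i0 - z0 ord0 i0); rewrite subKr.
  move: ez0; lra.
apply: (le_trans (ler_pM (modulus_ge0 _) (modulus_ge0 _) (H2 h w x h01) (HB w Gw))).
have jM : japanese w ^- M <= e ^- M * h ^+ M.
  rewrite [leRHS](_ : _ = (e / h) ^- M); last by rewrite expr_div_n invf_div mulrC.
  by apply: invX_le => //; rewrite divr_gt0.
have TR := japanese_trade (2 * d) (lt_le_trans ltr01 p1) (lt_le_trans ltr01 j1) X0 Xp.
have e3 : japanese w ^- (M + 3 * (2 * d)) =
    japanese w ^- M * (japanese w ^- (2 * (2 * d)) * japanese w ^- (2 * d)).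
  by rewrite (mulnDl 2 1 (2 * d)) mul1n !exprD !invfM.
rewrite e3 [leLHS](_ : _ = C2 * B * (japanese w ^- M * (japanese w ^- (2 * (2 * d)) *
   (japanese (x - lsubmx w) ^- (2 * d) * japanese w ^- (2 * d))))); last by ring.
rewrite [leRHS](_ : _ = C2 * B * ((e ^- M * h ^+ M) * (q * (weight w * weight x)))); last by ring.
apply: ler_wpM2l; first exact: mulr_ge0.
have pos n (v : E2) : 0 <= japanese v ^- n by rewrite invr_ge0 exprn_ge0// japanese_ge0.
have pos' n (v : E) : 0 <= japanese v ^- n by rewrite invr_ge0 exprn_ge0// japanese_ge0.
apply: ler_pM => //.
  by apply: mulr_ge0 => //; exact: mulr_ge0.
apply: (@le_trans _ _ (japanese w ^- (2 * (2 * d)) * (q * japanese x ^- (2 * d)))).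
  by apply: ler_wpM2l.
by rewrite mulrCA; apply: ler_wpM2l.
Qed.

End product_bound.

Lemma HWF_sub_WFG (u : (E -> R[i]) -> R[i]) : tempered u -> HWF u `<=` WFG u.
Proof.
move=> tu z0 [z00 nH]; split=> // -[phi [sphi [x1 phi1] [G [oG cG Gz0 rG]]]]; apply: nH.
have [K K0 HK] := @fourier_inversion R d.
have /rV0Pn[i zi] := z00.
have [r /= r0 Hr] : exists2 r : R, 0 < r & ball z0 r `<=` G.
  by have /nbhs_ballP[r r0 Hr] := open_nbhs_nbhs (conj oG Gz0); exists r.
(* With [r / 2] the cube of half-side [2 * e] around [z0] lies in the cone, and with a third of the
   coordinate this cube stays at distance at least [e] from the origin. The symbol itself lives on
   the smaller cube of half-side [e]. *)
pose e := Num.min (r / 2) (`|z0 ord0 i| / 3).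
have e0 : 0 < e by rewrite lt_min !divr_gt0// normr_gt0.
have boxG (z : E2) : (forall j, `|z ord0 j - z0 ord0 j| < 2 * e) -> G z.
  move=> zz; apply: Hr; split=> // j k; rewrite (ord1 j) /ball /= distrC.
  apply: (lt_le_trans (zz k)); rewrite mulrC -ler_pdivlMr// ge_min lexx //.
have ez0 : 3 * e <= `|z0 ord0 i| by rewrite mulrC -ler_pdivlMr// ge_min lexx orbT.
have [chi [schi chi_ge0 chi0 chi_supp]] := bump_exists z0 e0.
pose a z := (chi z)%:C.
have az0 (z : E2) j : e <= `|z ord0 j - z0 ord0 j| -> a z = 0.
  by move=> zj; rewrite /a (chi_supp z j).
have ya : symbol a := localized_symbol schi az0.
exists a; split; first exact/cc_smoothP.
  by rewrite /a chi0.
have [c c0 Hc] := L2norm_weyl_dual_le tu sphi K0 HK (energy_neq0 sphi phi1).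
move=> N; have [A A0 HA] := kappa_STFT_bound tu sphi cG rG e0 boxG ez0 schi az0 N.
apply: (@le_lt_trans _ _ (c * A)%:E%E); last exact: ltry.
apply: ub_ereal_sup => _ [h /= h01 <-]; have [h0 h1] := andP h01.
have hN : 0 < h ^+ N by rewrite exprn_gt0.
have AN : 0 <= A * h ^+ N by rewrite mulr_ge0// ltW.
have := Hc a h (A * h ^+ N) ya h01 AN (fun w x => HA h w x h01) => L.
apply: (@le_trans _ _ ((h ^- N)%:E * (c * (A * h ^+ N))%:E)%E).
  by apply: lee_wpmul2l => //; rewrite lee_fin invr_ge0 ltW.
by rewrite -EFinM lee_fin [c * _]mulrA [c * A * _]mulrC mulrA mulVf ?mul1r// gt_eqF.
Qed.

End HWF_sub_WFG.

Theorem theorem5p1 (R : realType) (d : nat)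
    (u : ('rV[R]_d -> complex R) -> complex R) (hu : tempered u) :
  WFG u = HWF u.
Proof. by apply/seteqP; split; [exact: WFG_sub_HWF|exact: HWF_sub_WFG]. Qed.
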